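(* Let $\kappa,\tau\in\mathbb{R}$ with $\kappa\neq4\tau^2$ and let $k\geq1$ be an integer. A $k$-parallel surface in the BCV space $\widetilde{M}^3(\kappa,\tau)$ is one of the following: (i) an open part of a Hopf-cylinder on a curve in $\widetilde{M}^2(\kappa)$ whose geodesic curvature is a polynomial function of degree at most $k-1$ of the arc length; (ii) an open part of a totally geodesic leaf of the Hopf-fibration; the latter case only occurring when $\tau=0$.
   Context: For $\kappa,\tau\in\mathbb{R}$ the Bianchi-Cartan-Vranceanu space (BCV space) $\widetilde{M}^3(\kappa,\tau)$ is the open set $\{(x,y,z)\in\mathbb{R}^3 \mid 1+\frac{\kappa}{4}(x^2+y^2)>0\}$ with the Riemannian metric $$ds^2=\frac{dx^2+dy^2}{(1+\frac{\kappa}{4}(x^2+y^2))^2}+\left(dz+\tau\frac{y\,dx-x\,dy}{1+\frac{\kappa}{4}(x^2+y^2)}\right)^2.$$ $\widetilde{M}^2(\kappa)$ is the surface $\{(x,y)\in\mathbb{R}^2 \mid 1+\frac{\kappa}{4}(x^2+y^2)>0\}$ with metric $\frac{dx^2+dy^2}{(1+\frac{\kappa}{4}(x^2+y^2))^2}$, of constant Gaussian curvature $\kappa$. The Riemannian submersion $\pi:\widetilde{M}^3(\kappa,\tau)\to\widetilde{M}^2(\kappa)$, $(x,y,z)\mapsto(x,y)$, is called the Hopf-fibration. A Hopf-cylinder is the inverse image under $\pi$ of a curve in $\widetilde{M}^2(\kappa)$. A leaf of the Hopf-fibration is a surface which is everywhere orthogonal to the fibres of $\pi$. For an isometrically immersed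 (oriented) surface $M^2$ in a Riemannian 3-manifold with unit normal $\xi$ and Levi Civita connection $\nabla$ of $M^2$, let $h$ be the scalar-valued second fundamental form, i.e. $\alpha(X,Y)=h(X,Y)\xi$ with $\alpha$ the second fundamental form. Put $(\nabla h)(X,Y,Z)=X[h(Y,Z)]-h(\nabla_XY,Z)-h(Y,\nabla_XZ)$ and recursively, for $k\geq2$, $$(\nabla^kh)(X_1,\ldots,X_k,Y,Z)=X_1[(\nabla^{k-1}h)(X_2,\ldots,X_k,Y,Z)]-(\nabla^{k-1}h)(\nabla_{X_1}X_2,\ldots,X_k,Y,Z)-\cdots-(\nabla^{k-1}h)(X_2,\ldots,X_k,Y,\nabla_{X_1}Z).$$ The surface is $k$-parallel if $\nabla^kh=0$ (with $\nabla^1h=\nabla h$; ''parallel'' means $1$-parallel). *)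

(* Defs.v *)
(* Real analysis over an arbitrary realType, with MathComp-Analysis. *)
From HB Require Import structures.
From mathcomp Require Export all_boot all_order all_algebra.
From mathcomp Require Export all_classical all_reals all_analysis.
From mathcomp Require Import ring.

Set Implicit Arguments.
Unset Strict Implicit.
Unset Printing Implicit Defensive.

Import Order.TTheory GRing.Theory Num.Theory.
Import numFieldNormedType.Exports.

Local Open Scope classical_set_scope.
Local Open Scope ring_scope.

(* Smoothness (C^oo) on an open set U: every iterated partial derivative is
   differentiable at every point of U. *)
Definition iter_partial (R : realType) (n : nat) (W : normedModType R)
    (s : seq 'I_n.+1) (f : 'rV[R]_n.+1 -> W) : 'rV[R]_n.+1 -> W :=
  foldr (fun i g p => 'D_(delta_mx 0 i) g p) f s.

Definition smooth_on (R : realType) (n : nat) (W : normedModType R)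
    (U : set 'rV[R]_n.+1) (f : 'rV[R]_n.+1 -> W) : Prop :=
  forall (s : seq 'I_n.+1) p, U p -> differentiable (iter_partial s f) p.

Definition injective_diff_on (R : realType) (n : nat) (W : normedModType R)
    (U : set 'rV[R]_n.+1) (f : 'rV[R]_n.+1 -> W) : Prop :=
  forall p, U p -> forall v, 'D_v f p = 0 -> v = 0.

(* A Riemannian metric on (an open subset of) R^n is given by its matrix G. *)
Definition inner (R : realType) (n : nat) (G : 'rV[R]_n.+1 -> 'M[R]_n.+1)
    (q u v : 'rV[R]_n.+1) : R :=
  (u *m G q *m v^T) 0 0.

Definition christoffel (R : realType) (n : nat)
    (G : 'rV[R]_n.+1 -> 'M[R]_n.+1) (q : 'rV[R]_n.+1)
    (k i j : 'I_n.+1) : R :=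
  2^-1 * \sum_(l < n.+1) invmx (G q) k l *
    ('D_(delta_mx 0 i) (fun x => G x j l) q
     + 'D_(delta_mx 0 j) (fun x => G x i l) q
     - 'D_(delta_mx 0 l) (fun x => G x i j) q).

(* Levi-Civita covariant derivative, at p and in the direction v, of a vector
   field V along a map F : E -> R^n.  Used with F an immersion, with F a curve
   (E = R) and with F the identity. *)
Definition covariant_along (R : realType) (n : nat) (E : normedModType R)
    (G : 'rV[R]_n.+1 -> 'M[R]_n.+1) (F : E -> 'rV[R]_n.+1)
    (v : E) (V : E -> 'rV[R]_n.+1) (p : E) : 'rV[R]_n.+1 :=
  'D_v V p + \row_(k < n.+1) \sum_(i < n.+1) \sum_(j < n.+1)
    christoffel G (F p) k i j * ('D_v F p) 0 i * (V p) 0 j.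

Definition levi_civita (R : realType) (n : nat)
    (G : 'rV[R]_n.+1 -> 'M[R]_n.+1) (X Y : 'rV[R]_n.+1 -> 'rV[R]_n.+1)
    (p : 'rV[R]_n.+1) : 'rV[R]_n.+1 :=
  covariant_along G id (X p) Y p.

Definition xcoord (R : realType) (n : nat) (q : 'rV[R]_n.+2) : R := q 0 0.
Definition ycoord (R : realType) (n : nat) (q : 'rV[R]_n.+2) : R := q 0 1.
Definition zcoord (R : realType) (q : 'rV[R]_3) : R := q 0 2.

Definition vec2 (R : realType) (x y : R) : 'rV[R]_2 :=
  \row_(i < 2) [:: x; y]`_i.
Definition vec3 (R : realType) (x y z : R) : 'rV[R]_3 :=
  \row_(i < 3) [:: x; y; z]`_i.

Definition bcv_factor (R : realType) (n : nat) (kappa : R) (q : 'rV[R]_n.+2) : R :=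
  1 + kappa / 4 * (xcoord q ^+ 2 + ycoord q ^+ 2).

(* The domain of M^2(kappa) for n = 0, and of M^3(kappa, tau) for n = 1. *)
Definition bcv_domain (R : realType) (n : nat) (kappa : R) : set 'rV[R]_n.+2 :=
  [set q | 0 < bcv_factor kappa q].

(* The 1-forms dx, dy, dz are the rows delta_mx 0 i, and the tensor square of
   a 1-form w has matrix w^T *m w. *)
Definition base_metric (R : realType) (kappa : R) (q : 'rV[R]_2) : 'M[R]_2 :=
  let dx : 'rV[R]_2 := delta_mx 0 0 in
  let dy : 'rV[R]_2 := delta_mx 0 1 in
  (bcv_factor kappa q) ^- 2 *: (dx^T *m dx + dy^T *m dy).

Definition bcv_metric (R : realType) (kappa tau : R) (q : 'rV[R]_3) : 'M[R]_3 :=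
  let dx : 'rV[R]_3 := delta_mx 0 0 in
  let dy : 'rV[R]_3 := delta_mx 0 1 in
  let dz : 'rV[R]_3 := delta_mx 0 2 in
  let eta := dz + (tau / bcv_factor kappa q) *:
                    (ycoord q *: dx - xcoord q *: dy) in
  (bcv_factor kappa q) ^- 2 *: (dx^T *m dx + dy^T *m dy) + eta^T *m eta.

Lemma bcv_metricE (R : realType) (kappa tau : R) (q u v : 'rV[R]_3) :
  let lam := bcv_factor kappa q in
  let eta (w : 'rV[R]_3) := zcoord w
    + tau * (ycoord q * xcoord w - xcoord q * ycoord w) / lam in
  inner (bcv_metric kappa tau) q u v =
  (xcoord u * xcoord v + ycoord u * ycoord v) / lam ^+ 2 + eta u * eta v.
Proof.
move=> lam eta; rewrite /inner /bcv_metric -/lam.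
have E (w w' : 'rV[R]_3) : (u *m (w^T *m w') *m v^T) 0 0 = 
   (\sum_i u 0 i * w 0 i) * (\sum_i v 0 i * w' 0 i).
  rewrite mulmxA -mulmxA [LHS]mxE big_ord1; congr (_ * _); rewrite mxE;
   by apply: eq_bigr => i _; rewrite !mxE // mulrC.
rewrite mulmxDr mulmxDl -scalemxAr -scalemxAl mulmxDr mulmxDl.
have D (A B : 'M[R]_1) : (A + B) 0 0 = A 0 0 + B 0 0 by rewrite mxE.
have Z a (A : 'M[R]_1) : (a *: A) 0 0 = a * A 0 0 by rewrite mxE.
rewrite D Z D !E.
rewrite !big_ord_recl !big_ord0 !mxE /=.
rewrite /eta /zcoord /xcoord /ycoord.
have -> : lift ord0 (lift ord0 ord0) = 2 :> 'I_3 by apply: val_inj.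
have -> : lift ord0 ord0 = 1 :> 'I_3 by apply: val_inj.
rewrite /= !(mulr0,mulr1,addr0,add0r,subr0,sub0r).
set a := lam^-1; rewrite -exprVn -/a; ring.
Qed.

Definition hopf (R : realType) (q : 'rV[R]_3) : 'rV[R]_2 :=
  vec2 (xcoord q) (ycoord q).

(* Connected smooth surfaces, given by an atlas of local parametrizations
   par i : dom i -> M (inverses of charts).  The value of par i outside of
   dom i is irrelevant. *)
Record surface (R : realType) := Surface {
  carrier :> topologicalType;
  patch : Type;
  dom : patch -> set 'rV[R]_2;
  par : patch -> 'rV[R]_2 -> carrier;
  dom_open : forall i, open (dom i);
  par_inj : forall i u v, dom i u -> dom i v -> par i u = par i v -> u = v;
  par_continuous : forall i u, dom i u -> {for u, continuous (par i)};
  par_open : forall i (V : set 'rV[R]_2),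
    open V -> V `<=` dom i -> open (par i @` V);
  par_cover : forall p, exists i, (par i @` dom i) p;
  par_transition : forall i j,
    let D := dom i `&` par i @^-1` (par j @` dom j) in
    exists2 phi : 'rV[R]_2 -> 'rV[R]_2, smooth_on D phi &
      forall u, D u -> dom j (phi u) /\ par j (phi u) = par i u;
  surface_hausdorff : hausdorff_space carrier;
  surface_second_countable : @second_countable carrier;
  surface_nonempty : [set: carrier] !=set0;
  surface_connected : connected [set: carrier]
}.

Definition immersion_bcv (R : realType) (kappa : R) (M : surface R)
    (f : M -> 'rV[R]_3) : Prop :=
  forall i : patch M,
    [/\ smooth_on (dom i) (f \o par i),
        injective_diff_on (dom i) (f \o par i) &
        forall u, dom i u -> bcv_domain kappa ((f \o par i) u)].

(* Local extrinsic geometry of a patch F : U -> M^3(kappa, tau). *)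

Definition induced_metric (R : realType) (kappa tau : R)
    (F : 'rV[R]_2 -> 'rV[R]_3) (p : 'rV[R]_2) : 'M[R]_2 :=
  \matrix_(a < 2, b < 2)
    inner (bcv_metric kappa tau) (F p)
      ('D_(delta_mx 0 a) F p) ('D_(delta_mx 0 b) F p).

Definition unit_normal (R : realType) (kappa tau : R) (U : set 'rV[R]_2)
    (F xi : 'rV[R]_2 -> 'rV[R]_3) : Prop :=
  smooth_on U xi /\
  forall p, U p ->
    inner (bcv_metric kappa tau) (F p) (xi p) (xi p) = 1 /\
    forall v, inner (bcv_metric kappa tau) (F p) ('D_v F p) (xi p) = 0.

(* h(X, Y) is the xi-component of the ambient covariant derivative of dF(Y)
   in the direction X (Gauss formula). *)
Definition second_form (R : realType) (kappa tau : R)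
    (F xi : 'rV[R]_2 -> 'rV[R]_3) (X Y : 'rV[R]_2 -> 'rV[R]_2)
    (p : 'rV[R]_2) : R :=
  inner (bcv_metric kappa tau) (F p)
    (covariant_along (bcv_metric kappa tau) F (X p) (fun q => 'D_(Y q) F q) p)
    (xi p).

(* Covariant tensors of all ranks are functions of a sequence of vector fields
   (the arguments of the tensor); junk values on sequences of a wrong size. *)
Definition tensor (R : realType) : Type :=
  seq ('rV[R]_2 -> 'rV[R]_2) -> 'rV[R]_2 -> R.

Definition nabla (R : realType) (g : 'rV[R]_2 -> 'M[R]_2) (T : tensor R) :
    tensor R :=
  fun Xs p =>
    if Xs is X :: Ys then
      'D_(X p) (T Ys) p -
      \sum_(i < size Ys) T (set_nth 0 Ys i (levi_civita g X (nth 0 Ys i))) p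
    else 0.

Definition second_form_tensor (R : realType) (kappa tau : R)
    (F xi : 'rV[R]_2 -> 'rV[R]_3) : tensor R :=
  fun Xs p =>
    if Xs is [:: X; Y] then second_form kappa tau F xi X Y p else 0.

(* nabla^k h = 0; for k = 0 this reads h = 0.  Changing the sign of xi changes
   the sign of nabla^k h, so that the unit normal may be chosen patchwise. *)
Definition nabla_h_vanishes (R : realType) (kappa tau : R) (k : nat)
    (M : surface R) (f : M -> 'rV[R]_3) : Prop :=
  forall (i : patch M) (xi : 'rV[R]_2 -> 'rV[R]_3),
    unit_normal kappa tau (dom i) (f \o par i) xi ->
  forall Xs : seq ('rV[R]_2 -> 'rV[R]_2),
    size Xs = k.+2 ->
    (forall j, (j < size Xs)%N -> smooth_on (dom i) (nth 0 Xs j)) ->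
  forall p, dom i p ->
    iter k (nabla (induced_metric kappa tau (f \o par i)))
      (second_form_tensor kappa tau (f \o par i) xi) Xs p = 0.

Definition k_parallel (R : realType) (kappa tau : R) (k : nat)
    (M : surface R) (f : M -> 'rV[R]_3) : Prop :=
  nabla_h_vanishes kappa tau k f.

Definition totally_geodesic (R : realType) (kappa tau : R)
    (M : surface R) (f : M -> 'rV[R]_3) : Prop :=
  nabla_h_vanishes kappa tau 0 f.

(* The submersion hopf is linear, so that w is tangent to its fibres iff
   hopf w = 0. *)
Definition hopf_leaf (R : realType) (kappa tau : R)
    (M : surface R) (f : M -> 'rV[R]_3) : Prop :=
  forall (i : patch M) u, dom i u -> forall (v : 'rV[R]_2) (w : 'rV[R]_3),
    hopf w = 0 ->
    inner (bcv_metric kappa tau) ((f \o par i) u) ('D_v (f \o par i) u) w = 0.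

(* The patch F : U -> R^3 is, near u, the composition of the patch
   Phi : W -> R^3 with a local diffeomorphism. *)
Definition reparametrizes_near (R : realType)
    (U : set 'rV[R]_2) (F : 'rV[R]_2 -> 'rV[R]_3)
    (W : set 'rV[R]_2) (Phi : 'rV[R]_2 -> 'rV[R]_3) (u : 'rV[R]_2) : Prop :=
  exists (O : set 'rV[R]_2) (phi : 'rV[R]_2 -> 'rV[R]_2),
    [/\ open O, O u, O `<=` U, smooth_on O phi & injective_diff_on O phi] /\
    forall v, O v -> W (phi v) /\ F v = Phi (phi v).

(* Being an open part is meant for immersed surfaces: multiple points are
   allowed, both for the part and for the whole. *)
Definition open_part (R : realType) (M : surface R) (f : M -> 'rV[R]_3)
    (N : surface R) (l : N -> 'rV[R]_3) : Prop :=
  forall (i : patch M) u, dom i u ->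
  exists j : patch N,
    reparametrizes_near (dom i) (f \o par i) (dom j) (l \o par j) u.

Definition arclength_curve (R : realType) (kappa : R) (J : set R)
    (gamma : R -> 'rV[R]_2) : Prop :=
  [/\ open J, is_interval J & J !=set0] /\
  forall s, J s ->
    [/\ forall n, derivable (derive1n n gamma) s 1,
        bcv_domain kappa (gamma s) &
        inner (base_metric kappa) (gamma s)
          (derive1 gamma s) (derive1 gamma s) = 1].

(* base_metric is conformal to the Euclidean metric, so that (-y', x') is a
   unit normal when (x', y') is a unit vector. *)
Definition geodesic_curvature (R : realType) (kappa : R)
    (gamma : R -> 'rV[R]_2) (s : R) : R :=
  inner (base_metric kappa) (gamma s)
    (covariant_along (base_metric kappa) gamma 1 (derive1 gamma) s)
    (vec2 (- ycoord (derive1 gamma s)) (xcoord (derive1 gamma s))).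

Definition hopf_cylinder (R : realType) (J : set R) (gamma : R -> 'rV[R]_2) :
    set 'rV[R]_3 :=
  @hopf R @^-1` (gamma @` J).

(* The Hopf-cylinder as an immersed surface, with domain J x R. *)
Definition cylinder_dom (R : realType) (J : set R) : set 'rV[R]_2 :=
  [set w | J (xcoord w)].

Definition cylinder_par (R : realType) (gamma : R -> 'rV[R]_2)
    (w : 'rV[R]_2) : 'rV[R]_3 :=
  vec3 (xcoord (gamma (xcoord w))) (ycoord (gamma (xcoord w))) (ycoord w).

Lemma cylinder_parE (R : realType) (J : set R) (gamma : R -> 'rV[R]_2) :
  @cylinder_par R gamma @` cylinder_dom J = hopf_cylinder J gamma.
Proof.
apply/seteqP; split=> [_ [w Jw <-]|q [s Js gs]].
  exists (xcoord w) => //; apply/rowP => -[[|[|i]] lti] //=;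
    rewrite /hopf /vec2 /xcoord /ycoord !mxE /= ?mxE //=;
    by congr (gamma _ _ _); apply: val_inj.
exists (vec2 s (zcoord q)); first by rewrite /cylinder_dom /= /xcoord mxE.
apply/rowP => -[[|[|[|i]]] lti] //=;
  rewrite /cylinder_par /xcoord /ycoord !mxE /= ?mxE ?gs /=;
  rewrite /hopf /vec2 ?mxE /=; rewrite /xcoord /ycoord /zcoord;
  by congr (q _ _); apply: val_inj.
Qed.

Definition open_part_cylinder (R : realType) (M : surface R)
    (f : M -> 'rV[R]_3) (J : set R) (gamma : R -> 'rV[R]_2) : Prop :=
  forall (i : patch M) u, dom i u ->
    reparametrizes_near (dom i) (f \o par i)
      (cylinder_dom J) (cylinder_par gamma) u.

(* Main.v *)
(* In the frame bundle of a patch, with its horizontal fields Z, H and its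
   vertical field V, the equation nabla^k h = 0 says that every word of length k
   in Z and H kills the components of h.  Since [Z, H] = K V with K the Gauss
   curvature, such words can be shortened where K <> 0, so that nabla h = 0 there;
   on open sets where K = 0, the Gauss and Codazzi equations express c nu^2 and
   c nu t (c = kappa - 4 tau^2, nu and t the normal and tangential parts of the
   fibre direction) through functions that are nilpotent under Z and H, which
   forces nu = 0.  In both cases nu^2 (1 - nu^2) = 0, and by connectedness either
   nu^2 = 1 everywhere, whence h = 0 and tau = 0, or nu = 0 everywhere.  In the
   last case let X be the unit tangent field orthogonal to the fibres.  Its dual
   1-form is closed, hence locally ds, and X^k h(X, X) = 0, so that h(X, X) is a
   polynomial in s of degree < k; the projection of the patch solves the Frenet
   equations with arc length s and curvature - h(X, X).  By uniqueness for these
   equations the local projections are parts of a single maximal curve. *)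

Require Import Defs.
From mathcomp Require Import ring lra.
Set Implicit Arguments.
Unset Strict Implicit.
Unset Printing Implicit Defensive.

Import Order.TTheory GRing.Theory Num.Theory.
Import numFieldNormedType.Exports.

Local Open Scope classical_set_scope.
Local Open Scope ring_scope.

(** * Smooth functions *)

(** On the surface itself [nabla] subtracts a connection term for every argument, so the vanishing
    of the k-th derivative is an entangled system. On the frame bundle these terms are absorbed:
    components of a tensor are functions, and their horizontal derivatives are again components.
    Words can be shortened because [V, Z] = H and [V, H] = -Z: once V is known to kill a word and
    its horizontal derivatives, commuting with V isolates the last letter. The flat case is decided
    by a sign: with q = c nu^2 and (p1, p2) = c nu t, the identity |t|^2 = 1 - nu^2 reads q (c - q)
    = p1^2 + p2^2, and in top order minus a square equals a sum of squares. Neither case covers a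
    neighbourhood of every point, so the two are combined by contradiction on an open set where nu^2
    (1 - nu^2) is nonzero. In the vertical case the surface itself supplies the local solutions of
    the Frenet equations; a Gronwall estimate gives their uniqueness, and a maximal solution is
    formed from all solutions that pass through one state. Two pieces of the curve may run in
    opposite directions, whence the sign [e] with [e ^+ 2 = 1]. *)

(** Turns the little-o definition into an epsilon estimate with a candidate differential, for
    functions that are only known through explicit bounds. *)
Lemma differentiable_approx (R : realType) (V W : normedModType R) (f : V -> W)
    (p : V) (L : {linear V -> W}) :
  continuous L ->
  (forall e : R, 0 < e ->
     \forall h \near (0 : V), `|f (h + p) - f p - L h| <= e * `|h|) ->
  differentiable f p /\ 'd f p = L :> (V -> W).
Proof.
move=> Lc fL; have fo : f \o shift p = cst (f p) + L +o_ 0 id.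
  apply/eqaddoP => e e0; move: (fL e e0); apply: filterS => h.
  by rewrite /= !fctE /= opprD addrA.
have dfL := diff_unique Lc fo.
by split=> //; apply/diff_locallyP; rewrite dfL.
Qed.

(** Differentiability is a condition at one point, whereas most functions below are known by a
    formula on an open set only; agreement near the point is what transfers it. *)
Lemma near_eq_diff (R : realType) (V W : normedModType R) (f g : V -> W) (p : V) :
  {near p, f =1 g} -> differentiable f p -> differentiable g p.
Proof.
move=> fg df.
suff [] : differentiable g p /\ 'd g p = 'd f p :> (V -> W) by [].
apply: differentiable_approx; first exact: diff_continuous.
have /diff_locallyP [_ /eqaddoP h] := df.
move=> e e0; move: (h e e0); apply: filter_app.
have fgp := nbhs_singleton fg.
move: fg; rewrite [X in X -> _](near_shift 0) subr0.
apply: filterS => x /= fgx; rewrite !fctE /= opprD addrA.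
by rewrite -fgp -fgx.
Qed.

Section SmoothGeneral.
Context {R : realType} {n : nat}.
Local Notation E := 'rV[R]_n.+1.
Implicit Types (W : normedModType R) (U : set E) (p q v : E).

Definition partial W (i : 'I_n.+1) (f : E -> W) : E -> W :=
  fun p => 'D_(delta_mx 0 i) f p.

(** Smoothness graded by the order: the derivative of a product, inverse or composition is again
    built from such functions, so closure properties follow by induction on [k]. *)
Fixpoint Ck W (k : nat) U (f : E -> W) : Prop :=
  (forall p, U p -> differentiable f p) /\
  (if k is k'.+1 then forall i, Ck k' U (partial i f) else True).

Lemma Ck_diff W k U (f : E -> W) : Ck k U f -> forall p, U p -> differentiable f p.
Proof. by case: k => [|k] []. Qed.

Lemma smooth_onP W U (f : E -> W) : smooth_on U f <-> forall k, Ck k U f.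
Proof.
(* In [iter_partial] the last letter of the word acts first, and [Ck] also peels off the innermost
   derivative; so words are split at their right end. *)
have rc s i (g : E -> W) : iter_partial (rcons s i) g = iter_partial s (partial i g).
  by rewrite /iter_partial foldr_rcons.
split=> [+ k|Cf s].
  elim: k f => [|k IH] f sf /=; first by split=> // p; exact: (sf [::]).
  split=> [p|i]; first exact: (sf [::]).
  by apply: IH => s p; rewrite -rc; exact: sf.
elim/last_ind: s f Cf => [|s i IH] f Cf p Up; first exact: (Ck_diff (Cf 0%N)).
rewrite rc; apply: IH => // k; exact: ((Cf k.+1).2 i).
Qed.

Lemma smooth_on_diff W U (f : E -> W) p : smooth_on U f -> U p -> differentiable f p.
Proof. by move=> sf; exact: (sf [::]). Qed.

Lemma smooth_on_partial W U i (f : E -> W) :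
  smooth_on U f -> smooth_on U (partial i f).
Proof. by move=> /smooth_onP sf; apply/smooth_onP => k; exact: ((sf k.+1).2 i). Qed.

Lemma smooth_on_sub W U V (f : E -> W) :
  V `<=` U -> smooth_on U f -> smooth_on V f.
Proof. by move=> VU sf s p /VU; exact: sf. Qed.

Lemma near_eq_open (T : topologicalType) (Y : Type) (O : set T) (f g : T -> Y) (p : T) :
  open O -> O p -> (forall q : T, O q -> f q = g q) -> \near p, f p = g p.
Proof.
move=> oU Up fg; have : nbhs p O by exact: open_nbhs_nbhs.
by apply: filterS => q /fg.
Qed.

Lemma eq_diff W U (f g : E -> W) p :
  open U -> U p -> (forall q, U q -> f q = g q) ->
  differentiable f p -> differentiable g p.
Proof. by move=> oU Up fg; apply: near_eq_diff; exact: near_eq_open oU Up fg. Qed.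

Lemma eq_partial W U (f g : E -> W) i p :
  open U -> U p -> (forall q, U q -> f q = g q) -> partial i f p = partial i g p.
Proof. by move=> oU Up fg; apply: near_eq_derive; exact: near_eq_open oU Up fg. Qed.

Lemma eq_Ck W k U (f g : E -> W) :
  open U -> (forall q, U q -> f q = g q) -> Ck k U f -> Ck k U g.
Proof.
move=> oU; elim: k f g => [|k IH] f g fg [df Pf].
  by split=> // p Up; exact: eq_diff oU Up fg (df p Up).
split=> [p Up|i]; first exact: eq_diff oU Up fg (df p Up).
apply: (IH (partial i f)); last exact: (Pf i).
by move=> q Uq; exact: eq_partial oU Uq fg.
Qed.

Lemma eq_smooth W U (f g : E -> W) :
  open U -> (forall q, U q -> f q = g q) -> smooth_on U f -> smooth_on U g.
Proof.
move=> oU fg /smooth_onP sf; apply/smooth_onP => k; exact: eq_Ck oU fg (sf k).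
Qed.

Lemma smooth_cst W U (c : W) : smooth_on U (fun _ : E => c).
Proof.
apply/smooth_onP => k; elim: k c => [|k IH] c; first by split=> // p _; exact: differentiable_cst.
split=> [p _|i]; first exact: differentiable_cst.
rewrite (_ : partial i _ = fun=> 0 : W); first exact: IH.
by apply/funext => p; exact: derive_cst.
Qed.

Lemma Ck_D W k U (f g : E -> W) : open U ->
  Ck k U f -> Ck k U g -> Ck k U (fun p => f p + g p).
Proof.
move=> oU; elim: k f g => [|k IH] f g [df Pf] [dg Pg].
  by split=> // p Up; apply: differentiableD; auto.
split=> [p Up|i]; first by apply: differentiableD; [exact: df|exact: dg].
apply: (eq_Ck oU) (IH _ _ (Pf i) (Pg i)) => q Uq.
by rewrite /partial [in RHS]deriveD //; apply: diff_derivable; auto.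
Qed.

Lemma Ck_M k U (f g : E -> R) : open U ->
  Ck k U f -> Ck k U g -> Ck k U (fun p => f p * g p).
Proof.
(* Leibniz leaves one factor underived, so the induction needs that factor at the lower order. *)
have low : forall k (h : E -> R), Ck k.+1 U h -> Ck k U h.
  elim=> [|l IH] h [dh Ph]; split=> // i.
  exact: (IH _ (Ph i)).
move=> oU; elim: k f g => [|k IH] f g Cf Cg.
  by split=> // p Up; apply: differentiableM; [exact: Cf.1|exact: Cg.1].
have [df Pf] := Cf; have [dg Pg] := Cg.
split=> [p Up|i]; first by apply: differentiableM; [exact: df|exact: dg].
apply: (@eq_Ck _ _ _ (fun p => f p * partial i g p + g p * partial i f p)) => //.
  move=> q Uq; rewrite /partial [RHS]deriveM; [by []|..].
    exact: diff_derivable (df q Uq).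
  exact: diff_derivable (dg q Uq).
by apply: Ck_D => //; apply: IH; [exact: low|exact: (Pg i)|exact: low|exact: (Pf i)].
Qed.

Lemma smoothD W U (f g : E -> W) : open U ->
  smooth_on U f -> smooth_on U g -> smooth_on U (fun p => f p + g p).
Proof.
move=> oU /smooth_onP sf /smooth_onP sg; apply/smooth_onP => k; exact: Ck_D.
Qed.

Lemma smoothM U (f g : E -> R) : open U ->
  smooth_on U f -> smooth_on U g -> smooth_on U (fun p => f p * g p).
Proof.
move=> oU /smooth_onP sf /smooth_onP sg; apply/smooth_onP => k; exact: Ck_M.
Qed.

Lemma smoothN U (f : E -> R) : open U ->
  smooth_on U f -> smooth_on U (fun p => - f p).
Proof.
move=> oU sf; apply: (@eq_smooth _ _ (fun p => -1 * f p)) => //.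
  by move=> q _; rewrite mulN1r.
by apply: smoothM => //; exact: smooth_cst.
Qed.

Lemma smoothB U (f g : E -> R) : open U ->
  smooth_on U f -> smooth_on U g -> smooth_on U (fun p => f p - g p).
Proof. by move=> oU sf sg; apply: smoothD => //; exact: smoothN. Qed.

Lemma smoothX U (f : E -> R) m : open U ->
  smooth_on U f -> smooth_on U (fun p => f p ^+ m).
Proof.
move=> oU sf; elim: m => [|m IH].
  by apply: (@eq_smooth R _ (fun _ : E => 1 : R)) => //; exact: smooth_cst.
apply: (@eq_smooth _ _ (fun p => f p * f p ^+ m)) => //; last exact: smoothM.
by move=> q _; rewrite exprS.
Qed.

(** The derivative -f' (1/f) (1/f) contains 1/f itself, one order lower; the induction is on the
    order with f fixed. *)
Lemma smoothV U (f : E -> R) : open U -> (forall p, U p -> f p != 0) ->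
  smooth_on U f -> smooth_on U (fun p => (f p)^-1).
Proof.
move=> oU f0 sf; apply/smooth_onP; have /smooth_onP Cf := sf.
elim=> [|k IH].
  by split=> // p Up; apply: differentiableV; [exact: (smooth_on_diff sf)|exact: f0].
split=> [p Up|i]; first by apply: differentiableV; [exact: (smooth_on_diff sf)|exact: f0].
apply: (@eq_Ck _ _ _ (fun p => - partial i f p * ((f p)^-1 * (f p)^-1))) => //.
  move=> q Uq; rewrite /partial [in RHS]deriveV ?f0 //.
    by rewrite /GRing.scale /= expr2 invfM mulNr mulNr mulrC.
  exact: diff_derivable (smooth_on_diff sf Uq).
apply: Ck_M => //; last exact: Ck_M.
by have /smooth_onP := smoothN oU (smooth_on_partial i sf).
Qed.

Lemma smooth_sqrt U (f : E -> R) : open U -> (forall p, U p -> 0 < f p) ->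
  smooth_on U f -> smooth_on U (fun p => Num.sqrt (f p)).
Proof.
move=> oU f0 sf; apply/smooth_onP; have /smooth_onP Cf := sf.
have ds p : U p -> differentiable (fun p => Num.sqrt (f p)) p.
  move=> Up; apply: (@differentiable_comp _ _ _ _ f (@Num.sqrt R)).
    exact: (smooth_on_diff sf).
  by apply/derivable1_diffP; case: (is_derive1_sqrt (f0 p Up)).
elim=> [|k IH]; first by split.
split=> // i.
(* The derivative f' / (2 sqrt f) is written as (f' / 2) (sqrt f) (1/f), so that the induction
   hypothesis on sqrt f and [smoothV] on f suffice. *)
apply: (@eq_Ck _ _ _ (fun p => (2^-1 * partial i f p) * (Num.sqrt (f p) * (f p)^-1))) => //.
  move=> q Uq; have fq := f0 q Uq.
  have /derivableP D : derivable (fun p => Num.sqrt (f p)) q (delta_mx 0 i).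
    exact: diff_derivable (ds q Uq).
  (* Differentiating sqrt f * sqrt f = f determines the derivative of the root. *)
  have := deriveM (diff_derivable (v := delta_mx 0 i) (ds q Uq))
    (diff_derivable (v := delta_mx 0 i) (ds q Uq)).
  rewrite (@near_eq_derive _ _ _ _ f); last first.
    apply: (near_eq_open oU Uq) => r Ur; rewrite fctE.
    by rewrite -expr2 sqr_sqrtr // ltW // f0.
  rewrite /partial => ->; rewrite /GRing.scale /=.
  have s0 : Num.sqrt (f q) != 0 by rewrite gt_eqF // sqrtr_gt0.
  by rewrite -[in _ / f q](sqr_sqrtr (ltW fq)) sqrtr_sqr ger0_norm ?sqrtr_ge0 //; field.
apply: Ck_M => //; last apply: Ck_M => //.
  by have /smooth_onP := smoothM oU (@smooth_cst R U 2^-1) (smooth_on_partial i sf).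
by have /smooth_onP := smoothV oU (fun p Up => lt0r_neq0 (f0 p Up)) sf.
Qed.

Lemma Ck_sum W k U (I : Type) (r : seq I) (f : I -> E -> W) : open U ->
  (forall i, Ck k U (f i)) -> Ck k U (fun p => \sum_(i <- r) f i p).
Proof.
move=> oU sf; elim: r => [|i r IH].
  apply: (@eq_Ck W _ _ (fun=> 0)) => //; first by move=> q _; rewrite big_nil.
  by have /smooth_onP := @smooth_cst W U 0.
apply: (@eq_Ck _ _ _ (fun p => f i p + \sum_(i <- r) f i p)) => //; last exact: Ck_D.
by move=> q _; rewrite big_cons.
Qed.

Lemma smooth_sum W U (I : Type) (r : seq I) (f : I -> E -> W) : open U ->
  (forall i, smooth_on U (f i)) -> smooth_on U (fun p => \sum_(i <- r) f i p).
Proof.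
move=> oU sf; apply/smooth_onP => k; apply: Ck_sum => // i.
by have /smooth_onP := sf i.
Qed.

Lemma derive_coord m (f : E -> 'rV[R]_m) p v j :
  derivable f p v -> 'D_v (fun q => f q 0 j) p = ('D_v f p) 0 j.
Proof. by move=> df; rewrite derive_mx // mxE. Qed.

Lemma smooth_coord m U (f : E -> 'rV[R]_m) j : open U ->
  smooth_on U f -> smooth_on U (fun p => f p 0 j).
Proof.
move=> oU /smooth_onP Cf; apply/smooth_onP => k; move: (Cf k) => {Cf}.
elim: k f => [|k IH] f [df Pf].
  split=> // p Up; apply: (@differentiable_comp _ _ _ _ f (fun M => M 0 j)); first exact: df.
  exact: differentiable_coord.
split=> [p Up|i].
  apply: (@differentiable_comp _ _ _ _ f (fun M => M 0 j)); first exact: df.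
  exact: differentiable_coord.
apply: (eq_Ck oU) (IH _ (Pf i)) => q Uq.
by rewrite /partial derive_coord //; apply: diff_derivable; auto.
Qed.

Lemma smooth_row m U (f : E -> 'rV[R]_m) : open U ->
  (forall j, smooth_on U (fun p => f p 0 j)) -> smooth_on U f.
Proof.
move=> oU sf.
have sZ (g : E -> R) (w : 'rV[R]_m) : smooth_on U g -> smooth_on U (fun p => g p *: w).
  move=> /smooth_onP Cg; apply/smooth_onP => k; move: (Cg k) => {Cg}.
  elim: k g => [|k IH] g [dg Pg].
    by split=> // p Up; apply: differentiableZl; auto.
  split=> [p Up|i]; first by apply: differentiableZl; auto.
  apply: (eq_Ck oU) (IH _ (Pg i)) => q Uq.
  rewrite /partial; have dgq := dg q Uq.
  by rewrite !deriveE ?diffZl //; exact: differentiableZl.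
apply: (@eq_smooth _ _ (fun p => \sum_j f p 0 j *: delta_mx 0 j)) => //.
  by move=> q _; rewrite [RHS]row_sum_delta.
by apply: smooth_sum => // j; exact: sZ.
Qed.

Lemma smooth_id_coord U i : open U -> smooth_on U (fun p : E => p 0 i).
Proof.
move=> oU; apply/smooth_onP; case=> [|k].
  by split=> // p _; exact: differentiable_coord.
split=> [p _|j]; first exact: differentiable_coord.
rewrite (_ : partial j _ = fun=> (delta_mx 0 j : E) 0 i).
  by have /smooth_onP := @smooth_cst _ U ((delta_mx 0 j : E) 0 i : R).
apply/funext => p; rewrite /partial (@derive_coord _ id) ?derive_id //.
Qed.

Lemma derive_sum_partial W (f : E -> W) p v : differentiable f p ->
  'D_v f p = \sum_i v 0 i *: partial i f p.
Proof.
move=> df; rewrite deriveE // [in LHS](row_sum_delta v) linear_sum.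
by apply: eq_bigr => i _; rewrite linearZ /partial deriveE.
Qed.

End SmoothGeneral.

(** By the chain rule a partial derivative of f o g is a sum of products of partials of g with
    (partial j f) o g, and the latter are compositions with the same g at a lower order. *)
Lemma smooth_comp (R : realType) m n (U : set 'rV[R]_n.+1)
    (V : set 'rV[R]_m.+1) (g : 'rV[R]_n.+1 -> 'rV[R]_m.+1) (f : 'rV[R]_m.+1 -> R) :
  open U -> (forall p, U p -> V (g p)) ->
  smooth_on U g -> smooth_on V f -> smooth_on U (fun p => f (g p)).
Proof.
move=> oU UV sg /smooth_onP Cf; apply/smooth_onP => k; move: (Cf k) => {Cf}.
have dgf (h : 'rV[R]_m.+1 -> R) : (forall q, V q -> differentiable h q) ->
    forall p, U p -> differentiable (fun p => h (g p)) p.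
  move=> dh p Up; apply: (@differentiable_comp _ _ _ _ g h).
    exact: (smooth_on_diff sg).
  by apply: dh; exact: UV.
elim: k f => [|k IH] f [df Pf]; first by split=> //; exact: dgf.
split=> [|i]; first exact: dgf.
apply: (@eq_Ck _ _ _ _ _ (fun p => \sum_j partial i g p 0 j * partial j f (g p))) => //.
  move=> q Uq; have dg := smooth_on_diff sg Uq; have dfg := df _ (UV q Uq).
  rewrite /= /partial [RHS]deriveE; last exact: dgf.
  rewrite (diff_comp dg dfg) /= -(deriveE _ dg) -(deriveE _ dfg).
  by rewrite (derive_sum_partial _ dfg).
apply: Ck_sum => // j; apply: Ck_M => //; last exact: IH (Pf j).
have /smooth_onP := smooth_coord j oU (smooth_on_partial i sg); exact.
Qed.

(** * Derivatives along lines *)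

Section Lines.
Context {R : realType} {V W : normedModType R}.

Lemma derive_comp (U : normedModType R) (f : V -> W) (g : U -> V) (x v : U) :
  differentiable g x -> differentiable f (g x) ->
  'D_v (fun y => f (g y)) x = 'D_('D_v g x) f (g x).
Proof.
move=> dg df; rewrite deriveE; last exact: (@differentiable_comp _ _ _ _ g f).
by rewrite (diff_comp dg df) /= !deriveE.
Qed.

Lemma is_derive_line (f : V -> W) (p v : V) (t : R) :
  differentiable f (p + t *: v) ->
  is_derive t 1 (fun s : R => f (p + s *: v)) ('D_v f (p + t *: v)).
Proof.
move=> df.
have dl : is_diff t (fun s : R => p + s *: v) (fun s : R => s *: v).
  apply: (@is_diff_eq _ _ _ _ (0 \+ (fun s : R => s *: v))).
  by apply/funext => s; rewrite /= add0r.
have dc : differentiable (fun s : R => f (p + s *: v)) t.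
  by apply: (@differentiable_comp _ _ _ _ (fun s : R => p + s *: v) f) => //.
split; first exact: diff_derivable.
rewrite (@derive_comp _ f (fun s : R => p + s *: v)) //.
suff -> : 'D_1 (fun s : R => p + s *: v) t = v by [].
by rewrite deriveE // diff_val scale1r.
Qed.

End Lines.

Lemma MVT_line (R : realType) (V : normedModType R) (f : V -> R) (p v : V) (h : R) :
  0 < h -> (forall s, 0 <= s <= h -> differentiable f (p + s *: v)) ->
  exists2 c, 0 < c < h & f (p + h *: v) - f p = 'D_v f (p + c *: v) * h.
Proof.
move=> h0 df; pose g (s : R) := f (p + s *: v).
have [||c] := @MVT R g (fun s => 'D_v f (p + s *: v)) 0 h h0.
- move=> s; rewrite in_itv /= => /andP[s0 sh].
  by apply: is_derive_line; apply: df; rewrite !ltW.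
- apply: continuous_in_subspaceT => s; rewrite inE /= in_itv /= => sh.
  apply: differentiable_continuous; apply/derivable1_diffP.
  by case: (is_derive_line (df s sh)).
rewrite in_itv /= => ch; rewrite /g scale0r addr0 subr0 => E.
by exists c.
Qed.

Lemma derive_translate (R : realType) (V W : normedModType R) (f : V -> W) (p c v : V) :
  'D_v (fun q => f (q + c)) p = 'D_v f (p + c).
Proof.
rewrite /derive; set g1 := (fun h : R => _); set g2 := (fun h : R => _).
suff -> : g1 = g2 by [].
by apply/funext => h; rewrite /g1 /g2 /= addrA.
Qed.

(** The second difference is the increment over h v of the function q -> f (q + h w) - f q. The mean
    value theorem is applied to this function along v, then to the v-derivative of f along w. *)
Lemma second_difference (R : realType) (V : normedModType R) (f : V -> R)
    (p v w : V) (h : R) : 0 < h ->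
  (forall s t, 0 <= s <= h -> 0 <= t <= h -> differentiable f (p + s *: v + t *: w)) ->
  (forall s t, 0 <= s <= h -> 0 <= t <= h ->
     differentiable (fun q => 'D_v f q) (p + s *: v + t *: w)) ->
  exists s t, [/\ 0 < s < h, 0 < t < h &
    f (p + h *: v + h *: w) - f (p + h *: w) - f (p + h *: v) + f p =
    'D_w (fun q => 'D_v f q) (p + s *: v + t *: w) * h ^+ 2].
Proof.
move=> h0 df ddf; have h0h : 0 <= h <= h by apply/andP; split => //; exact: ltW.
have z0h : 0 <= (0 : R) <= h by apply/andP; split => //; exact: ltW.
pose g q := f (q + h *: w) - f q.
have dgE s : 0 <= s <= h -> is_diff (p + s *: v) g
    (fun x => 'D_x f (p + s *: v + h *: w) - 'D_x f (p + s *: v)).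
  move=> sh; have d1 := df s h sh h0h.
  have d0 : differentiable f (p + s *: v).
    by have := df s 0 sh z0h; rewrite scale0r addr0.
  have d2 : differentiable (fun q : V => f (q + h *: w)) (p + s *: v).
    by apply: (@differentiable_comp _ _ _ _ (fun q => q + h *: w) f).
  split; first exact: differentiableB.
  apply/funext => x; rewrite -deriveE; last exact: differentiableB.
  have E := deriveB (diff_derivable (v := x) d2) (diff_derivable (v := x) d0).
  by rewrite derive_translate in E.
have [|s sh E] := @MVT_line _ _ g p v h h0.
  by move=> s /dgE [].
have s0h : 0 <= s <= h by case/andP: sh => *; rewrite !ltW.
have [|t th F] := @MVT_line _ _ (fun q => 'D_v f q) (p + s *: v) w h h0.
  by move=> t th; exact: ddf.
exists s, t; split => //.
have -> : 'D_w (fun q => 'D_v f q) (p + s *: v + t *: w) * h ^+ 2 = g (p + h *: v) - g p.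
  rewrite E; have [dg dE] := dgE s s0h.
  by rewrite (deriveE _ dg) dE F expr2 mulrA.
rewrite /g; ring.
Qed.

(** * Symmetry of second partial derivatives *)

Section Schwarz.
Context {R : realType} {n : nat}.
Local Notation E := 'rV[R]_n.+1.
Implicit Types (U : set E) (p q v : E).

(** The second difference over the parallelogram with sides h v and h w is symmetric in v and w.
    Read in the two orders, it is h^2 times a value of either mixed derivative near p, and both are
    continuous at p. *)
Lemma partialC U (f : E -> R) (i j : 'I_n.+1) p :
  open U -> U p -> smooth_on U f ->
  partial i (partial j f) p = partial j (partial i f) p.
Proof.
move=> oU Up sf.
set a := partial i (partial j f); set b := partial j (partial i f).
apply/eqP; apply: contraT; rewrite -subr_eq0 => ab.
(* Half the supposed gap: the two mixed derivatives will share a value closer than [e] to both [a p]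
   and [b p]. *)
pose e := `|a p - b p| / 2.
have e0 : 0 < e by rewrite divr_gt0 // normr_gt0.
have ca : {for p, continuous a}.
  by apply: differentiable_continuous; apply: smooth_on_diff Up; do 2!apply: smooth_on_partial.
have cb : {for p, continuous b}.
  by apply: differentiable_continuous; apply: smooth_on_diff Up; do 2!apply: smooth_on_partial.
have : \forall q \near p, [/\ U q, `|a p - a q| < e & `|b p - b q| < e].
  have H1 : \forall q \near p, U q by exact: open_nbhs_nbhs.
  have H2 : \forall q \near p, `|a p - a q| < e by move/cvgrPdist_lt: ca; apply.
  have H3 : \forall q \near p, `|b p - b q| < e by move/cvgrPdist_lt: cb; apply.
  by apply: filterS (filterI H1 (filterI H2 H3)) => q [? []].
case/nbhs_ballP => r /= r0 Br.
pose v : E := delta_mx 0 i; pose w : E := delta_mx 0 j.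
(* Small enough for the parallelogram to stay inside the ball. *)
pose h := r / (`|v| + `|w| + 1).
have D0 : 0 < `|v| + `|w| + 1 by rewrite ltr_wpDl // addr_ge0.
have h0 : 0 < h by rewrite divr_gt0.
have inB s t : 0 <= s <= h -> 0 <= t <= h -> ball p r (p + s *: v + t *: w).
  move=> /andP[s0 sh] /andP[t0 th]; rewrite -ball_normE /=.
  rewrite -addrA opprD addrA subrr add0r normrN.
  apply: le_lt_trans (ler_normD _ _) _; rewrite !normrZ !ger0_norm //.
  apply: (@le_lt_trans _ _ (h * (`|v| + `|w|))).
    by rewrite mulrDr lerD // ler_wpM2r.
  rewrite /h mulrAC ltr_pdivrMr // ltr_pM2l //; lra.
have inB' s t : 0 <= s <= h -> 0 <= t <= h -> ball p r (p + t *: w + s *: v).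
  by move=> sh th; rewrite -addrA [_ *: w + _]addrC addrA; exact: inB.
have [||s [t [sh th E1]]] := @second_difference _ _ f p v w h h0.
- by move=> s t sh th; apply: (smooth_on_diff sf); have [] := Br _ (inB s t sh th).
- move=> s t sh th; apply: (smooth_on_diff (smooth_on_partial i sf)).
  by have [] := Br _ (inB s t sh th).
have [||t' [s' [th' sh' E2]]] := @second_difference _ _ f p w v h h0.
- by move=> t' s' th' sh'; apply: (smooth_on_diff sf); have [] := Br _ (inB' s' t' sh' th').
- move=> t' s' th' sh'; apply: (smooth_on_diff (smooth_on_partial j sf)).
  by have [] := Br _ (inB' s' t' sh' th').
have W x : 0 < x < h -> 0 <= x <= h by case/andP => *; rewrite !ltW.
have [_ _ Hb] := Br _ (inB s t (W _ sh) (W _ th)).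
have [_ Ha _] := Br _ (inB' s' t' (W _ sh') (W _ th')).
have EE : b (p + s *: v + t *: w) = a (p + t' *: w + s' *: v).
  apply: (@mulIf _ (h ^+ 2)); first by rewrite expf_neq0 // gt_eqF.
  have F1 : b (p + s *: v + t *: w) * h ^+ 2 = _ := esym E1.
  have F2 : a (p + t' *: w + s' *: v) * h ^+ 2 = _ := esym E2.
  refine (etrans F1 (etrans _ (esym F2))).
  have -> : p + h *: w + h *: v = p + h *: v + h *: w by exact: addrAC.
  move: (f (p + h *: v + h *: w)) (f (p + h *: v)) (f (p + h *: w)) (f p) => A B C D.
  ring.
move: Ha; rewrite -EE => Ha.
have tri (A B C d : R) : `|A - C| < d -> `|B - C| < d -> `|A - B| < d + d.
  move=> HA HB; rewrite -(subrKA C) -[C - B]opprB.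
  by apply: le_lt_trans (ler_normB _ _) _; exact: ltrD.
by have := tri _ _ _ _ Ha Hb; rewrite /e -splitr ltxx.
Qed.

End Schwarz.

(** * Vector fields as derivations *)

Section Lie.
Context {R : realType} {n : nat}.
Local Notation E := 'rV[R]_n.+1.
Implicit Types (U : set E) (p q : E) (X Y : E -> E) (f g : E -> R).

(** The coordinate expression, rather than the directional derivative, shows [lie X f] as a
    combination of partial derivatives with smooth coefficients; the two agree where f is
    differentiable. *)
Definition lie X f : E -> R := fun p => \sum_i X p 0 i * partial i f p.

Lemma lieE X f p : differentiable f p -> lie X f p = 'D_(X p) f p.
Proof. by move=> df; rewrite derive_sum_partial. Qed.

Lemma lie_smooth U X f : open U -> smooth_on U X -> smooth_on U f ->
  smooth_on U (lie X f).
Proof.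
move=> oU sX sf; apply: smooth_sum => // i; apply: smoothM => //.
  exact: smooth_coord.
exact: smooth_on_partial.
Qed.

Lemma iter_lie_smooth U X f m : open U -> smooth_on U X -> smooth_on U f ->
  smooth_on U (iter m (lie X) f).
Proof. by move=> oU sX sf; elim: m => //= m IH; exact: lie_smooth. Qed.

Lemma eq_lie U X f g p : open U -> U p -> (forall q, U q -> f q = g q) ->
  lie X f p = lie X g p.
Proof.
by move=> oU Up fg; apply: eq_bigr => i _; rewrite (eq_partial i oU Up fg).
Qed.

Lemma eq_iter_lie U X f g m p : open U -> U p -> (forall q, U q -> f q = g q) ->
  iter m (lie X) f p = iter m (lie X) g p.
Proof.
move=> oU Up fg; elim: m p Up => [|m IH] p Up /=; first exact: fg.
exact: eq_lie oU Up IH.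
Qed.

Lemma lie_cst X c p : lie X (fun=> c) p = 0.
Proof.
by apply: big1 => i _; rewrite /partial [X in _ * X](_ : _ = 0) ?mulr0 // derive_cst.
Qed.

Lemma lieD U X f g p : U p -> smooth_on U f -> smooth_on U g ->
  lie X (fun q => f q + g q) p = lie X f p + lie X g p.
Proof.
move=> Up sf sg; rewrite /lie -big_split /=; apply: eq_bigr => i _.
rewrite /partial -mulrDr; congr (_ * _).
by apply: deriveD; apply: diff_derivable; [exact: smooth_on_diff sf Up|exact: smooth_on_diff sg Up].
Qed.

Lemma lieM U X f g p : U p -> smooth_on U f -> smooth_on U g ->
  lie X (fun q => f q * g q) p = lie X f p * g p + f p * lie X g p.
Proof.
move=> Up sf sg; rewrite /lie mulr_suml mulr_sumr -big_split /=.
apply: eq_bigr => i _; rewrite /partial [X in _ * X](_ : _ =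
  f p *: partial i g p + g p *: partial i f p).
  by rewrite /GRing.scale /= /partial; ring.
by apply: deriveM; apply: diff_derivable; [exact: smooth_on_diff sf Up|exact: smooth_on_diff sg Up].
Qed.

Lemma lieZ U X f c p : U p -> smooth_on U f ->
  lie X (fun q => c * f q) p = c * lie X f p.
Proof.
by move=> Up sf; rewrite (lieM X Up (smooth_cst (c : R)) sf) lie_cst mul0r add0r.
Qed.

Lemma lieN U X f p : U p -> smooth_on U f ->
  lie X (fun q => - f q) p = - lie X f p.
Proof.
move=> Up sf; rewrite -[RHS]mulN1r -(lieZ X (-1) Up sf); congr (lie X _ p).
by apply/funext => q; rewrite mulN1r.
Qed.

Lemma lieB U X f g p : open U -> U p -> smooth_on U f -> smooth_on U g ->
  lie X (fun q => f q - g q) p = lie X f p - lie X g p.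
Proof.
by move=> oU Up sf sg; rewrite (lieD X Up sf (smoothN oU sg)) (lieN X Up sg).
Qed.

(** Both orders produce the same second-order terms, by the symmetry of mixed partial derivatives;
    only derivatives of the coefficients survive. *)
Lemma lie_bracket U X Y f p : open U -> U p ->
  smooth_on U X -> smooth_on U Y -> smooth_on U f ->
  lie X (lie Y f) p - lie Y (lie X f) p =
  \sum_i (lie X (fun q => Y q 0 i) p - lie Y (fun q => X q 0 i) p) * partial i f p.
Proof.
move=> oU Up sX sY sf.
have key (A B : E -> E) : smooth_on U A -> smooth_on U B -> lie A (lie B f) p =
    \sum_i lie A (fun q => B q 0 i) p * partial i f p +
    \sum_i \sum_j A p 0 j * B p 0 i * partial j (partial i f) p.
  move=> sA sB.
  have -> : lie A (lie B f) p = \sum_i lie A (fun q => B q 0 i * partial i f q) p.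
    rewrite /lie exchange_big /=; apply: eq_bigr => j _.
    rewrite -mulr_sumr; congr (_ * _); rewrite /partial.
    have -> : (fun q => \sum_i B q 0 i * 'D_(delta_mx 0 i) f q) =
       \sum_i (fun q => B q 0 i * 'D_(delta_mx 0 i) f q).
      by apply/funext => q; rewrite fct_sumE.
    rewrite derive_sum // => i; apply: diff_derivable; apply: (smooth_on_diff _ Up).
    by apply: smoothM => //; [exact: smooth_coord|exact: smooth_on_partial].
  rewrite -big_split /=; apply: eq_bigr => i _.
  rewrite (lieM A Up (smooth_coord i oU sB) (smooth_on_partial i sf)); congr (_ + _).
  by rewrite [X in _ * X]/lie mulr_sumr; apply: eq_bigr => j _; ring.
rewrite (key X Y) // (key Y X) // opprD addrACA -sumrB.
rewrite [X in _ + X](_ : _ = 0) ?addr0; last first.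
  apply/eqP; rewrite subr_eq0; apply/eqP; rewrite exchange_big /=.
  apply: eq_bigr => j _; apply: eq_bigr => i _.
  by rewrite (partialC j i oU Up sf); ring.
by apply: eq_bigr => i _; rewrite mulrBl.
Qed.

Lemma iter_lieD U X f g m p : open U -> smooth_on U X -> U p ->
  smooth_on U f -> smooth_on U g ->
  iter m (lie X) (fun q => f q + g q) p = iter m (lie X) f p + iter m (lie X) g p.
Proof.
move=> oU sX + sf sg; elim: m p => [//|m IH] p Up.
rewrite [LHS]/= (eq_lie X oU Up IH).
by rewrite (lieD X Up) //; exact: iter_lie_smooth.
Qed.

Lemma iter_lieZ U X f c m p : open U -> smooth_on U X -> U p -> smooth_on U f ->
  iter m (lie X) (fun q => c * f q) p = c * iter m (lie X) f p.
Proof.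
move=> oU sX + sf; elim: m p => [//|m IH] p Up.
rewrite [LHS]/= (eq_lie X oU Up IH).
by rewrite (lieZ X c Up) //; exact: iter_lie_smooth.
Qed.

Lemma iter_lie_eq0 U X f m m' : open U -> (m <= m')%N ->
  (forall p, U p -> iter m (lie X) f p = 0) ->
  forall p, U p -> iter m' (lie X) f p = 0.
Proof.
move=> oU /subnK <-; elim: (m' - m)%N => [//|d IH] f0 p Up.
by rewrite addSn /= (eq_lie X oU Up (IH f0)) lie_cst.
Qed.

(* Only the middle term of the Leibniz formula survives. *)
Lemma iter_lieM_nilpotent U X a b f g : open U -> smooth_on U X ->
  smooth_on U f -> smooth_on U g ->
  (forall p, U p -> iter a.+1 (lie X) f p = 0) ->
  (forall p, U p -> iter b.+1 (lie X) g p = 0) ->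
  forall p, U p -> iter (a + b) (lie X) (fun q => f q * g q) p =
    'C(a + b, a)%:R * iter a (lie X) f p * iter b (lie X) g p.
Proof.
move=> oU sX; move En : (a + b)%N => m.
elim: m a b En f g => [|m IH] a b En f g sf sg f0 g0 p Up.
  by move/eqP: En; rewrite addn_eq0 => /andP[/eqP-> /eqP->]; rewrite bin0 mul1r.
rewrite iterSr.
have E q : U q -> lie X (fun q => f q * g q) q = lie X f q * g q + f q * lie X g q.
  by move=> Uq; exact: lieM Uq sf sg.
have sXf := lie_smooth oU sX sf; have sXg := lie_smooth oU sX sg.
rewrite (eq_iter_lie X m oU Up E) (iter_lieD m oU sX Up); [|exact: smoothM..].
have T1 : iter m (lie X) (fun q => lie X f q * g q) p =
    (if a is a'.+1 then 'C(m, a')%:R else 0) * iter a (lie X) f p * iter b (lie X) g p.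
  case: a En f0 => [|a'] En f0.
    rewrite !mul0r (@eq_iter_lie _ X _ (fun=> 0) m _ oU Up); last first.
      by move=> q Uq; have f0q : lie X f q = 0 := f0 q Uq; rewrite f0q mul0r.
    by apply: (@iter_lie_eq0 U X (fun=> 0) 0 m oU) Up.
  rewrite (IH a' b) //; last by move=> q Uq; rewrite -iterSr; exact: f0.
    by rewrite iterSr.
  by case: En.
have T2 : iter m (lie X) (fun q => f q * lie X g q) p =
    (if b is b'.+1 then 'C(m, a)%:R else 0) * iter a (lie X) f p * iter b (lie X) g p.
  case: b En g0 {T1} => [|b'] En g0.
    rewrite !mul0r (@eq_iter_lie _ X _ (fun=> 0) m _ oU Up); last first.
      by move=> q Uq; have g0q : lie X g q = 0 := g0 q Uq; rewrite g0q mulr0.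
    by apply: (@iter_lie_eq0 U X (fun=> 0) 0 m oU) Up.
  rewrite (IH a b') //; last by move=> q Uq; rewrite -iterSr; exact: g0.
    by rewrite iterSr.
  by move: En; rewrite addnS; case.
rewrite T1 T2 -!mulrDl; congr (_ * _ * _).
case: a En {f0 T1 T2} => [|a] En.
  by case: b En {g0} => [//|b] _; rewrite !bin0 add0r.
case: b En {g0} => [|b] En; last by rewrite binS natrD addrC.
by move: En; rewrite addn0 => -[->]; rewrite addr0 !binn.
Qed.

Lemma iter_lie_sqr U X f m : open U -> smooth_on U X -> smooth_on U f ->
  (forall p, U p -> iter m.+1 (lie X) f p = 0) ->
  forall p, U p -> iter (m + m) (lie X) (fun q => f q * f q) p =
    'C(m + m, m)%:R * iter m (lie X) f p ^+ 2.
Proof.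
by move=> oU sX sf f0 p Up; rewrite (iter_lieM_nilpotent oU sX sf sf f0 f0 Up) -mulrA.
Qed.

Lemma iter_lieM_eq0 U X f g m : open U -> smooth_on U X ->
  smooth_on U f -> smooth_on U g ->
  (forall p, U p -> iter m (lie X) f p = 0) ->
  (forall p, U p -> iter m (lie X) g p = 0) ->
  forall p, U p -> iter (m + m) (lie X) (fun q => f q * g q) p = 0.
Proof.
move=> oU sX sf sg f0 g0 p Up.
rewrite (iter_lieM_nilpotent oU sX sf sg _ _ Up) ?f0 ?mulr0 ?mul0r //.
- by move=> q Uq; exact: (iter_lie_eq0 oU (leqnSn m) f0).
- by move=> q Uq; exact: (iter_lie_eq0 oU (leqnSn m) g0).
Qed.

(* Comparing the top derivatives [X ^ 2m] of both sides of the relation gives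
   [- (X^m q)^2 = (X^m p1)^2 + (X^m p2)^2] as long as [m > 0]. *)
Lemma nilpotent_relation_const U X (q p1 p2 : E -> R) (c : R) (N : nat) : open U -> smooth_on U X ->
  smooth_on U q -> smooth_on U p1 -> smooth_on U p2 ->
  (forall w : E, U w -> q w * (c - q w) = p1 w ^+ 2 + p2 w ^+ 2) ->
  (forall w : E, U w -> iter N (lie X) q w = 0) ->
  (forall w : E, U w -> iter N (lie X) p1 w = 0) ->
  (forall w : E, U w -> iter N (lie X) p2 w = 0) ->
  forall w : E, U w -> [/\ lie X q w = 0, lie X p1 w = 0 & lie X p2 w = 0].
Proof.
move=> oU sX sq s1 s2 rel; case: N => [|N].
  move=> q0 p10 p20 p Up; rewrite (eq_lie X oU Up q0) (eq_lie X oU Up p10).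
  by rewrite (eq_lie X oU Up p20) !lie_cst.
elim: N => [|m IH] q0 p10 p20.
  by move=> p Up; split; [exact: q0|exact: p10|exact: p20].
have H p : U p -> [/\ iter m.+1 (lie X) q p = 0, iter m.+1 (lie X) p1 p = 0 &
    iter m.+1 (lie X) p2 p = 0].
  (* Since M = 2 (m + 1) is at least m + 2, the linear term c q dies under the M-th power, while
     each square keeps its middle Leibniz term. *)
  move=> Up; set M := (m.+1 + m.+1)%N.
  have E : iter M (lie X) (fun p => q p * q p) p + iter M (lie X) (fun p => p1 p * p1 p) p +
      iter M (lie X) (fun p => p2 p * p2 p) p = 0.
    rewrite -!(iter_lieD _ oU sX Up); try by do ?apply: smoothD => //; exact: smoothM.
    rewrite (@eq_iter_lie U X _ (fun p => c * q p) M p oU Up).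
      rewrite (iter_lieZ _ _ oU sX Up) // (@iter_lie_eq0 U X q m.+2 M) ?mulr0 //.
      by rewrite /M addSnnS leq_addl.
    by move=> r Ur; have := rel r Ur; rewrite mulrBr !expr2 => H; rewrite -addrA -H; ring.
  (* The three squares carry the same positive binomial coefficient, so a vanishing sum of real
     squares remains. *)
  move: E; rewrite !(iter_lie_sqr oU sX) // -!mulrDr => /eqP.
  rewrite mulf_eq0 pnatr_eq0 -leqn0 leqNgt bin_gt0 leq_addr /=.
  rewrite !paddr_eq0 ?addr_ge0 ?sqr_ge0 // !sqrf_eq0 => /andP[/andP[/eqP-> /eqP->] /eqP->].
  by [].
by apply: IH => p Up; have [] := H p Up.
Qed.

End Lie.

(** * The structure equations on the frame bundle *)

(** Certificates for equalities modulo hypotheses: the coefficients [ci] exhibit a - b in the ideal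
    generated by the differences li - ri, and [ring] or [field] checks the resulting identity. *)
Lemma lin_comb1 (R : comRingType) (a b c l r : R) :
  l = r -> a - b = c * (l - r) -> a = b.
Proof. by move=> -> E; apply/eqP; rewrite -subr_eq0 E subrr mulr0. Qed.

Lemma lin_comb2 (R : comRingType) (a b c1 l1 r1 c2 l2 r2 : R) :
  l1 = r1 -> l2 = r2 -> a - b = c1 * (l1 - r1) + c2 * (l2 - r2) -> a = b.
Proof. by move=> -> -> E; apply/eqP; rewrite -subr_eq0 E !subrr !mulr0 addr0. Qed.

Lemma lin_comb3 (R : comRingType) (a b c1 l1 r1 c2 l2 r2 c3 l3 r3 : R) :
  l1 = r1 -> l2 = r2 -> l3 = r3 ->
  a - b = c1 * (l1 - r1) + c2 * (l2 - r2) + c3 * (l3 - r3) -> a = b.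
Proof. by move=> -> -> -> E; apply/eqP; rewrite -subr_eq0 E !subrr !mulr0 !addr0. Qed.

Lemma lin_comb4 (R : comRingType) (a b c1 l1 r1 c2 l2 r2 c3 l3 r3 c4 l4 r4 : R) :
  l1 = r1 -> l2 = r2 -> l3 = r3 -> l4 = r4 ->
  a - b = c1 * (l1 - r1) + c2 * (l2 - r2) + c3 * (l3 - r3) + c4 * (l4 - r4) -> a = b.
Proof. by move=> -> -> -> -> E; apply/eqP; rewrite -subr_eq0 E !subrr !mulr0 !addr0. Qed.

Lemma lin_comb5 (R : comRingType) (a b c1 l1 r1 c2 l2 r2 c3 l3 r3 c4 l4 r4 c5 l5 r5 : R) :
  l1 = r1 -> l2 = r2 -> l3 = r3 -> l4 = r4 -> l5 = r5 ->
  a - b = c1 * (l1 - r1) + c2 * (l2 - r2) + c3 * (l3 - r3) + c4 * (l4 - r4) +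
    c5 * (l5 - r5) -> a = b.
Proof. by move=> -> -> -> -> -> E; apply/eqP; rewrite -subr_eq0 E !subrr !mulr0 !addr0. Qed.

Ltac smooth := repeat first
  [ assumption
  | apply: smooth_cst
  | apply: smoothD; [assumption|..]
  | apply: smoothN; [assumption|..]
  | apply: smoothM; [assumption|..]
  | apply: smoothX; [assumption|..]
  | apply: lie_smooth; [assumption|..] ].

(* [e1], [e2] is an adapted orthonormal frame moved by the horizontal fields
   [Z], [H] of the frame bundle, [hab] the second fundamental form in this frame. *)
Record moving_frame (R : realType) (n : nat) (kappa tau : R) (W : set 'rV[R]_n.+1)
    (Z H V : 'rV[R]_n.+1 -> 'rV[R]_n.+1)
    (x y e11 e12 e13 e21 e22 e23 n1 n2 n3 s1 s2 h11 h12 h22 K : 'rV[R]_n.+1 -> R) :=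
  MovingFrame {
  mf_open : open W;
  mf_Z : smooth_on W Z; mf_H : smooth_on W H; mf_V : smooth_on W V;
  mf_x : smooth_on W x; mf_y : smooth_on W y;
  mf_e11 : smooth_on W e11; mf_e12 : smooth_on W e12; mf_e13 : smooth_on W e13;
  mf_e21 : smooth_on W e21; mf_e22 : smooth_on W e22; mf_e23 : smooth_on W e23;
  mf_h11 : smooth_on W h11; mf_h12 : smooth_on W h12; mf_h22 : smooth_on W h22;
  mf_n1 : forall p, n1 p = e12 p * e23 p - e13 p * e22 p;
  mf_n2 : forall p, n2 p = e13 p * e21 p - e11 p * e23 p;
  mf_n3 : forall p, n3 p = e11 p * e22 p - e12 p * e21 p;
  mf_s1 : forall p, s1 p = kappa / 2 * (y p * e11 p - x p * e12 p) - 2 * tau * e13 p;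
  mf_s2 : forall p, s2 p = kappa / 2 * (y p * e21 p - x p * e22 p) - 2 * tau * e23 p;
  mf_o11 : forall p, W p -> e11 p ^+ 2 + e12 p ^+ 2 + e13 p ^+ 2 = 1;
  mf_o12 : forall p, W p -> e11 p * e21 p + e12 p * e22 p + e13 p * e23 p = 0;
  mf_o22 : forall p, W p -> e21 p ^+ 2 + e22 p ^+ 2 + e23 p ^+ 2 = 1;
  mf_Zx : forall p, W p -> lie Z x p = (1 + kappa / 4 * (x p ^+ 2 + y p ^+ 2)) * e11 p;
  mf_Zy : forall p, W p -> lie Z y p = (1 + kappa / 4 * (x p ^+ 2 + y p ^+ 2)) * e12 p;
  mf_Hx : forall p, W p -> lie H x p = (1 + kappa / 4 * (x p ^+ 2 + y p ^+ 2)) * e21 p;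
  mf_Hy : forall p, W p -> lie H y p = (1 + kappa / 4 * (x p ^+ 2 + y p ^+ 2)) * e22 p;
  mf_Ze11 : forall p, W p -> lie Z e11 p = h11 p * n1 p + s1 p * e12 p;
  mf_Ze12 : forall p, W p -> lie Z e12 p = h11 p * n2 p - s1 p * e11 p;
  mf_Ze13 : forall p, W p -> lie Z e13 p = h11 p * n3 p;
  mf_He11 : forall p, W p -> lie H e11 p = (h12 p + tau) * n1 p + s2 p * e12 p;
  mf_He12 : forall p, W p -> lie H e12 p = (h12 p + tau) * n2 p - s2 p * e11 p;
  mf_He13 : forall p, W p -> lie H e13 p = (h12 p + tau) * n3 p;
  mf_Ze21 : forall p, W p -> lie Z e21 p = (h12 p - tau) * n1 p + s1 p * e22 p;
  mf_Ze22 : forall p, W p -> lie Z e22 p = (h12 p - tau) * n2 p - s1 p * e21 p;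
  mf_Ze23 : forall p, W p -> lie Z e23 p = (h12 p - tau) * n3 p;
  mf_He21 : forall p, W p -> lie H e21 p = h22 p * n1 p + s2 p * e22 p;
  mf_He22 : forall p, W p -> lie H e22 p = h22 p * n2 p - s2 p * e21 p;
  mf_He23 : forall p, W p -> lie H e23 p = h22 p * n3 p;
  mf_V11 : forall p, W p -> lie V e11 p = e21 p; mf_V21 : forall p, W p -> lie V e21 p = - e11 p;
  mf_V12 : forall p, W p -> lie V e12 p = e22 p; mf_V22 : forall p, W p -> lie V e22 p = - e12 p;
  mf_V13 : forall p, W p -> lie V e13 p = e23 p; mf_V23 : forall p, W p -> lie V e23 p = - e13 p;
  mf_VZ : forall f p, smooth_on W f -> W p -> lie V (lie Z f) p - lie Z (lie V f) p = lie H f p;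
  mf_VH : forall f p, smooth_on W f -> W p -> lie V (lie H f) p - lie H (lie V f) p = - lie Z f p;
  mf_ZH : forall f p, smooth_on W f -> W p -> lie Z (lie H f) p - lie H (lie Z f) p = K p * lie V f p
}.

Section StructureEquations.
Context {R : realType} {n : nat} {kappa tau : R} {W : set 'rV[R]_n.+1}
  {Z H V : 'rV[R]_n.+1 -> 'rV[R]_n.+1}
  {x y e11 e12 e13 e21 e22 e23 n1 n2 n3 s1 s2 h11 h12 h22 K : 'rV[R]_n.+1 -> R}.
Hypothesis mf : moving_frame kappa tau W Z H V x y e11 e12 e13 e21 e22 e23 n1 n2 n3
  s1 s2 h11 h12 h22 K.
Let c := kappa - 4 * tau ^+ 2.

Let oW := mf_open mf.
Let sZ := mf_Z mf.
Let sH := mf_H mf.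
Let sV := mf_V mf.
Let sx := mf_x mf.
Let sy := mf_y mf.
Let se11 := mf_e11 mf.
Let se12 := mf_e12 mf.
Let se13 := mf_e13 mf.
Let se21 := mf_e21 mf.
Let se22 := mf_e22 mf.
Let se23 := mf_e23 mf.
Let sh11 := mf_h11 mf.
Let sh12 := mf_h12 mf.
Let sh22 := mf_h22 mf.

Lemma mf_sn1 : smooth_on W n1.
Proof. by rewrite (funext (mf_n1 mf)); smooth. Qed.

Lemma mf_sn2 : smooth_on W n2.
Proof. by rewrite (funext (mf_n2 mf)); smooth. Qed.

Lemma mf_sn3 : smooth_on W n3.
Proof. by rewrite (funext (mf_n3 mf)); smooth. Qed.

Lemma mf_ss1 : smooth_on W s1.
Proof. by rewrite (funext (mf_s1 mf)); smooth. Qed.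

Lemma mf_ss2 : smooth_on W s2.
Proof. by rewrite (funext (mf_s2 mf)); smooth. Qed.

Let sn1 := mf_sn1.
Let sn2 := mf_sn2.
Let sn3 := mf_sn3.
Let ss1 := mf_ss1.
Let ss2 := mf_ss2.

Lemma mf_orth p : W p ->
  [/\ n1 p ^+ 2 + n2 p ^+ 2 + n3 p ^+ 2 = 1,
      e13 p ^+ 2 + e23 p ^+ 2 + n3 p ^+ 2 = 1,
      [/\ n2 p * e23 p - n3 p * e22 p = - e11 p,
      n3 p * e21 p - n1 p * e23 p = - e12 p &
      n1 p * e22 p - n2 p * e21 p = - e13 p] &
      [/\ n2 p * e13 p - n3 p * e12 p = e21 p,
      n3 p * e11 p - n1 p * e13 p = e22 p &
      n1 p * e12 p - n2 p * e11 p = e23 p] ].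
Proof.
move=> Wp; have := (mf_o11 mf Wp, mf_o12 mf Wp, mf_o22 mf Wp).
rewrite (mf_n1 mf) (mf_n2 mf) (mf_n3 mf).
move: (e11 p) (e12 p) (e13 p) (e21 p) (e22 p) (e23 p) => a1 a2 a3 b1 b2 b3.
move=> -[ [r11 r12] r22]; split; [| |split|split].
- apply: (lin_comb3 r11 r12 r22 (c1 := b1 ^+ 2 + b2 ^+ 2 + b3 ^+ 2)
    (c2 := - (a1 * b1 + a2 * b2 + a3 * b3)) (c3 := 1)); ring.
- have NN : (a2 * b3 - a3 * b2) ^+ 2 + (a3 * b1 - a1 * b3) ^+ 2 + (a1 * b2 - a2 * b1) ^+ 2 = 1.
    apply: (lin_comb3 r11 r12 r22 (c1 := b1 ^+ 2 + b2 ^+ 2 + b3 ^+ 2)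
      (c2 := - (a1 * b1 + a2 * b2 + a3 * b3)) (c3 := 1)); ring.
  apply: (lin_comb3 r11 r12 r22 (c1 := 1 - b3 ^+ 2) (c2 := 2 * a3 * b3 - (a1 * b1 + a2 * b2 + a3 * b3))
    (c3 := a1 ^+ 2 + a2 ^+ 2)); ring.
- apply: (lin_comb2 r12 r22 (c1 := b1) (c2 := - a1)); ring.
- apply: (lin_comb2 r12 r22 (c1 := b2) (c2 := - a2)); ring.
- apply: (lin_comb2 r12 r22 (c1 := b3) (c2 := - a3)); ring.
- apply: (lin_comb2 r11 r12 (c1 := b1) (c2 := - a1)); ring.
- apply: (lin_comb2 r11 r12 (c1 := b2) (c2 := - a2)); ring.
- apply: (lin_comb2 r11 r12 (c1 := b3) (c2 := - a3)); ring.
Qed.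

Lemma mf_dn X p : W p ->
  [/\ lie X n1 p = lie X e12 p * e23 p + e12 p * lie X e23 p
        - (lie X e13 p * e22 p + e13 p * lie X e22 p),
      lie X n2 p = lie X e13 p * e21 p + e13 p * lie X e21 p
        - (lie X e11 p * e23 p + e11 p * lie X e23 p) &
      lie X n3 p = lie X e11 p * e22 p + e11 p * lie X e22 p
        - (lie X e12 p * e21 p + e12 p * lie X e21 p)].
Proof.
move=> Wp; rewrite (funext (mf_n1 mf)) (funext (mf_n2 mf)) (funext (mf_n3 mf)).
split; (rewrite (lieB X oW Wp); (try by smooth));
  rewrite (lieM X Wp); (try by smooth); rewrite (lieM X Wp) //.
Qed.

(** Weingarten equations: the product rule for n = e1 x e2 leaves cross products of n with e1 and
    e2, which [mf_orth] evaluates. *)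
Lemma mf_Zn p : W p ->
  [/\ lie Z n1 p = - h11 p * e11 p - (h12 p - tau) * e21 p + s1 p * n2 p,
      lie Z n2 p = - h11 p * e12 p - (h12 p - tau) * e22 p - s1 p * n1 p &
      lie Z n3 p = - h11 p * e13 p - (h12 p - tau) * e23 p].
Proof.
move=> Wp; have [-> -> ->] := mf_dn Z Wp; have [_ _ [a1 a2 a3] [b1 b2 b3]] := mf_orth Wp.
rewrite (mf_Ze11 mf Wp) (mf_Ze12 mf Wp) (mf_Ze13 mf Wp).
rewrite (mf_Ze21 mf Wp) (mf_Ze22 mf Wp) (mf_Ze23 mf Wp).
have := (mf_n1 mf p, mf_n2 mf p, mf_n3 mf p) => -[ [d1 d2] d3].
move: a1 a2 a3 b1 b2 b3 d1 d2 d3.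
move: (e11 p) (e12 p) (e13 p) (e21 p) (e22 p) (e23 p) (n1 p) (n2 p) (n3 p) (h11 p) (h12 p) (s1 p).
move=> f11 f12 f13 f21 f22 f23 m1 m2 m3 k11 k12 s a1 a2 a3 b1 b2 b3 d1 d2 d3; split.
- apply: (lin_comb3 a1 b1 d2 (c1 := k11) (c2 := - (k12 - tau)) (c3 := - s)); ring.
- apply: (lin_comb3 a2 b2 d1 (c1 := k11) (c2 := - (k12 - tau)) (c3 := s)); ring.
- apply: (lin_comb2 a3 b3 (c1 := k11) (c2 := - (k12 - tau))); ring.
Qed.

Lemma mf_Hn p : W p ->
  [/\ lie H n1 p = - (h12 p + tau) * e11 p - h22 p * e21 p + s2 p * n2 p,
      lie H n2 p = - (h12 p + tau) * e12 p - h22 p * e22 p - s2 p * n1 p &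
      lie H n3 p = - (h12 p + tau) * e13 p - h22 p * e23 p].
Proof.
move=> Wp; have [-> -> ->] := mf_dn H Wp; have [_ _ [a1 a2 a3] [b1 b2 b3]] := mf_orth Wp.
rewrite (mf_He11 mf Wp) (mf_He12 mf Wp) (mf_He13 mf Wp).
rewrite (mf_He21 mf Wp) (mf_He22 mf Wp) (mf_He23 mf Wp).
have := (mf_n1 mf p, mf_n2 mf p, mf_n3 mf p) => -[ [d1 d2] d3].
move: a1 a2 a3 b1 b2 b3 d1 d2 d3.
move: (e11 p) (e12 p) (e13 p) (e21 p) (e22 p) (e23 p) (n1 p) (n2 p) (n3 p) (h12 p) (h22 p) (s2 p).
move=> f11 f12 f13 f21 f22 f23 m1 m2 m3 k12 k22 s a1 a2 a3 b1 b2 b3 d1 d2 d3; split.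
- apply: (lin_comb3 a1 b1 d2 (c1 := k12 + tau) (c2 := - k22) (c3 := - s)); ring.
- apply: (lin_comb3 a2 b2 d1 (c1 := k12 + tau) (c2 := - k22) (c3 := s)); ring.
- apply: (lin_comb2 a3 b3 (c1 := k12 + tau) (c2 := - k22)); ring.
Qed.

(** s1 and s2 are the values on e1, e2 of the connection form of rotations about the fibre. Its
    exterior derivative is where kappa - 4 tau^2 originates: -kappa n3 comes from the base, and 4
    tau^2 n3 from the terms -2 tau e13 and -2 tau e23. *)
Lemma mf_ds p : W p -> lie Z s2 p - lie H s1 p = - c * n3 p.
Proof.
move=> Wp; rewrite (funext (mf_s1 mf)) (funext (mf_s2 mf)).
have E (X : 'rV[R]_n.+1 -> 'rV[R]_n.+1) (u v w : 'rV[R]_n.+1 -> R) :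
    smooth_on W u -> smooth_on W v -> smooth_on W w ->
    lie X (fun q => kappa / 2 * (y q * u q - x q * v q) - 2 * tau * w q) p =
    kappa / 2 * (lie X y p * u p + y p * lie X u p - (lie X x p * v p + x p * lie X v p))
    - 2 * tau * lie X w p.
  move=> su sv sw; rewrite (lieB X oW Wp); try by smooth.
  rewrite (lieZ X _ Wp); try by smooth.
  rewrite (lieZ X _ Wp); try by smooth.
  rewrite (lieB X oW Wp); try by smooth.
  by rewrite (lieM X Wp) // (lieM X Wp).
rewrite (E Z) // (E H) //.
rewrite (mf_Ze21 mf Wp) (mf_Ze22 mf Wp) (mf_Ze23 mf Wp).
rewrite (mf_He11 mf Wp) (mf_He12 mf Wp) (mf_He13 mf Wp).
rewrite (mf_Zx mf Wp) (mf_Zy mf Wp) (mf_Hx mf Wp) (mf_Hy mf Wp).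
rewrite (mf_s1 mf) (mf_s2 mf) (mf_n1 mf) (mf_n2 mf) (mf_n3 mf) /c.
by field.
Qed.

(** The relation [Z, H] = K V on a function whose Z and H derivatives have the common shape a b + u
    w; all six coordinates of the frame are of this kind. *)
Let commutator (a1 b1 u1 w1 a2 b2 u2 w2 : 'rV[R]_n.+1 -> R) (f : 'rV[R]_n.+1 -> R) p :
  smooth_on W f -> smooth_on W a1 -> smooth_on W b1 -> smooth_on W u1 -> smooth_on W w1 ->
  smooth_on W a2 -> smooth_on W b2 -> smooth_on W u2 -> smooth_on W w2 -> W p ->
  (forall q, W q -> lie Z f q = a1 q * b1 q + u1 q * w1 q) ->
  (forall q, W q -> lie H f q = a2 q * b2 q + u2 q * w2 q) ->
  lie Z a2 p * b2 p + a2 p * lie Z b2 p + (lie Z u2 p * w2 p + u2 p * lie Z w2 p)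
  - (lie H a1 p * b1 p + a1 p * lie H b1 p + (lie H u1 p * w1 p + u1 p * lie H w1 p))
  = K p * lie V f p.
Proof.
move=> sf ? ? ? ? ? ? ? ? Wp Zf Hf; rewrite -(mf_ZH mf sf Wp).
rewrite (eq_lie Z oW Wp Hf) (eq_lie H oW Wp Zf).
rewrite (lieD Z Wp); try by smooth.
rewrite (lieD H Wp); try by smooth.
by rewrite !(lieM _ Wp).
Qed.

(** Applying [Z, H] = K V to the coordinates of e1 and of e2 yields two vector equations. Their
    components along n are the Codazzi equations; the component of the first one along e2 is the
    Gauss equation, which identifies K. *)
Lemma mf_gauss_codazzi p : W p ->
  [/\ K p = h11 p * h22 p - h12 p ^+ 2 + tau ^+ 2 + c * n3 p ^+ 2,
      lie Z h12 p - lie H h11 p = c * n3 p * e23 p &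
      lie Z h22 p - lie H h12 p = - (c * n3 p * e13 p)].
Proof.
move=> Wp.
have sA : smooth_on W (fun q => h12 q + tau) by smooth.
have sB : smooth_on W (fun q => h12 q - tau) by smooth.
have sm1 : smooth_on W (fun q => - s1 q) by smooth.
have sm2 : smooth_on W (fun q => - s2 q) by smooth.
have s0 : smooth_on W (fun _ : 'rV[R]_n.+1 => 0 : R) by smooth.
have E1 := @commutator h11 n1 s1 e12 _ n1 s2 e12 e11 p se11 sh11 sn1 ss1 se12
  sA sn1 ss2 se12 Wp (mf_Ze11 mf) (mf_He11 mf).
have Z12 q : W q -> lie Z e12 q = h11 q * n2 q + (- s1 q) * e11 q.
  by move=> Wq; rewrite (mf_Ze12 mf Wq) mulNr.
have H12 q : W q -> lie H e12 q = (h12 q + tau) * n2 q + (- s2 q) * e11 q.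
  by move=> Wq; rewrite (mf_He12 mf Wq) mulNr.
have E2 := @commutator h11 n2 _ e11 _ n2 _ e11 e12 p se12 sh11 sn2 sm1 se11
  sA sn2 sm2 se11 Wp Z12 H12.
have Z13 q : W q -> lie Z e13 q = h11 q * n3 q + (fun=> 0) q * e11 q.
  by move=> Wq; rewrite (mf_Ze13 mf Wq) mul0r addr0.
have H13 q : W q -> lie H e13 q = (h12 q + tau) * n3 q + (fun=> 0) q * e11 q.
  by move=> Wq; rewrite (mf_He13 mf Wq) mul0r addr0.
have E3 := @commutator h11 n3 _ e11 _ n3 _ e11 e13 p se13 sh11 sn3 s0 se11
  sA sn3 s0 se11 Wp Z13 H13.
have E4 := @commutator _ n1 s1 e22 h22 n1 s2 e22 e21 p se21 sB sn1 ss1 se22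
  sh22 sn1 ss2 se22 Wp (mf_Ze21 mf) (mf_He21 mf).
have Z22 q : W q -> lie Z e22 q = (h12 q - tau) * n2 q + (- s1 q) * e21 q.
  by move=> Wq; rewrite (mf_Ze22 mf Wq) mulNr.
have H22 q : W q -> lie H e22 q = h22 q * n2 q + (- s2 q) * e21 q.
  by move=> Wq; rewrite (mf_He22 mf Wq) mulNr.
have E5 := @commutator _ n2 _ e21 h22 n2 _ e21 e22 p se22 sB sn2 sm1 se21
  sh22 sn2 sm2 se21 Wp Z22 H22.
have Z23 q : W q -> lie Z e23 q = (h12 q - tau) * n3 q + (fun=> 0) q * e21 q.
  by move=> Wq; rewrite (mf_Ze23 mf Wq) mul0r addr0.
have H23 q : W q -> lie H e23 q = h22 q * n3 q + (fun=> 0) q * e21 q.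
  by move=> Wq; rewrite (mf_He23 mf Wq) mul0r addr0.
have E6 := @commutator _ n3 _ e21 h22 n3 _ e21 e23 p se23 sB sn3 s0 se21
  sh22 sn3 s0 se21 Wp Z23 H23.
have ds := mf_ds Wp.
have [zn1 zn2 zn3] := mf_Zn Wp; have [hn1 hn2 hn3] := mf_Hn Wp.
have [NN _ [a1 a2 a3] [b1 b2 b3]] := mf_orth Wp.
have dA X : lie X (fun q => h12 q + tau) p = lie X h12 p.
  by rewrite (lieD X Wp) ?lie_cst ?addr0 //; smooth.
have dB X : lie X (fun q => h12 q - tau) p = lie X h12 p.
  by rewrite (lieD X Wp) ?lie_cst ?addr0 //; smooth.
move: E1 E2 E3 E4 E5 E6.
rewrite !dA !dB !lie_cst !(lieN _ Wp ss1) !(lieN _ Wp ss2).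
rewrite zn1 zn2 zn3 hn1 hn2 hn3.
rewrite (mf_Ze11 mf Wp) (mf_Ze12 mf Wp) (mf_He11 mf Wp) (mf_He12 mf Wp).
rewrite (mf_Ze21 mf Wp) (mf_Ze22 mf Wp) (mf_He21 mf Wp) (mf_He22 mf Wp).
rewrite (mf_V11 mf Wp) (mf_V12 mf Wp) (mf_V13 mf Wp).
rewrite (mf_V21 mf Wp) (mf_V22 mf Wp) (mf_V23 mf Wp).
have := (mf_o11 mf Wp, mf_o12 mf Wp, mf_o22 mf Wp, mf_n3 mf p).
have Ne1 : n1 p * e11 p + n2 p * e12 p + n3 p * e13 p = 0.
  by rewrite (mf_n1 mf) (mf_n2 mf) (mf_n3 mf); ring.
have Ne2 : n1 p * e21 p + n2 p * e22 p + n3 p * e23 p = 0.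
  by rewrite (mf_n1 mf) (mf_n2 mf) (mf_n3 mf); ring.
move: ds NN a1 a2 a3 b1 b2 b3 Ne1 Ne2; rewrite /c.
move: (e11 p) (e12 p) (e13 p) (e21 p) (e22 p) (e23 p) (n1 p) (n2 p) (n3 p)
  (h11 p) (h12 p) (h22 p) (s1 p) (s2 p) (K p) (lie Z s2 p) (lie H s1 p)
  (lie Z h12 p) (lie H h11 p) (lie Z h22 p) (lie H h12 p) (lie Z s1 p) (lie H s2 p).
move=> f11 f12 f13 f21 f22 f23 m1 m2 m3 k11 k12 k22 u1 u2 KK Zs2 Hs1 Z12' H11' Z22' H12' _ _.
move=> ds NN a1 a2 a3 b1 b2 b3 Ne1 Ne2 [ [ [r11 r12] r22] d3] E1 E2 E3 E4 E5 E6.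
(* With E3 the fibre direction, the first three equations read C n + (d - K) e2 + S (e1 x E3) = 0,
   the last three C' n - (d - K) e1 + S (e2 x E3) = 0. *)
pose S := Zs2 - Hs1; pose C := Z12' - H11'; pose C' := Z22' - H12'.
pose d := k11 * k22 - (k12 ^+ 2 - tau ^+ 2).
have F1 : C * m1 + d * f21 + S * f12 = KK * f21 by rewrite -E1 /C /d /S; ring.
have F2 : C * m2 + d * f22 - S * f11 = KK * f22 by rewrite -E2 /C /d /S; ring.
have F3 : C * m3 + d * f23 = KK * f23 by rewrite -E3 /C /d; ring.
have F4 : C' * m1 - d * f11 + S * f22 = - (KK * f11).
  by rewrite -[RHS]mulrN -E4 /C' /d /S; ring.
have F5 : C' * m2 - d * f12 - S * f21 = - (KK * f12).
  by rewrite -[RHS]mulrN -E5 /C' /d /S; ring.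
have F6 : C' * m3 - d * f13 = - (KK * f13).
  by rewrite -[RHS]mulrN -E6 /C' /d; ring.
have dsS : S = - (kappa - 4 * tau ^+ 2) * m3 by exact: ds.
(* Scalar product with n, where <e1 x E3, n> = e23. *)
have EC : C = - S * f23.
  apply: (lin_comb5 NN Ne2 F1 F2 F3 (c1 := - C) (c2 := KK - d) (c3 := m1) (c4 := m2) (c5 := m3)).
  have -> : f23 = m1 * f12 - m2 * f11 by rewrite b3.
  ring.
have EC' : C' = S * f13.
  apply: (lin_comb5 NN Ne1 F4 F5 F6 (c1 := - C') (c2 := d - KK) (c3 := m1) (c4 := m2) (c5 := m3)).
  have -> : f13 = - (m1 * f22 - m2 * f21) by rewrite a3 opprK.
  ring.
split.
(* Scalar product with e2, where <e1 x E3, e2> = -n3. *)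
- have : KK = d - S * m3.
    apply: (lin_comb5 r22 Ne2 F1 F2 F3 (c1 := d - KK) (c2 := C) (c3 := - f21) (c4 := - f22) (c5 := - f23)).
    rewrite d3; ring.
  by move=> ->; rewrite dsS /d; ring.
- by rewrite -/C EC dsS; ring.
- by rewrite -/C' EC' dsS; ring.
Qed.

End StructureEquations.

(** * Vanishing words: the curved and the flat case *)

Section Dichotomy.
Context {R : realType} {n : nat} {kappa tau : R} {W : set 'rV[R]_n.+1}
  {Z H V : 'rV[R]_n.+1 -> 'rV[R]_n.+1}
  {x y e11 e12 e13 e21 e22 e23 n1 n2 n3 s1 s2 h11 h12 h22 K : 'rV[R]_n.+1 -> R}.
Hypothesis mf : moving_frame kappa tau W Z H V x y e11 e12 e13 e21 e22 e23 n1 n2 n3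
  s1 s2 h11 h12 h22 K.
Let c := kappa - 4 * tau ^+ 2.
Hypothesis c0 : kappa <> 4 * tau ^+ 2.

Let oW := mf_open mf.

(** The head of the word acts last; [false] stands for the first field, [true] for the second. *)
Definition word (A B : 'rV[R]_n.+1 -> 'rV[R]_n.+1) (s : seq bool)
    (f : 'rV[R]_n.+1 -> R) : 'rV[R]_n.+1 -> R :=
  foldr (fun b g => lie (if b then B else A) g) f s.

Let smooth_if (b : bool) : smooth_on W (if b then H else Z).
Proof. by case: b; [exact: mf_H mf|exact: mf_Z mf]. Qed.

Lemma word_smooth s f : smooth_on W f -> smooth_on W (word Z H s f).
Proof. by move=> sf; elim: s => //= b s IH; exact: lie_smooth oW (smooth_if b) IH. Qed.

Lemma word_longer (O : set 'rV[R]_n.+1) k f : open O ->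
  (forall s p, size s = k -> O p -> word Z H s f p = 0) ->
  forall s p, (k <= size s)%N -> O p -> word Z H s f p = 0.
Proof.
move=> oO f0; elim=> [|b s IH] p; first by rewrite leqn0 => /eqP k0; exact: f0.
rewrite leq_eqVlt => /orP[/eqP E|]; first exact: f0.
rewrite ltnS => ks Op /=; rewrite (eq_lie _ oO Op (fun q => IH q ks)).
exact: lie_cst.
Qed.

(** Let g be a word of length j. As words of length j + 2 and j + 3 vanish, K V g = [Z, H] g = 0,
    and the same holds for Z g and H g in place of g; since K is nonzero, V kills all three on [O].
    Then H g = V Z g - Z V g and -Z g = V H g - H V g vanish too. *)
Lemma word_descent (O : set 'rV[R]_n.+1) j f : open O -> O `<=` W ->
  (forall p, O p -> K p != 0) -> smooth_on W f ->
  (forall s p, size s = j.+2 -> O p -> word Z H s f p = 0) ->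
  forall s p, size s = j.+1 -> O p -> word Z H s f p = 0.
Proof.
move=> oO OW K0 sf f0 [//|b s] p [ss] Op.
have sg := word_smooth s sf; set g := word Z H s f in sg *.
have V0 h q : smooth_on W h -> (forall q, O q -> lie Z (lie H h) q = 0) ->
    (forall q, O q -> lie H (lie Z h) q = 0) -> O q -> lie V h q = 0.
  move=> sh ZH0 HZ0 Oq; have := mf_ZH mf sh (OW _ Oq).
  rewrite ZH0 // HZ0 // subrr => /esym/eqP; rewrite mulf_eq0 (negbTE (K0 q Oq)) /=.
  by move/eqP.
have Vg q : O q -> lie V g q = 0.
  apply: V0 => // r Or.
    by apply: (f0 [:: false, true & s]) => //=; rewrite ss.
  by apply: (f0 [:: true, false & s]) => //=; rewrite ss.
have long t q : (j.+2 <= size t)%N -> O q -> word Z H t f q = 0.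
  exact: word_longer.
have VZg q : O q -> lie V (lie Z g) q = 0.
  apply: V0 => [|r Or|r Or]; first exact: lie_smooth oW (mf_Z mf) sg.
    by apply: (long [:: false, true, false & s]) => //=; rewrite ss.
  by apply: (long [:: true, false, false & s]) => //=; rewrite ss.
have VHg q : O q -> lie V (lie H g) q = 0.
  apply: V0 => [|r Or|r Or]; first exact: lie_smooth oW (mf_H mf) sg.
    by apply: (long [:: false, true, true & s]) => //=; rewrite ss.
  by apply: (long [:: true, false, true & s]) => //=; rewrite ss.
rewrite /= -/g; case: b.
  have := mf_VZ mf sg (OW _ Op); rewrite (VZg p Op) (eq_lie Z oO Op Vg) lie_cst subrr.
  by move=> <-.
have := mf_VH mf sg (OW _ Op); rewrite (VHg p Op) (eq_lie H oO Op Vg) lie_cst subrr.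
by move/esym/eqP; rewrite oppr_eq0 => /eqP.
Qed.

(** Each descent consumes a word of length at least two, so it stops at length one: it yields nabla
    h = 0, not h = 0. *)
Lemma word1_curved (O : set 'rV[R]_n.+1) k f : open O -> O `<=` W ->
  (forall p, O p -> K p != 0) -> smooth_on W f -> (0 < k)%N ->
  (forall s p, size s = k -> O p -> word Z H s f p = 0) ->
  forall s p, size s = 1%N -> O p -> word Z H s f p = 0.
Proof.
move=> oO OW K0 sf; case: k => // k _; elim: k => // k IH f0.
by apply: IH; exact: word_descent f0.
Qed.

Context {k : nat}.
Hypothesis k0 : (0 < k)%N.
Hypothesis w11 : forall s p, size s = k -> W p -> word Z H s h11 p = 0.
Hypothesis w12 : forall s p, size s = k -> W p -> word Z H s h12 p = 0.
Hypothesis w22 : forall s p, size s = k -> W p -> word Z H s h22 p = 0.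

Let c_neq0 : c != 0.
Proof. by rewrite subr_eq0; apply/eqP. Qed.

(** With nabla h = 0 the left sides of the Codazzi equations vanish, so either nu = 0 or the fibre
    direction has no tangential part; 1 - nu^2 = e13^2 + e23^2 merges both into one equation. *)
Lemma curved_dichotomy (O : set 'rV[R]_n.+1) : open O -> O `<=` W ->
  (forall p, O p -> K p != 0) -> forall p, O p -> n3 p ^+ 2 * (1 - n3 p ^+ 2) = 0.
Proof.
move=> oO OW K0 p Op; have Wp := OW p Op.
have w (f : 'rV[R]_n.+1 -> R) : smooth_on W f ->
    (forall s p, size s = k -> W p -> word Z H s f p = 0) ->
    lie Z f p = 0 /\ lie H f p = 0.
  move=> sf f0.
  have f1 := @word1_curved O k f oO OW K0 sf k0 (fun s p sk Op => f0 s p sk (OW p Op)).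
  by split; [exact: (f1 [:: false])|exact: (f1 [:: true])].
have [_ H11] := w _ (mf_h11 mf) w11; have [Z12 H12] := w _ (mf_h12 mf) w12.
have [Z22 _] := w _ (mf_h22 mf) w22.
have [_ C1 C2] := mf_gauss_codazzi mf Wp.
have [_ ee _ _] := mf_orth mf Wp.
move: C1 C2; rewrite H11 Z12 H12 Z22 subrr -/c => C1 C2.
have E1 : n3 p * e23 p = 0.
  by apply: (mulfI c_neq0); rewrite mulr0 mulrA -C1.
have E2 : n3 p * e13 p = 0.
  by apply: (mulfI c_neq0); rewrite mulr0 mulrA; apply: oppr_inj; rewrite -C2 oppr0.
move: ee E1 E2; move: (n3 p) (e13 p) (e23 p) => a b d ee E1 E2.
apply: (lin_comb3 ee E1 E2 (c1 := - a ^+ 2) (c2 := a * d) (c3 := a * b)); ring.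
Qed.

Lemma flat_vertical (O : set 'rV[R]_n.+1) : open O -> O `<=` W ->
  (forall p, O p -> K p = 0) -> forall p, O p -> n3 p = 0.
Proof.
move=> oO OW K0 p Op; have Wp := OW p Op.
have sub (f : 'rV[R]_n.+1 -> R) : smooth_on W f -> smooth_on O f by exact: smooth_on_sub.
have sn := sub _ (mf_sn3 mf).
have S11 := sub _ (mf_h11 mf). have S12 := sub _ (mf_h12 mf). have S22 := sub _ (mf_h22 mf).
have se13 := sub _ (mf_e13 mf). have se23 := sub _ (mf_e23 mf).
(* By the Gauss equation with K = 0, q is a polynomial in h11, h12, h22; by Codazzi, p1 and p2 are
   differences of words of length one. All three are nilpotent along Z and H, and [rel] is 1 - nu^2
   = e13^2 + e23^2 multiplied by c^2 nu^2. *)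
pose q r := c * n3 r ^+ 2; pose p1 r := c * n3 r * e23 r; pose p2 r := c * n3 r * e13 r.
have sq : smooth_on O q by rewrite /q; smooth.
have sp1 : smooth_on O p1 by rewrite /p1; smooth.
have sp2 : smooth_on O p2 by rewrite /p2; smooth.
have rel r : O r -> q r * (c - q r) = p1 r ^+ 2 + p2 r ^+ 2.
  move=> Or; have [_ ee _ _] := mf_orth mf (OW r Or).
  apply: (lin_comb1 ee (c := - c ^+ 2 * n3 r ^+ 2)); rewrite /q /p1 /p2; ring.
have key b : [/\ lie (if b then H else Z) q p = 0, lie (if b then H else Z) p1 p = 0 &
    lie (if b then H else Z) p2 p = 0].
  set X := if b then H else Z.
  have sX : smooth_on O X by apply: (smooth_on_sub OW); exact: smooth_if.
  have it (f : 'rV[R]_n.+1 -> R) s r : (forall s p, size s = k -> W p -> word Z H s f p = 0) ->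
      O r -> iter k (lie X) (word Z H s f) r = 0.
    move=> f0 Or.
    (* A power of one letter in front of s is again a word, of length at least k. *)
    have -> : iter k (lie X) (word Z H s f) = word Z H (nseq k b ++ s) f.
      by rewrite /word foldr_cat; elim: k => //= l ->.
    apply: (@word_longer W k f oW f0); last exact: OW.
    by rewrite size_cat size_nseq leq_addr.
  have sm (f : 'rV[R]_n.+1 -> R) s : smooth_on W f -> smooth_on O (word Z H s f).
    by move=> sf; apply: sub; exact: word_smooth.
  (* The exponent 2k serves all three: products of functions killed by the k-th power are killed by
     the power 2k, and 2k > 0 disposes of the constant -tau^2. *)
  apply: (@nilpotent_relation_const R n O X q p1 p2 c (k + k)) => //.
  - move=> r Or.
    have E r' : O r' -> q r' = - tau ^+ 2 + (h12 r' * h12 r' + (-1) * (h11 r' * h22 r')).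
      move=> Or'; have [G _ _] := mf_gauss_codazzi mf (OW r' Or').
      by move: G; rewrite K0 // => G; apply: (lin_comb1 G (c := -1)); rewrite /q /c; ring.
    rewrite (eq_iter_lie X (k + k) oO Or E) (iter_lieD _ oO sX Or); try by smooth.
    rewrite (iter_lieD _ oO sX Or); try by smooth.
    rewrite (iter_lieZ _ _ oO sX Or); try by smooth.
    rewrite !(iter_lieM_eq0 oO sX _ _ _ _ Or) //; try by move=> r' Or'; exact: (it _ [::]).
    rewrite mulr0 !addr0 (@iter_lie_eq0 R n O X (fun=> - tau ^+ 2) 1 (k + k) oO) //.
      by rewrite addn_gt0 k0.
    by move=> *; exact: lie_cst.
  - apply: (@iter_lie_eq0 R n O X p1 k (k + k) oO) => [|r Or]; first exact: leq_addr.
    have E r' : O r' -> p1 r' = word Z H [:: false] h12 r' + (-1) * word Z H [:: true] h11 r'.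
      by move=> Or'; have [_ + _] := mf_gauss_codazzi mf (OW r' Or'); rewrite mulN1r => ->.
    have T1 := sm _ [:: false] (mf_h12 mf); have T2 := sm _ [:: true] (mf_h11 mf).
    rewrite (eq_iter_lie X k oO Or E) (iter_lieD _ oO sX Or) //; last by smooth.
    by rewrite (iter_lieZ _ _ oO sX Or) // !it // mulr0 addr0.
  - apply: (@iter_lie_eq0 R n O X p2 k (k + k) oO) => [|r Or]; first exact: leq_addr.
    have E r' : O r' -> p2 r' = word Z H [:: true] h12 r' + (-1) * word Z H [:: false] h22 r'.
      move=> Or'; have [_ _ C] := mf_gauss_codazzi mf (OW r' Or').
      by rewrite mulN1r /=; apply: (lin_comb1 C (c := 1)); rewrite /p2 /c; ring.
    have T1 := sm _ [:: true] (mf_h12 mf); have T2 := sm _ [:: false] (mf_h22 mf).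
    rewrite (eq_iter_lie X k oO Or E) (iter_lieD _ oO sX Or) //; last by smooth.
    by rewrite (iter_lieZ _ _ oO sX Or) // !it // mulr0 addr0.
apply/eqP; apply: contraT => nz.
(* X (c nu^2) = 0 gives X nu = 0 where nu is nonzero; then X (c nu e23) = X (c nu e13) = 0 gives the
   same for e23 and e13. *)
have step b : lie (if b then H else Z) e13 p = 0 /\ lie (if b then H else Z) e23 p = 0.
  have [X0 X1 X2] := key b; set X := if b then H else Z in X0 X1 X2 *.
  have sc : smooth_on O (fun r => c * n3 r) by smooth.
  have n30 : lie X n3 p = 0.
    have qE : q = (fun r => c * (n3 r * n3 r)) by apply/funext => r; rewrite /q expr2.
    move: X0; rewrite qE (lieZ X c Op (f := fun r => n3 r * n3 r)); last by smooth.
    rewrite (lieM X Op) // => E; apply: (mulfI nz); apply: (mulfI c_neq0).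
    rewrite !mulr0; apply: (@mulfI _ (2 : R)); first by rewrite pnatr_eq0.
    by rewrite mulr0 -E; ring.
  move: X1 X2; rewrite (lieM X Op (f := fun r => c * n3 r) sc se23).
  rewrite (lieM X Op (f := fun r => c * n3 r) sc se13) (lieZ X c Op sn).
  rewrite n30 mulr0 !mul0r !add0r.
  move=> X1 X2; split; apply: (mulfI (mulf_neq0 c_neq0 nz)); rewrite mulr0 //.
have [Z1 Z2] := step false; have [H1 H2] := step true.
(* The derivatives of e13 and e23 are h11 nu, (h12 + tau) nu, (h12 - tau) nu and h22 nu. Their
   vanishing forces h = 0 and tau = 0 at p, and the Gauss equation is left with c nu^2 = 0. *)
move: Z1 Z2 H1 H2; rewrite (mf_Ze13 mf Wp) (mf_Ze23 mf Wp) (mf_He13 mf Wp) (mf_He23 mf Wp).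
have red a : a * n3 p = 0 -> a = 0.
  by move/eqP; rewrite mulf_eq0 (negbTE nz) orbF => /eqP.
move=> /red h11_0 /red hm /red hp /red h22_0.
have t0 : tau = 0.
  apply: (@mulfI _ (2 : R)); first by rewrite pnatr_eq0.
  by apply: (lin_comb2 hm hp (c1 := -1) (c2 := 1)); ring.
have h120 : h12 p = 0 by move: hp; rewrite t0 addr0.
have [G _ _] := mf_gauss_codazzi mf Wp.
have : c * n3 p ^+ 2 = 0.
  apply: (lin_comb1 G (c := -1)); rewrite (K0 p Op) h11_0 h22_0 h120 t0 /c t0; ring.
by move/eqP; rewrite mulf_eq0 (negbTE c_neq0) expf_eq0 /= => E; rewrite E in nz.
Qed.

Lemma vertical_or_horizontal p : W p -> n3 p ^+ 2 * (1 - n3 p ^+ 2) = 0.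
Proof.
move=> Wp; apply/eqP; apply: contraT => nz.
have sn := mf_sn3 mf.
have sF : smooth_on W (fun q => n3 q ^+ 2 * (1 - n3 q ^+ 2)).
  by smooth.
(* [moving_frame] records no regularity of K; its continuity is read off from the Gauss equation. *)
have dK : forall q, W q -> {for q, continuous (fun q => h11 q * h22 q - h12 q ^+ 2 + tau ^+ 2 + c * n3 q ^+ 2)}.
  move=> q Wq; apply: differentiable_continuous; apply: (smooth_on_diff _ Wq).
  by move: (mf_h11 mf) (mf_h12 mf) (mf_h22 mf) => ? ? ?; smooth.
have cF : {for p, continuous (fun q => n3 q ^+ 2 * (1 - n3 q ^+ 2))}.
  by apply: differentiable_continuous; exact: (smooth_on_diff sF Wp).
have nF : nbhs p [set q | n3 q ^+ 2 * (1 - n3 q ^+ 2) != 0 /\ W q].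
  have H1 : \forall q \near p, n3 q ^+ 2 * (1 - n3 q ^+ 2) != 0.
    by apply: (cF [set z | z != 0]); apply: open_nbhs_nbhs; split => //; exact: open_neq.
  have H2 : \forall q \near p, W q by exact: open_nbhs_nbhs.
  exact: filterI H1 H2.
move: nF; rewrite nbhsE => -[G [oO Op] OF].
(* Where K were nonzero, it would be so on a neighbourhood, and there the curved case makes nu^2 (1
   - nu^2) vanish, against the choice of G. *)
have K0 q : G q -> K q = 0.
  move=> Oq; apply/eqP; apply: contraT => Kq; have [Fq Wq] := OF q Oq.
  have KE r : W r -> K r = h11 r * h22 r - h12 r ^+ 2 + tau ^+ 2 + c * n3 r ^+ 2.
    by move=> Wr; have [] := mf_gauss_codazzi mf Wr.
  have : nbhs q [set r | K r != 0 /\ W r].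
    have H1 : \forall r \near q,
        h11 r * h22 r - h12 r ^+ 2 + tau ^+ 2 + c * n3 r ^+ 2 != 0.
      apply: (dK q Wq [set z | z != 0]); apply: open_nbhs_nbhs; split; first exact: open_neq.
      by rewrite /= -KE.
    have H2 : \forall q \near q, W q by exact: open_nbhs_nbhs.
    by apply: filterS (filterI H1 H2) => r [? ?]; split=> //; rewrite KE.
  rewrite nbhsE => -[G' [oO' Oq'] OK].
  move: Fq; rewrite (@curved_dichotomy G' oO') ?eqxx // => r Or; by have [] := OK r Or.
have n30 : n3 p = 0 by apply: (@flat_vertical G) => // q Oq; have [] := OF q Oq.
by move: nz; rewrite n30 expr0n mul0r eqxx.
Qed.

End Dichotomy.

(** * Christoffel symbols *)

(** The zeroth-order part of [covariant_along], isolated as a bilinear expression so that it can be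
    characterized by its inner products. *)
Definition christoffel_form (R : realType) (n : nat)
    (G : 'rV[R]_n.+1 -> 'M[R]_n.+1) (q u v : 'rV[R]_n.+1) : 'rV[R]_n.+1 :=
  \row_(k < n.+1) \sum_(i < n.+1) \sum_(j < n.+1) christoffel G q k i j * u 0 i * v 0 j.

Section Koszul.
Context {R : realType} {n : nat}.
Implicit Types (G : 'rV[R]_n.+1 -> 'M[R]_n.+1) (q u v w : 'rV[R]_n.+1).

Lemma innerE G q u v : inner G q u v = \sum_i \sum_j u 0 i * G q i j * v 0 j.
Proof.
rewrite /inner mxE; under eq_bigr do rewrite mxE mulr_suml.
by rewrite exchange_big /=; apply: eq_bigr => i _; apply: eq_bigr => j _; rewrite mxE.
Qed.

Lemma innerDl G q u u' v : inner G q (u + u') v = inner G q u v + inner G q u' v.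
Proof. by rewrite /inner !mulmxDl mxE. Qed.

Lemma derive_inner G q a u v : (forall i j, differentiable (fun x => G x i j) q) ->
  'D_a (fun x => inner G x u v) q =
  \sum_i \sum_j \sum_l u 0 i * v 0 j * a 0 l * partial l (fun x => G x i j) q.
Proof.
move=> dG.
have -> : (fun x => inner G x u v) = (fun x => \sum_i \sum_j (u 0 i * v 0 j) * G x i j).
  apply/funext => x; rewrite innerE; apply: eq_bigr => i _; apply: eq_bigr => j _; ring.
have dZ i j : differentiable (fun x => u 0 i * v 0 j * G x i j) q.
  by apply: differentiableM => //; exact: differentiable_cst.
have -> : (fun x => \sum_i \sum_j (u 0 i * v 0 j) * G x i j) =
    \sum_i \sum_j (fun x => (u 0 i * v 0 j) * G x i j).
  apply/funext => x; rewrite fct_sumE; apply: eq_bigr => i _; by rewrite fct_sumE.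
rewrite derive_sum; last first.
  by move=> i; apply: derivable_sum => j; exact: diff_derivable.
apply: eq_bigr => i _; rewrite derive_sum; last by move=> j; exact: diff_derivable.
apply: eq_bigr => j _.
have -> : 'D_a (fun x => (u 0 i * v 0 j) * G x i j) q =
   (u 0 i * v 0 j) * 'D_a (fun x => G x i j) q.
  by apply: deriveMl; exact: diff_derivable.
rewrite (derive_sum_partial a (dG i j)) mulr_sumr; apply: eq_bigr => l _.
by rewrite /GRing.scale /= mulrA.
Qed.

(** Koszul's formula for constant fields u, v, w. Pairing with w cancels the inverse matrix in
    [christoffel], so that connections are afterwards compared through inner products. *)
Lemma koszul G q u v w : (forall i j, differentiable (fun x => G x i j) q) ->
  (forall x i j, G x i j = G x j i) -> G q \in unitmx ->
  inner G q (christoffel_form G q u v) w =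
  2^-1 * ('D_u (fun x => inner G x v w) q + 'D_v (fun x => inner G x u w) q
          - 'D_w (fun x => inner G x u v) q).
Proof.
move=> dG symG uG.
pose T i j l := partial i (fun x => G x j l) q + partial j (fun x => G x i l) q
     - partial l (fun x => G x i j) q.
have first i j m : \sum_k christoffel G q k i j * G q k m = 2^-1 * T i j m.
  under eq_bigr => k _ do rewrite /christoffel -mulrA mulr_suml.
  rewrite -mulr_sumr exchange_big /=; congr (_ * _).
  transitivity (\sum_l T i j l * (invmx (G q) *m G q) l m).
    apply: eq_bigr => l _.
    (* Symmetry of the inverse brings the contraction into the form of a matrix product with G q. *)
    have sI k : invmx (G q) k l = invmx (G q) l k.
      have : (invmx (G q))^T = invmx (G q).
        rewrite trmx_inv; congr invmx; apply/matrixP => a b; rewrite mxE; exact: symG.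
      by move/matrixP => /(_ l k); rewrite mxE.
    rewrite mxE mulr_sumr; apply: eq_bigr => k _; rewrite sI /T /partial; ring.
  rewrite mulVmx // (bigD1 m) //= big1 ?addr0 => [|l lm]; rewrite !mxE ?eqxx ?mulr1 //.
  by rewrite (negbTE lm) mulr0.
have -> : inner G q (christoffel_form G q u v) w =
    \sum_i \sum_j \sum_m u 0 i * v 0 j * w 0 m * (2^-1 * T i j m).
  rewrite innerE.
  transitivity (\sum_k \sum_m \sum_i \sum_j
     u 0 i * v 0 j * w 0 m * (christoffel G q k i j * G q k m)).
    apply: eq_bigr => k _; apply: eq_bigr => m _; rewrite mxE -mulrA mulr_suml.
    apply: eq_bigr => i _; rewrite mulr_suml; apply: eq_bigr => j _; ring.
  under eq_bigr => k _ do rewrite exchange_big /=.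
  rewrite exchange_big /=; apply: eq_bigr => i _.
  under eq_bigr => k _ do rewrite exchange_big /=.
  rewrite exchange_big /=; apply: eq_bigr => j _.
  rewrite exchange_big /=; apply: eq_bigr => m _.
  by rewrite -first mulr_sumr.
rewrite !(derive_inner _ _ _ dG).
have -> : \sum_i \sum_j \sum_l v 0 i * w 0 j * u 0 l * partial l (fun x => G x i j) q =
    \sum_i \sum_j \sum_m u 0 i * v 0 j * w 0 m * partial i (fun x => G x j m) q.
  under eq_bigr => i _ do rewrite exchange_big /=.
  rewrite exchange_big /=.
  by do 3 (apply: eq_bigr => ? _); ring.
have -> : \sum_i \sum_j \sum_l u 0 i * w 0 j * v 0 l * partial l (fun x => G x i j) q =
    \sum_i \sum_j \sum_m u 0 i * v 0 j * w 0 m * partial j (fun x => G x i m) q.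
  by apply: eq_bigr => i _; rewrite exchange_big /=; do 2 (apply: eq_bigr => ? _); ring.
rewrite -big_split -sumrB mulr_sumr /=; apply: eq_bigr => i _.
rewrite -big_split -sumrB mulr_sumr /=; apply: eq_bigr => j _.
rewrite -big_split -sumrB mulr_sumr /=; apply: eq_bigr => m _.
by rewrite /T; ring.
Qed.

Lemma covariant_alongE (E : normedModType R) G (F V : E -> 'rV[R]_n.+1) (v p : E) :
  covariant_along G F v V p = 'D_v V p + christoffel_form G (F p) ('D_v F p) (V p).
Proof. by []. Qed.

Lemma definite_unitmx G q : (forall u, inner G q u u = 0 -> u = 0) -> G q \in unitmx.
Proof.
move=> def; rewrite -row_free_unit -kermx_eq0; apply/eqP/row_matrixP => i.
rewrite row0; apply: def; rewrite /inner -row_mul mulmx_ker row0 mul0mx.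
by rewrite mxE.
Qed.

End Koszul.

(** * The ambient space in its orthonormal frame *)

Section DeriveRules.
Context {R : realType} {V : normedModType R}.
Implicit Types (f g : V -> R) (p a : V).

(** Pointwise forms of the differentiation rules: the derivative of a formula is assembled as a term
    and its value then normalized by [ring] or [field]. *)
Lemma is_derive_add f g p a df dg : is_derive p a f df -> is_derive p a g dg ->
  is_derive p a (fun q => f q + g q) (df + dg).
Proof. by move=> hf hg; exact: is_deriveD hf hg. Qed.

Lemma is_derive_opp f p a df : is_derive p a f df -> is_derive p a (fun q => - f q) (- df).
Proof. by move=> hf; exact: is_deriveN hf. Qed.

Lemma is_derive_mul f g p a df dg : is_derive p a f df -> is_derive p a g dg ->
  is_derive p a (fun q => f q * g q) (df * g p + f p * dg).
Proof.
move=> hf hg; have := is_deriveM hf hg.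
by rewrite /GRing.scale /= addrC [g p * df]mulrC.
Qed.

Lemma is_derive_inv f p a df : f p != 0 -> is_derive p a f df ->
  is_derive p a (fun q => (f q)^-1) (- df / f p ^+ 2).
Proof.
move=> f0 hf; have dv : derivable f p a by case: hf.
split; first exact: derivableV.
by rewrite deriveV // (@derive_val _ _ _ _ _ _ _ hf) /GRing.scale /= mulNr mulNr mulrC.
Qed.

Lemma is_derive_const (c : R) p a : is_derive p a (fun=> c) 0.
Proof. exact: is_derive_cst. Qed.

Lemma is_derive_scale c f p a df : is_derive p a f df ->
  is_derive p a (fun q => c * f q) (c * df).
Proof.
move=> hf; apply: (is_derive_eq (is_derive_mul (is_derive_const c p a) hf)).
by rewrite mul0r add0r.
Qed.

Lemma is_derive_coord m (F : V -> 'rV[R]_m) p a i : derivable F p a ->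
  is_derive p a (fun q => F q 0 i) (('D_a F p) 0 i).
Proof.
move=> dF; split; first by have /derivable_mxP := dF; apply.
by rewrite derive_mx // mxE.
Qed.

End DeriveRules.

Section Ambient.
Context {R : realType}.
Variables (kappa tau : R).
Implicit Types (q u v w : 'rV[R]_3).
Local Notation lam q := (bcv_factor kappa q).

(** The values on w of the orthonormal coframe dx / lam, dy / lam, dz + tau (y dx - x dy) / lam at
    q; in these components the metric is the Euclidean one. *)
Definition cf1 q w : R := xcoord w / lam q.
Definition cf2 q w : R := ycoord w / lam q.
Definition cf3 q w : R :=
  zcoord w + tau * (ycoord q * xcoord w - xcoord q * ycoord w) / lam q.

Definition dlam q u : R := kappa / 2 * (xcoord q * xcoord u + ycoord q * ycoord u).
(** Derivatives of the coframe with respect to its base point q, in the direction u, with the vector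
    w held fixed. *)
Definition dcf1 q u w : R := - xcoord w * dlam q u / lam q ^+ 2.
Definition dcf2 q u w : R := - ycoord w * dlam q u / lam q ^+ 2.
Definition dcf3 q u w : R :=
  tau * (ycoord u * xcoord w - xcoord u * ycoord w) / lam q
  - tau * (ycoord q * xcoord w - xcoord q * ycoord w) * dlam q u / lam q ^+ 2.

Lemma bcv_inner q u v : inner (bcv_metric kappa tau) q u v =
  cf1 q u * cf1 q v + cf2 q u * cf2 q v + cf3 q u * cf3 q v.
Proof.
rewrite bcv_metricE /cf1 /cf2 /cf3 mulrDl expr2 invfM; congr (_ + _).
move: (lam q)^-1 => l; ring.
Qed.

Section Along.
Context {V : normedModType R}.
Variables (F W : V -> 'rV[R]_3) (p a : V).
Hypothesis (dF : derivable F p a) (dW : derivable W p a) (Fp : lam (F p) != 0).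

Lemma is_derive_lam : is_derive p a (fun r => lam (F r)) (dlam (F p) ('D_a F p)).
Proof.
have hx := is_derive_coord 0 dF; have hy := is_derive_coord 1 dF.
have := is_derive_add (is_derive_const 1 p a) (is_derive_scale (kappa / 4)
  (is_derive_add (is_derive_mul hx hx) (is_derive_mul hy hy))).
move=> H; apply: (is_derive_eq H); rewrite /dlam /xcoord /ycoord; by field.
Qed.

Lemma is_derive_cf1 : is_derive p a (fun r => cf1 (F r) (W r))
  (cf1 (F p) ('D_a W p) + dcf1 (F p) ('D_a F p) (W p)).
Proof.
have := is_derive_mul (is_derive_coord 0 dW) (is_derive_inv (f := fun r => lam (F r)) Fp is_derive_lam).
move=> H; apply: (is_derive_eq H); rewrite /cf1 /dcf1 /xcoord.
by field.
Qed.

Lemma is_derive_cf2 : is_derive p a (fun r => cf2 (F r) (W r))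
  (cf2 (F p) ('D_a W p) + dcf2 (F p) ('D_a F p) (W p)).
Proof.
have := is_derive_mul (is_derive_coord 1 dW) (is_derive_inv (f := fun r => lam (F r)) Fp is_derive_lam).
move=> H; apply: (is_derive_eq H); rewrite /cf2 /dcf2 /ycoord.
by field.
Qed.

Lemma is_derive_cf3 : is_derive p a (fun r => cf3 (F r) (W r))
  (cf3 (F p) ('D_a W p) + dcf3 (F p) ('D_a F p) (W p)).
Proof.
have hx := is_derive_coord 0 dF; have hy := is_derive_coord 1 dF.
have kx := is_derive_coord 0 dW; have ky := is_derive_coord 1 dW.
have H := is_derive_add (is_derive_coord 2 dW)
  (is_derive_mul (is_derive_scale tau (is_derive_add (is_derive_mul hy kx)
     (is_derive_opp (is_derive_mul hx ky)))) (is_derive_inv (f := fun r => lam (F r)) Fp is_derive_lam)).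
apply: (is_derive_eq H); rewrite /cf3 /dcf3 /zcoord /xcoord /ycoord.
by field.
Qed.

End Along.

Lemma cf_const q u w : lam q != 0 ->
  [/\ is_derive q u (fun x => cf1 x w) (dcf1 q u w),
      is_derive q u (fun x => cf2 x w) (dcf2 q u w) &
      is_derive q u (fun x => cf3 x w) (dcf3 q u w)].
Proof.
move=> lq; have di : derivable (@id 'rV[R]_3) q u by exact: derivable_id.
have dc : derivable (fun _ : 'rV[R]_3 => w) q u by exact: derivable_cst.
have c0 : 'D_u (fun _ : 'rV[R]_3 => w) q = 0 by exact: derive_cst.
have iE : 'D_u (@id 'rV[R]_3) q = u by exact: derive_id.
split; [apply: (is_derive_eq (is_derive_cf1 di dc lq))
       |apply: (is_derive_eq (is_derive_cf2 di dc lq))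
       |apply: (is_derive_eq (is_derive_cf3 di dc lq))];
  rewrite c0 iE; rewrite ?/cf1 ?/cf2 ?/cf3 /xcoord /ycoord /zcoord !mxE;
  rewrite ?mulr0 ?mul0r ?subr0 ?mulr0 ?mul0r ?add0r //.
Qed.

Lemma bcv_entry q i j : bcv_metric kappa tau q i j =
  inner (bcv_metric kappa tau) q (delta_mx 0 i) (delta_mx 0 j).
Proof.
rewrite innerE (bigD1 i) //= (bigD1 j) //= !big1 => [|k ki|k kj].
- by rewrite !mxE !eqxx /= mul1r mulr1 !addr0.
- apply: big1 => l _; rewrite mxE eqxx /= (negbTE ki) mul0r mul0r //.
- by rewrite [delta_mx 0 j _ _]mxE eqxx /= (negbTE kj) mulr0.
Qed.

Lemma bcv_sym q i j : bcv_metric kappa tau q i j = bcv_metric kappa tau q j i.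
Proof. by rewrite !bcv_entry !bcv_inner; ring. Qed.

Lemma derive_bcv_inner q a u v : lam q != 0 ->
  is_derive q a (fun x => inner (bcv_metric kappa tau) x u v)
   (dcf1 q a u * cf1 q v + cf1 q u * dcf1 q a v +
    (dcf2 q a u * cf2 q v + cf2 q u * dcf2 q a v) +
    (dcf3 q a u * cf3 q v + cf3 q u * dcf3 q a v)).
Proof.
move=> lq; have [u1 u2 u3] := cf_const a u lq; have [v1 v2 v3] := cf_const a v lq.
have -> : (fun x => inner (bcv_metric kappa tau) x u v) =
  (fun x => cf1 x u * cf1 x v + cf2 x u * cf2 x v + cf3 x u * cf3 x v).
  by apply/funext => x; exact: bcv_inner.
exact: is_derive_add (is_derive_add (is_derive_mul u1 v1) (is_derive_mul u2 v2))
  (is_derive_mul u3 v3).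
Qed.

Lemma smooth_lam : smooth_on setT (fun q => lam q).
Proof.
have oT : open [set: 'rV[R]_3] by exact: openT.
have sx i : smooth_on [set: 'rV[R]_3] (fun q : 'rV[R]_3 => q 0 i) by exact: smooth_id_coord.
apply: smoothD => //; first exact: smooth_cst.
apply: smoothM => //; first exact: smooth_cst.
apply: smoothD => //; first by apply: (smoothX (f := fun q : 'rV[R]_3 => q 0 0)).
by apply: (smoothX (f := fun q : 'rV[R]_3 => q 0 1)).
Qed.

Lemma bcv_entry_diff q i j : bcv_domain kappa q ->
  differentiable (fun x => bcv_metric kappa tau x i j) q.
Proof.
move=> lq.
have oT : open [set: 'rV[R]_3] by exact: openT.
have sx k : smooth_on [set: 'rV[R]_3] (fun q : 'rV[R]_3 => q 0 k) by exact: smooth_id_coord.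
have oD : open (bcv_domain kappa : set 'rV[R]_3).
  have -> : (bcv_domain kappa : set 'rV[R]_3) = (fun q => lam q) @^-1` [set x | 0 < x] by [].
  apply: open_comp; last exact: open_gt.
  by move=> x _; apply: differentiable_continuous; exact: (smooth_on_diff smooth_lam).
have -> : (fun x => bcv_metric kappa tau x i j) =
  (fun x => inner (bcv_metric kappa tau) x (delta_mx 0 i) (delta_mx 0 j)).
  by apply/funext => x; exact: bcv_entry.
have -> : (fun x => inner (bcv_metric kappa tau) x (delta_mx 0 i) (delta_mx 0 j)) =
  (fun x => cf1 x (delta_mx 0 i) * cf1 x (delta_mx 0 j) + cf2 x (delta_mx 0 i) * cf2 x (delta_mx 0 j)
    + cf3 x (delta_mx 0 i) * cf3 x (delta_mx 0 j)).
  by apply/funext => x; exact: bcv_inner.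
apply: (smooth_on_diff (U := bcv_domain kappa)) => //.
have sl : smooth_on (bcv_domain kappa : set 'rV[R]_3) (fun q => (lam q)^-1).
  apply: smoothV => //; first by move=> x; exact: lt0r_neq0.
  exact: smooth_on_sub smooth_lam.
have s1 u : smooth_on (bcv_domain kappa) (fun x => cf1 x u).
  exact: (smoothM oD (@smooth_cst R 2 R _ (xcoord u)) sl).
have s2 u : smooth_on (bcv_domain kappa) (fun x => cf2 x u).
  exact: (smoothM oD (@smooth_cst R 2 R _ (ycoord u)) sl).
have sc k : smooth_on (bcv_domain kappa) (fun q : 'rV[R]_3 => q 0 k).
  exact: smooth_on_sub (sx k).
have s3 u : smooth_on (bcv_domain kappa) (fun x => cf3 x u).
  have cst (c : R) := @smooth_cst R 2 R (bcv_domain kappa) c.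
  exact: (smoothD oD (cst (zcoord u)) (smoothM oD (smoothM oD (cst tau)
    (smoothB oD (smoothM oD (sc 1) (cst (xcoord u))) (smoothM oD (sc 0) (cst (ycoord u))))) sl)).
exact: (smoothD oD (smoothD oD (smoothM oD (s1 _) (s1 _)) (smoothM oD (s2 _) (s2 _)))
  (smoothM oD (s3 _) (s3 _))).
Qed.

Lemma cf_eq0 q w : lam q != 0 -> cf1 q w = 0 -> cf2 q w = 0 -> cf3 q w = 0 -> w = 0.
Proof.
move=> lq; rewrite /cf1 /cf2 /cf3 => /eqP; rewrite mulf_eq0 invr_eq0 (negbTE lq) orbF => /eqP x0.
move=> /eqP; rewrite mulf_eq0 invr_eq0 (negbTE lq) orbF => /eqP y0.
rewrite x0 y0 !mulr0 subrr mulr0 mul0r addr0 => z0.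
apply/rowP => -[[|[|[|i]]] lti] //; rewrite mxE.
- by rewrite -[RHS]x0; congr (w _ _); exact: val_inj.
- by rewrite -[RHS]y0; congr (w _ _); exact: val_inj.
- by rewrite -[RHS]z0; congr (w _ _); exact: val_inj.
Qed.

Lemma bcv_unitmx q : lam q != 0 -> bcv_metric kappa tau q \in unitmx.
Proof.
move=> lq; apply: definite_unitmx => u; rewrite bcv_inner -!expr2 => /eqP.
rewrite !paddr_eq0 ?addr_ge0 ?sqr_ge0 // !sqrf_eq0 => /andP[/andP[/eqP? /eqP?] /eqP?].
exact: cf_eq0 lq _ _ _.
Qed.

Definition sig q u : R :=
  kappa / 2 * (ycoord q * cf1 q u - xcoord q * cf2 q u) - 2 * tau * cf3 q u.

(* In the frame [E1 = lam dx - tau y dz], [E2 = lam dy + tau x dz], [E3 = dz] the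
   Levi-Civita connection is [d + (tau u + sig(u) E3) x _]. *)
Lemma bcv_christoffel q u v w : bcv_domain kappa q ->
  inner (bcv_metric kappa tau) q (christoffel_form (bcv_metric kappa tau) q u v) w =
  (dcf1 q u v + tau * (cf2 q u * cf3 q v - cf3 q u * cf2 q v) - sig q u * cf2 q v) * cf1 q w +
  (dcf2 q u v + tau * (cf3 q u * cf1 q v - cf1 q u * cf3 q v) + sig q u * cf1 q v) * cf2 q w +
  (dcf3 q u v + tau * (cf1 q u * cf2 q v - cf2 q u * cf1 q v)) * cf3 q w.
Proof.
move=> lq; have lq0 : lam q != 0 by exact: lt0r_neq0.
rewrite koszul; [|by move=> i j; exact: bcv_entry_diff|exact: bcv_sym|exact: bcv_unitmx].
rewrite (@derive_val _ _ _ _ _ _ _ (derive_bcv_inner u v w lq0)).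
rewrite (@derive_val _ _ _ _ _ _ _ (derive_bcv_inner v u w lq0)).
rewrite (@derive_val _ _ _ _ _ _ _ (derive_bcv_inner w u v lq0)).
rewrite /dcf1 /dcf2 /dcf3 /sig /cf1 /cf2 /cf3 /dlam.
have : lam q = 1 + kappa / 4 * (xcoord q ^+ 2 + ycoord q ^+ 2) by [].
move: lq0 => {lq}; move: (lam q) => l l0 lE.
have -> : kappa / 2 = 2 * (kappa / 4) by field.
move: lE; move: (kappa / 4) => k lE.
move: (xcoord q) (ycoord q) (xcoord u) (ycoord u) (zcoord u) (xcoord v) (ycoord v)
  (zcoord v) (xcoord w) (ycoord w) (zcoord w) lE.
move=> x y u1 u2 u3 v1 v2 v3 w1 w2 w3 lE.
(* The derivative of the third coframe form simplifies only through the definition of lam, hence its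
   expansion before [field]. *)
rewrite lE in l0 *.
by field.
Qed.

End Ambient.

(** * Functions of one variable *)

Section OneVariable.
Context {R : realType}.
Implicit Types (f g : R -> R) (a b s t : R) (J : set R).

Lemma within_derivable f a b : (forall t, a <= t <= b -> derivable f t 1) ->
  {within `[a, b], continuous f}.
Proof.
by move=> df; apply: derivable_within_continuous => t; rewrite in_itv /=; exact: df.
Qed.

Lemma mvt f (df : R -> R) a b : a < b ->
  (forall t, a <= t <= b -> is_derive t 1 f (df t)) ->
  exists2 c, a < c < b & f b - f a = df c * (b - a).
Proof.
move=> ab D; have [t|t tab|c] := MVT (f := f) (df := df) ab.
- by rewrite in_itv /= => /andP[h1 h2]; apply: D; rewrite !ltW.
- by apply: within_derivable tab => s /D h; exact: ex_derive.
- by rewrite in_itv /= => h1 h2; exists c.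
Qed.

Lemma zero_derive_const f J s t : is_interval J ->
  (forall t, J t -> is_derive t 1 f 0) -> J s -> J t -> f s = f t.
Proof.
move=> iJ D; wlog st : s t / s < t.
  move=> H Js Jt; case: (ltgtP s t) => [st|ts|-> //]; first exact: H.
  by apply/esym; exact: H.
move=> Js Jt; have [|c _ E] := mvt (f := f) (df := fun=> 0) st.
  by move=> r rst; apply: D; exact: iJ Js Jt r rst.
by move/eqP: E; rewrite mul0r subr_eq0 => /eqP.
Qed.

Lemma is_derive_expZ K t : is_derive t 1 (fun s => expR (K * s)) (K * expR (K * t)).
Proof.
have d1 : is_derive t 1 (fun s : R => K * s) K.
  by apply: (is_derive_eq (is_derive_scale K (is_derive_id t 1))); rewrite mulr1.
have := @is_derive1_comp _ expR (fun s : R => K * s) t (expR (K * t)) K (is_derive_expR _) d1.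
by move=> h; apply: (is_derive_eq h); rewrite mulrC.
Qed.

(** The function f e^(-C t) is nonincreasing and f e^(C t) nondecreasing, so a zero of the
    nonnegative f at either end spreads to the other. *)
Lemma gronwall_zero f (df : R -> R) (C : R) a b : a <= b ->
  (forall t, a <= t <= b -> is_derive t 1 f (df t)) ->
  (forall t, a <= t <= b -> 0 <= f t /\ `|df t| <= C * f t) ->
  f a = 0 \/ f b = 0 -> f a = 0 /\ f b = 0.
Proof.
rewrite le_eqVlt => /orP[/eqP <- _ _ []//|ab D B].
have mid c : a < c < b -> a <= c <= b by case/andP => h1 h2; rewrite !ltW.
(* Used with K = -C to pass from a to b, and with K = C to pass from b to a. *)
have G (K : R) : exists2 c, a < c < b & f b * expR (K * b) - f a * expR (K * a) =
    (df c + K * f c) * expR (K * c) * (b - a).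
  have [t tab|c cab ->] := mvt (f := fun t => f t * expR (K * t))
    (df := fun t => (df t + K * f t) * expR (K * t)) ab; last by exists c.
  by apply: (is_derive_eq (is_derive_mul (D t tab) (is_derive_expZ K t))); ring.
have pos x : 0 < expR x :> R := expR_gt0 x.
have ba : 0 < b - a by rewrite subr_gt0.
case=> [faz|fbz]; split=> //; apply/eqP; rewrite eq_le.
- have [c cab E] := G (- C); rewrite faz mul0r subr0 in E.
  have [f0 /ler_normlP[_ h]] := B c (mid c cab).
  have bb : a <= b <= b by rewrite lexx ltW.
  have [-> _] := B b bb.
  rewrite andbT -(pmulr_lle0 _ (pos (- C * b))) E pmulr_lle0 // pmulr_lle0 //.
  by rewrite mulNr subr_le0.
- have [c cab E] := G C; rewrite fbz mul0r sub0r in E.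
  have [f0 /ler_normlP[h _]] := B c (mid c cab).
  have aa : a <= a <= b by rewrite lexx ltW.
  have [-> _] := B a aa.
  rewrite andbT -(pmulr_lle0 _ (pos (C * a))) -oppr_ge0 E pmulr_lge0 // pmulr_lge0 //.
  by rewrite -lerBlDr sub0r lerNl.
Qed.

Lemma continuous_segment_bounded f a b : (forall t, a <= t <= b -> {for t, continuous f}) ->
  exists C, forall t, a <= t <= b -> `|f t| <= C.
Proof.
move=> cf; case: (leP a b) => [ab|ba]; last first.
  by exists 0 => t /andP[h1 h2]; have := le_lt_trans (le_trans h1 h2) ba; rewrite ltxx.
have cn : {within `[a, b], continuous (fun t => `|f t|)}.
  apply: continuous_in_subspaceT => t; rewrite inE /= in_itv /= => tab.
  by apply: continuous_comp; [exact: cf|exact: norm_continuous].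
have [c _ h] := EVT_max ab cn.
by exists `|f c| => t tab; apply: h; rewrite in_itv.
Qed.

(** Gronwall for the energy E, the sum of the squares of the entries of d. The Lipschitz constant
    may depend on the segment, as continuity of the coefficients bounds them on segments only. *)
Lemma lipschitz_ode_zero n J (d dd : R -> 'rV[R]_n.+1) s t : is_interval J ->
  (forall r, J r -> is_derive r 1 d (dd r)) ->
  (forall a b, J a -> J b -> exists C, forall r, a <= r <= b ->
     forall i, `|dd r 0 i| <= C * \sum_j `|d r 0 j|) ->
  J s -> J t -> d s = 0 -> d t = 0.
Proof.
move=> iJ D L.
suff H a b : a <= b -> J a -> J b -> d a = 0 \/ d b = 0 -> d a = 0 /\ d b = 0.
  move=> Js Jt ds; case: (leP s t) => [st|/ltW ts].
    by have [] := H s t st Js Jt (or_introl ds).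
  by have [] := H t s ts Jt Js (or_intror ds).
move=> ab Ja Jb z.
have Jab r : a <= r <= b -> J r by move=> h; exact: iJ Ja Jb r h.
pose E r := \sum_i d r 0 i ^+ 2.
pose dE r := \sum_i 2 * (d r 0 i * dd r 0 i).
have DE r : a <= r <= b -> is_derive r 1 E (dE r).
  move=> rab; have Dr := D r (Jab r rab).
  have Di i : is_derive r 1 (fun r => d r 0 i ^+ 2) (2 * (d r 0 i * dd r 0 i)).
    have e : ('D_1 d r) 0 i = dd r 0 i by rewrite (@derive_val _ _ _ _ _ _ _ Dr).
    have c := is_derive_coord i (@ex_derive _ _ _ _ _ _ _ Dr); rewrite e in c.
    by apply: (is_derive_eq (is_derive_mul c c)); ring.
  rewrite /E /dE; rewrite (_ : (fun r => _) = \sum_i (fun r => d r 0 i ^+ 2)).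
    exact: is_derive_sum.
  by apply/funext => q; rewrite fct_sumE.
have [C CP] := L a b Ja Jb.
have E0 r : 0 <= E r by apply: sumr_ge0 => i _; rewrite sqr_ge0.
(* By 2 |a| |b| <= a^2 + b^2, |E'| is at most |C| times the sum of d_i^2 + d_j^2 over all pairs (i,
   j), in which every square occurs 2 (n + 1) times. *)
have B r : a <= r <= b -> `|dE r| <= (`|C| * (n.+1%:R + n.+1%:R)) * E r.
  move=> rab; have -> : `|C| * (n.+1%:R + n.+1%:R) * E r =
      \sum_(i < n.+1) \sum_(j < n.+1) `|C| * (d r 0 i ^+ 2 + d r 0 j ^+ 2).
    under eq_bigr => i _ do rewrite -mulr_sumr big_split /= sumr_const card_ord -/(E r).
    rewrite -mulr_sumr big_split /= sumr_const card_ord.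
    have -> : \sum_(i < n.+1) d r 0 i ^+ 2 *+ n.+1 = E r *+ n.+1 by rewrite -sumrMnl.
    by rewrite -mulrA mulrDl !mulr_natl.
  apply: le_trans (ler_norm_sum _ _ _) _; apply: ler_sum => i _.
  have dC : `|dd r 0 i| <= `|C| * \sum_j `|d r 0 j|.
    by apply: le_trans (CP r rab i) _; rewrite ler_wpM2r ?ler_norm ?sumr_ge0.
  rewrite !normrM (ger0_norm (ler0n _ 2)).
  have -> : \sum_(j < n.+1) `|C| * (d r 0 i ^+ 2 + d r 0 j ^+ 2) =
      `|C| * \sum_(j < n.+1) (d r 0 i ^+ 2 + d r 0 j ^+ 2) by rewrite mulr_sumr.
  have S : 2 * (`|d r 0 i| * \sum_j `|d r 0 j|) <= \sum_(j < n.+1) (d r 0 i ^+ 2 + d r 0 j ^+ 2).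
    rewrite !mulr_sumr; apply: ler_sum => j _; rewrite -subr_ge0.
    rewrite -(real_normK (num_real (d r 0 i))) -(real_normK (num_real (d r 0 j))).
    by rewrite (_ : _ - _ = (`|d r 0 i| - `|d r 0 j|) ^+ 2) ?sqr_ge0 //; ring.
  apply: le_trans (ler_wpM2l (normr_ge0 C) S).
  rewrite [leRHS]mulrCA ler_wpM2l ?ler0n // [leRHS]mulrCA; exact: ler_wpM2l.
have Ed r : E r = 0 <-> d r = 0.
  split=> [/eqP|dr0]; last by rewrite /E big1 // => i _; rewrite dr0 mxE expr0n.
  rewrite psumr_eq0 => [/allP h|i _]; last by rewrite sqr_ge0.
  apply/rowP => i; have := h i (mem_index_enum i); rewrite /= sqrf_eq0 => /eqP ->.
  by rewrite mxE.
have z' : E a = 0 \/ E b = 0 by case: z => /Ed; [left|right].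
have [] := gronwall_zero ab DE (fun r rab => conj (E0 r) (B r rab)) z'.
by move=> /Ed ? /Ed.
Qed.

Lemma antiderivative f (v r : R) : 0 < r ->
  (forall t, `|t - v| < r -> {for t, continuous f}) ->
  exists F : R -> R, F v = 0 /\ forall t, `|t - v| < r / 2 -> is_derive t 1 F (f t).
Proof.
(* The factor 3/4 keeps the closed interval of integration inside the domain of continuity, with the
   requested radius r / 2 in its interior. *)
move=> r0 cf; pose a := v - r * (3 / 4); pose u := v + r * (3 / 4).
have int x : a < x -> x < u -> (@lebesgue_measure R).-integrable `[a, u] (EFin \o f).
  move=> ax xu; apply: continuous_compact_integrable; first exact: segment_compact.
  apply: continuous_in_subspaceT => t; rewrite inE /= in_itv /= => /andP[h1 h2].
  by apply: cf; rewrite ltr_norml; apply/andP; split; rewrite /a /u in h1 h2; lra.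
pose G x := (\int[lebesgue_measure]_(t in `[a, x]) f t)%R.
exists (fun x => G x - G v); split=> [|t]; first by rewrite subrr.
rewrite ltr_norml => /andP[h1 h2].
have ta : a < t by rewrite /a; lra.
have tu : t < u by rewrite /u; lra.
have [|d e] := continuous_FTC1_closed tu (int t ta tu) ta.
  by apply: cf; rewrite ltr_norml; apply/andP; split; lra.
have D : is_derive t 1 G (f t) := DeriveDef d (etrans (esym (derive1E _ _)) e).
by apply: (is_derive_eq (is_derive_add D (is_derive_const (- G v) t 1))); rewrite addr0.
Qed.

Lemma local_inverse f (df : R -> R) (t0 r : R) : 0 < r ->
  (forall t, `|t - t0| < r -> is_derive t 1 f (df t) /\ 0 < df t) ->
  exists (e : R) (g : R -> R), [/\ 0 < e, g (f t0) = t0 &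
    forall s, `|s - f t0| < e -> [/\ `|g s - t0| < r, f (g s) = s & is_derive s 1 g (df (g s))^-1] ].
Proof.
move=> r0 D; pose a := t0 - r / 2; pose b := t0 + r / 2.
have inab t : a <= t <= b -> `|t - t0| < r.
  by rewrite /a /b => /andP[h1 h2]; rewrite ltr_norml; apply/andP; split; lra.
have incr s t : a <= s -> s < t -> t <= b -> f s < f t.
  move=> h1 h2 h3; have [|c /andP[c1 c2] E] := mvt (f := f) (df := df) h2.
    move=> q /andP[q1 q2]; have [] // := D q _; apply: inab; apply/andP; split.
      exact: le_trans h1 q1.
    exact: le_trans q2 h3.
  rewrite -subr_gt0 E mulr_gt0 ?subr_gt0 //.
  have [|//] := D c _; apply: inab; apply/andP; split; first exact: le_trans h1 (ltW c1).
  exact: le_trans (ltW c2) h3.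
have fa : f a < f t0 by apply: incr; rewrite /a /b; lra.
have fb : f t0 < f b by apply: incr; rewrite /a /b; lra.
have cf : {within `[a, b], continuous f}.
  by apply: within_derivable => t /inab /D[h _]; exact: ex_derive.
have ab : a <= b by rewrite /a /b; lra.
have ivt s : f a < s < f b -> exists t, a < t < b /\ f t = s.
  move=> /andP[s1 s2]; have [|c] := IVT (v := s) ab cf.
    by rewrite min_l ?max_r ?(ltW s1) ?(ltW s2) //; exact: ltW (lt_trans s1 s2).
  rewrite in_itv /= => /andP[c1 c2] fc; exists c; split=> //.
  rewrite !lt_neqAle c1 c2 !andbT; apply/andP; split; apply/eqP => E.
    by move: s1; rewrite -fc E ltxx.
  by move: s2; rewrite -fc E ltxx.
(* The inverse is chosen on the whole line, with a meaningless value outside of the interval from f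
   a to f b. *)
have ivt' s : exists t, f a < s < f b -> a < t < b /\ f t = s.
  by case: (boolP (f a < s < f b)) => [/ivt[t h]|_]; [exists t|exists 0].
have [g gP] := choice ivt'.
have inj s t : a <= s <= b -> a <= t <= b -> f s = f t -> s = t.
  move=> /andP[s1 s2] /andP[t1 t2] e; case: (ltgtP s t) => // h.
    by have := incr s t s1 h t2; rewrite e ltxx.
  by have := incr t s t1 h s2; rewrite e ltxx.
have gf t : a < t < b -> g (f t) = t.
  move=> /andP[t1 t2].
  have fin : f a < f t < f b by rewrite !incr // ?lexx // ltW.
  have [/andP[g1 g2] fg] := gP _ fin.
  by apply: inj => //; rewrite !ltW.
exists (Num.min (f b - f t0) (f t0 - f a)), g; split.
- by rewrite lt_min !subr_gt0 fa fb.
- by apply: gf; rewrite /a /b; apply/andP; split; lra.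
move=> s; rewrite lt_min !ltr_norml => /andP[/andP[_ h1] /andP[h2 _]].
have sin : f a < s < f b by apply/andP; split; lra.
have [/andP[g1 g2] fg] := gP s sin.
have gin : `|g s - t0| < r by apply: inab; rewrite !ltW.
have [Dg dg] := D _ gin.
have nab : \forall t \near g s, a < t < b.
  have : g s \in `]a, b[%R by rewrite in_itv /= g1 g2.
  by move/near_in_itvoo; apply: filterS => t; rewrite in_itv.
have fgK : {near g s, cancel f g} by apply: filterS nab => t; exact: gf.
have cfn : {near g s, continuous f}.
  apply: filterS nab => t /andP[t1 t2]; apply: differentiable_continuous.
  apply/derivable1_diffP; have [|h _] := D t _; last exact: ex_derive.
  by apply: inab; rewrite !ltW.
have h := is_derive_inverse fgK cfn Dg (lt0r_neq0 dg); rewrite fg in h.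
by split=> //; rewrite -ltr_norml.
Qed.

End OneVariable.

(* Conversion must not unfold derivatives to limits. *)
#[local] Opaque derive.

(** * Immersed patches *)

Lemma sum_ord2 (V : nmodType) (f : 'I_2 -> V) : \sum_i f i = f 0 + f 1.
Proof.
rewrite !big_ord_recl big_ord0 addr0; congr (_ + f _); exact: val_inj.
Qed.

Lemma cfD (R : realType) (kappa tau : R) (q w w' : 'rV[R]_3) :
  [/\ cf1 kappa q (w + w') = cf1 kappa q w + cf1 kappa q w',
      cf2 kappa q (w + w') = cf2 kappa q w + cf2 kappa q w' &
      cf3 kappa tau q (w + w') = cf3 kappa tau q w + cf3 kappa tau q w'].
Proof. by rewrite /cf1 /cf2 /cf3 /xcoord /ycoord /zcoord !mxE; split; ring. Qed.

Lemma cfZ (R : realType) (kappa tau : R) (q : 'rV[R]_3) (c : R) (w : 'rV[R]_3) :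
  [/\ cf1 kappa q (c *: w) = c * cf1 kappa q w, cf2 kappa q (c *: w) = c * cf2 kappa q w &
      cf3 kappa tau q (c *: w) = c * cf3 kappa tau q w].
Proof. by rewrite /cf1 /cf2 /cf3 /xcoord /ycoord /zcoord !mxE; split; ring. Qed.

Section Patch.
Context {R : realType}.
Variables (kappa tau : R) (U : set 'rV[R]_2) (F : 'rV[R]_2 -> 'rV[R]_3).
Hypotheses (oU : open U) (sF : smooth_on U F) (iF : injective_diff_on U F).
Hypothesis DF : forall p, U p -> bcv_domain kappa (F p).
Implicit Types (X Y : 'rV[R]_2 -> 'rV[R]_2) (p u v w : 'rV[R]_2).
Local Notation g := (induced_metric kappa tau F).
Local Notation lam q := (bcv_factor kappa q).

Lemma lamF p : U p -> lam (F p) != 0.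
Proof. by move=> Up; exact: lt0r_neq0 (DF Up). Qed.

Lemma dFp p : U p -> differentiable F p.
Proof. by move=> Up; exact: smooth_on_diff sF Up. Qed.

Definition push Y p : 'rV[R]_3 := 'D_(Y p) F p.

Lemma pushE Y p : U p -> push Y p = \sum_i Y p 0 i *: partial i F p.
Proof. by move=> Up; rewrite /push (derive_sum_partial _ (dFp Up)). Qed.

Lemma smooth_push Y : smooth_on U Y -> smooth_on U (push Y).
Proof.
move=> sY; apply: smooth_row => // k.
apply: (@eq_smooth _ _ _ _ (fun p => \sum_i Y p 0 i * partial i F p 0 k)) => //.
  move=> q Uq; rewrite pushE // summxE; apply: eq_bigr => i _; by rewrite mxE.
apply: smooth_sum => // i; apply: smoothM => //; first exact: smooth_coord.
by apply: smooth_coord => //; exact: smooth_on_partial.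
Qed.

Lemma smooth_lamF : smooth_on U (fun p => lam (F p)).
Proof. exact: (smooth_comp (V := setT)) (smooth_lam kappa). Qed.

Lemma smooth_cf (P : 'rV[R]_2 -> 'rV[R]_3) : smooth_on U P ->
  [/\ smooth_on U (fun p => cf1 kappa (F p) (P p)),
      smooth_on U (fun p => cf2 kappa (F p) (P p)) &
      smooth_on U (fun p => cf3 kappa tau (F p) (P p))].
Proof.
move=> sP; have sl := smoothV oU lamF smooth_lamF.
have pc k := smooth_coord k oU sP; have fc k := smooth_coord k oU sF.
split; [exact: smoothM oU (pc 0) sl|exact: smoothM oU (pc 1) sl|].
apply: (smoothD oU (pc 2)); apply: (fun h => smoothM oU h sl).
apply: (smoothM oU (smooth_cst tau)).
exact: (smoothB oU (smoothM oU (fc 1) (pc 0)) (smoothM oU (fc 0) (pc 1))).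
Qed.

Definition push_cf1 Y p := cf1 kappa (F p) (push Y p).
Local Notation b1 := push_cf1.
Definition push_cf2 Y p := cf2 kappa (F p) (push Y p).
Local Notation b2 := push_cf2.
Definition push_cf3 Y p := cf3 kappa tau (F p) (push Y p).
Local Notation b3 := push_cf3.

Lemma smooth_b Y : smooth_on U Y ->
  [/\ smooth_on U (b1 Y), smooth_on U (b2 Y) & smooth_on U (b3 Y)].
Proof. by move=> /smooth_push; exact: smooth_cf. Qed.

(* Frame components of the ambient covariant derivative of [dF(Y)] along [v]. *)
Definition nabla_cf1 v Y p : R := 'D_v (b1 Y) p
  + tau * (b2 (cst v) p * b3 Y p - b3 (cst v) p * b2 Y p)
  - sig kappa tau (F p) (push (cst v) p) * b2 Y p.
Local Notation nab1 := nabla_cf1.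
Definition nabla_cf2 v Y p : R := 'D_v (b2 Y) p
  + tau * (b3 (cst v) p * b1 Y p - b1 (cst v) p * b3 Y p)
  + sig kappa tau (F p) (push (cst v) p) * b1 Y p.
Local Notation nab2 := nabla_cf2.
Definition nabla_cf3 v Y p : R := 'D_v (b3 Y) p
  + tau * (b1 (cst v) p * b2 Y p - b2 (cst v) p * b1 Y p).
Local Notation nab3 := nabla_cf3.

Lemma derive_b Y v p : U p -> differentiable (push Y) p ->
  [/\ 'D_v (b1 Y) p = cf1 kappa (F p) ('D_v (push Y) p) + dcf1 kappa (F p) ('D_v F p) (push Y p),
      'D_v (b2 Y) p = cf2 kappa (F p) ('D_v (push Y) p) + dcf2 kappa (F p) ('D_v F p) (push Y p) &
      'D_v (b3 Y) p = cf3 kappa tau (F p) ('D_v (push Y) p) + dcf3 kappa tau (F p) ('D_v F p) (push Y p)].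
Proof.
move=> Up dY; have dv : derivable F p v by apply: diff_derivable; exact: dFp.
have dPv : derivable (push Y) p v by exact: diff_derivable.
split.
- exact: (@derive_val _ _ _ _ _ _ _ (is_derive_cf1 dv dPv (lamF Up))).
- exact: (@derive_val _ _ _ _ _ _ _ (is_derive_cf2 dv dPv (lamF Up))).
- exact: (@derive_val _ _ _ _ _ _ _ (is_derive_cf3 tau dv dPv (lamF Up))).
Qed.

(** The derivatives [dcf] of the coframe in the Christoffel form turn components of a derivative
    into derivatives of components; what remains are the connection terms of [nabla_cf1],
    [nabla_cf2], [nabla_cf3]. *)
Lemma second_form_frame (xi : 'rV[R]_2 -> 'rV[R]_3) X Y p :
  U p -> smooth_on U Y -> second_form kappa tau F xi X Y p =
  nab1 (X p) Y p * cf1 kappa (F p) (xi p) + nab2 (X p) Y p * cf2 kappa (F p) (xi p) +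
  nab3 (X p) Y p * cf3 kappa tau (F p) (xi p).
Proof.
move=> Up sY; rewrite /second_form covariant_alongE innerDl bcv_inner.
rewrite bcv_christoffel; last exact: DF.
have [e1 e2 e3] := derive_b (X p) Up (smooth_on_diff (smooth_push sY) Up).
rewrite /nab1 /nab2 /nab3 e1 e2 e3 /b1 /b2 /b3.
have -> : push (cst (X p)) p = 'D_(X p) F p by [].
change (fun q => 'D_(Y q) F q) with (push Y); change ('D_(Y p) F p) with (push Y p).
move: ('D_(X p) F p) ('D_(X p) (push Y) p) (push Y p) (F p) (xi p) => a b c d e.
ring.
Qed.

Lemma derive2C u v p : U p ->
  'D_u (push (cst v)) p = 'D_v (push (cst u)) p.
Proof.
move=> Up.
have key a b k : ('D_a (push (cst b)) p) 0 k =
    \sum_i \sum_j a 0 i * b 0 j * partial i (partial j (fun q => F q 0 k)) p.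
  have sb := smooth_push (@smooth_cst R 1 _ U b).
  rewrite -derive_coord; last by apply: diff_derivable; exact: smooth_on_diff sb Up.
  have sFk : smooth_on U (fun q => F q 0 k) by exact: smooth_coord.
  rewrite (@near_eq_derive _ _ _ _ (fun q => \sum_j b 0 j * partial j (fun q => F q 0 k) q)); last first.
    apply: (near_eq_open oU Up) => q Uq; rewrite pushE // summxE; apply: eq_bigr => j _.
    rewrite mxE /partial derive_coord //; apply: diff_derivable; exact: dFp.
  have sj j : smooth_on U (fun q => b 0 j * partial j (fun q => F q 0 k) q).
    by apply: smoothM => //; [exact: smooth_cst|exact: smooth_on_partial].
  rewrite derive_sum_partial; last by apply: (smooth_on_diff _ Up); exact: smooth_sum.
  apply: eq_bigr => i _; rewrite /GRing.scale /=.
  have -> : (fun q => \sum_j b 0 j * partial j (fun q => F q 0 k) q) =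
     \sum_j (fun q => b 0 j * partial j (fun q => F q 0 k) q).
    by apply/funext => q; rewrite fct_sumE.
  rewrite /partial derive_sum; last by move=> j; apply: diff_derivable; exact: smooth_on_diff (sj j) Up.
  rewrite mulr_sumr; apply: eq_bigr => j _.
  have := @deriveMl _ _ (partial j (fun q => F q 0 k)) (b 0 j) p (delta_mx 0 i).
  rewrite /GRing.scale /= => ->; first by rewrite mulrA.
  by apply: diff_derivable; exact: smooth_on_diff (smooth_on_partial j sFk) Up.
apply/rowP => k.
refine (etrans (key u v k) (etrans _ (esym (key v u k)))).
rewrite exchange_big.
apply: eq_bigr => j _; apply: eq_bigr => i _.
by rewrite (partialC i j oU Up (smooth_coord k oU sF)) [v 0 j * _]mulrC.
Qed.

(** Absence of torsion: the second derivative of F is symmetric in the constant vectors u and v, and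
    so is the contribution of the ambient Christoffel form. *)
Lemma nabC u v p : U p ->
  [/\ nab1 u (cst v) p = nab1 v (cst u) p, nab2 u (cst v) p = nab2 v (cst u) p &
      nab3 u (cst v) p = nab3 v (cst u) p].
Proof.
move=> Up.
have dp a := smooth_on_diff (smooth_push (@smooth_cst R 1 _ U a)) Up.
(* The components as functions of the second derivative D and the first derivatives A, B; the claim
   becomes an identity in A and B for fixed D. *)
pose N1 q D A B := cf1 kappa q D + dcf1 kappa q A B
  + tau * (cf2 kappa q A * cf3 kappa tau q B - cf3 kappa tau q A * cf2 kappa q B)
  - sig kappa tau q A * cf2 kappa q B.
pose N2 q D A B := cf2 kappa q D + dcf2 kappa q A B
  + tau * (cf3 kappa tau q A * cf1 kappa q B - cf1 kappa q A * cf3 kappa tau q B)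
  + sig kappa tau q A * cf1 kappa q B.
pose N3 q D A B := cf3 kappa tau q D + dcf3 kappa tau q A B
  + tau * (cf1 kappa q A * cf2 kappa q B - cf2 kappa q A * cf1 kappa q B).
have nE a b D : 'D_a (push (cst b)) p = D ->
    [/\ nab1 a (cst b) p = N1 (F p) D ('D_a F p) ('D_b F p),
    nab2 a (cst b) p = N2 (F p) D ('D_a F p) ('D_b F p) &
    nab3 a (cst b) p = N3 (F p) D ('D_a F p) ('D_b F p)].
  move=> DE; have [e1 e2 e3] := derive_b a Up (dp b).
  by split; [rewrite /nab1 e1 DE|rewrite /nab2 e2 DE|rewrite /nab3 e3 DE].
have [D hD] : exists D, 'D_v (push (cst u)) p = D by eexists.
have [-> -> ->] := nE u v D (etrans (derive2C u v Up) hD).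
have [-> -> ->] := nE v u D hD.
have := lamF Up; rewrite /N1 /N2 /N3.
move: (F p) ('D_u F p) ('D_v F p) => q A B.
rewrite /sig /dcf1 /dcf2 /dcf3 /dlam /cf1 /cf2 /cf3.
have : lam q = 1 + kappa / 4 * (xcoord q ^+ 2 + ycoord q ^+ 2) by [].
have -> : kappa / 2 = 2 * (kappa / 4) by field.
move: (lam q) (kappa / 4) => l k lE l0.
move: (xcoord q) (ycoord q) (xcoord A) (ycoord A) (zcoord A)
  (xcoord B) (ycoord B) (zcoord B) (xcoord D) (ycoord D) (zcoord D) lE.
move=> x y u1 u2 u3 v1 v2 v3 w1 w2 w3 lE; rewrite lE in l0 *.
by split; field.
Qed.

Lemma pushD Y Y' p : U p -> push (fun q => Y q + Y' q) p = push Y p + push Y' p.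
Proof.
move=> Up; rewrite (pushE _ Up) (pushE Y Up) (pushE Y' Up) -big_split.
by apply: eq_bigr => i _; rewrite mxE scalerDl.
Qed.

Lemma pushZ (c : R) Y Y' p : U p -> Y p = c *: Y' p -> push Y p = c *: push Y' p.
Proof.
move=> Up YE; rewrite (pushE Y Up) (pushE Y' Up) scaler_sumr.
by apply: eq_bigr => i _; rewrite YE mxE scalerA.
Qed.

Lemma induced_entry q i j : g q i j =
  b1 (cst (delta_mx 0 i)) q * b1 (cst (delta_mx 0 j)) q +
  b2 (cst (delta_mx 0 i)) q * b2 (cst (delta_mx 0 j)) q +
  b3 (cst (delta_mx 0 i)) q * b3 (cst (delta_mx 0 j)) q.
Proof. by rewrite mxE bcv_inner. Qed.

Lemma b_sum u p : U p ->
  [/\ b1 (cst u) p = \sum_i u 0 i * b1 (cst (delta_mx 0 i)) p,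
      b2 (cst u) p = \sum_i u 0 i * b2 (cst (delta_mx 0 i)) p &
      b3 (cst u) p = \sum_i u 0 i * b3 (cst (delta_mx 0 i)) p].
Proof.
move=> Up.
have pE : push (cst u) p = u 0 0 *: push (cst (delta_mx 0 0)) p + u 0 1 *: push (cst (delta_mx 0 1)) p.
  by refine (etrans (pushE (cst u) Up) _); rewrite sum_ord2.
rewrite !sum_ord2 /b1 /b2 /b3 pE.
have [d1 d2 d3] := cfD kappa tau (F p)
  (u 0 0 *: push (cst (delta_mx 0 0)) p) (u 0 1 *: push (cst (delta_mx 0 1)) p).
have [x1 x2 x3] := cfZ kappa tau (F p) (u 0 0) (push (cst (delta_mx 0 0)) p).
have [y1 y2 y3] := cfZ kappa tau (F p) (u 0 1) (push (cst (delta_mx 0 1)) p).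
split; [exact: etrans d1 (congr2 +%R x1 y1)|exact: etrans d2 (congr2 +%R x2 y2)|].
exact: etrans d3 (congr2 +%R x3 y3).
Qed.

Lemma induced_inner p u v : U p -> inner g p u v =
  b1 (cst u) p * b1 (cst v) p + b2 (cst u) p * b2 (cst v) p + b3 (cst u) p * b3 (cst v) p.
Proof.
move=> Up; rewrite innerE.
have alg (a b x1 x2 x3 y1 y2 y3 : R) : a * (x1 * y1 + x2 * y2 + x3 * y3) * b =
  a * x1 * (b * y1) + a * x2 * (b * y2) + a * x3 * (b * y3) by ring.
have [-> -> ->] := b_sum u Up; have [-> -> ->] := b_sum v Up.
rewrite !mulr_suml -!big_split; apply: eq_bigr => i _.
rewrite !mulr_sumr -!big_split; apply: eq_bigr => j _.
by rewrite induced_entry; exact: alg.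
Qed.

Lemma push_coord Y p k : U p ->
  push Y p 0 k = Y p 0 0 * partial 0 F p 0 k + Y p 0 1 * partial 1 F p 0 k.
Proof.
move=> Up; have comb (a b : R) (v w : 'rV[R]_3) : (a *: v + b *: w) 0 k = a * v 0 k + b * w 0 k.
  by rewrite !mxE.
by refine (etrans (congr1 (fun M : 'rV[R]_3 => M 0 k) (etrans (pushE Y Up) (sum_ord2 _))) (comb _ _ _ _)).
Qed.

Lemma derive_push u Y p k : U p -> smooth_on U Y ->
  ('D_u (push Y) p) 0 k =
  ('D_u Y p) 0 0 * partial 0 F p 0 k + Y p 0 0 * 'D_u (fun q => partial 0 F q 0 k) p +
  (('D_u Y p) 0 1 * partial 1 F p 0 k + Y p 0 1 * 'D_u (fun q => partial 1 F q 0 k) p).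
Proof.
move=> Up sY; have dY : derivable Y p u by apply: diff_derivable; exact: smooth_on_diff sY Up.
have dF i : derivable (fun q => partial i F q 0 k) p u.
  apply: diff_derivable; apply: (smooth_on_diff _ Up); apply: smooth_coord => //.
  exact: smooth_on_partial.
have dP : derivable (push Y) p u.
  by apply: diff_derivable; exact: smooth_on_diff (smooth_push sY) Up.
refine (etrans (esym (derive_coord k dP)) _).
have E : \near p, push Y p 0 k = Y p 0 0 * partial 0 F p 0 k + Y p 0 1 * partial 1 F p 0 k.
  by apply: (near_eq_open oU Up (f := fun q => push Y q 0 k)) => q; exact: push_coord.
refine (etrans (near_eq_derive _ E) _).
have H := is_derive_add
  (is_derive_mul (is_derive_coord 0 dY) (derivableP (dF 0)))
  (is_derive_mul (is_derive_coord 1 dY) (derivableP (dF 1))).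
exact: (@derive_val _ _ _ _ _ _ _ H).
Qed.

Lemma derive_push_split u Y p : U p -> smooth_on U Y ->
  'D_u (push Y) p = push (cst ('D_u Y p)) p + 'D_u (push (cst (Y p))) p.
Proof.
move=> Up sY; apply/rowP => k; rewrite mxE.
have c0 : 'D_u (fun _ : 'rV[R]_2 => Y p) p = 0 by exact: derive_cst.
refine (etrans (derive_push u k Up sY) _).
refine (etrans _ (esym (congr2 +%R (push_coord (cst ('D_u Y p)) k Up)
  (derive_push u k Up (@smooth_cst _ _ _ U (Y p)))))).
rewrite c0 [in RHS](mxE _ _ 0 0) [in RHS](mxE _ _ 0 1).
have alg (x y A B c d : R) : x + A + (y + B) = x + y + (0 * c + A + (0 * d + B)) by ring.
exact: alg.
Qed.

(** Product rule: the derivative of dF(Y) is the tangent vector dF(D_u Y) plus the derivative of dF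
    applied to Y frozen at its value in p. *)
Lemma nab_split u Y p : U p -> smooth_on U Y ->
  [/\ nab1 u Y p = b1 (cst ('D_u Y p)) p + nab1 u (cst (Y p)) p,
      nab2 u Y p = b2 (cst ('D_u Y p)) p + nab2 u (cst (Y p)) p &
      nab3 u Y p = b3 (cst ('D_u Y p)) p + nab3 u (cst (Y p)) p].
Proof.
move=> Up sY.
have [e1 e2 e3] := derive_b u Up (smooth_on_diff (smooth_push sY) Up).
have [f1 f2 f3] := derive_b u Up (smooth_on_diff (smooth_push (@smooth_cst _ _ _ U (Y p))) Up).
have [d1 d2 d3] := cfD kappa tau (F p) (push (cst ('D_u Y p)) p) ('D_u (push (cst (Y p))) p).
have S := derive_push_split u Up sY.
have alg (cf : 'rV[R]_3 -> R) (D A B : 'rV[R]_3) (d : R) :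
    D = A + B -> cf (A + B) = cf A + cf B -> cf D + d = cf A + (cf B + d).
  by move=> -> ->; rewrite addrA.
have E1 := etrans e1 (etrans (alg (cf1 kappa (F p)) _ _ _ _ S d1) (congr1 (+%R _) (esym f1))).
have E2 := etrans e2 (etrans (alg (cf2 kappa (F p)) _ _ _ _ S d2) (congr1 (+%R _) (esym f2))).
have E3 := etrans e3 (etrans (alg (cf3 kappa tau (F p)) _ _ _ _ S d3) (congr1 (+%R _) (esym f3))).
have a1 (x y t s : R) : x + y + t - s = x + (y + t - s) by ring.
have a2 (x y t s : R) : x + y + t + s = x + (y + t + s) by ring.
have a3 (x y t : R) : x + y + t = x + (y + t) by ring.
split; [exact: etrans (congr1 (fun z => z + _ - _) E1) (a1 _ _ _ _)
  |exact: etrans (congr1 (fun z => z + _ + _) E2) (a2 _ _ _ _)|].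
exact: etrans (congr1 (fun z => z + _) E3) (a3 _ _ _).
Qed.

(* The connection form is skew, hence [nabla_cf] is metric. *)
Lemma derive_dot a X Y p : U p -> smooth_on U X -> smooth_on U Y ->
  'D_a (fun q => b1 X q * b1 Y q + b2 X q * b2 Y q + b3 X q * b3 Y q) p =
  (nab1 a X p * b1 Y p + nab2 a X p * b2 Y p + nab3 a X p * b3 Y p) +
  (b1 X p * nab1 a Y p + b2 X p * nab2 a Y p + b3 X p * nab3 a Y p).
Proof.
move=> Up sX sY.
have [x1 x2 x3] := smooth_b sX; have [y1 y2 y3] := smooth_b sY.
have D (f : 'rV[R]_2 -> R) (sf : smooth_on U f) : is_derive p a f ('D_a f p).
  by apply: derivableP; apply: diff_derivable; exact: smooth_on_diff sf Up.
have H := is_derive_add (is_derive_add (is_derive_mul (D _ x1) (D _ y1))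
  (is_derive_mul (D _ x2) (D _ y2))) (is_derive_mul (D _ x3) (D _ y3)).
refine (etrans (@derive_val _ _ _ _ _ _ _ H) _).
rewrite /nab1 /nab2 /nab3.
have alg (dx1 dx2 dx3 dy1 dy2 dy3 X1 X2 X3 Y1 Y2 Y3 a1 a2 a3 s : R) :
  dx1 * Y1 + X1 * dy1 + (dx2 * Y2 + X2 * dy2) + (dx3 * Y3 + X3 * dy3) =
  (dx1 + tau * (a2 * X3 - a3 * X2) - s * X2) * Y1 +
  (dx2 + tau * (a3 * X1 - a1 * X3) + s * X1) * Y2 + (dx3 + tau * (a1 * X2 - a2 * X1)) * Y3 +
  (X1 * (dy1 + tau * (a2 * Y3 - a3 * Y2) - s * Y2) +
   X2 * (dy2 + tau * (a3 * Y1 - a1 * Y3) + s * Y1) + X3 * (dy3 + tau * (a1 * Y2 - a2 * Y1))).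
  by ring.
exact: alg.
Qed.

Lemma induced_unitmx p : U p -> g p \in unitmx.
Proof.
move=> Up; apply: definite_unitmx => u; rewrite (induced_inner u u Up) -!expr2 => /eqP.
rewrite !paddr_eq0 ?addr_ge0 ?sqr_ge0 // !sqrf_eq0 => /andP[/andP[/eqP z1 /eqP z2] /eqP z3].
by apply: (iF Up); exact: cf_eq0 (lamF Up) z1 z2 z3.
Qed.

Lemma induced_entry_diff i j p : U p -> differentiable (fun x => g x i j) p.
Proof.
move=> Up; rewrite (funext (fun q => induced_entry q i j)).
have [x1 x2 x3] := smooth_b (@smooth_cst R 1 _ U (delta_mx 0 i)).
have [y1 y2 y3] := smooth_b (@smooth_cst R 1 _ U (delta_mx 0 j)).
apply: (smooth_on_diff _ Up).
exact: (smoothD oU (smoothD oU (smoothM oU x1 y1) (smoothM oU x2 y2)) (smoothM oU x3 y3)).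
Qed.

(** Gauss formula for constant fields: the derivative [nabla_cf] is metric by [derive_dot] and
    torsion-free by [nabC], so Koszul's formula for the induced metric collapses to the tangential
    part of the ambient derivative. *)
Lemma induced_christoffel u v w p : U p ->
  inner g p (christoffel_form g p u v) w =
  nab1 u (cst v) p * b1 (cst w) p + nab2 u (cst v) p * b2 (cst w) p +
  nab3 u (cst v) p * b3 (cst w) p.
Proof.
move=> Up; rewrite koszul; [|by move=> i j; exact: induced_entry_diff| |exact: induced_unitmx].
  have sc a := @smooth_cst R 1 _ U (a : 'rV[R]_2).
  have D a c d : 'D_a (fun x => inner g x c d) p =
    (nab1 a (cst c) p * b1 (cst d) p + nab2 a (cst c) p * b2 (cst d) p + nab3 a (cst c) p * b3 (cst d) p) +
    (b1 (cst c) p * nab1 a (cst d) p + b2 (cst c) p * nab2 a (cst d) p + b3 (cst c) p * nab3 a (cst d) p).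
    refine (etrans _ (derive_dot a Up (sc c) (sc d))).
    apply: near_eq_derive; apply: (near_eq_open oU Up (f := fun x => inner g x c d)) => q Uq.
    exact: induced_inner.
  rewrite (D u v w) (D v u w) (D w u v).
  have [<- <- <-] := nabC u v Up; have [<- <- <-] := nabC u w Up; have [<- <- <-] := nabC v w Up.
  have alg (a1 a2 a3 c1 c2 c3 d1 d2 d3 x1 x2 x3 y1 y2 y3 z1 z2 z3 : R) :
    2^-1 * (a1 * x1 + a2 * x2 + a3 * x3 + (y1 * c1 + y2 * c2 + y3 * c3) +
     (a1 * x1 + a2 * x2 + a3 * x3 + (z1 * d1 + z2 * d2 + z3 * d3)) -
     (c1 * y1 + c2 * y2 + c3 * y3 + (z1 * d1 + z2 * d2 + z3 * d3))) =
    a1 * x1 + a2 * x2 + a3 * x3 by field.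
  exact: alg.
move=> x i j.
have alg (a b c a' b' c' : R) : a * a' + b * b' + c * c' = a' * a + b' * b + c' * c by ring.
exact: etrans (induced_entry x i j) (etrans (alg _ _ _ _ _ _) (esym (induced_entry x j i))).
Qed.

(** Extends the Gauss formula to variable Y, where both sides gain the term dF(D_X Y). *)
Lemma levi_civita_frame X Y w p : U p -> smooth_on U Y ->
  let L := cst (levi_civita g X Y p) in
  b1 L p * b1 (cst w) p + b2 L p * b2 (cst w) p + b3 L p * b3 (cst w) p =
  nab1 (X p) Y p * b1 (cst w) p + nab2 (X p) Y p * b2 (cst w) p + nab3 (X p) Y p * b3 (cst w) p.
Proof.
move=> Up sY L; have iE := induced_inner (levi_civita g X Y p) w Up.
refine (etrans (esym iE) _).
have lE : levi_civita g X Y p = 'D_(X p) Y p + christoffel_form g p (X p) (Y p).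
  have iE' : 'D_(X p) (@id 'rV[R]_2) p = X p by exact: derive_id.
  by refine (etrans (covariant_alongE _ _ _ _ _) _); rewrite iE'.
rewrite lE innerDl (induced_christoffel _ _ _ Up) (induced_inner _ _ Up).
have [-> -> ->] := nab_split (X p) Up sY.
have alg (a1 a2 a3 c1 c2 c3 x1 x2 x3 : R) :
  a1 * x1 + a2 * x2 + a3 * x3 + (c1 * x1 + c2 * x2 + c3 * x3) =
  (a1 + c1) * x1 + (a2 + c2) * x2 + (a3 + c3) * x3 by ring.
exact: alg.
Qed.

End Patch.

(** * Adapted orthonormal frames *)

(** Multiplied by the Gram determinant of a and d, the expansion of w in a, d, a x d is a polynomial
    identity; orthonormality then sets this determinant to 1. *)
Lemma orthonormal_expand (R : comRingType) (a1 a2 a3 d1 d2 d3 w1 w2 w3 : R) :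
  let m1 := a2 * d3 - a3 * d2 in let m2 := a3 * d1 - a1 * d3 in
  let m3 := a1 * d2 - a2 * d1 in
  let A := w1 * a1 + w2 * a2 + w3 * a3 in
  let D := w1 * d1 + w2 * d2 + w3 * d3 in
  let M := w1 * m1 + w2 * m2 + w3 * m3 in
  a1 * a1 + a2 * a2 + a3 * a3 = 1 -> a1 * d1 + a2 * d2 + a3 * d3 = 0 ->
  d1 * d1 + d2 * d2 + d3 * d3 = 1 ->
  [/\ w1 = A * a1 + D * d1 + M * m1, w2 = A * a2 + D * d2 + M * m2 &
      w3 = A * a3 + D * d3 + M * m3].
Proof.
move=> m1 m2 m3 A D M g11 g12 g22.
pose G := (a1 * a1 + a2 * a2 + a3 * a3) * (d1 * d1 + d2 * d2 + d3 * d3)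
  - (a1 * d1 + a2 * d2 + a3 * d3) ^+ 2.
have G1 : G = 1 by rewrite /G g11 g12 g22; ring.
pose P := A * (d1 * d1 + d2 * d2 + d3 * d3) - D * (a1 * d1 + a2 * d2 + a3 * d3).
pose Q := D * (a1 * a1 + a2 * a2 + a3 * a3) - A * (a1 * d1 + a2 * d2 + a3 * d3).
have PE : P = A by rewrite /P g12 g22; ring.
have QE : Q = D by rewrite /Q g12 g11; ring.
have E1 : w1 * G = P * a1 + Q * d1 + M * m1 by rewrite /G /P /Q /M /A /D /m1 /m2 /m3; ring.
have E2 : w2 * G = P * a2 + Q * d2 + M * m2 by rewrite /G /P /Q /M /A /D /m1 /m2 /m3; ring.
have E3 : w3 * G = P * a3 + Q * d3 + M * m3 by rewrite /G /P /Q /M /A /D /m1 /m2 /m3; ring.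
by move: E1 E2 E3; rewrite G1 PE QE !mulr1.
Qed.

Section Frame.
Context {R : realType}.
Variables (kappa tau : R) (U : set 'rV[R]_2) (F : 'rV[R]_2 -> 'rV[R]_3).
Hypotheses (oU : open U) (sF : smooth_on U F) (iF : injective_diff_on U F).
Hypothesis DF : forall p, U p -> bcv_domain kappa (F p).
Implicit Types (X Y : 'rV[R]_2 -> 'rV[R]_2) (p u v w : 'rV[R]_2).
Local Notation g := (induced_metric kappa tau F).
Local Notation b1 := (push_cf1 kappa F).
Local Notation b2 := (push_cf2 kappa F).
Local Notation b3 := (push_cf3 kappa tau F).
Local Notation nab1 := (nabla_cf1 kappa tau F).
Local Notation nab2 := (nabla_cf2 kappa tau F).
Local Notation nab3 := (nabla_cf3 kappa tau F).
Local Notation sg := (sig kappa tau).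

Variables (X1 X2 : 'rV[R]_2 -> 'rV[R]_2).
Hypotheses (sX1 : smooth_on U X1) (sX2 : smooth_on U X2).
Hypothesis o11 : forall p, U p -> b1 X1 p * b1 X1 p + b2 X1 p * b2 X1 p + b3 X1 p * b3 X1 p = 1.
Hypothesis o12 : forall p, U p -> b1 X1 p * b1 X2 p + b2 X1 p * b2 X2 p + b3 X1 p * b3 X2 p = 0.
Hypothesis o22 : forall p, U p -> b1 X2 p * b1 X2 p + b2 X2 p * b2 X2 p + b3 X2 p * b3 X2 p = 1.

Definition normal_cf1 p : R := b2 X1 p * b3 X2 p - b3 X1 p * b2 X2 p.
Local Notation m1 := normal_cf1.
Definition normal_cf2 p : R := b3 X1 p * b1 X2 p - b1 X1 p * b3 X2 p.
Local Notation m2 := normal_cf2.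
Definition normal_cf3 p : R := b1 X1 p * b2 X2 p - b2 X1 p * b1 X2 p.
Local Notation m3 := normal_cf3.

(** The connection form of the frame, <nabla_v X1, X2>. *)
Definition frame_connection v p : R :=
  nab1 v X1 p * b1 X2 p + nab2 v X1 p * b2 X2 p + nab3 v X1 p * b3 X2 p.
Local Notation om := frame_connection.
Definition normal_form v Y p : R := nab1 v Y p * m1 p + nab2 v Y p * m2 p + nab3 v Y p * m3 p.
Local Notation hh := normal_form.

Let derive_dot_const v Y Y' (c : R) p : U p -> smooth_on U Y -> smooth_on U Y' ->
  (forall q, U q -> b1 Y q * b1 Y' q + b2 Y q * b2 Y' q + b3 Y q * b3 Y' q = c) ->
  (nab1 v Y p * b1 Y' p + nab2 v Y p * b2 Y' p + nab3 v Y p * b3 Y' p) +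
  (b1 Y p * nab1 v Y' p + b2 Y p * nab2 v Y' p + b3 Y p * nab3 v Y' p) = 0.
Proof.
move=> Up sY sY' H; refine (etrans (esym (derive_dot tau oU sF DF v Up sY sY')) _).
have c0 : 'D_v (fun=> c) p = 0 by exact: derive_cst.
refine (etrans _ c0); apply: near_eq_derive.
exact: (near_eq_open oU Up (f := fun q => b1 Y q * b1 Y' q + b2 Y q * b2 Y' q + b3 Y q * b3 Y' q)).
Qed.

(** Differentiating <X1, X1> = 1 removes the component along X1; the other two are the connection
    form and the second fundamental form by definition. *)
Lemma nab_frame1 v p : U p ->
  [/\ nab1 v X1 p = om v p * b1 X2 p + hh v X1 p * m1 p,
      nab2 v X1 p = om v p * b2 X2 p + hh v X1 p * m2 p &
      nab3 v X1 p = om v p * b3 X2 p + hh v X1 p * m3 p].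
Proof.
move=> Up; have e := derive_dot_const v Up sX1 sX1 o11.
have [E1 E2 E3] := orthonormal_expand (nab1 v X1 p) (nab2 v X1 p) (nab3 v X1 p)
  (o11 Up) (o12 Up) (o22 Up).
have z : nab1 v X1 p * b1 X1 p + nab2 v X1 p * b2 X1 p + nab3 v X1 p * b3 X1 p = 0.
  have alg (x y z x' y' z' : R) : x * x' + y * y' + z * z' + (x' * x + y' * y + z' * z) = 0 ->
    x * x' + y * y' + z * z' = 0.
    by move=> H; apply: (lin_comb1 H (c := 2^-1)); field.
  exact: alg e.
have fin (w A a D d M m : R) : A = 0 -> w = A * a + D * d + M * m -> w = D * d + M * m.
  by move=> -> ->; rewrite mul0r add0r.
by split; [exact: fin z E1|exact: fin z E2|exact: fin z E3].
Qed.

Lemma nab_frame2 v p : U p ->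
  [/\ nab1 v X2 p = - om v p * b1 X1 p + hh v X2 p * m1 p,
      nab2 v X2 p = - om v p * b2 X1 p + hh v X2 p * m2 p &
      nab3 v X2 p = - om v p * b3 X1 p + hh v X2 p * m3 p].
Proof.
move=> Up; have e := derive_dot_const v Up sX2 sX2 o22.
have e' := derive_dot_const v Up sX1 sX2 o12.
have [E1 E2 E3] := orthonormal_expand (nab1 v X2 p) (nab2 v X2 p) (nab3 v X2 p)
  (o11 Up) (o12 Up) (o22 Up).
have z : nab1 v X2 p * b1 X2 p + nab2 v X2 p * b2 X2 p + nab3 v X2 p * b3 X2 p = 0.
  have alg (x y z x' y' z' : R) : x * x' + y * y' + z * z' + (x' * x + y' * y + z' * z) = 0 ->
    x * x' + y * y' + z * z' = 0.
    by move=> H; apply: (lin_comb1 H (c := 2^-1)); field.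
  exact: alg e.
have z' : nab1 v X2 p * b1 X1 p + nab2 v X2 p * b2 X1 p + nab3 v X2 p * b3 X1 p = - om v p.
  have alg (s x y t x' y' t' : R) : s + (x' * x + y' * y + t' * t) = 0 ->
    x * x' + y * y' + t * t' = - s.
    by move=> H; apply: (lin_comb1 H (c := 1)); ring.
  exact: alg e'.
have fin (w A a D d M m o : R) : D = 0 -> A = - o -> w = A * a + D * d + M * m ->
    w = - o * a + M * m.
  by move=> -> -> ->; rewrite mul0r addr0.
by split; [exact: fin z z' E1|exact: fin z z' E2|exact: fin z z' E3].
Qed.

Lemma b_inj v p : U p -> b1 (cst v) p = 0 -> b2 (cst v) p = 0 -> b3 (cst v) p = 0 -> v = 0.
Proof.
by move=> Up z1 z2 z3; apply: (iF Up); exact: cf_eq0 (lamF DF Up) z1 z2 z3.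
Qed.

Lemma b_comb v u (c d : R) p : U p -> let z := c *: v + d *: u in
  [/\ b1 (cst z) p = c * b1 (cst v) p + d * b1 (cst u) p,
      b2 (cst z) p = c * b2 (cst v) p + d * b2 (cst u) p &
      b3 (cst z) p = c * b3 (cst v) p + d * b3 (cst u) p].
Proof.
move=> Up z; have zE : push F (cst z) p = c *: push F (cst v) p + d *: push F (cst u) p.
  refine (etrans (pushD sF (cst (c *: v)) (cst (d *: u)) Up) (congr2 +%R _ _)).
    exact: (pushZ sF (Y := cst (c *: v)) (Y' := cst v) Up).
  exact: (pushZ sF (Y := cst (d *: u)) (Y' := cst u) Up).
have [d1 d2 d3] := cfD kappa tau (F p) (c *: push F (cst v) p) (d *: push F (cst u) p).
have [x1 x2 x3] := cfZ kappa tau (F p) c (push F (cst v) p).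
have [y1 y2 y3] := cfZ kappa tau (F p) d (push F (cst u) p).
split; [refine (etrans (congr1 (cf1 kappa (F p)) zE) (etrans d1 (congr2 +%R x1 y1)))
  |refine (etrans (congr1 (cf2 kappa (F p)) zE) (etrans d2 (congr2 +%R x2 y2)))|].
exact: (etrans (congr1 (cf3 kappa tau (F p)) zE) (etrans d3 (congr2 +%R x3 y3))).
Qed.

Lemma frame_independent (c d : R) p : U p -> c *: X1 p + d *: X2 p = 0 -> c = 0 /\ d = 0.
Proof.
move=> Up z; have [e1 e2 e3] := b_comb (X1 p) (X2 p) c d Up.
have [z1 z2 z3] := b_comb 0 0 0 0 Up.
have q11 := o11 Up; have q12 := o12 Up; have q22 := o22 Up.
move: e1 e2 e3; rewrite z => e1 e2 e3.
have alg (x1 x2 x3 y1 y2 y3 t1 t2 t3 : R) : t1 = c * x1 + d * y1 -> t2 = c * x2 + d * y2 ->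
   t3 = c * x3 + d * y3 ->  t1 = 0 -> t2 = 0 -> t3 = 0 ->
   x1 * x1 + x2 * x2 + x3 * x3 = 1 -> x1 * y1 + x2 * y2 + x3 * y3 = 0 ->
   y1 * y1 + y2 * y2 + y3 * y3 = 1 -> c = 0 /\ d = 0.
  move=> -> -> -> h1 h2 h3 r11 r12 r22; split.
    apply: (lin_comb5 h1 h2 h3 r11 r12 (c1 := x1) (c2 := x2) (c3 := x3) (c4 := - c) (c5 := - d)); ring.
  apply: (lin_comb5 h1 h2 h3 r12 r22 (c1 := y1) (c2 := y2) (c3 := y3) (c4 := - c) (c5 := - d)); ring.
have null f1 f2 : 0 *: (0 : 'rV[R]_2) + 0 *: 0 = 0 -> f1 = 0 * f2 + 0 * f2 -> f1 = 0 :> R.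
  by move=> _ ->; rewrite mul0r addr0.
have zz : 0 *: (0 : 'rV[R]_2) + 0 *: 0 = 0 by rewrite scale0r addr0.
move: z1 z2 z3; rewrite zz => z1 z2 z3.
exact: alg e1 e2 e3 (null _ _ zz z1) (null _ _ zz z2) (null _ _ zz z3) q11 q12 q22.
Qed.

Lemma frame_span v p : U p -> exists c d : R, v = c *: X1 p + d *: X2 p.
Proof.
move=> Up; have ind c d := @frame_independent c d p Up.
move: (X1 p) (X2 p) ind => x y ind.
have row2 (z t : 'rV[R]_2) : z 0 0 = t 0 0 -> z 0 1 = t 0 1 -> z = t.
  move=> e0 e1; apply/rowP => -[[|[|i]] lti] //.
    by rewrite (_ : Ordinal lti = 0) //; exact: val_inj.
  by rewrite (_ : Ordinal lti = 1) //; exact: val_inj.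
pose W := x 0 0 * y 0 1 - x 0 1 * y 0 0.
(* If the determinant vanished, (y_1, -x_1) and (y_0, -x_0) would be coefficients of linear
   relations between x and y, so that x = y = 0, which is again a relation. *)
have W0 : W != 0.
  apply/eqP => W0.
  have [y1 x1] : y 0 1 = 0 /\ - x 0 1 = 0.
    apply: ind; apply: row2; rewrite !mxE; last by ring.
    by rewrite -W0 /W; ring.
  have [y0 x0] : y 0 0 = 0 /\ - x 0 0 = 0.
    apply: ind; apply: row2; rewrite !mxE; first by ring.
    by apply: oppr_inj; rewrite oppr0 -W0 /W; ring.
  have [/eqP] : (1 : R) = 0 /\ (0 : R) = 0; last by rewrite oner_eq0.
  apply: ind; apply: row2; rewrite !mxE ?y0 ?y1.
    by move/eqP: x0; rewrite oppr_eq0 => /eqP->; ring.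
  by move/eqP: x1; rewrite oppr_eq0 => /eqP->; ring.
exists ((v 0 0 * y 0 1 - v 0 1 * y 0 0) / W), ((x 0 0 * v 0 1 - x 0 1 * v 0 0) / W).
by apply: row2; rewrite !mxE; move: W0; rewrite /W => W0; field.
Qed.

Lemma tangent_normal v p : U p ->
  b1 (cst v) p * m1 p + b2 (cst v) p * m2 p + b3 (cst v) p * m3 p = 0.
Proof.
move=> Up; have [c [d vE]] := frame_span v Up.
have [e1 e2 e3] := b_comb (X1 p) (X2 p) c d Up.
have alg (x1 x2 x3 y1 y2 y3 t1 t2 t3 : R) : t1 = c * x1 + d * y1 -> t2 = c * x2 + d * y2 ->
   t3 = c * x3 + d * y3 -> t1 * (x2 * y3 - x3 * y2) + t2 * (x3 * y1 - x1 * y3) +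
   t3 * (x1 * y2 - x2 * y1) = 0 by move=> -> -> ->; ring.
by rewrite vE; exact: alg e1 e2 e3.
Qed.

Definition frame_form11 p := hh (X1 p) X1 p.
Local Notation k11 := frame_form11.
Definition frame_form12 p := hh (X1 p) X2 p.
Local Notation k12 := frame_form12.
Definition frame_form22 p := hh (X2 p) X2 p.
Local Notation k22 := frame_form22.
Definition frame_connection1 p := om (X1 p) p.
Local Notation w1 := frame_connection1.
Definition frame_connection2 p := om (X2 p) p.
Local Notation w2 := frame_connection2.
Definition frame_rotation1 p := kappa / 2 * (ycoord (F p) * b1 X1 p - xcoord (F p) * b2 X1 p) - 2 * tau * b3 X1 p.
Local Notation s1 := frame_rotation1.
Definition frame_rotation2 p := kappa / 2 * (ycoord (F p) * b1 X2 p - xcoord (F p) * b2 X2 p) - 2 * tau * b3 X2 p.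
Local Notation s2 := frame_rotation2.

(** nabla_X1 X2 - nabla_X2 X1 = dF([X1, X2]) is tangent to the surface. Its normal part gives the
    symmetry of h, its tangential part expresses the bracket through the connection form. *)
Lemma frame_bracket p : U p -> hh (X2 p) X1 p = k12 p /\
  'D_(X1 p) X2 p - 'D_(X2 p) X1 p = - w1 p *: X1 p + - w2 p *: X2 p.
Proof.
move=> Up; set A := 'D_(X1 p) X2 p; set B := 'D_(X2 p) X1 p.
have [n1 n2 n3] := nab_split tau oU sF DF (X1 p) Up sX2.
have [l1 l2 l3] := nab_split tau oU sF DF (X2 p) Up sX1.
have [c1 c2 c3] := nabC tau oU sF DF (X1 p) (X2 p) Up.
have [f1 f2 f3] := nab_frame1 (X2 p) Up; have [h1 h2 h3] := nab_frame2 (X1 p) Up.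
have [e1 e2 e3] := b_comb A B 1 (-1) Up.
have tn := tangent_normal (1 *: A + -1 *: B) Up.
have alg (na nb bA bB nc nd x y k k' m a d t : R) : na = bA + nc -> nb = bB + nd -> nc = nd ->
    nb = y * d + k * m -> na = - x * a + k' * m -> t = 1 * bA + -1 * bB ->
    t = - x * a + - y * d + (k' - k) * m.
  move=> H1 H2 H3 H4 H5 ->; have -> : bA = na - nc by rewrite H1; ring.
  have -> : bB = nb - nd by rewrite H2; ring.
  rewrite H3 H4 H5; ring.
have E1 := alg _ _ _ _ _ _ _ _ _ _ _ _ _ _ n1 l1 c1 f1 h1 e1.
have E2 := alg _ _ _ _ _ _ _ _ _ _ _ _ _ _ n2 l2 c2 f2 h2 e2.
have E3 := alg _ _ _ _ _ _ _ _ _ _ _ _ _ _ n3 l3 c3 f3 h3 e3.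
have kk : hh (X2 p) X1 p = k12 p.
  have q11 := o11 Up; have q12 := o12 Up; have q22 := o22 Up.
  have alg2 (a1 a2 a3 d1 d2 d3 t1 t2 t3 x y z : R) :
    a1 * a1 + a2 * a2 + a3 * a3 = 1 -> a1 * d1 + a2 * d2 + a3 * d3 = 0 ->
    d1 * d1 + d2 * d2 + d3 * d3 = 1 ->
    t1 = x * a1 + y * d1 + z * (a2 * d3 - a3 * d2) ->
    t2 = x * a2 + y * d2 + z * (a3 * d1 - a1 * d3) ->
    t3 = x * a3 + y * d3 + z * (a1 * d2 - a2 * d1) ->
    t1 * (a2 * d3 - a3 * d2) + t2 * (a3 * d1 - a1 * d3) + t3 * (a1 * d2 - a2 * d1) = 0 ->
    z = 0.
    move=> r11 r12 r22 -> -> -> H.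
    apply: (lin_comb4 H r11 r12 r22 (c1 := 1)
      (c2 := - z * (d1 * d1 + d2 * d2 + d3 * d3)) (c3 := z * (a1 * d1 + a2 * d2 + a3 * d3))
      (c4 := - z)); ring.
  have Z := alg2 _ _ _ _ _ _ _ _ _ _ _ _ q11 q12 q22 E1 E2 E3 tn.
  by apply/esym/eqP; rewrite -subr_eq0; apply/eqP; exact: Z.
split; first exact: kk.
have z0 : (k12 p - hh (X2 p) X1 p) = 0 by rewrite kk subrr.
have [y1 y2 y3] := b_comb (X1 p) (X2 p) (w1 p) (w2 p) Up.
have [x1 x2 x3] := b_comb (1 *: A + -1 *: B) (w1 p *: X1 p + w2 p *: X2 p) 1 1 Up.
have alg3 (t a d x y m t' s k : R) : t = - x * a + - y * d + k * m -> k = 0 -> t' = x * a + y * d ->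
   s = 1 * t + 1 * t' -> s = 0 by move=> -> -> -> ->; ring.
have Z1 := alg3 _ _ _ _ _ _ _ _ _ E1 z0 y1 x1.
have Z2 := alg3 _ _ _ _ _ _ _ _ _ E2 z0 y2 x2.
have Z3 := alg3 _ _ _ _ _ _ _ _ _ E3 z0 y3 x3.
have algv (x y z t : 'rV[R]_2) (c d : R) :
    1 *: (1 *: x + -1 *: y) + 1 *: (c *: z + d *: t) = 0 -> x - y = - c *: z + - d *: t.
  rewrite !scale1r scaleN1r => /eqP; rewrite addr_eq0 => /eqP ->.
  by rewrite opprD !scaleNr.
exact: algv (b_inj Up Z1 Z2 Z3).
Qed.

(** The definition of [nabla_cf] solved for the plain derivatives. The ambient term tau (u x v)
    vanishes for u = v and is plus or minus tau n for the two mixed derivatives, which is the origin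
    of k12 + tau here and k12 - tau in [frame_table2]. *)
Lemma frame_table1 p : U p ->
  [/\ lie X1 (b1 X1) p = w1 p * b1 X2 p + k11 p * m1 p + s1 p * b2 X1 p,
      lie X1 (b2 X1) p = w1 p * b2 X2 p + k11 p * m2 p - s1 p * b1 X1 p &
      lie X1 (b3 X1) p = w1 p * b3 X2 p + k11 p * m3 p] /\
  [/\ lie X2 (b1 X1) p = w2 p * b1 X2 p + (k12 p + tau) * m1 p + s2 p * b2 X1 p,
      lie X2 (b2 X1) p = w2 p * b2 X2 p + (k12 p + tau) * m2 p - s2 p * b1 X1 p &
      lie X2 (b3 X1) p = w2 p * b3 X2 p + (k12 p + tau) * m3 p].
Proof.
move=> Up; have [x1 x2 x3] := smooth_b tau oU sF DF sX1.
have [kk _] := frame_bracket Up.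
rewrite !lieE; try by [exact: smooth_on_diff x1 Up|exact: smooth_on_diff x2 Up|exact: smooth_on_diff x3 Up].
have [f1 f2 f3] := nab_frame1 (X1 p) Up; have [h1 h2 h3] := nab_frame1 (X2 p) Up.
move: h1 h2 h3; rewrite kk => h1 h2 h3.
split; split.
- have alg (D a2 a3 r s : R) : D + tau * (a2 * a3 - a3 * a2) - s * a2 = r -> D = r + s * a2.
    by move=> H; apply: (lin_comb1 H (c := 1)); ring.
  exact: alg f1.
- have alg (D a2 a3 r s : R) : D + tau * (a3 * a2 - a2 * a3) + s * a2 = r -> D = r - s * a2.
    by move=> H; apply: (lin_comb1 H (c := 1)); ring.
  exact: alg f2.
- have alg (D a2 a3 r : R) : D + tau * (a3 * a2 - a2 * a3) = r -> D = r.
    by move=> H; apply: (lin_comb1 H (c := 1)); ring.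
  exact: alg f3.
- have alg (D a2 a3 d2 d3 o d k s : R) : D + tau * (d2 * a3 - d3 * a2) - s * a2 =
    o * d + k * (a2 * d3 - a3 * d2) -> D = o * d + (k + tau) * (a2 * d3 - a3 * d2) + s * a2.
    by move=> H; apply: (lin_comb1 H (c := 1)); ring.
  exact: alg h1.
- have alg (D a2 a3 d2 d3 o d k s : R) : D + tau * (d2 * a3 - d3 * a2) + s * a3 =
    o * d + k * (a2 * d3 - a3 * d2) -> D = o * d + (k + tau) * (a2 * d3 - a3 * d2) - s * a3.
    by move=> H; apply: (lin_comb1 H (c := 1)); ring.
  exact: alg h2.
- have alg (D a2 a3 d2 d3 o d k : R) : D + tau * (d2 * a3 - d3 * a2) =
    o * d + k * (a2 * d3 - a3 * d2) -> D = o * d + (k + tau) * (a2 * d3 - a3 * d2).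
    by move=> H; apply: (lin_comb1 H (c := 1)); ring.
  exact: alg h3.
Qed.

Lemma frame_table2 p : U p ->
  [/\ lie X1 (b1 X2) p = - w1 p * b1 X1 p + (k12 p - tau) * m1 p + s1 p * b2 X2 p,
      lie X1 (b2 X2) p = - w1 p * b2 X1 p + (k12 p - tau) * m2 p - s1 p * b1 X2 p &
      lie X1 (b3 X2) p = - w1 p * b3 X1 p + (k12 p - tau) * m3 p] /\
  [/\ lie X2 (b1 X2) p = - w2 p * b1 X1 p + k22 p * m1 p + s2 p * b2 X2 p,
      lie X2 (b2 X2) p = - w2 p * b2 X1 p + k22 p * m2 p - s2 p * b1 X2 p &
      lie X2 (b3 X2) p = - w2 p * b3 X1 p + k22 p * m3 p].
Proof.
move=> Up; have [x1 x2 x3] := smooth_b tau oU sF DF sX2.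
rewrite !lieE; try by [exact: smooth_on_diff x1 Up|exact: smooth_on_diff x2 Up|exact: smooth_on_diff x3 Up].
have [f1 f2 f3] := nab_frame2 (X2 p) Up; have [h1 h2 h3] := nab_frame2 (X1 p) Up.
split; split.
- have alg (D a2 a3 d2 d3 e k s : R) : D + tau * (a2 * d3 - a3 * d2) - s * d2 =
    e + k * (a2 * d3 - a3 * d2) -> D = e + (k - tau) * (a2 * d3 - a3 * d2) + s * d2.
    by move=> H; apply: (lin_comb1 H (c := 1)); ring.
  exact: alg h1.
- have alg (D a2 a3 d2 d3 e k s : R) : D + tau * (a2 * d3 - a3 * d2) + s * d3 =
    e + k * (a2 * d3 - a3 * d2) -> D = e + (k - tau) * (a2 * d3 - a3 * d2) - s * d3.
    by move=> H; apply: (lin_comb1 H (c := 1)); ring.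
  exact: alg h2.
- have alg (D a2 a3 d2 d3 e k : R) : D + tau * (a2 * d3 - a3 * d2) =
    e + k * (a2 * d3 - a3 * d2) -> D = e + (k - tau) * (a2 * d3 - a3 * d2).
    by move=> H; apply: (lin_comb1 H (c := 1)); ring.
  exact: alg h3.
- have alg (D a2 a3 r s : R) : D + tau * (a2 * a3 - a3 * a2) - s * a2 = r -> D = r + s * a2.
    by move=> H; apply: (lin_comb1 H (c := 1)); ring.
  exact: alg f1.
- have alg (D a2 a3 r s : R) : D + tau * (a3 * a2 - a2 * a3) + s * a2 = r -> D = r - s * a2.
    by move=> H; apply: (lin_comb1 H (c := 1)); ring.
  exact: alg f2.
- have alg (D a2 a3 r : R) : D + tau * (a3 * a2 - a2 * a3) = r -> D = r.
    by move=> H; apply: (lin_comb1 H (c := 1)); ring.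
  exact: alg f3.
Qed.

Lemma lie_xy Y p : U p ->
  lie Y (fun q => xcoord (F q)) p = bcv_factor kappa (F p) * b1 Y p /\
  lie Y (fun q => ycoord (F q)) p = bcv_factor kappa (F p) * b2 Y p.
Proof.
move=> Up; have dF : derivable F p (Y p) by apply: diff_derivable; exact: dFp sF _ Up.
have l0 := lamF DF Up.
have alg (l x d : R) : l != 0 -> d = x -> d = l * (x / l) by move=> l00 ->; field.
have dx : differentiable (fun q => xcoord (F q)) p.
  exact: smooth_on_diff (smooth_coord 0 oU sF) Up.
have dy : differentiable (fun q => ycoord (F q)) p.
  exact: smooth_on_diff (smooth_coord 1 oU sF) Up.
rewrite (lieE Y dx) (lieE Y dy).
by split; apply: alg => //; exact: derive_coord.
Qed.

Lemma smooth_nab X Y : smooth_on U X -> smooth_on U Y ->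
  [/\ smooth_on U (fun p => nab1 (X p) Y p), smooth_on U (fun p => nab2 (X p) Y p) &
      smooth_on U (fun p => nab3 (X p) Y p)].
Proof.
move=> sX sY; have [x1 x2 x3] := smooth_b tau oU sF DF sX.
have [y1 y2 y3] := smooth_b tau oU sF DF sY.
have ct (c : R) := @smooth_cst R 1 R U c.
have fx := smooth_coord 0 oU sF; have fy := smooth_coord 1 oU sF.
have ssg : smooth_on U (fun p => sg (F p) (push F (cst (X p)) p)).
  exact: (smoothB oU (smoothM oU (ct (kappa / 2)) (smoothB oU (smoothM oU fy x1) (smoothM oU fx x2)))
    (smoothM oU (ct (2 * tau)) x3)).
have l (f : 'rV[R]_2 -> R) : smooth_on U f -> smooth_on U (fun p => 'D_(X p) f p).
  move=> sf; apply: (eq_smooth oU _ (lie_smooth oU sX sf)) => q Uq.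
  by apply: lieE; exact: smooth_on_diff sf Uq.
split.
- exact: (smoothB oU (smoothD oU (l _ y1) (smoothM oU (ct tau)
    (smoothB oU (smoothM oU x2 y3) (smoothM oU x3 y2)))) (smoothM oU ssg y2)).
- exact: (smoothD oU (smoothD oU (l _ y2) (smoothM oU (ct tau)
    (smoothB oU (smoothM oU x3 y1) (smoothM oU x1 y3)))) (smoothM oU ssg y1)).
- exact: (smoothD oU (l _ y3) (smoothM oU (ct tau)
    (smoothB oU (smoothM oU x1 y2) (smoothM oU x2 y1)))).
Qed.

Lemma smooth_frame :
  [/\ [/\ smooth_on U m1, smooth_on U m2 & smooth_on U m3],
      [/\ smooth_on U k11, smooth_on U k12 & smooth_on U k22],
      smooth_on U w1 & smooth_on U w2].
Proof.
have [x1 x2 x3] := smooth_b tau oU sF DF sX1.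
have [y1 y2 y3] := smooth_b tau oU sF DF sX2.
have sm1 : smooth_on U m1 := smoothB oU (smoothM oU x2 y3) (smoothM oU x3 y2).
have sm2 : smooth_on U m2 := smoothB oU (smoothM oU x3 y1) (smoothM oU x1 y3).
have sm3 : smooth_on U m3 := smoothB oU (smoothM oU x1 y2) (smoothM oU x2 y1).
have [p1 p2 p3] := smooth_nab sX1 sX1; have [q1 q2 q3] := smooth_nab sX1 sX2.
have [r1 r2 r3] := smooth_nab sX2 sX2; have [t1 t2 t3] := smooth_nab sX2 sX1.
split; [by []|split| |].
- exact: (smoothD oU (smoothD oU (smoothM oU p1 sm1) (smoothM oU p2 sm2)) (smoothM oU p3 sm3)).
- exact: (smoothD oU (smoothD oU (smoothM oU q1 sm1) (smoothM oU q2 sm2)) (smoothM oU q3 sm3)).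
- exact: (smoothD oU (smoothD oU (smoothM oU r1 sm1) (smoothM oU r2 sm2)) (smoothM oU r3 sm3)).
- exact: (smoothD oU (smoothD oU (smoothM oU p1 y1) (smoothM oU p2 y2)) (smoothM oU p3 y3)).
- exact: (smoothD oU (smoothD oU (smoothM oU t1 y1) (smoothM oU t2 y2)) (smoothM oU t3 y3)).
Qed.

End Frame.

(** * The frame bundle of a surface *)

Section Lift.
Context {R : realType}.
Implicit Types (w v : 'rV[R]_3) (f : 'rV[R]_2 -> R) (U : set 'rV[R]_2).

(** The frame bundle over U is trivialized by (X1, X2): the first two coordinates of a point are its
    base point, the third is the rotation angle of the frame, running over the whole line. *)
Definition base w : 'rV[R]_2 := vec2 (w 0 0) (w 0 1).
Definition lift f w : R := f (base w).
Definition bundle U : set 'rV[R]_3 := [set w | U (base w)].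
Definition cosf w : R := cos (w 0 2).
Definition sinf w : R := sin (w 0 2).

Lemma vec2E (x y : R) : vec2 x y 0 0 = x /\ vec2 x y 0 1 = y.
Proof. by rewrite !mxE. Qed.

Lemma vec3E (x y z : R) : [/\ vec3 x y z 0 0 = x, vec3 x y z 0 1 = y & vec3 x y z 0 2 = z].
Proof. by rewrite !mxE. Qed.

Lemma row2P (z t : 'rV[R]_2) : z 0 0 = t 0 0 -> z 0 1 = t 0 1 -> z = t.
Proof.
move=> e0 e1; apply/rowP => -[[|[|i]] lti] //.
  by rewrite (_ : Ordinal lti = 0) //; exact: val_inj.
by rewrite (_ : Ordinal lti = 1) //; exact: val_inj.
Qed.

Lemma sum_ord3 (V : nmodType) (f : 'I_3 -> V) : \sum_i f i = f 0 + f 1 + f 2.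
Proof.
rewrite !big_ord_recl big_ord0 addr0 addrA; congr (_ + f _ + f _); exact: val_inj.
Qed.

Lemma base_comb (h : R) v w : base (h *: v + w) = h *: base v + base w.
Proof. by apply: row2P; rewrite !mxE. Qed.

Transparent derive.
(** As [base] is linear, the two difference quotients coincide as functions; for this comparison
    [derive] has to be unfolded. *)
Lemma derive_lift f v w : 'D_v (lift f) w = 'D_(base v) f (base w).
Proof.
rewrite /derive; set g1 := (fun h : R => _); set g2 := (fun h : R => _).
suff -> : g1 = g2 by [].
by apply/funext => h; rewrite /g1 /g2 /= /lift base_comb.
Qed.
Opaque derive.

Lemma base_delta : [/\ base (delta_mx 0 0) = delta_mx 0 0, base (delta_mx 0 1) = delta_mx 0 1 &
  base (delta_mx 0 2) = 0].
Proof. by split; apply: row2P; rewrite !mxE. Qed.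

Lemma partial_lift f w : [/\ partial 0 (lift f) w = partial 0 f (base w),
   partial 1 (lift f) w = partial 1 f (base w) & partial 2 (lift f) w = 0].
Proof.
have [d0 d1 d2] := base_delta.
split; rewrite /partial derive_lift ?d0 ?d1 //; rewrite d2; exact: derive0.
Qed.

Lemma lie_lift A f w : lie A (lift f) w =
  A w 0 0 * partial 0 f (base w) + A w 0 1 * partial 1 f (base w).
Proof.
by have [e0 e1 e2] := partial_lift f w; rewrite /lie sum_ord3 e0 e1 e2 mulr0 addr0.
Qed.

Lemma smooth_base : smooth_on setT base.
Proof.
apply: smooth_row; first exact: openT.
move=> j; have -> : (fun w => base w 0 j) = (fun w => if j == 0 then w 0 0 else w 0 1).
  apply/funext => w; rewrite mxE; case: j => -[|[|j]] //.
by case: (j == 0); apply: smooth_id_coord; exact: openT.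
Qed.

Lemma open_bundle U : open U -> open (bundle U).
Proof.
move=> oU; have -> : bundle U = base @^-1` U by [].
apply: open_comp => // w _; apply: differentiable_continuous.
exact: smooth_on_diff smooth_base _.
Qed.

Lemma smooth_lift U f : open U -> smooth_on U f -> smooth_on (bundle U) (lift f).
Proof.
move=> oU sf; apply: (smooth_comp (V := U)) => //; first exact: open_bundle.
exact: smooth_on_sub smooth_base.
Qed.

Lemma derive_scale_dir (phi : R -> R) (t r : R) : differentiable phi t ->
  'D_r phi t = r * 'D_1 phi t.
Proof.
by move=> df; rewrite !deriveE // -[in LHS](mulr1 r) -[r * 1]/(r *: (1 : R)) linearZ.
Qed.

Lemma diff_angle (phi : R -> R) w : differentiable phi (w 0 2) ->
  differentiable (fun w => phi (w 0 2)) w.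
Proof.
move=> df; apply: (@differentiable_comp _ _ _ _ (fun w : 'rV[R]_3 => w 0 2) phi) => //.
exact: differentiable_coord.
Qed.

Lemma derive_angle (phi : R -> R) v w : differentiable phi (w 0 2) ->
  'D_v (fun w => phi (w 0 2)) w = v 0 2 * 'D_1 phi (w 0 2).
Proof.
move=> df; have dc : differentiable (fun w : 'rV[R]_3 => w 0 2) w by exact: differentiable_coord.
refine (etrans (derive_comp v dc df) _).
have -> : 'D_v (fun w : 'rV[R]_3 => w 0 2) w = v 0 2.
  refine (etrans (@derive_coord _ _ _ id _ _ _ _) _); first exact: derivable_id.
  by have -> : 'D_v (@id 'rV[R]_3) w = v by exact: derive_id.
exact: derive_scale_dir.
Qed.

Lemma diff_cos (t : R) : differentiable (@cos R) t.
Proof. by apply/derivable1_diffP; case: (is_derive_cos t). Qed.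

Lemma diff_sin (t : R) : differentiable (@sin R) t.
Proof. by apply/derivable1_diffP; case: (is_derive_sin t). Qed.

Lemma derive_cosf v w : 'D_v cosf w = - sinf w * v 0 2.
Proof.
refine (etrans (derive_angle v (diff_cos _)) _).
by rewrite (@derive_val _ _ _ _ _ _ _ (is_derive_cos (w 0 2))) mulrC.
Qed.

Lemma derive_sinf v w : 'D_v sinf w = cosf w * v 0 2.
Proof.
refine (etrans (derive_angle v (diff_sin _)) _).
by rewrite (@derive_val _ _ _ _ _ _ _ (is_derive_sin (w 0 2))) mulrC.
Qed.

(** A joint induction on the order, since the derivatives of either function involve the other. *)
Lemma smooth_cosf_sinf (W : set 'rV[R]_3) : open W -> smooth_on W cosf /\ smooth_on W sinf.
Proof.
move=> oW; suff H k : Ck k W cosf /\ Ck k W sinf.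
  by split; apply/smooth_onP => k; case: (H k).
elim: k => [|k [IHc IHs]].
  by split; split => // p _; apply: diff_angle; [exact: diff_cos|exact: diff_sin].
have ct (c : R) : Ck k W (fun _ : 'rV[R]_3 => c) by have /smooth_onP := @smooth_cst R 2 R W c.
split; split=> [p _|i].
- by apply: diff_angle; exact: diff_cos.
- have -> : partial i cosf = (fun w => ((-1) * sinf w) * (delta_mx 0 i : 'rV[R]_3) 0 2).
    by apply/funext => w; rewrite /partial derive_cosf mulN1r.
  by apply: Ck_M => //; exact: Ck_M.
- by apply: diff_angle; exact: diff_sin.
- have -> : partial i sinf = (fun w => cosf w * (delta_mx 0 i : 'rV[R]_3) 0 2).
    by apply/funext => w; rewrite /partial derive_sinf.
  by apply: Ck_M.
Qed.

Lemma lie_cosf A w : lie A cosf w = - sinf w * A w 0 2.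
Proof. by rewrite lieE ?derive_cosf //; apply: diff_angle; exact: diff_cos. Qed.

Lemma lie_sinf A w : lie A sinf w = cosf w * A w 0 2.
Proof. by rewrite lieE ?derive_sinf //; apply: diff_angle; exact: diff_sin. Qed.

Lemma cs1 w : cosf w ^+ 2 + sinf w ^+ 2 = 1.
Proof. exact: cos2Dsin2. Qed.

End Lift.

Lemma smooth_vec3 (R : realType) n (U : set 'rV[R]_n.+1) (f g h : 'rV[R]_n.+1 -> R) : open U ->
  smooth_on U f -> smooth_on U g -> smooth_on U h ->
  smooth_on U (fun p => vec3 (f p) (g p) (h p)).
Proof.
move=> oU sf sg sh; apply: smooth_row => // j.
have -> : (fun p => vec3 (f p) (g p) (h p) 0 j) =
    if val j == 0%N then f else if val j == 1%N then g else h.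
  by apply/funext => p; rewrite mxE; case: j => -[|[|[|j]]].
by case: ifP => // _; case: ifP.
Qed.

(** What the frame bundle has to know of a patch: the position x, y, the ambient components a, d of
    the two frame vectors, the second fundamental form k and the connection form w. The metric has
    disappeared behind these functions. *)
Record surface_frame (R : realType) (kappa tau : R) (U : set 'rV[R]_2)
    (X1 X2 : 'rV[R]_2 -> 'rV[R]_2)
    (x y a1 a2 a3 d1 d2 d3 k11 k12 k22 w1 w2 : 'rV[R]_2 -> R) := SurfaceFrame {
  sf_open : open U;
  sf_X1 : smooth_on U X1; sf_X2 : smooth_on U X2;
  sf_x : smooth_on U x; sf_y : smooth_on U y;
  sf_a : [/\ smooth_on U a1, smooth_on U a2 & smooth_on U a3];
  sf_d : [/\ smooth_on U d1, smooth_on U d2 & smooth_on U d3];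
  sf_k : [/\ smooth_on U k11, smooth_on U k12 & smooth_on U k22];
  sf_w1 : smooth_on U w1; sf_w2 : smooth_on U w2;
  sf_o11 : forall p, U p -> a1 p * a1 p + a2 p * a2 p + a3 p * a3 p = 1;
  sf_o12 : forall p, U p -> a1 p * d1 p + a2 p * d2 p + a3 p * d3 p = 0;
  sf_o22 : forall p, U p -> d1 p * d1 p + d2 p * d2 p + d3 p * d3 p = 1;
  sf_x1 : forall p, U p -> lie X1 x p = (1 + kappa / 4 * (x p ^+ 2 + y p ^+ 2)) * a1 p;
  sf_y1 : forall p, U p -> lie X1 y p = (1 + kappa / 4 * (x p ^+ 2 + y p ^+ 2)) * a2 p;
  sf_x2 : forall p, U p -> lie X2 x p = (1 + kappa / 4 * (x p ^+ 2 + y p ^+ 2)) * d1 p;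
  sf_y2 : forall p, U p -> lie X2 y p = (1 + kappa / 4 * (x p ^+ 2 + y p ^+ 2)) * d2 p;
  sf_a1 : forall p, U p ->
    let m1 := a2 p * d3 p - a3 p * d2 p in let m2 := a3 p * d1 p - a1 p * d3 p in
    let m3 := a1 p * d2 p - a2 p * d1 p in
    let s1 := kappa / 2 * (y p * a1 p - x p * a2 p) - 2 * tau * a3 p in
    let s2 := kappa / 2 * (y p * d1 p - x p * d2 p) - 2 * tau * d3 p in
    [/\ lie X1 a1 p = w1 p * d1 p + k11 p * m1 + s1 * a2 p,
        lie X1 a2 p = w1 p * d2 p + k11 p * m2 - s1 * a1 p &
        lie X1 a3 p = w1 p * d3 p + k11 p * m3] /\
    [/\ lie X2 a1 p = w2 p * d1 p + (k12 p + tau) * m1 + s2 * a2 p,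
        lie X2 a2 p = w2 p * d2 p + (k12 p + tau) * m2 - s2 * a1 p &
        lie X2 a3 p = w2 p * d3 p + (k12 p + tau) * m3];
  sf_d1 : forall p, U p ->
    let m1 := a2 p * d3 p - a3 p * d2 p in let m2 := a3 p * d1 p - a1 p * d3 p in
    let m3 := a1 p * d2 p - a2 p * d1 p in
    let s1 := kappa / 2 * (y p * a1 p - x p * a2 p) - 2 * tau * a3 p in
    let s2 := kappa / 2 * (y p * d1 p - x p * d2 p) - 2 * tau * d3 p in
    [/\ lie X1 d1 p = - w1 p * a1 p + (k12 p - tau) * m1 + s1 * d2 p,
        lie X1 d2 p = - w1 p * a2 p + (k12 p - tau) * m2 - s1 * d1 p &
        lie X1 d3 p = - w1 p * a3 p + (k12 p - tau) * m3] /\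
    [/\ lie X2 d1 p = - w2 p * a1 p + k22 p * m1 + s2 * d2 p,
        lie X2 d2 p = - w2 p * a2 p + k22 p * m2 - s2 * d1 p &
        lie X2 d3 p = - w2 p * a3 p + k22 p * m3];
  sf_bracket : forall p j, U p ->
    lie X1 (fun q => X2 q 0 j) p - lie X2 (fun q => X1 q 0 j) p =
    - w1 p * X1 p 0 j - w2 p * X2 p 0 j
}.

(** * The moving frame on the bundle *)

Section Bundle.
Context {R : realType} {kappa tau : R} {U : set 'rV[R]_2} {X1 X2 : 'rV[R]_2 -> 'rV[R]_2}
  {x y a1 a2 a3 d1 d2 d3 k11 k12 k22 w1 w2 : 'rV[R]_2 -> R}.
Hypothesis sf : surface_frame kappa tau U X1 X2 x y a1 a2 a3 d1 d2 d3 k11 k12 k22 w1 w2.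
Local Notation cs := (@cosf R).
Local Notation sn := (@sinf R).
Implicit Types (w : 'rV[R]_3).

(** The horizontal lift of the first vector of the rotated frame: the angular component, minus the
    connection form, makes the frame parallel along it. [bH] does the same for the second vector. *)
Definition bZ w : 'rV[R]_3 :=
  vec3 (cs w * X1 (base w) 0 0 + sn w * X2 (base w) 0 0)
       (cs w * X1 (base w) 0 1 + sn w * X2 (base w) 0 1)
       (- (cs w * w1 (base w) + sn w * w2 (base w))).
Definition bH w : 'rV[R]_3 :=
  vec3 (- sn w * X1 (base w) 0 0 + cs w * X2 (base w) 0 0)
       (- sn w * X1 (base w) 0 1 + cs w * X2 (base w) 0 1)
       (- (- sn w * w1 (base w) + cs w * w2 (base w))).
Definition bV w : 'rV[R]_3 := vec3 0 0 1.

Definition rot1 (a d : 'rV[R]_2 -> R) w : R := cs w * lift a w + sn w * lift d w.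
Definition rot2 (a d : 'rV[R]_2 -> R) w : R := - sn w * lift a w + cs w * lift d w.

Definition bh11 w : R := cs w ^+ 2 * lift k11 w + 2 * (cs w * sn w) * lift k12 w + sn w ^+ 2 * lift k22 w.
Definition bh12 w : R := cs w * sn w * (lift k22 w - lift k11 w) + (cs w ^+ 2 - sn w ^+ 2) * lift k12 w.
Definition bh22 w : R := sn w ^+ 2 * lift k11 w - 2 * (cs w * sn w) * lift k12 w + cs w ^+ 2 * lift k22 w.

Definition bs (f1 f2 f3 : 'rV[R]_3 -> R) w : R :=
  kappa / 2 * (lift y w * f1 w - lift x w * f2 w) - 2 * tau * f3 w.

(** The vertical component of [Z, H]; [mf_gauss_codazzi] expresses it through the second fundamental
    form. *)
Definition bK w : R := lie bZ (fun q => bH q 0 2) w - lie bH (fun q => bZ q 0 2) w.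

Let oU := sf_open sf.
Let oB : open (bundle U) := open_bundle oU.
Let sc : smooth_on (bundle U) cs := (smooth_cosf_sinf oB).1.
Let ss : smooth_on (bundle U) sn := (smooth_cosf_sinf oB).2.

Lemma lie_lift_Z f w : lie bZ (lift f) w =
  cs w * lie X1 f (base w) + sn w * lie X2 f (base w).
Proof.
rewrite lie_lift /lie !sum_ord2; have [-> -> _] := vec3E (cs w * X1 (base w) 0 0 + sn w * X2 (base w) 0 0)
       (cs w * X1 (base w) 0 1 + sn w * X2 (base w) 0 1)
       (- (cs w * w1 (base w) + sn w * w2 (base w))).
move: (partial 0 f (base w)) (partial 1 f (base w)) (X1 (base w) 0 0) (X1 (base w) 0 1)
  (X2 (base w) 0 0) (X2 (base w) 0 1) (cs w) (sn w) => *; ring.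
Qed.

Lemma lie_lift_H f w : lie bH (lift f) w =
  - sn w * lie X1 f (base w) + cs w * lie X2 f (base w).
Proof.
rewrite lie_lift /lie !sum_ord2; have [-> -> _] := vec3E (- sn w * X1 (base w) 0 0 + cs w * X2 (base w) 0 0)
       (- sn w * X1 (base w) 0 1 + cs w * X2 (base w) 0 1)
       (- (- sn w * w1 (base w) + cs w * w2 (base w))).
move: (partial 0 f (base w)) (partial 1 f (base w)) (X1 (base w) 0 0) (X1 (base w) 0 1)
  (X2 (base w) 0 0) (X2 (base w) 0 1) (cs w) (sn w) => *; ring.
Qed.

Lemma lie_V f w : lie bV f w = partial 2 f w.
Proof.
by rewrite /lie sum_ord3; have [-> -> ->] := vec3E (0 : R) 0 1; rewrite !mul0r !add0r mul1r.
Qed.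

Lemma lie_lift_V f w : lie bV (lift f) w = 0.
Proof. by rewrite lie_V; have [] := partial_lift f w. Qed.

Lemma smooth_rot1 a d : smooth_on U a -> smooth_on U d -> smooth_on (bundle U) (rot1 a d).
Proof.
move=> sa sd; exact: (smoothD oB (smoothM oB sc (smooth_lift oU sa)) (smoothM oB ss (smooth_lift oU sd))).
Qed.

Lemma smooth_rot2 a d : smooth_on U a -> smooth_on U d -> smooth_on (bundle U) (rot2 a d).
Proof.
move=> sa sd; exact: (smoothD oB (smoothM oB (smoothN oB ss) (smooth_lift oU sa))
  (smoothM oB sc (smooth_lift oU sd))).
Qed.

Lemma lie_rot1 A a d w : smooth_on U a -> smooth_on U d -> bundle U w ->
  lie A (rot1 a d) w = A w 0 2 * rot2 a d w + cs w * lie A (lift a) w + sn w * lie A (lift d) w.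
Proof.
move=> sa sd Bw; have la := smooth_lift oU sa; have ld := smooth_lift oU sd.
refine (etrans (lieD A Bw (smoothM oB sc la) (smoothM oB ss ld)) _).
refine (etrans (congr2 +%R (lieM A Bw sc la) (lieM A Bw ss ld)) _).
rewrite lie_cosf lie_sinf /rot2.
move: (lie A (lift a) w) (lie A (lift d) w) (lift a w) (lift d w) (cs w) (sn w) (A w 0 2) => *; ring.
Qed.

Lemma lie_rot2 A a d w : smooth_on U a -> smooth_on U d -> bundle U w ->
  lie A (rot2 a d) w = - A w 0 2 * rot1 a d w - sn w * lie A (lift a) w + cs w * lie A (lift d) w.
Proof.
move=> sa sd Bw; have la := smooth_lift oU sa; have ld := smooth_lift oU sd.
refine (etrans (lieD A Bw (smoothM oB (smoothN oB ss) la) (smoothM oB sc ld)) _).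
refine (etrans (congr2 +%R (lieM A Bw (smoothN oB ss) la) (lieM A Bw sc ld)) _).
rewrite (lieN A Bw ss) lie_cosf lie_sinf /rot1.
move: (lie A (lift a) w) (lie A (lift d) w) (lift a w) (lift d w) (cs w) (sn w) (A w 0 2) => *; ring.
Qed.

Let bZ2 w : bZ w 0 2 = - (cs w * w1 (base w) + sn w * w2 (base w)).
Proof. by have [] := vec3E (cs w * X1 (base w) 0 0 + sn w * X2 (base w) 0 0)
       (cs w * X1 (base w) 0 1 + sn w * X2 (base w) 0 1)
       (- (cs w * w1 (base w) + sn w * w2 (base w))). Qed.
Let bH2 w : bH w 0 2 = - (- sn w * w1 (base w) + cs w * w2 (base w)).
Proof. by have [] := vec3E (- sn w * X1 (base w) 0 0 + cs w * X2 (base w) 0 0)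
       (- sn w * X1 (base w) 0 1 + cs w * X2 (base w) 0 1)
       (- (- sn w * w1 (base w) + cs w * w2 (base w))). Qed.
Let bV2 w : bV w 0 2 = 1.
Proof. by have [] := vec3E (0 : R) 0 1. Qed.

Lemma Z_rot1 a d w : smooth_on U a -> smooth_on U d -> bundle U w ->
  lie bZ (rot1 a d) w = - (cs w * w1 (base w) + sn w * w2 (base w)) * (- sn w * a (base w) + cs w * d (base w))
  + cs w * (cs w * lie X1 a (base w) + sn w * lie X2 a (base w))
  + sn w * (cs w * lie X1 d (base w) + sn w * lie X2 d (base w)).
Proof. by move=> sa sd Bw; rewrite lie_rot1 // bZ2 !lie_lift_Z. Qed.

Lemma Z_rot2 a d w : smooth_on U a -> smooth_on U d -> bundle U w ->
  lie bZ (rot2 a d) w = (cs w * w1 (base w) + sn w * w2 (base w)) * (cs w * a (base w) + sn w * d (base w))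
  - sn w * (cs w * lie X1 a (base w) + sn w * lie X2 a (base w))
  + cs w * (cs w * lie X1 d (base w) + sn w * lie X2 d (base w)).
Proof. by move=> sa sd Bw; rewrite lie_rot2 // bZ2 !lie_lift_Z opprK. Qed.

Lemma H_rot1 a d w : smooth_on U a -> smooth_on U d -> bundle U w ->
  lie bH (rot1 a d) w = - (- sn w * w1 (base w) + cs w * w2 (base w)) * (- sn w * a (base w) + cs w * d (base w))
  + cs w * (- sn w * lie X1 a (base w) + cs w * lie X2 a (base w))
  + sn w * (- sn w * lie X1 d (base w) + cs w * lie X2 d (base w)).
Proof. by move=> sa sd Bw; rewrite lie_rot1 // bH2 !lie_lift_H. Qed.

Lemma H_rot2 a d w : smooth_on U a -> smooth_on U d -> bundle U w ->
  lie bH (rot2 a d) w = (- sn w * w1 (base w) + cs w * w2 (base w)) * (cs w * a (base w) + sn w * d (base w))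
  - sn w * (- sn w * lie X1 a (base w) + cs w * lie X2 a (base w))
  + cs w * (- sn w * lie X1 d (base w) + cs w * lie X2 d (base w)).
Proof. by move=> sa sd Bw; rewrite lie_rot2 // bH2 !lie_lift_H opprK. Qed.

Lemma V_rot1 a d w : smooth_on U a -> smooth_on U d -> bundle U w ->
  lie bV (rot1 a d) w = rot2 a d w.
Proof. by move=> sa sd Bw; rewrite lie_rot1 // bV2 !lie_lift_V !mulr0 !addr0 mul1r. Qed.

Lemma V_rot2 a d w : smooth_on U a -> smooth_on U d -> bundle U w ->
  lie bV (rot2 a d) w = - rot1 a d w.
Proof. by move=> sa sd Bw; rewrite lie_rot2 // bV2 !lie_lift_V !mulr0 subr0 addr0 mulN1r. Qed.

Lemma smooth_bZ : smooth_on (bundle U) bZ.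
Proof.
have s1 := sf_X1 sf; have s2 := sf_X2 sf.
exact: (smooth_vec3 oB (smooth_rot1 (smooth_coord 0 oU s1) (smooth_coord 0 oU s2))
  (smooth_rot1 (smooth_coord 1 oU s1) (smooth_coord 1 oU s2))
  (smoothN oB (smooth_rot1 (sf_w1 sf) (sf_w2 sf)))).
Qed.

Lemma smooth_bH : smooth_on (bundle U) bH.
Proof.
have s1 := sf_X1 sf; have s2 := sf_X2 sf.
exact: (smooth_vec3 oB (smooth_rot2 (smooth_coord 0 oU s1) (smooth_coord 0 oU s2))
  (smooth_rot2 (smooth_coord 1 oU s1) (smooth_coord 1 oU s2))
  (smoothN oB (smooth_rot2 (sf_w1 sf) (sf_w2 sf)))).
Qed.

Lemma smooth_bh : [/\ smooth_on (bundle U) bh11, smooth_on (bundle U) bh12 & smooth_on (bundle U) bh22].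
Proof.
have [s11 s12 s22] := sf_k sf.
have l11 := smooth_lift oU s11; have l12 := smooth_lift oU s12; have l22 := smooth_lift oU s22.
by split; rewrite /bh11 /bh12 /bh22; smooth.
Qed.

(** Rotating the frame multiplies the cross product of its vectors by cos^2 + sin^2, so each
    structure equation on the bundle is a combination of equations on the patch, up to a multiple of
    cos^2 + sin^2 - 1. *)
Lemma bundle_moving_frame : moving_frame kappa tau (bundle U) bZ bH bV (lift x) (lift y)
  (rot1 a1 d1) (rot1 a2 d2) (rot1 a3 d3) (rot2 a1 d1) (rot2 a2 d2) (rot2 a3 d3)
  (fun w => rot1 a2 d2 w * rot2 a3 d3 w - rot1 a3 d3 w * rot2 a2 d2 w)
  (fun w => rot1 a3 d3 w * rot2 a1 d1 w - rot1 a1 d1 w * rot2 a3 d3 w)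
  (fun w => rot1 a1 d1 w * rot2 a2 d2 w - rot1 a2 d2 w * rot2 a1 d1 w)
  (bs (rot1 a1 d1) (rot1 a2 d2) (rot1 a3 d3)) (bs (rot2 a1 d1) (rot2 a2 d2) (rot2 a3 d3))
  bh11 bh12 bh22 bK.
Proof.
have [sa1 sa2 sa3] := sf_a sf; have [sd1 sd2 sd3] := sf_d sf.
have [h11 h12 h22] := smooth_bh.
have sx := sf_x sf; have sy := sf_y sf.
(* In the base directions the angular parts of Z and H cancel the bracket given by [sf_bracket], so
   [Z, H] is vertical. *)
have bracket (f : 'rV[R]_3 -> R) w : smooth_on (bundle U) f -> bundle U w ->
    lie bZ (lie bH f) w - lie bH (lie bZ f) w = bK w * lie bV f w.
  move=> sf' Bw; rewrite (lie_bracket oB Bw smooth_bZ smooth_bH sf') sum_ord3 lie_V.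
  have e (j : 'I_2) (i : 'I_3) : (fun w => bZ w 0 i) = rot1 (fun q => X1 q 0 j) (fun q => X2 q 0 j) ->
      (fun w => bH w 0 i) = rot2 (fun q => X1 q 0 j) (fun q => X2 q 0 j) ->
      lie bZ (fun w => bH w 0 i) w - lie bH (fun w => bZ w 0 i) w = 0.
    move=> -> ->; have s1 := smooth_coord j oU (sf_X1 sf); have s2 := smooth_coord j oU (sf_X2 sf).
    rewrite (Z_rot2 s1 s2 Bw) (H_rot1 s1 s2 Bw).
    have := sf_bracket sf j Bw.
    move: (lie X1 (fun q => X2 q 0 j) (base w)) (lie X2 (fun q => X1 q 0 j) (base w))
      (lie X1 (fun q => X1 q 0 j) (base w)) (lie X2 (fun q => X2 q 0 j) (base w))
      (cs w) (sn w) (w1 (base w)) (w2 (base w)) (X1 (base w) 0 j) (X2 (base w) 0 j).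
    move=> A B C D c s u v x1 x2 E2.
    by apply: (lin_comb1 E2 (c := c ^+ 2 + s ^+ 2)); ring.
  rewrite (e 0 0) ?mul0r ?(e 1 1) ?mul0r ?add0r //.
  - by apply/funext => w'; exact: (let: And3 _ h _ := vec3E _ _ _ in h).
  - by apply/funext => w'; exact: (let: And3 _ h _ := vec3E _ _ _ in h).
  - by apply/funext => w'; exact: (let: And3 h _ _ := vec3E _ _ _ in h).
  - by apply/funext => w'; exact: (let: And3 h _ _ := vec3E _ _ _ in h).
(* V has constant coefficients, so [V, A] results from differentiating the coefficients of A in the
   angle; this rotates Z into H and H into -Z. *)
have bracketV (A B : 'rV[R]_3 -> 'rV[R]_3) (f : 'rV[R]_3 -> R) w : smooth_on (bundle U) A ->
    (forall i, lie bV (fun w => A w 0 i) w = B w 0 i) ->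
    smooth_on (bundle U) f -> bundle U w ->
    lie bV (lie A f) w - lie A (lie bV f) w = lie B f w.
  move=> sA AB sf' Bw; have sV : smooth_on (bundle U) bV by exact: smooth_cst.
  rewrite (lie_bracket oB Bw sV sA sf'); apply: eq_bigr => i _; rewrite AB.
  have -> : (fun w => bV w 0 i) = fun=> (vec3 0 0 1 : 'rV[R]_3) 0 i by [].
  by rewrite lie_cst subr0.
have cmp (i : 'I_3) : i = 0 \/ i = 1 \/ i = 2.
  by case: i => -[|[|[|j]]] lj //; [left|right; left|right; right]; exact: val_inj.
have sX j := (smooth_coord j oU (sf_X1 sf)); have sY j := (smooth_coord j oU (sf_X2 sf)).
have VZc w i : bundle U w -> lie bV (fun w => bZ w 0 i) w = bH w 0 i.
  move=> Bw; case: (cmp i) => [->|[->|->]].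
  - have -> : (fun w => bZ w 0 0) = rot1 (fun q => X1 q 0 0) (fun q => X2 q 0 0).
      by apply/funext => w'; exact: (let: And3 h _ _ := vec3E _ _ _ in h).
    refine (etrans (V_rot1 (sX 0) (sY 0) Bw) _); apply: esym.
    exact: (let: And3 h _ _ := vec3E _ _ _ in h).
  - have -> : (fun w => bZ w 0 1) = rot1 (fun q => X1 q 0 1) (fun q => X2 q 0 1).
      by apply/funext => w'; exact: (let: And3 _ h _ := vec3E _ _ _ in h).
    refine (etrans (V_rot1 (sX 1) (sY 1) Bw) _); apply: esym.
    exact: (let: And3 _ h _ := vec3E _ _ _ in h).
  - rewrite (funext bZ2) (lieN bV Bw (smooth_rot1 (sf_w1 sf) (sf_w2 sf))).
    by rewrite (V_rot1 (sf_w1 sf) (sf_w2 sf) Bw) bH2.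
have VHc w i : bundle U w -> lie bV (fun w => bH w 0 i) w = - bZ w 0 i.
  move=> Bw; case: (cmp i) => [->|[->|->]].
  - have -> : (fun w => bH w 0 0) = rot2 (fun q => X1 q 0 0) (fun q => X2 q 0 0).
      by apply/funext => w'; exact: (let: And3 h _ _ := vec3E _ _ _ in h).
    refine (etrans (V_rot2 (sX 0) (sY 0) Bw) _); congr (- _); apply: esym.
    exact: (let: And3 h _ _ := vec3E _ _ _ in h).
  - have -> : (fun w => bH w 0 1) = rot2 (fun q => X1 q 0 1) (fun q => X2 q 0 1).
      by apply/funext => w'; exact: (let: And3 _ h _ := vec3E _ _ _ in h).
    refine (etrans (V_rot2 (sX 1) (sY 1) Bw) _); congr (- _); apply: esym.
    exact: (let: And3 _ h _ := vec3E _ _ _ in h).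
  - rewrite (funext bH2) (lieN bV Bw (smooth_rot2 (sf_w1 sf) (sf_w2 sf))).
    by rewrite (V_rot2 (sf_w1 sf) (sf_w2 sf) Bw) bZ2.
apply: MovingFrame => //.
- exact: smooth_bZ.
- exact: smooth_bH.
- exact: smooth_cst.
- exact: smooth_lift.
- exact: smooth_lift.
- exact: smooth_rot1.
- exact: smooth_rot1.
- exact: smooth_rot1.
- exact: smooth_rot2.
- exact: smooth_rot2.
- exact: smooth_rot2.
- move=> w Bw; have o1 := sf_o11 sf Bw; have o2 := sf_o12 sf Bw; have o3 := sf_o22 sf Bw.
  rewrite /rot1 /rot2 /lift; move: (cs1 w) o1 o2 o3.
  move: (cs w) (sn w) (w1 (base w)) (w2 (base w)) (k11 (base w)) (k12 (base w)) (k22 (base w)) (x (base w)) (y (base w)) (a1 (base w)) (a2 (base w)) (a3 (base w)) (d1 (base w)) (d2 (base w)) (d3 (base w)).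
  move=> c s u v q11 q12 q22 xx yy f1 f2 f3 g1 g2 g3 E1 o1 o2 o3.
  by apply: (lin_comb4 o1 o2 o3 E1 (c1 := c ^+ 2) (c2 := 2 * c * s) (c3 := s ^+ 2) (c4 := 1)); ring.
- move=> w Bw; have o1 := sf_o11 sf Bw; have o2 := sf_o12 sf Bw; have o3 := sf_o22 sf Bw.
  rewrite /rot1 /rot2 /lift; move: (cs1 w) o1 o2 o3.
  move: (cs w) (sn w) (w1 (base w)) (w2 (base w)) (k11 (base w)) (k12 (base w)) (k22 (base w)) (x (base w)) (y (base w)) (a1 (base w)) (a2 (base w)) (a3 (base w)) (d1 (base w)) (d2 (base w)) (d3 (base w)).
  move=> c s u v q11 q12 q22 xx yy f1 f2 f3 g1 g2 g3 E1 o1 o2 o3.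
  by apply: (lin_comb4 o1 o2 o3 E1 (c1 := - c * s) (c2 := c ^+ 2 - s ^+ 2) (c3 := c * s) (c4 := 0)); ring.
- move=> w Bw; have o1 := sf_o11 sf Bw; have o2 := sf_o12 sf Bw; have o3 := sf_o22 sf Bw.
  rewrite /rot1 /rot2 /lift; move: (cs1 w) o1 o2 o3.
  move: (cs w) (sn w) (w1 (base w)) (w2 (base w)) (k11 (base w)) (k12 (base w)) (k22 (base w)) (x (base w)) (y (base w)) (a1 (base w)) (a2 (base w)) (a3 (base w)) (d1 (base w)) (d2 (base w)) (d3 (base w)).
  move=> c s u v q11 q12 q22 xx yy f1 f2 f3 g1 g2 g3 E1 o1 o2 o3.
  by apply: (lin_comb4 o1 o2 o3 E1 (c1 := s ^+ 2) (c2 := - 2 * c * s) (c3 := c ^+ 2) (c4 := 1)); ring.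
- move=> w Bw; rewrite lie_lift_Z (sf_x1 sf Bw) (sf_x2 sf Bw) /rot1 /rot2 /lift.
  move: (cs w) (sn w) (x (base w)) (y (base w)) (a1 (base w)) (a2 (base w)) (d1 (base w)) (d2 (base w)).
  by move=> *; ring.
- move=> w Bw; rewrite lie_lift_Z (sf_y1 sf Bw) (sf_y2 sf Bw) /rot1 /rot2 /lift.
  move: (cs w) (sn w) (x (base w)) (y (base w)) (a1 (base w)) (a2 (base w)) (d1 (base w)) (d2 (base w)).
  by move=> *; ring.
- move=> w Bw; rewrite lie_lift_H (sf_x1 sf Bw) (sf_x2 sf Bw) /rot1 /rot2 /lift.
  move: (cs w) (sn w) (x (base w)) (y (base w)) (a1 (base w)) (a2 (base w)) (d1 (base w)) (d2 (base w)).
  by move=> *; ring.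
- move=> w Bw; rewrite lie_lift_H (sf_y1 sf Bw) (sf_y2 sf Bw) /rot1 /rot2 /lift.
  move: (cs w) (sn w) (x (base w)) (y (base w)) (a1 (base w)) (a2 (base w)) (d1 (base w)) (d2 (base w)).
  by move=> *; ring.
- move=> w Bw; have [ [A1 A2 A3] [A1' A2' A3']] := sf_a1 sf Bw.
  have [ [D1 D2 D3] [D1' D2' D3']] := sf_d1 sf Bw.
  refine (etrans (Z_rot1 sa1 sd1 Bw) _); rewrite A1 A1' D1 D1'.
  rewrite /bs /bh11 /bh12 /bh22 /rot1 /rot2 /lift; move: (cs1 w).
  move: (cs w) (sn w) (w1 (base w)) (w2 (base w)) (k11 (base w)) (k12 (base w)) (k22 (base w)) (x (base w)) (y (base w)) (a1 (base w)) (a2 (base w)) (a3 (base w)) (d1 (base w)) (d2 (base w)) (d3 (base w)).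
  move=> c s u v q11 q12 q22 xx yy f1 f2 f3 g1 g2 g3 E1.
  (* The coefficient is minus the component h11 in the rotated frame times a component of the normal
     of the original frame; the other structure equations follow the same pattern. *)
  by apply: (lin_comb1 E1 (c := - (c ^+ 2 * q11 + 2 * (c * s) * q12 + s ^+ 2 * q22) * (f2 * g3 - f3 * g2))); ring.
- move=> w Bw; have [ [A1 A2 A3] [A1' A2' A3']] := sf_a1 sf Bw.
  have [ [D1 D2 D3] [D1' D2' D3']] := sf_d1 sf Bw.
  refine (etrans (Z_rot1 sa2 sd2 Bw) _); rewrite A2 A2' D2 D2'.
  rewrite /bs /bh11 /bh12 /bh22 /rot1 /rot2 /lift; move: (cs1 w).
  move: (cs w) (sn w) (w1 (base w)) (w2 (base w)) (k11 (base w)) (k12 (base w)) (k22 (base w)) (x (base w)) (y (base w)) (a1 (base w)) (a2 (base w)) (a3 (base w)) (d1 (base w)) (d2 (base w)) (d3 (base w)).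
  move=> c s u v q11 q12 q22 xx yy f1 f2 f3 g1 g2 g3 E1.
  by apply: (lin_comb1 E1 (c := - (c ^+ 2 * q11 + 2 * (c * s) * q12 + s ^+ 2 * q22) * (f3 * g1 - f1 * g3))); ring.
- move=> w Bw; have [ [A1 A2 A3] [A1' A2' A3']] := sf_a1 sf Bw.
  have [ [D1 D2 D3] [D1' D2' D3']] := sf_d1 sf Bw.
  refine (etrans (Z_rot1 sa3 sd3 Bw) _); rewrite A3 A3' D3 D3'.
  rewrite /bs /bh11 /bh12 /bh22 /rot1 /rot2 /lift; move: (cs1 w).
  move: (cs w) (sn w) (w1 (base w)) (w2 (base w)) (k11 (base w)) (k12 (base w)) (k22 (base w)) (x (base w)) (y (base w)) (a1 (base w)) (a2 (base w)) (a3 (base w)) (d1 (base w)) (d2 (base w)) (d3 (base w)).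
  move=> c s u v q11 q12 q22 xx yy f1 f2 f3 g1 g2 g3 E1.
  by apply: (lin_comb1 E1 (c := - (c ^+ 2 * q11 + 2 * (c * s) * q12 + s ^+ 2 * q22) * (f1 * g2 - f2 * g1))); ring.
- move=> w Bw; have [ [A1 A2 A3] [A1' A2' A3']] := sf_a1 sf Bw.
  have [ [D1 D2 D3] [D1' D2' D3']] := sf_d1 sf Bw.
  refine (etrans (H_rot1 sa1 sd1 Bw) _); rewrite A1 A1' D1 D1'.
  rewrite /bs /bh11 /bh12 /bh22 /rot1 /rot2 /lift; move: (cs1 w).
  move: (cs w) (sn w) (w1 (base w)) (w2 (base w)) (k11 (base w)) (k12 (base w)) (k22 (base w)) (x (base w)) (y (base w)) (a1 (base w)) (a2 (base w)) (a3 (base w)) (d1 (base w)) (d2 (base w)) (d3 (base w)).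
  move=> c s u v q11 q12 q22 xx yy f1 f2 f3 g1 g2 g3 E1.
  by apply: (lin_comb1 E1 (c := - (c * s * (q22 - q11) + (c ^+ 2 - s ^+ 2) * q12) * (f2 * g3 - f3 * g2))); ring.
- move=> w Bw; have [ [A1 A2 A3] [A1' A2' A3']] := sf_a1 sf Bw.
  have [ [D1 D2 D3] [D1' D2' D3']] := sf_d1 sf Bw.
  refine (etrans (H_rot1 sa2 sd2 Bw) _); rewrite A2 A2' D2 D2'.
  rewrite /bs /bh11 /bh12 /bh22 /rot1 /rot2 /lift; move: (cs1 w).
  move: (cs w) (sn w) (w1 (base w)) (w2 (base w)) (k11 (base w)) (k12 (base w)) (k22 (base w)) (x (base w)) (y (base w)) (a1 (base w)) (a2 (base w)) (a3 (base w)) (d1 (base w)) (d2 (base w)) (d3 (base w)).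
  move=> c s u v q11 q12 q22 xx yy f1 f2 f3 g1 g2 g3 E1.
  by apply: (lin_comb1 E1 (c := - (c * s * (q22 - q11) + (c ^+ 2 - s ^+ 2) * q12) * (f3 * g1 - f1 * g3))); ring.
- move=> w Bw; have [ [A1 A2 A3] [A1' A2' A3']] := sf_a1 sf Bw.
  have [ [D1 D2 D3] [D1' D2' D3']] := sf_d1 sf Bw.
  refine (etrans (H_rot1 sa3 sd3 Bw) _); rewrite A3 A3' D3 D3'.
  rewrite /bs /bh11 /bh12 /bh22 /rot1 /rot2 /lift; move: (cs1 w).
  move: (cs w) (sn w) (w1 (base w)) (w2 (base w)) (k11 (base w)) (k12 (base w)) (k22 (base w)) (x (base w)) (y (base w)) (a1 (base w)) (a2 (base w)) (a3 (base w)) (d1 (base w)) (d2 (base w)) (d3 (base w)).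
  move=> c s u v q11 q12 q22 xx yy f1 f2 f3 g1 g2 g3 E1.
  by apply: (lin_comb1 E1 (c := - (c * s * (q22 - q11) + (c ^+ 2 - s ^+ 2) * q12) * (f1 * g2 - f2 * g1))); ring.
- move=> w Bw; have [ [A1 A2 A3] [A1' A2' A3']] := sf_a1 sf Bw.
  have [ [D1 D2 D3] [D1' D2' D3']] := sf_d1 sf Bw.
  refine (etrans (Z_rot2 sa1 sd1 Bw) _); rewrite A1 A1' D1 D1'.
  rewrite /bs /bh11 /bh12 /bh22 /rot1 /rot2 /lift; move: (cs1 w).
  move: (cs w) (sn w) (w1 (base w)) (w2 (base w)) (k11 (base w)) (k12 (base w)) (k22 (base w)) (x (base w)) (y (base w)) (a1 (base w)) (a2 (base w)) (a3 (base w)) (d1 (base w)) (d2 (base w)) (d3 (base w)).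
  move=> c s u v q11 q12 q22 xx yy f1 f2 f3 g1 g2 g3 E1.
  by apply: (lin_comb1 E1 (c := - (c * s * (q22 - q11) + (c ^+ 2 - s ^+ 2) * q12) * (f2 * g3 - f3 * g2))); ring.
- move=> w Bw; have [ [A1 A2 A3] [A1' A2' A3']] := sf_a1 sf Bw.
  have [ [D1 D2 D3] [D1' D2' D3']] := sf_d1 sf Bw.
  refine (etrans (Z_rot2 sa2 sd2 Bw) _); rewrite A2 A2' D2 D2'.
  rewrite /bs /bh11 /bh12 /bh22 /rot1 /rot2 /lift; move: (cs1 w).
  move: (cs w) (sn w) (w1 (base w)) (w2 (base w)) (k11 (base w)) (k12 (base w)) (k22 (base w)) (x (base w)) (y (base w)) (a1 (base w)) (a2 (base w)) (a3 (base w)) (d1 (base w)) (d2 (base w)) (d3 (base w)).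
  move=> c s u v q11 q12 q22 xx yy f1 f2 f3 g1 g2 g3 E1.
  by apply: (lin_comb1 E1 (c := - (c * s * (q22 - q11) + (c ^+ 2 - s ^+ 2) * q12) * (f3 * g1 - f1 * g3))); ring.
- move=> w Bw; have [ [A1 A2 A3] [A1' A2' A3']] := sf_a1 sf Bw.
  have [ [D1 D2 D3] [D1' D2' D3']] := sf_d1 sf Bw.
  refine (etrans (Z_rot2 sa3 sd3 Bw) _); rewrite A3 A3' D3 D3'.
  rewrite /bs /bh11 /bh12 /bh22 /rot1 /rot2 /lift; move: (cs1 w).
  move: (cs w) (sn w) (w1 (base w)) (w2 (base w)) (k11 (base w)) (k12 (base w)) (k22 (base w)) (x (base w)) (y (base w)) (a1 (base w)) (a2 (base w)) (a3 (base w)) (d1 (base w)) (d2 (base w)) (d3 (base w)).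
  move=> c s u v q11 q12 q22 xx yy f1 f2 f3 g1 g2 g3 E1.
  by apply: (lin_comb1 E1 (c := - (c * s * (q22 - q11) + (c ^+ 2 - s ^+ 2) * q12) * (f1 * g2 - f2 * g1))); ring.
- move=> w Bw; have [ [A1 A2 A3] [A1' A2' A3']] := sf_a1 sf Bw.
  have [ [D1 D2 D3] [D1' D2' D3']] := sf_d1 sf Bw.
  refine (etrans (H_rot2 sa1 sd1 Bw) _); rewrite A1 A1' D1 D1'.
  rewrite /bs /bh11 /bh12 /bh22 /rot1 /rot2 /lift; move: (cs1 w).
  move: (cs w) (sn w) (w1 (base w)) (w2 (base w)) (k11 (base w)) (k12 (base w)) (k22 (base w)) (x (base w)) (y (base w)) (a1 (base w)) (a2 (base w)) (a3 (base w)) (d1 (base w)) (d2 (base w)) (d3 (base w)).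
  move=> c s u v q11 q12 q22 xx yy f1 f2 f3 g1 g2 g3 E1.
  by apply: (lin_comb1 E1 (c := - (s ^+ 2 * q11 - 2 * (c * s) * q12 + c ^+ 2 * q22) * (f2 * g3 - f3 * g2))); ring.
- move=> w Bw; have [ [A1 A2 A3] [A1' A2' A3']] := sf_a1 sf Bw.
  have [ [D1 D2 D3] [D1' D2' D3']] := sf_d1 sf Bw.
  refine (etrans (H_rot2 sa2 sd2 Bw) _); rewrite A2 A2' D2 D2'.
  rewrite /bs /bh11 /bh12 /bh22 /rot1 /rot2 /lift; move: (cs1 w).
  move: (cs w) (sn w) (w1 (base w)) (w2 (base w)) (k11 (base w)) (k12 (base w)) (k22 (base w)) (x (base w)) (y (base w)) (a1 (base w)) (a2 (base w)) (a3 (base w)) (d1 (base w)) (d2 (base w)) (d3 (base w)).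
  move=> c s u v q11 q12 q22 xx yy f1 f2 f3 g1 g2 g3 E1.
  by apply: (lin_comb1 E1 (c := - (s ^+ 2 * q11 - 2 * (c * s) * q12 + c ^+ 2 * q22) * (f3 * g1 - f1 * g3))); ring.
- move=> w Bw; have [ [A1 A2 A3] [A1' A2' A3']] := sf_a1 sf Bw.
  have [ [D1 D2 D3] [D1' D2' D3']] := sf_d1 sf Bw.
  refine (etrans (H_rot2 sa3 sd3 Bw) _); rewrite A3 A3' D3 D3'.
  rewrite /bs /bh11 /bh12 /bh22 /rot1 /rot2 /lift; move: (cs1 w).
  move: (cs w) (sn w) (w1 (base w)) (w2 (base w)) (k11 (base w)) (k12 (base w)) (k22 (base w)) (x (base w)) (y (base w)) (a1 (base w)) (a2 (base w)) (a3 (base w)) (d1 (base w)) (d2 (base w)) (d3 (base w)).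
  move=> c s u v q11 q12 q22 xx yy f1 f2 f3 g1 g2 g3 E1.
  by apply: (lin_comb1 E1 (c := - (s ^+ 2 * q11 - 2 * (c * s) * q12 + c ^+ 2 * q22) * (f1 * g2 - f2 * g1))); ring.
- by move=> w Bw; exact: V_rot1.
- by move=> w Bw; exact: V_rot2.
- by move=> w Bw; exact: V_rot1.
- by move=> w Bw; exact: V_rot2.
- by move=> w Bw; exact: V_rot1.
- by move=> w Bw; exact: V_rot2.
- move=> f w sf' Bw; refine (bracketV _ _ f w smooth_bZ _ sf' Bw) => i; exact: VZc.
- move=> f w sf' Bw; refine (etrans (bracketV _ (fun w => - bZ w) f w smooth_bH _ sf' Bw) _) => [i|].
    have oppE (v : 'rV[R]_3) k : (- v) 0 k = - v 0 k by rewrite mxE.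
    exact: etrans (VHc w i Bw) (esym (oppE _ _)).
  by rewrite /lie -sumrN; apply: eq_bigr => i _; rewrite mxE mulNr.
Qed.

End Bundle.

(** * Covariant derivatives of h as words on the frame bundle *)

Section FrameTensor.
Context {R : realType}.
Variables (kappa tau : R) (U : set 'rV[R]_2) (F : 'rV[R]_2 -> 'rV[R]_3).
Hypotheses (oU : open U) (sF : smooth_on U F) (iF : injective_diff_on U F).
Hypothesis DF : forall p, U p -> bcv_domain kappa (F p).
Implicit Types (X Y : 'rV[R]_2 -> 'rV[R]_2) (p u v : 'rV[R]_2) (w : 'rV[R]_3).
Local Notation g := (induced_metric kappa tau F).
Local Notation b1 := (push_cf1 kappa F).
Local Notation b2 := (push_cf2 kappa F).
Local Notation b3 := (push_cf3 kappa tau F).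
Local Notation nab1 := (nabla_cf1 kappa tau F).
Local Notation nab2 := (nabla_cf2 kappa tau F).
Local Notation nab3 := (nabla_cf3 kappa tau F).

Variables (X1 X2 : 'rV[R]_2 -> 'rV[R]_2).
Hypotheses (sX1 : smooth_on U X1) (sX2 : smooth_on U X2).
Hypothesis o11 : forall p, U p -> b1 X1 p * b1 X1 p + b2 X1 p * b2 X1 p + b3 X1 p * b3 X1 p = 1.
Hypothesis o12 : forall p, U p -> b1 X1 p * b1 X2 p + b2 X1 p * b2 X2 p + b3 X1 p * b3 X2 p = 0.
Hypothesis o22 : forall p, U p -> b1 X2 p * b1 X2 p + b2 X2 p * b2 X2 p + b3 X2 p * b3 X2 p = 1.

Local Notation m1 := (normal_cf1 kappa tau F X1 X2).
Local Notation m2 := (normal_cf2 kappa tau F X1 X2).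
Local Notation m3 := (normal_cf3 kappa F X1 X2).
Local Notation hh := (normal_form kappa tau F X1 X2).
Local Notation k11 := (frame_form11 kappa tau F X1 X2).
Local Notation k12 := (frame_form12 kappa tau F X1 X2).
Local Notation k22 := (frame_form22 kappa tau F X1 X2).
Local Notation w1 := (frame_connection1 kappa tau F X1 X2).
Local Notation w2 := (frame_connection2 kappa tau F X1 X2).

Lemma patch_surface_frame : surface_frame kappa tau U X1 X2
  (fun q => xcoord (F q)) (fun q => ycoord (F q)) (b1 X1) (b2 X1) (b3 X1) (b1 X2) (b2 X2) (b3 X2)
  k11 k12 k22 w1 w2.
Proof.
have [sm sk sw1 sw2] := smooth_frame tau oU sF DF sX1 sX2.
apply: SurfaceFrame => //.
- exact: smooth_coord 0 oU sF.
- exact: smooth_coord 1 oU sF.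
- exact: (smooth_b tau oU sF DF sX1).
- exact: (smooth_b tau oU sF DF sX2).
- by move=> p Up; have [] := lie_xy oU sF DF X1 Up.
- by move=> p Up; have [] := lie_xy oU sF DF X1 Up.
- by move=> p Up; have [] := lie_xy oU sF DF X2 Up.
- by move=> p Up; have [] := lie_xy oU sF DF X2 Up.
- move=> p Up; exact: (frame_table1 oU sF iF DF sX1 sX2 o11 o12 o22 Up).
- move=> p Up; exact: (frame_table2 oU sF DF sX1 sX2 o11 o12 o22 Up).
- move=> p j Up; have [_ E] := frame_bracket oU sF iF DF sX1 sX2 o11 o12 o22 Up.
  have d1 := smooth_on_diff sX1 Up; have d2 := smooth_on_diff sX2 Up.
  have c1 := smooth_on_diff (smooth_coord j oU sX1) Up.
  have c2 := smooth_on_diff (smooth_coord j oU sX2) Up.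
  rewrite (lieE X1 c2) (lieE X2 c1).
  rewrite (derive_coord j (diff_derivable (v := X1 p) d2)).
  rewrite (derive_coord j (diff_derivable (v := X2 p) d1)).
  have alg (A B C D : 'rV[R]_2) (c d : R) : A - B = - c *: C + - d *: D ->
    A 0 j - B 0 j = - c * C 0 j - d * D 0 j.
    by move=> H; have := congr1 (fun M : 'rV[R]_2 => M 0 j) H; rewrite !mxE -mulNr.
  exact: alg E.
Qed.

Lemma nab_dir (c d : R) u v z Y p : U p -> smooth_on U Y -> z = c *: u + d *: v ->
  [/\ nab1 z Y p = c * nab1 u Y p + d * nab1 v Y p,
      nab2 z Y p = c * nab2 u Y p + d * nab2 v Y p &
      nab3 z Y p = c * nab3 u Y p + d * nab3 v Y p].
Proof.
move=> Up sY zE; have [y1 y2 y3] := smooth_b tau oU sF DF sY.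
have [] := b_comb kappa tau sF u v c d Up; rewrite -zE => e1 e2 e3.
have lin (f : 'rV[R]_2 -> R) : smooth_on U f -> 'D_z f p = c * 'D_u f p + d * 'D_v f p.
  move=> sf; have df := smooth_on_diff sf Up.
  by rewrite zE !deriveE // linearP linearZ.
have l1 := lin _ y1; have l2 := lin _ y2; have l3 := lin _ y3.
have alg1 (Dz Du Dv z1 z2 z3 u1 u2 u3 v1 v2 v3 y2' y3' K xx yy : R) :
  Dz = c * Du + d * Dv -> z1 = c * u1 + d * v1 -> z2 = c * u2 + d * v2 -> z3 = c * u3 + d * v3 ->
  Dz + tau * (z2 * y3' - z3 * y2') - (K * (yy * z1 - xx * z2) - 2 * tau * z3) * y2' =
  c * (Du + tau * (u2 * y3' - u3 * y2') - (K * (yy * u1 - xx * u2) - 2 * tau * u3) * y2') +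
  d * (Dv + tau * (v2 * y3' - v3 * y2') - (K * (yy * v1 - xx * v2) - 2 * tau * v3) * y2').
  by move=> -> -> -> ->; ring.
have alg2 (Dz Du Dv z1 z2 z3 u1 u2 u3 v1 v2 v3 y1' y3' K xx yy : R) :
  Dz = c * Du + d * Dv -> z1 = c * u1 + d * v1 -> z2 = c * u2 + d * v2 -> z3 = c * u3 + d * v3 ->
  Dz + tau * (z3 * y1' - z1 * y3') + (K * (yy * z1 - xx * z2) - 2 * tau * z3) * y1' =
  c * (Du + tau * (u3 * y1' - u1 * y3') + (K * (yy * u1 - xx * u2) - 2 * tau * u3) * y1') +
  d * (Dv + tau * (v3 * y1' - v1 * y3') + (K * (yy * v1 - xx * v2) - 2 * tau * v3) * y1').
  by move=> -> -> -> ->; ring.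
have alg3 (Dz Du Dv z1 z2 u1 u2 v1 v2 y1' y2' : R) :
  Dz = c * Du + d * Dv -> z1 = c * u1 + d * v1 -> z2 = c * u2 + d * v2 ->
  Dz + tau * (z1 * y2' - z2 * y1') =
  c * (Du + tau * (u1 * y2' - u2 * y1')) + d * (Dv + tau * (v1 * y2' - v2 * y1')).
  by move=> -> -> ->; ring.
split; [exact: (alg1 _ _ _ _ _ _ _ _ _ _ _ _ _ _ (kappa / 2) (xcoord (F p)) (ycoord (F p)) l1 e1 e2 e3)
  |exact: (alg2 _ _ _ _ _ _ _ _ _ _ _ _ _ _ (kappa / 2) (xcoord (F p)) (ycoord (F p)) l2 e1 e2 e3)|].
exact: (alg3 _ _ _ _ _ _ _ _ _ _ _ l3 e1 e2).
Qed.

Definition frame_coord1 Y p : R := b1 Y p * b1 X1 p + b2 Y p * b2 X1 p + b3 Y p * b3 X1 p.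
Definition frame_coord2 Y p : R := b1 Y p * b1 X2 p + b2 Y p * b2 X2 p + b3 Y p * b3 X2 p.

Lemma smooth_al_be Y : smooth_on U Y -> smooth_on U (frame_coord1 Y) /\ smooth_on U (frame_coord2 Y).
Proof.
move=> sY; have [y1 y2 y3] := smooth_b tau oU sF DF sY.
have [x1 x2 x3] := smooth_b tau oU sF DF sX1.
have [z1 z2 z3] := smooth_b tau oU sF DF sX2.
split; first exact: (smoothD oU (smoothD oU (smoothM oU y1 x1) (smoothM oU y2 x2)) (smoothM oU y3 x3)).
exact: (smoothD oU (smoothD oU (smoothM oU y1 z1) (smoothM oU y2 z2)) (smoothM oU y3 z3)).
Qed.

Lemma comp_span Y p : U p -> Y p = frame_coord1 Y p *: X1 p + frame_coord2 Y p *: X2 p.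
Proof.
move=> Up; have [c [d vE]] := frame_span sF o11 o12 o22 (Y p) Up.
have [] := b_comb kappa tau sF (X1 p) (X2 p) c d Up; rewrite -vE => e1 e2 e3.
have alg (y1 y2 y3 x1 x2 x3 z1 z2 z3 : R) :
  x1 * x1 + x2 * x2 + x3 * x3 = 1 -> x1 * z1 + x2 * z2 + x3 * z3 = 0 ->
  z1 * z1 + z2 * z2 + z3 * z3 = 1 -> y1 = c * x1 + d * z1 -> y2 = c * x2 + d * z2 ->
  y3 = c * x3 + d * z3 -> y1 * x1 + y2 * x2 + y3 * x3 = c /\ y1 * z1 + y2 * z2 + y3 * z3 = d.
  move=> r11 r12 r22 -> -> ->; split.
    by apply: (lin_comb2 r11 r12 (c1 := c) (c2 := d)); ring.
  by apply: (lin_comb2 r12 r22 (c1 := c) (c2 := d)); ring.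
have [ca db] := alg _ _ _ _ _ _ _ _ _ (o11 Up) (o12 Up) (o22 Up) e1 e2 e3.
have {}ca : frame_coord1 Y p = c by exact: ca.
have {}db : frame_coord2 Y p = d by exact: db.
by rewrite ca db.
Qed.

Lemma nab_field X Y p : U p -> smooth_on U Y ->
  [/\ nab1 (X p) Y p = frame_coord1 X p * nab1 (X1 p) Y p + frame_coord2 X p * nab1 (X2 p) Y p,
      nab2 (X p) Y p = frame_coord1 X p * nab2 (X1 p) Y p + frame_coord2 X p * nab2 (X2 p) Y p &
      nab3 (X p) Y p = frame_coord1 X p * nab3 (X1 p) Y p + frame_coord2 X p * nab3 (X2 p) Y p].
Proof. by move=> Up sY; exact: nab_dir Up sY (comp_span X Up). Qed.

Definition nal v Y p : R := nab1 v Y p * b1 X1 p + nab2 v Y p * b2 X1 p + nab3 v Y p * b3 X1 p.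
Definition nbe v Y p : R := nab1 v Y p * b1 X2 p + nab2 v Y p * b2 X2 p + nab3 v Y p * b3 X2 p.

(** The derivative of the coordinates of Y differs from the coordinates of its covariant derivative
    by the connection form, which the angular parts of Z and H will compensate. *)
Lemma derive_al_be v Y p : U p -> smooth_on U Y ->
  'D_v (frame_coord1 Y) p = nal v Y p + frame_connection kappa tau F X1 X2 v p * frame_coord2 Y p /\
  'D_v (frame_coord2 Y) p = nbe v Y p - frame_connection kappa tau F X1 X2 v p * frame_coord1 Y p.
Proof.
move=> Up sY; have tn := tangent_normal sF o11 o12 o22 (Y p) Up.
have [f1 f2 f3] := nab_frame1 oU sF DF sX1 o11 o12 o22 v Up.
have [h1 h2 h3] := nab_frame2 oU sF DF sX1 sX2 o11 o12 o22 v Up.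
have alg (D N y1 y2 y3 n1 n2 n3 x1 x2 x3 o k t1 t2 t3 : R) :
  D = N + (y1 * n1 + y2 * n2 + y3 * n3) -> n1 = o * x1 + k * t1 -> n2 = o * x2 + k * t2 ->
  n3 = o * x3 + k * t3 -> y1 * t1 + y2 * t2 + y3 * t3 = 0 -> D = N + o * (y1 * x1 + y2 * x2 + y3 * x3).
  move=> -> -> -> -> H; apply: (lin_comb1 H (c := k)); ring.
split.
  exact: (alg _ _ _ _ _ _ _ _ _ _ _ _ _ _ _ _ (derive_dot tau oU sF DF v Up sY sX1) f1 f2 f3 tn).
rewrite -mulNr.
exact: (alg _ _ _ _ _ _ _ _ _ _ _ _ _ _ _ _ (derive_dot tau oU sF DF v Up sY sX2) h1 h2 h3 tn).
Qed.

Lemma al_be_levi_civita X Y p : U p -> smooth_on U Y ->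
  frame_coord1 (levi_civita g X Y) p = frame_coord1 X p * nal (X1 p) Y p + frame_coord2 X p * nal (X2 p) Y p /\
  frame_coord2 (levi_civita g X Y) p = frame_coord1 X p * nbe (X1 p) Y p + frame_coord2 X p * nbe (X2 p) Y p.
Proof.
move=> Up sY; have [n1 n2 n3] := nab_field X Up sY.
have alg (D a b A1 A2 A3 B1 B2 B3 C1 C2 C3 x1 x2 x3 : R) :
  D = A1 * x1 + A2 * x2 + A3 * x3 -> A1 = a * B1 + b * C1 -> A2 = a * B2 + b * C2 ->
  A3 = a * B3 + b * C3 ->
  D = a * (B1 * x1 + B2 * x2 + B3 * x3) + b * (C1 * x1 + C2 * x2 + C3 * x3).
  by move=> -> -> -> ->; ring.
split.
  exact: (alg _ _ _ _ _ _ _ _ _ _ _ _ _ _ _ (levi_civita_frame tau oU sF iF DF X (X1 p) Up sY) n1 n2 n3).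
exact: (alg _ _ _ _ _ _ _ _ _ _ _ _ _ _ _ (levi_civita_frame tau oU sF iF DF X (X2 p) Up sY) n1 n2 n3).
Qed.

(** [levi_civita] is defined with an inverse matrix; smoothness is read off from its frame
    coordinates, which are polynomial in smooth functions. *)
Lemma smooth_levi_civita X Y : smooth_on U X -> smooth_on U Y -> smooth_on U (levi_civita g X Y).
Proof.
move=> sX sY; have [aX bX] := smooth_al_be sX.
have [x1 x2 x3] := smooth_b tau oU sF DF sX1. have [z1 z2 z3] := smooth_b tau oU sF DF sX2.
have [p1 p2 p3] := smooth_nab tau oU sF DF sX1 sY.
have [q1 q2 q3] := smooth_nab tau oU sF DF sX2 sY.
have sal : smooth_on U (frame_coord1 (levi_civita g X Y)).
  apply: (eq_smooth oU (f := fun p => frame_coord1 X p * nal (X1 p) Y p + frame_coord2 X p * nal (X2 p) Y p)).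
    by move=> p Up; have [-> _] := al_be_levi_civita X Up sY.
  exact: (smoothD oU (smoothM oU aX (smoothD oU (smoothD oU (smoothM oU p1 x1) (smoothM oU p2 x2)) (smoothM oU p3 x3)))
    (smoothM oU bX (smoothD oU (smoothD oU (smoothM oU q1 x1) (smoothM oU q2 x2)) (smoothM oU q3 x3)))).
have sbe : smooth_on U (frame_coord2 (levi_civita g X Y)).
  apply: (eq_smooth oU (f := fun p => frame_coord1 X p * nbe (X1 p) Y p + frame_coord2 X p * nbe (X2 p) Y p)).
    by move=> p Up; have [_ ->] := al_be_levi_civita X Up sY.
  exact: (smoothD oU (smoothM oU aX (smoothD oU (smoothD oU (smoothM oU p1 z1) (smoothM oU p2 z2)) (smoothM oU p3 z3)))
    (smoothM oU bX (smoothD oU (smoothD oU (smoothM oU q1 z1) (smoothM oU q2 z2)) (smoothM oU q3 z3)))).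
apply: smooth_row => // j.
apply: (eq_smooth oU (f := fun p => frame_coord1 (levi_civita g X Y) p * X1 p 0 j + frame_coord2 (levi_civita g X Y) p * X2 p 0 j)).
  have comb (A B C : 'rV[R]_2) (c d : R) : A = c *: B + d *: C -> c * B 0 j + d * C 0 j = A 0 j.
    by move=> ->; rewrite !mxE.
  by move=> p Up; exact: comb (comp_span _ Up).
exact: (smoothD oU (smoothM oU sal (smooth_coord j oU sX1)) (smoothM oU sbe (smooth_coord j oU sX2))).
Qed.

Lemma second_form_comp (xi : 'rV[R]_2 -> 'rV[R]_3) X Y p : U p -> smooth_on U Y ->
  cf1 kappa (F p) (xi p) = m1 p -> cf2 kappa (F p) (xi p) = m2 p -> cf3 kappa tau (F p) (xi p) = m3 p ->
  second_form kappa tau F xi X Y p =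
  frame_coord1 X p * (frame_coord1 Y p * k11 p + frame_coord2 Y p * k12 p) + frame_coord2 X p * (frame_coord1 Y p * k12 p + frame_coord2 Y p * k22 p).
Proof.
move=> Up sY x1 x2 x3; rewrite (second_form_frame tau oU sF DF xi X Up sY) x1 x2 x3.
have lin v : hh v Y p = frame_coord1 Y p * hh v X1 p + frame_coord2 Y p * hh v X2 p.
  (* h(v, Z) depends on Z at p only, as D_v Z contributes a tangent vector. A frozen field can be
     exchanged with the direction by [nabC], so linearity in Y reduces to linearity in the
     direction. *)
  have red Z : smooth_on U Z -> hh v Z p = hh v (cst (Z p)) p.
    move=> sZ; have [n1 n2 n3] := nab_split tau oU sF DF v Up sZ.
    have tn := tangent_normal sF o11 o12 o22 ('D_v Z p) Up.
    have alg (N1 N2 N3 c1 c2 c3 d1 d2 d3 t1 t2 t3 : R) : N1 = c1 + d1 -> N2 = c2 + d2 -> N3 = c3 + d3 ->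
      c1 * t1 + c2 * t2 + c3 * t3 = 0 -> N1 * t1 + N2 * t2 + N3 * t3 = d1 * t1 + d2 * t2 + d3 * t3.
      by move=> -> -> -> H; apply: (lin_comb1 H (c := 1)); ring.
    exact: alg n1 n2 n3 tn.
  rewrite (red _ sY) (red _ sX1) (red _ sX2).
  have [e1 e2 e3] := nabC tau oU sF DF v (Y p) Up.
  have [f1 f2 f3] := nabC tau oU sF DF v (X1 p) Up.
  have [h1 h2 h3] := nabC tau oU sF DF v (X2 p) Up.
  have [n1 n2 n3] := nab_dir Up (@smooth_cst _ _ _ U v) (comp_span Y Up).
  have alg (N1 N2 N3 M1 M2 M3 a1 a2 a3 c1 c2 c3 a1' a2' a3' c1' c2' c3' t1 t2 t3 a b : R) :
    N1 = M1 -> N2 = M2 -> N3 = M3 -> a1 = a1' -> a2 = a2' -> a3 = a3' -> c1 = c1' -> c2 = c2' ->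
    c3 = c3' -> M1 = a * a1' + b * c1' -> M2 = a * a2' + b * c2' -> M3 = a * a3' + b * c3' ->
    N1 * t1 + N2 * t2 + N3 * t3 = a * (a1 * t1 + a2 * t2 + a3 * t3) + b * (c1 * t1 + c2 * t2 + c3 * t3).
    by move=> -> -> -> -> -> -> -> -> -> -> -> ->; ring.
  exact: alg e1 e2 e3 f1 f2 f3 h1 h2 h3 n1 n2 n3.
have [n1 n2 n3] := nab_field X Up sY.
have [kk _] := frame_bracket oU sF iF DF sX1 sX2 o11 o12 o22 Up.
have l1 := lin (X1 p); have l2 := lin (X2 p); rewrite kk in l2.
have alg (N1 N2 N3 a b B1 B2 B3 C1 C2 C3 t1 t2 t3 r s : R) :
  N1 = a * B1 + b * C1 -> N2 = a * B2 + b * C2 -> N3 = a * B3 + b * C3 ->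
  B1 * t1 + B2 * t2 + B3 * t3 = r -> C1 * t1 + C2 * t2 + C3 * t3 = s ->
  N1 * t1 + N2 * t2 + N3 * t3 = a * r + b * s.
  by move=> -> -> -> <- <-; ring.
exact: alg n1 n2 n3 l1 l2.
Qed.

(** Coordinates of Y in the frame rotated by the angle of w, indexed like the letters of a word. *)
Definition bundle_coord Y (a : bool) w : R :=
  if a then rot2 (frame_coord1 Y) (frame_coord2 Y) w else rot1 (frame_coord1 Y) (frame_coord2 Y) w.

Local Notation Z := (bZ (X1 := X1) (X2 := X2) (w1 := w1) (w2 := w2)).
Local Notation H := (bH (X1 := X1) (X2 := X2) (w1 := w1) (w2 := w2)).
Local Notation ZH a := (if a then H else Z).
Local Notation B := (bundle U).

Let sfr := patch_surface_frame.
Let oB : open B := open_bundle oU.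
Let sZ : smooth_on B Z := smooth_bZ sfr.
Let sH : smooth_on B H := smooth_bH sfr.
Let sZH (a : bool) : smooth_on B (ZH a).
Proof. by case: a. Qed.

Lemma smooth_comp_field Y a : smooth_on U Y -> smooth_on B (bundle_coord Y a).
Proof.
move=> /smooth_al_be [sa sb]; case: a; first exact: (smooth_rot2 sfr sa sb).
exact: (smooth_rot1 sfr sa sb).
Qed.

(** The left side differentiates along the horizontal lift of X. That this is covariant
    differentiation of the coordinates is the purpose of the frame bundle. *)
Lemma lie_comp X Y b w : smooth_on U Y -> B w ->
  bundle_coord X false w * lie Z (bundle_coord Y b) w + bundle_coord X true w * lie H (bundle_coord Y b) w =
  bundle_coord (levi_civita g X Y) b w.
Proof.
move=> sY Bw; have [sa sb] := smooth_al_be sY.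
have [LA LB] := al_be_levi_civita X Bw sY.
have [A1 B1] := derive_al_be (X1 (base w)) Bw sY.
have [A2 B2] := derive_al_be (X2 (base w)) Bw sY.
rewrite -(lieE X1 (smooth_on_diff sa Bw)) in A1.
rewrite -(lieE X1 (smooth_on_diff sb Bw)) in B1.
rewrite -(lieE X2 (smooth_on_diff sa Bw)) in A2.
rewrite -(lieE X2 (smooth_on_diff sb Bw)) in B2.
have E1 := cs1 w; case: b.
  have alg (c s u v a b A B' C D n1 n2 n1' n2' x y Zc Hc LX LY : R) : c ^+ 2 + s ^+ 2 = 1 ->
    A = n1 + u * b -> C = n1' - u * a -> B' = n2 + v * b -> D = n2' - v * a ->
    Zc = (c * u + s * v) * (c * a + s * b) - s * (c * A + s * B') + c * (c * C + s * D) ->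
    Hc = (- s * u + c * v) * (c * a + s * b) - s * (- s * A + c * B') + c * (- s * C + c * D) ->
    LX = x * n1 + y * n2 -> LY = x * n1' + y * n2' ->
    (c * x + s * y) * Zc + (- s * x + c * y) * Hc = - s * LX + c * LY.
    move=> e -> -> -> -> -> -> -> ->.
    by apply: (lin_comb1 e (c := c * (x * n1' + y * n2') - s * (x * n1 + y * n2))); ring.
  exact: (alg _ _ _ _ _ _ _ _ _ _ _ _ _ _ _ _ _ _ _ _ E1 A1 B1 A2 B2
    (Z_rot2 sfr sa sb Bw) (H_rot2 sfr sa sb Bw) LA LB).
have alg (c s u v a b A B' C D n1 n2 n1' n2' x y Zc Hc LX LY : R) : c ^+ 2 + s ^+ 2 = 1 ->
  A = n1 + u * b -> C = n1' - u * a -> B' = n2 + v * b -> D = n2' - v * a ->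
  Zc = - (c * u + s * v) * (- s * a + c * b) + c * (c * A + s * B') + s * (c * C + s * D) ->
  Hc = - (- s * u + c * v) * (- s * a + c * b) + c * (- s * A + c * B') + s * (- s * C + c * D) ->
  LX = x * n1 + y * n2 -> LY = x * n1' + y * n2' ->
  (c * x + s * y) * Zc + (- s * x + c * y) * Hc = c * LX + s * LY.
  move=> e -> -> -> -> -> -> -> ->.
  by apply: (lin_comb1 e (c := c * (x * n1 + y * n2) + s * (x * n1' + y * n2'))); ring.
exact: (alg _ _ _ _ _ _ _ _ _ _ _ _ _ _ _ _ _ _ _ _ E1 A1 B1 A2 B2
  (Z_rot1 sfr sa sb Bw) (H_rot1 sfr sa sb Bw) LA LB).
Qed.

Implicit Types (G : seq bool -> 'rV[R]_3 -> R) (Ys : seq ('rV[R]_2 -> 'rV[R]_2)).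

Fixpoint smooths Ys : Prop := if Ys is Y :: Ys' then smooth_on U Y /\ smooths Ys' else True.

(* [bundle_eval G Ys] is the contraction of the tensor whose components in the moving frame
   are the functions [G s] with the vector fields [Ys]. *)
Fixpoint bundle_eval G Ys w : R :=
  if Ys is Y :: Ys' then bundle_coord Y false w * bundle_eval (fun s => G (false :: s)) Ys' w +
    bundle_coord Y true w * bundle_eval (fun s => G (true :: s)) Ys' w
  else G [::] w.

(** The terms of the Leibniz rule for [bundle_eval] in which [A] falls on a coordinate of one of the
    fields. *)
Fixpoint bundle_deriv_eval A G Ys w : R :=
  if Ys is Y :: Ys' then
    lie A (bundle_coord Y false) w * bundle_eval (fun s => G (false :: s)) Ys' w +
    lie A (bundle_coord Y true) w * bundle_eval (fun s => G (true :: s)) Ys' w +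
    (bundle_coord Y false w * bundle_deriv_eval A (fun s => G (false :: s)) Ys' w +
     bundle_coord Y true w * bundle_deriv_eval A (fun s => G (true :: s)) Ys' w)
  else 0.

Lemma smooth_ev G Ys : (forall s, smooth_on B (G s)) -> smooths Ys -> smooth_on B (bundle_eval G Ys).
Proof.
elim: Ys G => [|Y Ys IH] G sG /=; first by move=> _; exact: sG.
move=> [sY sYs]; have i1 := IH (fun s => G (false :: s)) (fun s => sG _) sYs.
have i2 := IH (fun s => G (true :: s)) (fun s => sG _) sYs.
exact: (smoothD oB (smoothM oB (smooth_comp_field false sY) i1) (smoothM oB (smooth_comp_field true sY) i2)).
Qed.

Lemma lie_ev A G Ys w : (forall s, smooth_on B (G s)) -> smooths Ys -> B w ->
  lie A (bundle_eval G Ys) w = bundle_eval (fun s => lie A (G s)) Ys w + bundle_deriv_eval A G Ys w.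
Proof.
elim: Ys G => [|Y Ys IH] G sG; first by rewrite /= addr0.
move=> [sY sYs] Bw.
have i1 := smooth_ev (G := fun s => G (false :: s)) (fun s => sG _) sYs.
have i2 := smooth_ev (G := fun s => G (true :: s)) (fun s => sG _) sYs.
have c1 := smooth_comp_field false sY; have c2 := smooth_comp_field true sY.
refine (etrans (lieD A Bw (smoothM oB c1 i1) (smoothM oB c2 i2)) _).
refine (etrans (congr2 +%R (lieM A Bw c1 i1) (lieM A Bw c2 i2)) _).
have j1 := IH (fun s => G (false :: s)) (fun s => sG _) sYs Bw.
have j2 := IH (fun s => G (true :: s)) (fun s => sG _) sYs Bw.
have alg (a b c d e f g' h i j e' f' : R) : e = g' + h -> f = i + j ->
  a * b + c * e + (d * e' + f' * f) = c * g' + f' * i + (a * b + d * e' + (c * h + f' * j)).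
  by move=> -> ->; ring.
exact: alg j1 j2.
Qed.

(** Along the horizontal lift of X these Leibniz terms add up to the correction terms that [nabla]
    subtracts. *)
Lemma dev_levi_civita X G Ys w : smooths Ys -> B w ->
  bundle_coord X false w * bundle_deriv_eval Z G Ys w + bundle_coord X true w * bundle_deriv_eval H G Ys w =
  \sum_(j < size Ys) bundle_eval G (set_nth 0 Ys j (levi_civita g X (nth 0 Ys j))) w.
Proof.
elim: Ys G => [|Y Ys IH] G; first by rewrite /= !mulr0 addr0 big_ord0.
move=> [sY sYs] Bw; rewrite big_ord_recl.
have j1 := IH (fun s => G (false :: s)) sYs Bw.
have j2 := IH (fun s => G (true :: s)) sYs Bw.
have l1 := lie_comp X false sY Bw; have l2 := lie_comp X true sY Bw.
have -> : \sum_(i < size Ys) bundle_eval G (set_nth 0 (Y :: Ys) (fintype.lift ord0 i)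
    (levi_civita g X (nth 0 (Y :: Ys) (fintype.lift ord0 i)))) w =
  bundle_coord Y false w * (\sum_(j < size Ys) bundle_eval (fun s => G (false :: s)) (set_nth 0 Ys j (levi_civita g X (nth 0 Ys j))) w) +
  bundle_coord Y true w * (\sum_(j < size Ys) bundle_eval (fun s => G (true :: s)) (set_nth 0 Ys j (levi_civita g X (nth 0 Ys j))) w).
  by rewrite !mulr_sumr -big_split; apply: eq_bigr => i _.
rewrite -j1 -j2.
have alg (x y a b c d e f a' b' u v u' v' u2 v2 L1 L2 : R) :
  x * a + y * a' = L1 -> x * b + y * b' = L2 ->
  x * (a * e + b * f + (c * u + d * v)) + y * (a' * e + b' * f + (c * u' + d * v')) =
  L1 * e + L2 * f + (c * (x * u + y * u') + d * (x * v + y * v')).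
  by move=> <- <-; ring.
exact: alg l1 l2.
Qed.

Local Notation h11 := (bh11 (k11 := k11) (k12 := k12) (k22 := k22)).
Local Notation h12 := (bh12 (k11 := k11) (k12 := k12) (k22 := k22)).
Local Notation h22 := (bh22 (k11 := k11) (k12 := k12) (k22 := k22)).

Definition bundle_form (a b : bool) : 'rV[R]_3 -> R :=
  if a then (if b then h22 else h12) else (if b then h12 else h11).

(** Plain iterated derivatives, since the bundle has absorbed the correction terms; an index word of
    a length other than m + 2 leads to 0. *)
Fixpoint nabla_comp (m : nat) (s : seq bool) : 'rV[R]_3 -> R :=
  match m, s with
  | 0%N, [:: a; b] => bundle_form a b
  | m'.+1, a :: s' => lie (ZH a) (nabla_comp m' s')
  | _, _ => fun=> 0
  end.

Lemma smooth_nabla_comp m s : smooth_on B (nabla_comp m s).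
Proof.
have s0 : smooth_on B (fun=> 0 : R) by exact: smooth_cst.
have [sh11 sh12 sh22] := smooth_bh sfr.
elim: m s => [|m IH] s /=; last by case: s => [|a s] //; exact: lie_smooth oB (sZH a) (IH s).
case: s => [|a [|b [|c s]]]; [exact: s0|exact: s0| |exact: s0].
by case: a; case: b; [exact: sh22|exact: sh12|exact: sh12|exact: sh11].
Qed.

Definition section_at (t : R) (p : 'rV[R]_2) : 'rV[R]_3 := vec3 (p 0 0) (p 0 1) t.

Lemma base_section t p : base (section_at t p) = p.
Proof. by apply: row2P; rewrite !mxE. Qed.

Lemma smooths_set_nth Ys j Y : (j < size Ys)%N -> smooths Ys -> smooth_on U Y ->
  smooths (set_nth 0 Ys j Y).
Proof.
elim: Ys j => [|Y' Ys IH] [|j] //= jl [s1 s2] sY; first by split.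
by split=> //; exact: IH.
Qed.

Lemma smooths_nth Ys j : (j < size Ys)%N -> smooths Ys -> smooth_on U (nth 0 Ys j).
Proof. by elim: Ys j => [|Y Ys IH] [|j] //= jl [s1 s2] //; exact: IH. Qed.

Lemma smoothsP Ys : (forall j, (j < size Ys)%N -> smooth_on U (nth 0 Ys j)) -> smooths Ys.
Proof.
elim: Ys => [//|Y Ys IH] sY; split; first exact: (sY 0%N).
by apply: IH => j jl; exact: (sY j.+1).
Qed.

(** In the induction step, the horizontal derivative of a contraction is the contraction of the
    derived components plus the Leibniz terms on the fields, and [nabla] removes exactly the
    latter. *)
Lemma nabla_ev (xi : 'rV[R]_2 -> 'rV[R]_3) :
  (forall p, U p -> [/\ cf1 kappa (F p) (xi p) = m1 p, cf2 kappa (F p) (xi p) = m2 p &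
    cf3 kappa tau (F p) (xi p) = m3 p]) ->
  forall m Ys w, size Ys = m.+2 -> smooths Ys -> B w ->
  iter m (nabla g) (second_form_tensor kappa tau F xi) Ys (base w) = bundle_eval (nabla_comp m) Ys w.
Proof.
move=> xiN; elim=> [|m IH] Ys w.
  case: Ys => [|X [|Y [|? ?]]] // _ [sX [sY _]] Bw.
  have [n1 n2 n3] := xiN _ Bw.
  refine (etrans (second_form_comp X Bw sY n1 n2 n3) _).
  rewrite /= /rot1 /rot2 /bh11 /bh12 /bh22 /lift; move: (cs1 w).
  move: (cosf w) (sinf w) (frame_coord1 X (base w)) (frame_coord2 X (base w)) (frame_coord1 Y (base w)) (frame_coord2 Y (base w))
    (k11 (base w)) (k12 (base w)) (k22 (base w)).
  move=> c s x y x' y' q11 q12 q22 e; apply: (lin_comb1 e (c := - (c ^+ 2 + s ^+ 2 + 1) *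
    (x * (x' * q11 + y' * q12) + y * (x' * q12 + y' * q22)))); ring.
case: Ys => [//|X Ys] [ss] [sX sYs] Bw.
set T := iter m (nabla g) (second_form_tensor kappa tau F xi).
have TE w' : B w' -> lift (T Ys) w' = bundle_eval (nabla_comp m) Ys w' by exact: IH.
have sev := smooth_ev (smooth_nabla_comp m) sYs.
(* Smoothness on the bundle descends to the patch through the section of angle 0. *)
have sT : smooth_on U (T Ys).
  have ssec : smooth_on U (section_at 0).
    by apply: smooth_vec3 => //; [exact: smooth_id_coord|exact: smooth_id_coord|exact: smooth_cst].
  apply: (eq_smooth oU (f := fun p => bundle_eval (nabla_comp m) Ys (section_at 0 p))).
    by move=> p Up; rewrite -TE /lift /bundle /= base_section.
  by apply: (smooth_comp oU _ ssec sev) => p Up; rewrite /bundle /= base_section.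
have D : 'D_(X (base w)) (T Ys) (base w) =
    bundle_coord X false w * lie Z (bundle_eval (nabla_comp m) Ys) w + bundle_coord X true w * lie H (bundle_eval (nabla_comp m) Ys) w.
  have e1 := eq_lie Z oB Bw TE; have e2 := eq_lie H oB Bw TE.
  rewrite -e1 -e2 (lie_lift_Z (T Ys) w) (lie_lift_H (T Ys) w).
  have dT := smooth_on_diff sT Bw.
  rewrite (lieE X1 dT) (lieE X2 dT).
  have XE := comp_span X Bw.
  have -> : 'D_(X (base w)) (T Ys) (base w) = frame_coord1 X (base w) * 'D_(X1 (base w)) (T Ys) (base w)
      + frame_coord2 X (base w) * 'D_(X2 (base w)) (T Ys) (base w).
    by rewrite {1}XE !deriveE // linearP linearZ.
  rewrite /bundle_coord /rot1 /rot2 /lift; move: (cs1 w).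
  move: (cosf w) (sinf w) (frame_coord1 X (base w)) (frame_coord2 X (base w)) ('D_(X1 (base w)) (T Ys) (base w))
    ('D_(X2 (base w)) (T Ys) (base w)) => c s x y d1 d2 e.
  by apply: (lin_comb1 e (c := - (x * d1 + y * d2))); ring.
have l1 := lie_ev Z (smooth_nabla_comp m) sYs Bw.
have l2 := lie_ev H (smooth_nabla_comp m) sYs Bw.
have dd := dev_levi_civita X (nabla_comp m) sYs Bw.
have S : \sum_(j < size Ys) T (set_nth 0 Ys j (levi_civita g X (nth 0 Ys j))) (base w) =
  \sum_(j < size Ys) bundle_eval (nabla_comp m) (set_nth 0 Ys j (levi_civita g X (nth 0 Ys j))) w.
  apply: eq_bigr => j _; apply: IH => //.
    by rewrite size_set_nth (maxn_idPr _) // ltn_ord.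
  apply: smooths_set_nth => //; apply: smooth_levi_civita => //; exact: smooths_nth.
have alg (D' S' x y a b a' b' d d' : R) : D' = x * a + y * b -> a = a' + d -> b = b' + d' ->
  x * d + y * d' = S' -> D' - S' = x * a' + y * b' by move=> -> -> -> <-; ring.
refine (etrans (congr1 (fun z => _ - z) S) _).
exact: alg D l1 l2 dd.
Qed.

(** Fields on the patch that coincide with the moving frame over all points of angle t; fed into a
    tensor, they extract a single component at any prescribed bundle point. *)
Definition frame_field (t : R) (a : bool) : 'rV[R]_2 -> 'rV[R]_2 :=
  if a then (fun q => - sin t *: X1 q + cos t *: X2 q) else (fun q => cos t *: X1 q + sin t *: X2 q).

Lemma smooth_frame_field t a : smooth_on U (frame_field t a).
Proof.
have lin (c d : R) : smooth_on U (fun q => c *: X1 q + d *: X2 q).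
  apply: smooth_row => // j; apply: (eq_smooth oU (f := fun q => c * X1 q 0 j + d * X2 q 0 j)).
    by move=> q _; rewrite !mxE.
  exact: (smoothD oU (smoothM oU (smooth_cst c) (smooth_coord j oU sX1))
     (smoothM oU (smooth_cst d) (smooth_coord j oU sX2))).
by case: a; exact: lin.
Qed.

Lemma comp_frame_field a b w : B w -> bundle_coord (frame_field (w 0 2) a) b w = (a == b)%:R.
Proof.
move=> Bw; set t := w 0 2.
have key (Y : 'rV[R]_2 -> 'rV[R]_2) (c d : R) : Y (base w) = c *: X1 (base w) + d *: X2 (base w) ->
    frame_coord1 Y (base w) = c /\ frame_coord2 Y (base w) = d.
  move=> E; have ind := frame_independent sF o11 o12 o22 (p := base w) Bw.
  have E2 := comp_span Y Bw; rewrite {1}E in E2.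
  have alg (V : lmodType R) (x y : R) (u v : V) : c *: u + d *: v = x *: u + y *: v ->
      (c - x) *: u + (d - y) *: v = 0 by move=> e; rewrite !scalerBl addrACA -opprD e subrr.
  have [h1 h2] := ind _ _ (alg _ _ _ _ _ E2).
  have subE (x y : R) : x - y = 0 -> y = x by move/eqP; rewrite subr_eq0 => /eqP.
  exact: (conj (subE _ _ h1) (subE _ _ h2)).
have e := cs1 w.
case: a; [have [ea eb] := key (frame_field t true) (- sin t) (cos t) (erefl _)
  |have [ea eb] := key (frame_field t false) (cos t) (sin t) (erefl _)];
  case: b; rewrite /bundle_coord /rot1 /rot2 /lift ea eb /cosf /sinf -/t /=;
  move: e; rewrite /cosf /sinf -/t; move: (cos t) (sin t) => c s e.
- by rewrite -e; ring.
- by ring.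
- by ring.
- by rewrite -e; ring.
Qed.

Lemma ev_frame_field G s w : B w -> bundle_eval G [seq frame_field (w 0 2) a | a <- s] w = G s w.
Proof.
move=> Bw; elim: s G => [//|a s IH] G /=.
have c1 := comp_frame_field a false Bw; have c2 := comp_frame_field a true Bw.
rewrite /bundle_coord in c1 c2; rewrite c1 c2 !IH.
by case: a {c1 c2} => /=; rewrite ?mul1r ?mul0r ?add0r ?addr0.
Qed.

Lemma nabla_comp_word m s a b : size s = m ->
  nabla_comp m (s ++ [:: a; b]) = word Z H s (bundle_form a b).
Proof. by elim: s m => [|c s IH] [|m] //= [/IH ->]. Qed.

Lemma nabla_h_word (xi : 'rV[R]_2 -> 'rV[R]_3) m :
  (forall p, U p -> [/\ cf1 kappa (F p) (xi p) = m1 p, cf2 kappa (F p) (xi p) = m2 p &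
    cf3 kappa tau (F p) (xi p) = m3 p]) ->
  (forall Xs, size Xs = m.+2 -> (forall j, (j < size Xs)%N -> smooth_on U (nth 0 Xs j)) ->
    forall p, U p -> iter m (nabla g) (second_form_tensor kappa tau F xi) Xs p = 0) ->
  forall s a b w, size s = m -> B w -> word Z H s (bundle_form a b) w = 0.
Proof.
move=> xiN par s a b w sm Bw; rewrite -(nabla_comp_word _ _ sm) -(ev_frame_field _ _ Bw).
set Ys := [seq _ | _ <- _].
have sY j : (j < size Ys)%N -> smooth_on U (nth 0 Ys j).
  rewrite size_map => jl; rewrite (nth_map false) //; exact: smooth_frame_field.
have szY : size Ys = m.+2 by rewrite size_map size_cat /= sm addn2.
rewrite -(nabla_ev xiN szY (smoothsP sY) Bw); exact: par.
Qed.

End FrameTensor.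

Definition orthonormal_frame (R : realType) (kappa tau : R) (U : set 'rV[R]_2)
    (F : 'rV[R]_2 -> 'rV[R]_3) (X1 X2 : 'rV[R]_2 -> 'rV[R]_2) :=
  let dot Y Y' p := push_cf1 kappa F Y p * push_cf1 kappa F Y' p + push_cf2 kappa F Y p * push_cf2 kappa F Y' p
    + push_cf3 kappa tau F Y p * push_cf3 kappa tau F Y' p in
  [/\ smooth_on U X1, smooth_on U X2, forall p, U p -> dot X1 X1 p = 1,
      forall p, U p -> dot X1 X2 p = 0 & forall p, U p -> dot X2 X2 p = 1].

(** * Existence of frames, and the dichotomy on one patch *)

Section FrameExistence.
Context {R : realType}.
Variables (kappa tau : R) (U : set 'rV[R]_2) (F : 'rV[R]_2 -> 'rV[R]_3).
Hypotheses (oU : open U) (sF : smooth_on U F) (iF : injective_diff_on U F).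
Hypothesis DF : forall p, U p -> bcv_domain kappa (F p).
Implicit Types (X Y : 'rV[R]_2 -> 'rV[R]_2) (p u v : 'rV[R]_2) (w : 'rV[R]_3).
Local Notation b1 := (push_cf1 kappa F).
Local Notation b2 := (push_cf2 kappa F).
Local Notation b3 := (push_cf3 kappa tau F).

Lemma smooth_comb (c d : 'rV[R]_2 -> R) X Y : smooth_on U c -> smooth_on U d ->
  smooth_on U X -> smooth_on U Y -> smooth_on U (fun p => c p *: X p + d p *: Y p).
Proof.
move=> sc sd sX sY; apply: smooth_row => // j.
apply: (eq_smooth oU (f := fun q => c q * X q 0 j + d q * Y q 0 j)).
  by move=> q _; rewrite !mxE.
exact: (smoothD oU (smoothM oU sc (smooth_coord j oU sX)) (smoothM oU sd (smooth_coord j oU sY))).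
Qed.

Lemma b_field (c d : 'rV[R]_2 -> R) X Y p : U p -> let Z := fun q => c q *: X q + d q *: Y q in
  [/\ b1 Z p = c p * b1 X p + d p * b1 Y p, b2 Z p = c p * b2 X p + d p * b2 Y p &
      b3 Z p = c p * b3 X p + d p * b3 Y p].
Proof. by move=> Up; exact: (b_comb kappa tau sF (X p) (Y p) (c p) (d p) Up). Qed.

Lemma sqr3_gt0 Y p : U p -> Y p != 0 -> 0 < b1 Y p * b1 Y p + b2 Y p * b2 Y p + b3 Y p * b3 Y p.
Proof.
move=> Up Y0; have inj := @b_inj _ _ tau _ _ iF DF (Y p) p Up.
rewrite lt_neqAle eq_sym; apply/andP; split; last first.
  by rewrite -!expr2 !addr_ge0 ?sqr_ge0.
apply: contraNN Y0; rewrite -!expr2 !paddr_eq0 ?addr_ge0 ?sqr_ge0 // !sqrf_eq0.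
by move=> /andP[/andP[/eqP z1 /eqP z2] /eqP z3]; apply/eqP; exact: inj.
Qed.

(** Gram-Schmidt for the coordinate fields, whose images are independent because F is an
    immersion. *)
Lemma orthonormal_frame_exists : exists X1 X2, orthonormal_frame kappa tau U F X1 X2.
Proof.
pose e0 : 'rV[R]_2 := delta_mx 0 0; pose e1 : 'rV[R]_2 := delta_mx 0 1.
pose Y0 : 'rV[R]_2 -> 'rV[R]_2 := cst e0; pose Y1 : 'rV[R]_2 -> 'rV[R]_2 := cst e1.
have s0 : smooth_on U Y0 by exact: smooth_cst.
have s1 : smooth_on U Y1 by exact: smooth_cst.
pose dot Y Y' p := b1 Y p * b1 Y' p + b2 Y p * b2 Y' p + b3 Y p * b3 Y' p.
have sdot Y Y' : smooth_on U Y -> smooth_on U Y' -> smooth_on U (dot Y Y').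
  move=> sY sY'; have [y1 y2 y3] := smooth_b tau oU sF DF sY.
  have [z1 z2 z3] := smooth_b tau oU sF DF sY'.
  exact: (smoothD oU (smoothD oU (smoothM oU y1 z1) (smoothM oU y2 z2)) (smoothM oU y3 z3)).
have pos0 p : U p -> 0 < dot Y0 Y0 p.
  move=> Up; apply: sqr3_gt0 => //; apply/eqP => /rowP/(_ 0).
  by rewrite /Y0 /e0 !mxE /= => /eqP; rewrite oner_eq0.
pose d01 p := - dot Y0 Y1 p.
(* Orthogonalization free of divisions: |Y0|^2 Y1 - <Y0, Y1> Y0. Its second coordinate |Y0|^2 is
   positive, so it never vanishes. *)
pose Y2 p := dot Y0 Y0 p *: Y1 p + d01 p *: Y0 p.
have sd01 : smooth_on U d01 := smoothN oU (sdot _ _ s0 s1).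
have s2 : smooth_on U Y2 := smooth_comb (sdot _ _ s0 s0) sd01 s1 s0.
have pos2 p : U p -> 0 < dot Y2 Y2 p.
  move=> Up; apply: sqr3_gt0 => //; apply/eqP => /rowP/(_ 1).
  rewrite /Y2 /Y1 /Y0 /e0 /e1 !mxE /= mulr1 mulr0 addr0 => /eqP.
  by rewrite gt_eqF // pos0.
pose n0 p := (Num.sqrt (dot Y0 Y0 p))^-1; pose n2 p := (Num.sqrt (dot Y2 Y2 p))^-1.
have sn (f : 'rV[R]_2 -> R) : (forall p, U p -> 0 < f p) -> smooth_on U f ->
    smooth_on U (fun p => (Num.sqrt (f p))^-1).
  move=> f0 sf; apply: smoothV => //; last exact: smooth_sqrt.
  by move=> p Up; rewrite gt_eqF // sqrtr_gt0 f0.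
have sn0 : smooth_on U n0 := sn _ pos0 (sdot _ _ s0 s0).
have sn2 : smooth_on U n2 := sn _ pos2 (sdot _ _ s2 s2).
have z0 : smooth_on U (fun=> 0 : R) := smooth_cst _.
(* The zero summands give both fields the two-term shape of [b_field] and [smooth_comb]. *)
exists (fun p => n0 p *: Y0 p + 0 *: Y0 p), (fun p => n2 p *: Y2 p + 0 *: Y0 p).
have unit1 (g : R) : 0 < g -> (Num.sqrt g)^-1 ^+ 2 * g = 1.
  by move=> g0; rewrite exprVn sqr_sqrtr ?ltW // mulVf // gt_eqF.
have conv (x1 x2 x3 y1 y2 y3 t1 t2 t3 r1 r2 r3 : R) : x1 = t1 -> x2 = t2 -> x3 = t3 ->
    y1 = r1 -> y2 = r2 -> y3 = r3 -> x1 * y1 + x2 * y2 + x3 * y3 = t1 * r1 + t2 * r2 + t3 * r3.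
  by move=> -> -> -> -> -> ->.
have sq3 (n x1 x2 x3 y y' y'' : R) : n ^+ 2 * (x1 * x1 + x2 * x2 + x3 * x3) = 1 ->
    (n * x1 + 0 * y) * (n * x1 + 0 * y) + (n * x2 + 0 * y') * (n * x2 + 0 * y') +
    (n * x3 + 0 * y'') * (n * x3 + 0 * y'') = 1.
  by move=> <-; ring.
split; [exact: (smooth_comb sn0 z0 s0 s0)|exact: (smooth_comb sn2 z0 s2 s0)| | |] => p Up.
- have [E1 E2 E3] := b_field n0 (fun=> 0) Y0 Y0 Up.
  by refine (etrans (conv _ _ _ _ _ _ _ _ _ _ _ _ E1 E2 E3 E1 E2 E3) (sq3 _ _ _ _ _ _ _ (unit1 _ (pos0 _ Up)))).
- have [E1 E2 E3] := b_field n0 (fun=> 0) Y0 Y0 Up.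
  have [f1 f2 f3] := b_field n2 (fun=> 0) Y2 Y0 Up.
  have [h1 h2 h3] := b_field (dot Y0 Y0) d01 Y1 Y0 Up.
  refine (etrans (conv _ _ _ _ _ _ _ _ _ _ _ _ E1 E2 E3 f1 f2 f3) _).
  have alg (n m x1 x2 x3 y1 y2 y3 r1 r2 r3 t1 t2 t3 : R) : 
    r1 = (x1 * x1 + x2 * x2 + x3 * x3) * y1 + - (x1 * y1 + x2 * y2 + x3 * y3) * x1 ->
    r2 = (x1 * x1 + x2 * x2 + x3 * x3) * y2 + - (x1 * y1 + x2 * y2 + x3 * y3) * x2 ->
    r3 = (x1 * x1 + x2 * x2 + x3 * x3) * y3 + - (x1 * y1 + x2 * y2 + x3 * y3) * x3 ->
    (n * x1 + 0 * t1) * (m * r1 + 0 * t1) + (n * x2 + 0 * t2) * (m * r2 + 0 * t2)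
    + (n * x3 + 0 * t3) * (m * r3 + 0 * t3) = 0.
    by move=> -> -> ->; ring.
  exact: alg h1 h2 h3.
- have [E1 E2 E3] := b_field n2 (fun=> 0) Y2 Y0 Up.
  by refine (etrans (conv _ _ _ _ _ _ _ _ _ _ _ _ E1 E2 E3 E1 E2 E3) (sq3 _ _ _ _ _ _ _ (unit1 _ (pos2 _ Up)))).
Qed.

Section Normal.
Variables (X1 X2 : 'rV[R]_2 -> 'rV[R]_2).
Hypothesis orth : orthonormal_frame kappa tau U F X1 X2.
Local Notation m1 := (normal_cf1 kappa tau F X1 X2).
Local Notation m2 := (normal_cf2 kappa tau F X1 X2).
Local Notation m3 := (normal_cf3 kappa F X1 X2).

(** Found by inverting the coframe: the vector with components m1, m2, m3. *)
Definition frame_normal p : 'rV[R]_3 :=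
  vec3 (bcv_factor kappa (F p) * m1 p) (bcv_factor kappa (F p) * m2 p)
    (m3 p - tau * (ycoord (F p) * m1 p - xcoord (F p) * m2 p)).

Lemma frame_normalE p : U p -> [/\ cf1 kappa (F p) (frame_normal p) = m1 p,
  cf2 kappa (F p) (frame_normal p) = m2 p & cf3 kappa tau (F p) (frame_normal p) = m3 p].
Proof.
move=> Up; have l0 := lamF DF Up.
have [E1 E2 E3] : [/\ xcoord (frame_normal p) = bcv_factor kappa (F p) * m1 p,
    ycoord (frame_normal p) = bcv_factor kappa (F p) * m2 p &
    zcoord (frame_normal p) = m3 p - tau * (ycoord (F p) * m1 p - xcoord (F p) * m2 p)].
  by rewrite /xcoord /ycoord /zcoord !mxE.
rewrite /cf1 /cf2 /cf3 E1 E2 E3.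
move: (m1 p) (m2 p) (m3 p) (xcoord (F p)) (ycoord (F p)) (bcv_factor kappa (F p)) l0.
by move=> x y z s t l l0; split; field.
Qed.

Lemma frame_normal_unit_normal : unit_normal kappa tau U F frame_normal.
Proof.
have [sX1 sX2 o11 o12 o22] := orth.
have [ [sm1 sm2 sm3] _ _ _] := smooth_frame tau oU sF DF sX1 sX2.
have sl := smooth_lamF kappa oU sF.
split.
  apply: smooth_vec3 => //; [exact: (smoothM oU sl sm1)|exact: (smoothM oU sl sm2)|].
  apply: (smoothB oU sm3); apply: (smoothM oU (smooth_cst tau)).
  exact: (smoothB oU (smoothM oU (smooth_coord 1 oU sF) sm1) (smoothM oU (smooth_coord 0 oU sF) sm2)).
move=> p Up; have [e1 e2 e3] := frame_normalE Up; split.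
  rewrite bcv_inner e1 e2 e3; have q11 := o11 p Up; have q12 := o12 p Up; have q22 := o22 p Up.
  have alg (x1 x2 x3 y1 y2 y3 : R) : x1 * x1 + x2 * x2 + x3 * x3 = 1 ->
    x1 * y1 + x2 * y2 + x3 * y3 = 0 -> y1 * y1 + y2 * y2 + y3 * y3 = 1 ->
    (x2 * y3 - x3 * y2) * (x2 * y3 - x3 * y2) + (x3 * y1 - x1 * y3) * (x3 * y1 - x1 * y3)
    + (x1 * y2 - x2 * y1) * (x1 * y2 - x2 * y1) = 1.
    move=> r11 r12 r22; apply: (lin_comb3 r11 r12 r22 (c1 := y1 * y1 + y2 * y2 + y3 * y3)
      (c2 := - (x1 * y1 + x2 * y2 + x3 * y3)) (c3 := 1)); ring.
  exact: alg q11 q12 q22.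
move=> v; rewrite bcv_inner e1 e2 e3.
exact: (tangent_normal sF o11 o12 o22 v Up).
Qed.

Local Notation w1 := (frame_connection1 kappa tau F X1 X2).
Local Notation w2 := (frame_connection2 kappa tau F X1 X2).

Definition nabla_vanishes_on k := forall xi, unit_normal kappa tau U F xi ->
  forall Xs, size Xs = k.+2 -> (forall j, (j < size Xs)%N -> smooth_on U (nth 0 Xs j)) ->
  forall p, U p ->
  iter k (nabla (induced_metric kappa tau F)) (second_form_tensor kappa tau F xi) Xs p = 0.

Lemma words_vanish k : nabla_vanishes_on k -> forall s a b w, size s = k -> bundle U w ->
  word (@bZ R X1 X2 w1 w2) (@bH R X1 X2 w1 w2) s (bundle_form kappa tau F X1 X2 a b) w = 0.
Proof.
move=> par; have [sX1 sX2 o11 o12 o22] := orth.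
exact: (nabla_h_word oU sF iF DF sX1 sX2 o11 o12 o22 frame_normalE (par _ frame_normal_unit_normal)).
Qed.

Lemma vertical_or_horizontal_patch k : kappa <> 4 * tau ^+ 2 -> (0 < k)%N ->
  nabla_vanishes_on k -> forall p, U p -> m3 p ^+ 2 * (1 - m3 p ^+ 2) = 0.
Proof.
move=> c0 k0 par p Up; have [sX1 sX2 o11 o12 o22] := orth; have W := words_vanish par.
have sf := patch_surface_frame oU sF iF DF sX1 sX2 o11 o12 o22.
have Bw : bundle U (section_at 0 p) by rewrite /bundle /= base_section.
have mf := bundle_moving_frame sf.
have key := vertical_or_horizontal mf c0 k0 (fun s q ss Bq => W s false false q ss Bq)
  (fun s q ss Bq => W s false true q ss Bq) (fun s q ss Bq => W s true true q ss Bq) Bw.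
(* The normal component of the fibre direction is the same in all rotated frames, up to the factor
   cos^2 + sin^2. *)
have e := cs1 (section_at 0 p); move: key e; rewrite /rot1 /rot2 /lift base_section.
have alg (c s a1 a2 d1 d2 : R) :
    ((c * a1 + s * d1) * (- s * a2 + c * d2) - (c * a2 + s * d2) * (- s * a1 + c * d1)) ^+ 2 *
    (1 - ((c * a1 + s * d1) * (- s * a2 + c * d2) - (c * a2 + s * d2) * (- s * a1 + c * d1)) ^+ 2) = 0 ->
    c ^+ 2 + s ^+ 2 = 1 -> (a1 * d2 - a2 * d1) ^+ 2 * (1 - (a1 * d2 - a2 * d1) ^+ 2) = 0.
  have -> : (c * a1 + s * d1) * (- s * a2 + c * d2) - (c * a2 + s * d2) * (- s * a1 + c * d1)
    = (c ^+ 2 + s ^+ 2) * (a1 * d2 - a2 * d1) by ring.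
  by move=> H e; move: H; rewrite e mul1r.
exact: alg.
Qed.

End Normal.
End FrameExistence.

(** * Vertical and horizontal points *)

(** A frame-free condition, like [horizontal_at], so that points can be compared across patches. *)
Definition vertical_at (R : realType) (F : 'rV[R]_2 -> 'rV[R]_3) (u : 'rV[R]_2) :=
  exists2 v, v != 0 & hopf ('D_v F u) = 0.

Definition horizontal_at (R : realType) (kappa tau : R) (F : 'rV[R]_2 -> 'rV[R]_3)
    (u : 'rV[R]_2) := forall v, cf3 kappa tau (F u) ('D_v F u) = 0.

Lemma hopf_eq0 (R : realType) (w : 'rV[R]_3) : hopf w = 0 <-> xcoord w = 0 /\ ycoord w = 0.
Proof.
split=> [e|[e1 e2]].
  split; [have := congr1 (fun z : 'rV[R]_2 => z 0 0) e|have := congr1 (fun z : 'rV[R]_2 => z 0 1) e];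
    by rewrite /= !mxE.
by apply/rowP => -[[|[|j]] lt] //; rewrite /hopf e1 e2 !mxE.
Qed.

Section PatchPoints.
Context {R : realType}.
Variables (kappa tau : R) (U : set 'rV[R]_2) (F : 'rV[R]_2 -> 'rV[R]_3).
Hypotheses (oU : open U) (sF : smooth_on U F) (iF : injective_diff_on U F).
Hypothesis DF : forall p, U p -> bcv_domain kappa (F p).
Variables (X1 X2 : 'rV[R]_2 -> 'rV[R]_2).
Hypothesis orth : orthonormal_frame kappa tau U F X1 X2.
Local Notation b1 := (push_cf1 kappa F).
Local Notation b2 := (push_cf2 kappa F).
Local Notation b3 := (push_cf3 kappa tau F).
Local Notation m1 := (normal_cf1 kappa tau F X1 X2).
Local Notation m2 := (normal_cf2 kappa tau F X1 X2).
Local Notation m3 := (normal_cf3 kappa F X1 X2).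

(** The unit fibre direction has coframe components (0, 0, 1); its coefficients in the basis X1, X2,
    n are their third components. In particular m3 is nu. *)
Lemma e3_expand p : U p ->
  [/\ b3 X1 p * b1 X1 p + b3 X2 p * b1 X2 p + m3 p * m1 p = 0,
      b3 X1 p * b2 X1 p + b3 X2 p * b2 X2 p + m3 p * m2 p = 0 &
      b3 X1 p * b3 X1 p + b3 X2 p * b3 X2 p + m3 p * m3 p = 1].
Proof.
move=> Up; have [_ _ o11 o12 o22] := orth.
have [E1 E2 E3] := orthonormal_expand 0 0 1 (o11 p Up) (o12 p Up) (o22 p Up).
have alg (a d m t x1 x2 y1 y2 z1 z2 r A B C : R) :
  t = (0 * x1 + 0 * x2 + 1 * a) * A + (0 * y1 + 0 * y2 + 1 * d) * B + (0 * z1 + 0 * z2 + 1 * m) * C ->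
  a * A + d * B + m * C = t by move=> ->; ring.
by split; [exact: alg E1|exact: alg E2|exact: alg E3].
Qed.

Lemma hopf_push v p : U p -> hopf ('D_v F p) = 0 <-> b1 (cst v) p = 0 /\ b2 (cst v) p = 0.
Proof.
move=> Up; have l0 := lamF DF Up; apply: (iff_trans (hopf_eq0 _)).
have divE (x l : R) : l != 0 -> x = 0 <-> x / l = 0.
  move=> l1; split=> [->|/eqP]; first by rewrite mul0r.
  by rewrite mulf_eq0 invr_eq0 (negbTE l1) orbF => /eqP.
have e1 := divE (xcoord ('D_v F p)) _ l0; have e2 := divE (ycoord ('D_v F p)) _ l0.
split=> -[h1 h2]; first exact: (conj (e1.1 h1) (e2.1 h2)).
exact: (conj (e1.2 h1) (e2.2 h2)).
Qed.

Lemma vertical_atP p : U p -> vertical_at F p <-> m3 p = 0.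
Proof.
move=> Up; have [sX1 sX2 o11 o12 o22] := orth; split.
  case=> v v0 /(hopf_push v Up)[z1 z2].
  have tn := tangent_normal sF o11 o12 o22 v Up.
  have z3 : b3 (cst v) p != 0.
    apply: contraNN v0 => /eqP z3; apply/eqP.
    exact: (b_inj iF DF Up z1 z2 z3).
  have alg (x1 x2 x3 n1 n2 n3 : R) : x1 * n1 + x2 * n2 + x3 * n3 = 0 -> x1 = 0 -> x2 = 0 ->
      x3 != 0 -> n3 = 0.
    move=> + x10 x20 x30; rewrite x10 x20 !mul0r !add0r => /eqP.
    by rewrite mulf_eq0 (negbTE x30) => /eqP.
  exact: alg tn z1 z2 z3.
move=> z; have [E1 E2 E3] := e3_expand Up.
have [f1 f2 f3] := b_comb kappa tau sF (X1 p) (X2 p) (b3 X1 p) (b3 X2 p) Up.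
(* If nu = 0, the tangential part of the fibre direction is the fibre direction itself. *)
set v := _ *: _ + _ in f1 f2 f3.
have alg (x y m t r : R) : x + y + m * t = r -> m = 0 -> x + y = r.
  by move=> + m0; rewrite m0 mul0r addr0.
have B1 : b1 (cst v) p = 0 := etrans f1 (alg _ _ _ _ _ E1 z).
have B2 : b2 (cst v) p = 0 := etrans f2 (alg _ _ _ _ _ E2 z).
have B3 : b3 (cst v) p = 1 := etrans f3 (alg _ _ _ _ _ E3 z).
exists v; last by apply/(hopf_push v Up).
apply/eqP => v0.
have [_ _ z3] := b_comb kappa tau sF 0 0 0 0 Up; move: B3.
have -> : v = 0 *: 0 + 0 *: 0 by rewrite v0 !scale0r addr0.
have abs (x a b : R) : x = 0 * a + 0 * b -> x = 1 -> False.
  by rewrite !mul0r addr0 => -> /eqP; rewrite eq_sym oner_eq0.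
exact: abs z3.
Qed.

Lemma horizontal_atP p : U p -> horizontal_at kappa tau F p <-> m3 p ^+ 2 = 1.
Proof.
move=> Up; have [sX1 sX2 o11 o12 o22] := orth; have [_ _ E3] := e3_expand Up; split.
  move=> h; have h1 : b3 X1 p = 0 := h (X1 p); have h2 : b3 X2 p = 0 := h (X2 p).
  by move: E3; rewrite h1 h2 !mul0r !add0r.
move=> z; have [z1 z2] : b3 X1 p = 0 /\ b3 X2 p = 0.
  have alg (x y m : R) : x * x + y * y + m * m = 1 -> m ^+ 2 = 1 -> x = 0 /\ y = 0.
    rewrite -!expr2 => + m1; rewrite m1 => /eqP; rewrite -subr_eq0 addrK.
    rewrite paddr_eq0 ?sqr_ge0 // !sqrf_eq0 => /andP[/eqP -> /eqP ->]; by split.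
  exact: alg E3 z.
move=> v; have [c [d vE]] := frame_span sF o11 o12 o22 v Up.
have [_ _ f3] := b_comb kappa tau sF (X1 p) (X2 p) c d Up.
have alg (x a b : R) : x = c * a + d * b -> a = 0 -> b = 0 -> x = 0.
  by move=> -> -> ->; rewrite !mulr0 addr0.
rewrite vE; exact: alg f3 z1 z2.
Qed.

End PatchPoints.

(** * The dichotomy on a connected surface *)

Section Dichotomy.
Context {R : realType}.
Variables (kappa tau : R) (M : surface R) (f : M -> 'rV[R]_3).
Hypothesis imm : immersion_bcv kappa f.
Implicit Types (i j : patch M) (u v : 'rV[R]_2).

Lemma surface_transition i j u v : dom i u -> dom j v -> par i u = par j v ->
  exists (O : set 'rV[R]_2) (phi : 'rV[R]_2 -> 'rV[R]_2),
    [/\ open O, O u, O `<=` dom i, smooth_on O phi & phi u = v] /\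
    forall w, O w -> dom j (phi w) /\ par j (phi w) = par i w.
Proof.
move=> du dv e; have [phi sphi phiE] := @par_transition _ M i j.
have oj : open (par j @` dom j) by apply: (par_open (dom_open (i := j))).
set D := _ `&` _ in sphi phiE.
have nD w : D w -> nbhs w D.
  move=> [dw jw]; apply: filterI; first exact: open_nbhs_nbhs (conj (dom_open (i := i)) dw).
  by apply: (par_continuous dw); exact: open_nbhs_nbhs.
have Du : D u by split=> //; exists v.
have oD : open D by rewrite openE => w /nD.
have phiu : phi u = v by have [d1 d2] := phiE u Du; apply: (par_inj d1 dv); rewrite d2.
exists D, phi; split=> //; split=> //.
by move=> w [].
Qed.

Lemma derive_transition i j u v : dom i u -> dom j v -> par i u = par j v ->
  exists2 phi : 'rV[R]_2 -> 'rV[R]_2, f (par i u) = f (par j v) &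
  forall w, 'D_w (f \o par i) u = 'D_('D_w phi u) (f \o par j) v.
Proof.
move=> du dv e; have [Q [phi [ [oO Ou Odom sphi phiu] phiE] ] ] := surface_transition du dv e.
exists phi; first by rewrite e.
have [sj _ _] := imm j.
move=> w; rewrite -phiu -(derive_comp (f := f \o par j)); last 2 first.
- exact: smooth_on_diff sphi Ou.
- by apply: (smooth_on_diff sj); rewrite phiu.
apply: near_eq_derive; apply: (near_eq_open oO Ou) => q Oq /=.
by have [_ ->] := phiE q Oq.
Qed.

(** A tangent vector along the fibre has vanishing first two components, and at a horizontal point
    also the third; the chain rule carries it from one patch to the other. *)
Lemma not_vertical_horizontal i j u v : dom i u -> dom j v -> par i u = par j v ->
  vertical_at (f \o par i) u -> horizontal_at kappa tau (f \o par j) v -> False.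
Proof.
move=> du dv e [w w0 hw] hor; have [phi fe De] := derive_transition du dv e.
have [_ inj Di] := imm i.
move/eqP: w0; apply; apply: (inj u du); have [x0 y0] := (hopf_eq0 _).1 hw.
have l0 : bcv_factor kappa (f (par i u)) != 0 by exact: lt0r_neq0 (Di u du).
apply: (cf_eq0 (kappa := kappa) (tau := tau) l0).
- by rewrite /cf1 x0 mul0r.
- by rewrite /cf2 y0 mul0r.
- by rewrite De /= fe; exact: hor.
Qed.

Lemma connected_surface (S : set M) : S !=set0 -> open S -> open (~` S) -> S = setT.
Proof.
move=> S0 oS oC; apply: (@surface_connected _ M) => //.
  by exists S => //; rewrite setTI.
by exists S; rewrite ?setTI // -openC.
Qed.

(** As nu^2 takes only the values 0 and 1, nu = 0 is the open condition nu^2 <> 1, and nu^2 = 1 the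
    open condition nu^2 <> 0; connectedness leaves one of them. *)
Lemma vertical_or_horizontal_surface k : kappa <> 4 * tau ^+ 2 -> (0 < k)%N ->
  k_parallel kappa tau k f ->
  (forall i u, dom i u -> vertical_at (f \o par i) u) \/
  (forall i u, dom i u -> horizontal_at kappa tau (f \o par i) u).
Proof.
move=> c0 k0 kp.
pose S0 := [set m | exists i u, [/\ dom i u, par i u = m & vertical_at (f \o par i) u] ].
pose S1 := [set m | exists i u, [/\ dom i u, par i u = m & horizontal_at kappa tau (f \o par i) u] ].
(* The function nu belongs to a patch and a frame; what passes between patches are the two point
   conditions. *)
have patch_frame i : exists nu : 'rV[R]_2 -> R, smooth_on (dom i) nu /\ forall u, dom i u ->
    [/\ vertical_at (f \o par i) u <-> nu u = 0,
        horizontal_at kappa tau (f \o par i) u <-> nu u ^+ 2 = 1 &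
        nu u ^+ 2 * (1 - nu u ^+ 2) = 0].
  have [sF iF DF] := imm i; have oU := dom_open (i := i).
  have [X1 [X2 orth] ] := orthonormal_frame_exists tau oU sF iF DF.
  have [sX1 sX2 _ _ _] := orth.
  have [ [_ _ sm3] _ _ _] := smooth_frame tau oU sF DF sX1 sX2.
  exists (normal_cf3 kappa (f \o par i) X1 X2); split=> // u du; split.
  - exact: vertical_atP orth u du.
  - exact: horizontal_atP orth u du.
  - exact: (vertical_or_horizontal_patch oU sF iF DF orth c0 k0 (kp i) du).
have cov m : S0 m \/ S1 m.
  have [i [u du <-] ] := par_cover m; have [nu [_ nuP] ] := patch_frame i.
  have [v h e] := nuP u du; move/eqP: e; rewrite mulf_eq0 sqrf_eq0 subr_eq0 => /orP[/eqP e|/eqP e].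
    by left; exists i, u; split=> //; apply/v.
  by right; exists i, u; split=> //; apply/h.
have dis m : S0 m -> S1 m -> False.
  move=> [i [u [du <- vu] ] ] [j [v [dv e hv] ] ]; exact: (not_vertical_horizontal du dv (esym e) vu hv).
have opn (P : forall i, 'rV[R]_2 -> Prop) (c : R) :
    (forall i (nu : 'rV[R]_2 -> R), smooth_on (dom i) nu -> (forall u, dom i u ->
      [/\ vertical_at (f \o par i) u <-> nu u = 0,
        horizontal_at kappa tau (f \o par i) u <-> nu u ^+ 2 = 1 &
        nu u ^+ 2 * (1 - nu u ^+ 2) = 0]) -> forall u, dom i u -> (P i u <-> nu u ^+ 2 != c)) ->
    open [set m | exists i u, [/\ dom i u, par i u = m & P i u] ].
  move=> PE.
  have -> : [set m | exists i u, [/\ dom i u, par i u = m & P i u] ] =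
      \bigcup_i (par i @` [set u | dom i u /\ P i u]).
    apply/seteqP; split=> m.
      by move=> [i [u [du um Pu] ] ]; exists i => //; exists u.
    by move=> [i _ [u [du Pu] um] ]; exists i, u.
  apply: bigcup_open => i _; apply: par_open; last by move=> u [].
  have [nu [snu nuP] ] := patch_frame i; have PEi := PE i nu snu nuP.
  rewrite openE => u [du Pu].
  have cnu : {for u, continuous (fun u => nu u ^+ 2)}.
    apply: differentiable_continuous; exact: (smooth_on_diff (smoothX 2 (dom_open (i := i)) snu) du).
  have n1 : \forall w \near u, dom i w by exact: open_nbhs_nbhs (conj (dom_open (i := i)) du).
  have n2 : \forall w \near u, nu w ^+ 2 != c.
    apply: (cnu [set z | z != c]); apply: open_nbhs_nbhs; split; last exact/PEi.
    exact: open_neq.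
  rewrite /interior /=; near=> w.
  have dw : dom i w by near: w.
  by split=> //; apply/PEi => //; near: w.
have o0 : open S0.
  apply: (opn (fun i u => vertical_at (f \o par i) u) 1) => i nu snu nuP u du.
  have [v h e] := nuP u du; split=> [/v -> |n1]; first by rewrite expr0n eq_sym oner_eq0.
  apply/v; move/eqP: e; rewrite mulf_eq0 sqrf_eq0 subr_eq0 [1 == _]eq_sym (negbTE n1) orbF.
  by move/eqP.
have o1 : open S1.
  apply: (opn (fun i u => horizontal_at kappa tau (f \o par i) u) 0) => i nu snu nuP u du.
  have [v h e] := nuP u du; split=> [/h -> |n1]; first by rewrite oner_eq0.
  by apply/h; move/eqP: e; rewrite mulf_eq0 (negbTE n1) subr_eq0 => /eqP.
have C0 : ~` S0 = S1.
  apply/seteqP; split=> m; first by case: (cov m).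
  by move=> h1 h0; exact: dis h0 h1.
case: (pselect (S0 !=set0)) => [S0n|S0e].
  left; have E : S0 = setT by apply: connected_surface => //; rewrite C0.
  move=> i u du; have : S0 (par i u) by rewrite E.
  have [nu [_ nuP] ] := patch_frame i; have [v h e] := nuP u du.
  move=> Su; move/eqP: e; rewrite mulf_eq0 sqrf_eq0 subr_eq0 => /orP[/eqP e|/eqP e]; first exact/v.
  by case: (dis (par i u) Su); exists i, u; split=> //; apply/h.
right=> i u du; have [nu [_ nuP] ] := patch_frame i; have [v h e] := nuP u du.
move/eqP: e; rewrite mulf_eq0 sqrf_eq0 subr_eq0 => /orP[/eqP e|/eqP e]; last exact/h.
by case: S0e; exists (par i u), i, u; split=> //; apply/v.
Unshelve. all: by end_near.
Qed.

End Dichotomy.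

(** * Horizontal surfaces are totally geodesic leaves *)

Section HorizontalPatch.
Context {R : realType}.
Variables (kappa tau : R) (U : set 'rV[R]_2) (F : 'rV[R]_2 -> 'rV[R]_3).
Hypotheses (oU : open U) (sF : smooth_on U F) (iF : injective_diff_on U F).
Hypothesis DF : forall p, U p -> bcv_domain kappa (F p).
Hypothesis hor : forall p, U p -> horizontal_at kappa tau F p.

(** The third components of X1 and X2 vanish identically, hence so do their derivatives (h12 + tau)
    nu along X2 and (h12 - tau) nu along X1; as nu^2 = 1, subtracting gives 2 tau = 0. This is the
    integrability condition of the horizontal planes. *)
Lemma horizontal_tau0 p : U p -> tau = 0.
Proof.
move=> Up; have [X1 [X2 orth] ] := orthonormal_frame_exists tau oU sF iF DF.
have [sX1 sX2 o11 o12 o22] := orth.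
have [_ [_ _ T1] ] := frame_table1 oU sF iF DF sX1 sX2 o11 o12 o22 Up.
have [ [_ _ T2] _] := frame_table2 oU sF DF sX1 sX2 o11 o12 o22 Up.
have z X q : U q -> push_cf3 kappa tau F X q = 0 by move=> Uq; exact: hor.
have l0 X Y : lie Y (push_cf3 kappa tau F X) p = 0.
  by rewrite (eq_lie Y oU Up (fun q => z X q)) lie_cst.
have m3E := (horizontal_atP sF orth Up).1 (hor Up).
have alg (l l' d a o o' k m : R) : l = o * d + (k + tau) * m -> l' = - o' * a + (k - tau) * m ->
    l = 0 -> l' = 0 -> d = 0 -> a = 0 -> m ^+ 2 = 1 -> tau = 0.
  move=> E E' z1 z2 z3 z4 mm; move: E E'; rewrite z1 z2 z3 z4 => E E'.
  by apply: (lin_comb3 mm E E' (c1 := - tau) (c2 := - m / 2) (c3 := m / 2)); field.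
exact: alg T1 T2 (l0 _ _) (l0 _ _) (z _ _ Up) (z _ _ Up) m3E.
Qed.

Lemma horizontal_normal xi p : unit_normal kappa tau U F xi -> U p ->
  cf1 kappa (F p) (xi p) = 0 /\ cf2 kappa (F p) (xi p) = 0.
Proof.
move=> [_ nxi] Up; have [X1 [X2 orth] ] := orthonormal_frame_exists tau oU sF iF DF.
have [sX1 sX2 o11 o12 o22] := orth; have [_ n0] := nxi p Up.
have n1 := etrans (esym (bcv_inner _ _ _ _ _)) (n0 (X1 p)).
have n2 := etrans (esym (bcv_inner _ _ _ _ _)) (n0 (X2 p)).
have za : push_cf3 kappa tau F X1 p = 0 := hor Up (X1 p).
have zd : push_cf3 kappa tau F X2 p = 0 := hor Up (X2 p).
have [E1 E2 _] := orthonormal_expand (cf1 kappa (F p) (xi p)) (cf2 kappa (F p) (xi p))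
  (cf3 kappa tau (F p) (xi p)) (o11 p Up) (o12 p Up) (o22 p Up).
have alg (x1 x2 x3 a1 a2 a3 d1 d2 d3 A D M m t : R) : a1 * x1 + a2 * x2 + a3 * x3 = 0 ->
   d1 * x1 + d2 * x2 + d3 * x3 = 0 -> m = 0 ->
   t = (x1 * a1 + x2 * a2 + x3 * a3) * A + (x1 * d1 + x2 * d2 + x3 * d3) * D + M * m -> t = 0.
  move=> e1 e2 -> ->; apply: (lin_comb2 e1 e2 (c1 := A) (c2 := D)); ring.
have prod0 (x y z w : R) : y = 0 -> z = 0 -> x * y - z * w = 0.
  by move=> -> ->; rewrite mulr0 mul0r subr0.
have prod0' (x y z w : R) : x = 0 -> w = 0 -> x * y - z * w = 0.
  by move=> -> ->; rewrite mulr0 mul0r subr0.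
split; first exact: alg n1 n2 (prod0 _ _ _ _ zd za) E1.
exact: alg n1 n2 (prod0' _ _ _ _ za zd) E2.
Qed.

(** The normal is a multiple of the fibre direction, and the third component of the ambient
    derivative of dF(Y) is the derivative of the zero function, the term with tau being zero. *)
Lemma horizontal_second_form xi X Y p : unit_normal kappa tau U F xi -> U p -> smooth_on U Y ->
  second_form kappa tau F xi X Y p = 0.
Proof.
move=> nxi Up sY; rewrite (second_form_frame tau oU sF DF xi X Up sY).
have [z1 z2] := horizontal_normal nxi Up.
have n3 : nabla_cf3 kappa tau F (X p) Y p = 0.
  have d0 : 'D_(X p) (push_cf3 kappa tau F Y) p = 0.
    refine (etrans (near_eq_derive _ (near_eq_open oU Up (g := fun=> 0 : R) _)) (derive_cst _ _ _)).
    by move=> q Uq; exact: hor.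
  have alg (d x y : R) : d = 0 -> tau = 0 -> d + tau * (x - y) = 0.
    by move=> -> ->; rewrite mul0r addr0.
  exact: alg d0 (horizontal_tau0 Up).
have alg (x y z a b c : R) : a = 0 -> b = 0 -> z = 0 -> x * a + y * b + z * c = 0.
  by move=> -> -> ->; rewrite !mulr0 mul0r !addr0.
exact: alg z1 z2 n3.
Qed.

End HorizontalPatch.

Section Horizontal.
Context {R : realType}.
Variables (kappa tau : R) (M : surface R) (f : M -> 'rV[R]_3).
Hypothesis imm : immersion_bcv kappa f.
Hypothesis hor : forall (i : patch M) u, dom i u -> horizontal_at kappa tau (f \o par i) u.

Lemma horizontal_hopf_leaf : hopf_leaf kappa tau f.
Proof.
move=> i u du v w /hopf_eq0 [x0 y0]; rewrite bcv_inner (hor du) mul0r addr0.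
by rewrite {2}/cf1 {2}/cf2 x0 y0 !mul0r !mulr0 addr0.
Qed.

Lemma horizontal_totally_geodesic : totally_geodesic kappa tau f.
Proof.
move=> i xi nxi [//|X [//|Y [|? ?] ] ] // _ sXs p dp; have [sF iF DF] := imm i.
apply: (horizontal_second_form (dom_open (i := i)) sF iF DF (@hor i) _ nxi dp).
exact: (sXs 1%N).
Qed.

Lemma horizontal_tau : tau = 0.
Proof.
have [m _] := surface_nonempty M; have [i [u du _] ] := par_cover m.
have [sF iF DF] := imm i.
exact: (horizontal_tau0 (dom_open (i := i)) sF iF DF (@hor i) du).
Qed.

End Horizontal.

Lemma open_part_refl (R : realType) (M : surface R) (f : M -> 'rV[R]_3) : open_part f f.
Proof.
move=> i u du; exists i, (dom i), id; split; last by [].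
split=> //; [exact: dom_open| |].
  by apply: smooth_row => [|j]; [exact: dom_open|apply: smooth_id_coord; exact: dom_open].
by move=> p _ v; rewrite derive_id.
Qed.

(** * Vertical patches *)

(** The data from which the curve is recovered: X1 is the unit field orthogonal to the fibres, X2
    the fibre direction, (a, b) the direction of the projected curve and c = h(X1, X1). The
    derivatives of x, y, a, b along X1 form [frenet_field]. *)
Record cylinder_frame (R : realType) (kappa : R) (k : nat) (U : set 'rV[R]_2)
    (X1 X2 : 'rV[R]_2 -> 'rV[R]_2) (x y a b c : 'rV[R]_2 -> R) := CylinderFrame {
  cy_X1 : smooth_on U X1; cy_X2 : smooth_on U X2;
  cy_x : smooth_on U x; cy_y : smooth_on U y;
  cy_a : smooth_on U a; cy_b : smooth_on U b; cy_c : smooth_on U c;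
  cy_unit : forall p, U p -> a p ^+ 2 + b p ^+ 2 = 1;
  cy_x1 : forall p, U p -> lie X1 x p = (1 + kappa / 4 * (x p ^+ 2 + y p ^+ 2)) * a p;
  cy_y1 : forall p, U p -> lie X1 y p = (1 + kappa / 4 * (x p ^+ 2 + y p ^+ 2)) * b p;
  cy_a1 : forall p, U p -> lie X1 a p = (c p + kappa / 2 * (y p * a p - x p * b p)) * b p;
  cy_b1 : forall p, U p -> lie X1 b p = - ((c p + kappa / 2 * (y p * a p - x p * b p)) * a p);
  cy_x2 : forall p, U p -> lie X2 x p = 0; cy_y2 : forall p, U p -> lie X2 y p = 0;
  cy_a2 : forall p, U p -> lie X2 a p = 0; cy_b2 : forall p, U p -> lie X2 b p = 0;
  cy_c2 : forall j p, U p -> lie X2 (iter j (lie X1) c) p = 0;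
  cy_ck : forall p, U p -> iter k (lie X1) c p = 0;
  cy_bracket : forall p j, U p ->
    lie X1 (fun q => X2 q 0 j) p = lie X2 (fun q => X1 q 0 j) p;
  cy_basis : forall p, U p -> X1 p 0 0 * X2 p 0 1 - X1 p 0 1 * X2 p 0 0 != 0
}.

(** * Adapted frames on vertical patches *)

Section Adapted.
Context {R : realType}.
Variables (kappa tau : R) (U : set 'rV[R]_2) (F : 'rV[R]_2 -> 'rV[R]_3).
Hypotheses (oU : open U) (sF : smooth_on U F) (iF : injective_diff_on U F).
Hypothesis DF : forall p, U p -> bcv_domain kappa (F p).
Local Notation b1 := (push_cf1 kappa F).
Local Notation b2 := (push_cf2 kappa F).
Local Notation b3 := (push_cf3 kappa tau F).

Definition adapted_frame (X1 X2 : 'rV[R]_2 -> 'rV[R]_2) :=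
  forall p, U p -> [/\ b3 X1 p = 0, b1 X2 p = 0, b2 X2 p = 0 & b3 X2 p = 1].

(** With nu = 0 the coefficients (t1, t2) of the fibre direction in X1, X2 form a unit vector; the
    new frame is t2 X1 - t1 X2 and t1 X1 + t2 X2, whose second field maps to the fibre direction. *)
Lemma adapted_frame_exists : (forall p, U p -> vertical_at F p) ->
  exists X1 X2, orthonormal_frame kappa tau U F X1 X2 /\ adapted_frame X1 X2.
Proof.
move=> ver; have [X1 [X2 orth] ] := orthonormal_frame_exists tau oU sF iF DF.
have [sX1 sX2 o11 o12 o22] := orth.
have m0 p (Up : U p) := (vertical_atP sF iF DF orth Up).1 (ver p Up).
have [_ _ s13] := smooth_b tau oU sF DF sX1; have [_ _ s23] := smooth_b tau oU sF DF sX2.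
pose n13 p := - b3 X1 p; have sn13 : smooth_on U n13 := smoothN oU s13.
have E p (Up : U p) := e3_expand orth Up.
have B1 p (Up : U p) := b_field kappa tau sF (b3 X2) n13 X1 X2 Up.
have B2 p (Up : U p) := b_field kappa tau sF (b3 X1) (b3 X2) X1 X2 Up.
have drop (z m t r : R) : z + m * t = r -> m = 0 -> z = r by move=> + m00; rewrite m00 mul0r addr0.
exists (fun p => b3 X2 p *: X1 p + n13 p *: X2 p), (fun p => b3 X1 p *: X1 p + b3 X2 p *: X2 p).
have conv (x1 x2 x3 y1 y2 y3 t1 t2 t3 r1 r2 r3 : R) : x1 = t1 -> x2 = t2 -> x3 = t3 ->
    y1 = r1 -> y2 = r2 -> y3 = r3 -> x1 * y1 + x2 * y2 + x3 * y3 = t1 * r1 + t2 * r2 + t3 * r3.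
  by move=> -> -> -> -> -> ->.
split.
- split; [exact: (smooth_comb oU s23 sn13 sX1 sX2)|exact: (smooth_comb oU s13 s23 sX1 sX2)| | |] => p Up.
  + have [f1 f2 f3] := B1 p Up; refine (etrans (conv _ _ _ _ _ _ _ _ _ _ _ _ f1 f2 f3 f1 f2 f3) _).
    have [_ _ E3] := E p Up.
    have alg (x1 x2 x3 y1 y2 y3 m : R) : x1 * x1 + x2 * x2 + x3 * x3 = 1 ->
      x1 * y1 + x2 * y2 + x3 * y3 = 0 -> y1 * y1 + y2 * y2 + y3 * y3 = 1 ->
      x3 * x3 + y3 * y3 = 1 ->
      (y3 * x1 + - x3 * y1) * (y3 * x1 + - x3 * y1) + (y3 * x2 + - x3 * y2) * (y3 * x2 + - x3 * y2)
      + (y3 * x3 + - x3 * y3) * (y3 * x3 + - x3 * y3) = 1.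
      move=> r11 r12 r22 e; apply: (lin_comb4 r11 r12 r22 e (c1 := y3 ^+ 2) (c2 := - 2 * y3 * x3)
        (c3 := x3 ^+ 2) (c4 := 1)); ring.
    exact: (alg _ _ _ _ _ _ 0 (o11 p Up) (o12 p Up) (o22 p Up) (drop _ _ _ _ E3 (m0 p Up))).
  + have [f1 f2 f3] := B1 p Up; have [g1 g2 g3] := B2 p Up.
    refine (etrans (conv _ _ _ _ _ _ _ _ _ _ _ _ f1 f2 f3 g1 g2 g3) _).
    have alg (x1 x2 x3 y1 y2 y3 : R) : x1 * x1 + x2 * x2 + x3 * x3 = 1 ->
      x1 * y1 + x2 * y2 + x3 * y3 = 0 -> y1 * y1 + y2 * y2 + y3 * y3 = 1 ->
      (y3 * x1 + - x3 * y1) * (x3 * x1 + y3 * y1) + (y3 * x2 + - x3 * y2) * (x3 * x2 + y3 * y2)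
      + (y3 * x3 + - x3 * y3) * (x3 * x3 + y3 * y3) = 0.
      move=> r11 r12 r22; apply: (lin_comb3 r11 r12 r22 (c1 := x3 * y3)
        (c2 := y3 ^+ 2 - x3 ^+ 2) (c3 := - x3 * y3)); ring.
    exact: alg (o11 p Up) (o12 p Up) (o22 p Up).
  + have [g1 g2 g3] := B2 p Up; have [E1 E2 E3] := E p Up.
    refine (etrans (conv _ _ _ _ _ _ _ _ _ _ _ _ g1 g2 g3 g1 g2 g3) _).
    have z := m0 p Up.
    have alg (x1 x2 x3 : R) : x1 = 0 -> x2 = 0 -> x3 = 1 -> x1 * x1 + x2 * x2 + x3 * x3 = 1.
      by move=> -> -> ->; rewrite !mul0r mul1r !add0r.
    exact: alg (drop _ _ _ _ E1 z) (drop _ _ _ _ E2 z) (drop _ _ _ _ E3 z).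
- move=> p Up; have [_ _ f3] := B1 p Up; have [g1 g2 g3] := B2 p Up; have [E1 E2 E3] := E p Up.
  have z := m0 p Up; have com (x y : R) : x * y + - y * x = 0 by ring.
  split; [exact: (etrans f3 (com _ _))|exact: (etrans g1 (drop _ _ _ _ E1 z))
   |exact: (etrans g2 (drop _ _ _ _ E2 z))|exact: (etrans g3 (drop _ _ _ _ E3 z))].
Qed.

Section Frame.
Variables X1 X2 : 'rV[R]_2 -> 'rV[R]_2.
Hypothesis orth : orthonormal_frame kappa tau U F X1 X2.
Hypothesis ad : adapted_frame X1 X2.
Local Notation k11 := (frame_form11 kappa tau F X1 X2).
Local Notation k12 := (frame_form12 kappa tau F X1 X2).
Local Notation k22 := (frame_form22 kappa tau F X1 X2).
Local Notation w1 := (frame_connection1 kappa tau F X1 X2).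
Local Notation w2 := (frame_connection2 kappa tau F X1 X2).
Local Notation x := (fun q => xcoord (F q)).
Local Notation y := (fun q => ycoord (F q)).

Lemma adapted_unit p : U p -> b1 X1 p ^+ 2 + b2 X1 p ^+ 2 = 1.
Proof.
move=> Up; have [_ _ o11 _ _] := orth; have [z _ _ _] := ad Up.
have alg (r s t : R) : r * r + s * s + t * t = 1 -> t = 0 -> r ^+ 2 + s ^+ 2 = 1.
  by move=> + t0; rewrite t0 mulr0 addr0.
exact: alg (o11 p Up) z.
Qed.

(** The components of X2 and the third component of X1 are constant, so their rows in the general
    tables become equations that determine w1, w2, k12 and k22, as (b1 X1, b2 X1) is a unit
    vector. *)
Lemma adapted_table p : U p ->
  [/\ w1 p = 0, w2 p = 0, k12 p = tau & k22 p = 0] /\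
  [/\ lie X1 (b1 X1) p = (k11 p + kappa / 2 * (ycoord (F p) * b1 X1 p - xcoord (F p) * b2 X1 p)) * b2 X1 p,
      lie X1 (b2 X1) p = - ((k11 p + kappa / 2 * (ycoord (F p) * b1 X1 p - xcoord (F p) * b2 X1 p)) * b1 X1 p),
      lie X2 (b1 X1) p = 0 & lie X2 (b2 X1) p = 0].
Proof.
move=> Up; have [sX1 sX2 o11 o12 o22] := orth.
have [ [A1 A2 A3] [A4 A5 A6] ] := frame_table1 oU sF iF DF sX1 sX2 o11 o12 o22 Up.
have [ [D1 D2 _] [D4 D5 _] ] := frame_table2 oU sF DF sX1 sX2 o11 o12 o22 Up.
have [a3 d1 d2 d3] := ad Up; have un := adapted_unit Up.
have lc X g (c : R) : (forall q, U q -> g q = c) -> lie X g p = 0.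
  by move=> gc; rewrite (eq_lie X oU Up gc) lie_cst.
have la3 X : lie X (b3 X1) p = 0 by apply: (lc X _ 0) => q /ad[].
have ld1 X : lie X (b1 X2) p = 0 by apply: (lc X _ 0) => q /ad[].
have ld2 X : lie X (b2 X2) p = 0 by apply: (lc X _ 0) => q /ad[].
have zero2 (q a b : R) : q * a = 0 -> q * b = 0 -> a ^+ 2 + b ^+ 2 = 1 -> q = 0.
  move=> h1 h2 h3; apply: (lin_comb3 h1 h2 h3 (c1 := a) (c2 := b) (c3 := - q)); ring.
have algw (l o d3' K a1 a2 d1' d2' : R) : l = o * d3' + K * (a1 * d2' - a2 * d1') ->
    l = 0 -> d3' = 1 -> d1' = 0 -> d2' = 0 -> o = 0.
  by move=> + l0 e3 e1 e2; rewrite l0 e3 e1 e2 !mulr0 subrr mulr0 addr0 mulr1 => ->.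
have W1 : w1 p = 0 := algw _ _ _ _ _ _ _ _ A3 (la3 _) d3 d1 d2.
have W2 : w2 p = 0 := algw _ _ _ _ _ _ _ _ A6 (la3 _) d3 d1 d2.
have algk1 (l o a1 K a2 a3' d2' d3' s : R) : l = - o * a1 + K * (a2 * d3' - a3' * d2') + s * d2' ->
    l = 0 -> o = 0 -> d3' = 1 -> a3' = 0 -> d2' = 0 -> K * a2 = 0.
  by move=> + l0 o0 e3 e1 e2; rewrite l0 o0 e3 e1 e2 !(mulr0,mul0r,subr0,mulr1,oppr0,add0r,addr0) => <-.
have algk2 (l o a1 K a2 a3' d1' d3' s : R) : l = - o * a2 + K * (a3' * d1' - a1 * d3') - s * d1' ->
    l = 0 -> o = 0 -> d3' = 1 -> a3' = 0 -> d1' = 0 -> K * a1 = 0.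
  move=> + l0 o0 e3 e1 e2; rewrite l0 o0 e3 e1 e2.
  by move=> h; apply: (lin_comb1 h (c := 1)); ring.
have K12 : k12 p - tau = 0.
  exact: zero2 (algk2 _ _ _ _ _ _ _ _ _ D2 (ld2 _) W1 d3 a3 d1)
     (algk1 _ _ _ _ _ _ _ _ _ D1 (ld1 _) W1 d3 a3 d2) un.
have K22 : k22 p = 0.
  exact: zero2 (algk2 _ _ _ _ _ _ _ _ _ D5 (ld2 _) W2 d3 a3 d1)
     (algk1 _ _ _ _ _ _ _ _ _ D4 (ld1 _) W2 d3 a3 d2) un.
have K12' : k12 p = tau by apply/eqP; rewrite -subr_eq0; apply/eqP; exact: K12.
split; first by split.
have algA1 (l o d1' k m s t : R) a1 a2 a3' d2' d3' : 
  l = o * d1' + k * (a2 * d3' - a3' * d2') + (s - 2 * tau * a3') * t -> o = 0 -> d3' = 1 -> a3' = 0 ->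
  t = a2 -> a1 = m -> l = (k + s) * a2.
  by move=> -> -> -> -> -> _; ring.
have algA2 (l o d1' k s t : R) a1 a3' d2' d3' : 
  l = o * d2' + k * (a3' * d1' - a1 * d3') - (s - 2 * tau * a3') * t -> o = 0 -> d3' = 1 -> a3' = 0 ->
  t = a1 -> l = - ((k + s) * a1).
  by move=> -> -> -> -> ->; ring.
have algA4 (l o d1' k x' y' a2 a3' d2' d3' : R) : 
  l = o * d1' + (k + tau) * (a2 * d3' - a3' * d2') + (kappa / 2 * (y' * d1' - x' * d2') - 2 * tau * d3') * a2 ->
  o = 0 -> k = tau -> d3' = 1 -> a3' = 0 -> d1' = 0 -> d2' = 0 -> l = 0.
  by move=> -> -> -> -> -> -> ->; ring.
have algA5 (l o d1' k x' y' a1 a3' d2' d3' : R) : 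
  l = o * d2' + (k + tau) * (a3' * d1' - a1 * d3') - (kappa / 2 * (y' * d1' - x' * d2') - 2 * tau * d3') * a1 ->
  o = 0 -> k = tau -> d3' = 1 -> a3' = 0 -> d1' = 0 -> d2' = 0 -> l = 0.
  by move=> -> -> -> -> -> -> ->; ring.
split.
- exact: (algA1 _ _ _ _ _ _ _ _ _ _ _ _ A1 W1 d3 a3 (erefl _) (erefl 0)).
- exact: (algA2 _ _ _ _ _ _ _ _ _ _ A2 W1 d3 a3 (erefl _)).
- exact: algA4 A4 W2 K12' d3 a3 d1 d2.
- exact: algA5 A5 W2 K12' d3 a3 d1 d2.
Qed.

Lemma adapted_lie_commute g p : smooth_on U g -> U p ->
  lie X1 (lie X2 g) p = lie X2 (lie X1 g) p.
Proof.
move=> sg Up; have [sX1 sX2 o11 o12 o22] := orth.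
have sf := patch_surface_frame oU sF iF DF sX1 sX2 o11 o12 o22.
have [ [W1 W2 _ _] _] := adapted_table Up.
apply/eqP; rewrite -subr_eq0; apply/eqP; rewrite (lie_bracket oU Up sX1 sX2 sg).
apply: big1 => j _; rewrite (sf_bracket sf j Up).
have alg (o o' s t r : R) : o = 0 -> o' = 0 -> (- o * s - o' * t) * r = 0.
  by move=> -> ->; rewrite oppr0 !mul0r subr0 mul0r.
exact: alg W1 W2.
Qed.

(** X2 commutes with X1 and kills x, y and the direction (a, b). Applied to X1 a = (k11 + s) b and
    X1 b = -(k11 + s) a, it gives (X2 k11) b = (X2 k11) a = 0, while a^2 + b^2 = 1. *)
Lemma adapted_curvature_invariant p : U p -> lie X2 k11 p = 0.
Proof.
move=> Up; have [sX1 sX2 o11 o12 o22] := orth.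
have [sa sb _] := smooth_b tau oU sF DF sX1.
have [_ [sk _ _] _ _] := smooth_frame tau oU sF DF sX1 sX2.
have sx := smooth_coord 0 oU sF; have sy := smooth_coord 1 oU sF.
have T q (Uq : U q) := adapted_table Uq.
pose s q := kappa / 2 * (ycoord (F q) * b1 X1 q - xcoord (F q) * b2 X1 q).
have ss : smooth_on U s := smoothM oU (smooth_cst (kappa / 2)) (smoothB oU (smoothM oU sy sa) (smoothM oU sx sb)).
have [_ [_ _ la lb] ] := T p Up.
have [lx ly] := lie_xy oU sF DF X2 Up; have [_ d1 d2 _] := ad Up.
have ls : lie X2 s p = 0.
  have e1 := lieM X2 Up sy sa; have e2 := lieM X2 Up sx sb.
  have e3 := lieB X2 oU Up (smoothM oU sy sa) (smoothM oU sx sb).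
  have e4 := lieZ X2 (kappa / 2) Up (smoothB oU (smoothM oU sy sa) (smoothM oU sx sb)).
  have alg (S D A B x' y' lx' ly' a b l d d' : R) : S = kappa / 2 * D -> D = A - B ->
     A = ly' * a + y' * 0 -> B = lx' * b + x' * 0 -> lx' = l * d -> ly' = l * d' -> d = 0 -> d' = 0 -> S = 0.
    by move=> -> -> -> -> -> -> -> ->; ring.
  rewrite la in e1; rewrite lb in e2; exact: alg e4 e3 e1 e2 lx ly d1 d2.
have key g : smooth_on U g -> lie X2 g p = 0 -> lie X2 (fun q => (k11 q + s q) * g q) p = 0 -> lie X2 k11 p * g p = 0.
  move=> sg lg; have e1 := lieM X2 Up (smoothD oU sk ss) sg; have e2 := lieD X2 Up sk ss.
  have alg (S D K g' x' : R) : S = D * g' + x' * 0 -> D = K + 0 -> S = 0 -> K * g' = 0.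
    by move=> -> -> h; rewrite -h; ring.
  rewrite lg in e1; rewrite ls in e2; exact: alg e1 e2.
have lX1 g : (forall q, U q -> g q = 0) -> lie X1 g p = 0.
  by move=> g0; exact: etrans (eq_lie X1 oU Up (g := fun=> 0) g0) (lie_cst X1 0 p).
have ea : lie X2 (lie X1 (b1 X1)) p = 0.
  refine (etrans (esym (adapted_lie_commute sa Up)) (lX1 _ _)) => q Uq.
  by have [_ [_ _ h _] ] := T q Uq.
have eb : lie X2 (lie X1 (b2 X1)) p = 0.
  refine (etrans (esym (adapted_lie_commute sb Up)) (lX1 _ _)) => q Uq.
  by have [_ [_ _ _ h] ] := T q Uq.
have ka : lie X2 k11 p * b2 X1 p = 0.
  apply: (key _ sb lb); refine (etrans (esym (eq_lie X2 oU Up _)) ea) => q Uq.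
  by have [_ [h _ _ _] ] := T q Uq.
have kb : lie X2 k11 p * b1 X1 p = 0.
  apply: (key _ sa la).
  have e2 := lieN X2 Up (smoothM oU (smoothD oU sk ss) sa).
  have e3 : lie X2 (fun q => - ((k11 q + s q) * b1 X1 q)) p = 0.
    refine (etrans (esym (eq_lie X2 oU Up _)) eb) => q Uq.
    by have [_ [_ h _ _] ] := T q Uq.
  by apply: oppr_inj; rewrite oppr0; exact: etrans (esym e2) e3.
have zero2 (q a b : R) : q * a = 0 -> q * b = 0 -> b ^+ 2 + a ^+ 2 = 1 -> q = 0.
  move=> h1 h2 h3; apply: (lin_comb3 h1 h2 h3 (c1 := a) (c2 := b) (c3 := - q)); ring.
exact: zero2 ka kb (adapted_unit Up).
Qed.

Lemma adapted_iter_invariant j p : U p -> lie X2 (iter j (lie X1) k11) p = 0.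
Proof.
have [sX1 sX2 o11 o12 o22] := orth; have [_ [sk _ _] _ _] := smooth_frame tau oU sF DF sX1 sX2.
elim: j p => [|j IH] p Up; first exact: adapted_curvature_invariant.
refine (etrans (esym (adapted_lie_commute (iter_lie_smooth j oU sX1 sk) Up)) _).
exact: etrans (eq_lie X1 oU Up (g := fun=> 0) IH) (lie_cst X1 0 p).
Qed.

(** The connection form vanishes, so Z has no angular part and treats cos and sin as constants. Each
    letter Z contributes a factor cos and a derivative X1, because X2 kills the iterated derivatives
    of k11. *)
Lemma adapted_word j : exists r : R, forall w, bundle U w ->
  word (@bZ R X1 X2 w1 w2) (@bH R X1 X2 w1 w2) (nseq j false) (bundle_form kappa tau F X1 X2 false false) w =
  cosf w ^+ j.+2 * lift (iter j (lie X1) k11) w + r * (cosf w * sinf w).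
Proof.
have [sX1 sX2 o11 o12 o22] := orth; have [_ [sk _ _] _ _] := smooth_frame tau oU sF DF sX1 sX2.
have oB := open_bundle oU.
elim: j => [|j [r IH] ].
  (* In the rotated frame h11 is cos^2 k11 + 2 cos sin k12 with k12 = tau; the mixed term dies under
     the first derivative, whence the constant 0 afterwards. *)
  exists (2 * tau) => w Bw; have [ [_ _ e1 e2] _] := adapted_table (p := base w) Bw.
  have alg (c s k k' k'' : R) : k' = tau -> k'' = 0 ->
    c ^+ 2 * k + 2 * (c * s) * k' + s ^+ 2 * k'' = c ^+ 2 * k + 2 * tau * (c * s).
    by move=> -> ->; ring.
  exact: alg e1 e2.
exists 0 => w Bw; set G := iter j (lie X1) k11 in IH *.
have sG : smooth_on U G := iter_lie_smooth j oU sX1 sk.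
have sLG := smooth_lift oU sG.
rewrite /= (eq_lie _ oB Bw IH).
have [ [z1 z2 _ _] _] := adapted_table (p := base w) Bw.
have Z2 : @bZ R X1 X2 w1 w2 w 0 2 = 0.
  have [_ _ E] := vec3E (cosf w * X1 (base w) 0 0 + sinf w * X2 (base w) 0 0)
    (cosf w * X1 (base w) 0 1 + sinf w * X2 (base w) 0 1) (- (cosf w * w1 (base w) + sinf w * w2 (base w))).
  have alg (E' c s o o' : R) : E' = - (c * o + s * o') -> o = 0 -> o' = 0 -> E' = 0.
    by move=> -> -> ->; rewrite !mulr0 addr0 oppr0.
  exact: alg E z1 z2.
set Z := @bZ _ _ _ _ _ in Z2 *.
have lc : lie Z (@cosf R) w = 0 by rewrite lie_cosf Z2 mulr0.
have ls : lie Z (@sinf R) w = 0 by rewrite lie_sinf Z2 mulr0.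
have [scs ssn] := smooth_cosf_sinf oB.
have lX n : lie Z (fun w => cosf w ^+ n) w = 0.
  elim: n => [|n IHn]; first by rewrite (lie_cst _ 1).
  have e := lieM Z Bw scs (smoothX n oB scs).
  rewrite lc IHn in e; rewrite (eq_lie Z oB Bw (g := fun w => cosf w * cosf w ^+ n)); last by move=> q _; rewrite exprS.
  by rewrite e mul0r mulr0 addr0.
have e1 := lieM Z Bw (smoothX j.+2 oB scs) sLG.
have e2 := lieM Z Bw scs ssn.
have e3 := lieZ Z r Bw (smoothM oB scs ssn).
have e4 := lieD Z Bw (smoothM oB (smoothX j.+2 oB scs) sLG) (smoothM oB (smooth_cst r) (smoothM oB scs ssn)).
have e5 : lie Z (lift G) w = _ := lie_lift_Z G w.
have e6 : lie X2 G (base w) = 0 := adapted_iter_invariant j (p := base w) Bw.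
rewrite lX in e1; rewrite lc ls in e2.
have alg (L A B C D c cj s g d1 d2 t : R) : L = A + B -> A = 0 * t + cj * D -> B = r * C ->
   C = 0 * s + c * 0 -> D = c * d1 + s * d2 -> d2 = 0 -> L = c * cj * d1 + 0 * g.
  by move=> -> -> -> -> -> ->; ring.
rewrite exprS; exact: alg e4 e1 e3 e2 e5 e6.
Qed.

Lemma adapted_cylinder_frame k : nabla_vanishes_on kappa tau U F k ->
  cylinder_frame kappa k U X1 X2 x y (b1 X1) (b2 X1) k11.
Proof.
move=> par; have [sX1 sX2 o11 o12 o22] := orth.
have [sa sb _] := smooth_b tau oU sF DF sX1.
have [_ [sk _ _] _ _] := smooth_frame tau oU sF DF sX1 sX2.
have T q (Uq : U q) := adapted_table Uq.
apply: CylinderFrame => //.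
- exact: smooth_coord 0 oU sF.
- exact: smooth_coord 1 oU sF.
- exact: adapted_unit.
- by move=> p Up; have [] := lie_xy oU sF DF X1 Up.
- by move=> p Up; have [] := lie_xy oU sF DF X1 Up.
- by move=> p /T[_ [] ].
- by move=> p /T[_ [] ].
- by move=> p Up; have [-> _] := lie_xy oU sF DF X2 Up; have [_ -> _ _] := ad Up; rewrite mulr0.
- by move=> p Up; have [_ ->] := lie_xy oU sF DF X2 Up; have [_ _ -> _] := ad Up; rewrite mulr0.
- by move=> p /T[_ [] ].
- by move=> p /T[_ [] ].
- by move=> j p; exact: adapted_iter_invariant.
- move=> p Up; have [r E] := adapted_word k.
  (* At angle 0 the word Z^k on h11 reduces to X1^k k11. *)
  have Bw : bundle U (section_at 0 p) by rewrite /bundle /= base_section.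
  have := words_vanish oU sF iF DF orth par false false (size_nseq k false) Bw.
  rewrite E // /lift base_section.
  have -> : cosf (section_at 0 p) = 1 by rewrite /cosf /section_at !mxE /= cos0.
  have -> : sinf (section_at 0 p) = 0 by rewrite /sinf /section_at !mxE /= sin0.
  by rewrite expr1n mul1r !mulr0 addr0.
- move=> p j Up; have sf := patch_surface_frame oU sF iF DF sX1 sX2 o11 o12 o22.
  have [ [W1 W2 _ _] _] := T p Up.
  have alg (A B o o' s t : R) : A - B = - o * s - o' * t -> o = 0 -> o' = 0 -> A = B.
    by move=> + o0 o1; rewrite o0 o1 oppr0 !mul0r subr0 => /eqP; rewrite subr_eq0 => /eqP.
  exact: alg (sf_bracket sf j Up) W1 W2.
- move=> p Up; apply/eqP => W0.
  have ind c d := frame_independent sF o11 o12 o22 (c := c) (d := d) Up.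
  move: W0 ind; move: (X1 p) (X2 p) => u v W0 ind.
  have [v1 u1] : v 0 1 = 0 /\ - u 0 1 = 0.
    apply: ind; apply: row2P; rewrite !mxE; last by ring.
    by rewrite -W0; ring.
  have [v0 u0] : v 0 0 = 0 /\ - u 0 0 = 0.
    apply: ind; apply: row2P; rewrite !mxE; first by ring.
    by apply: oppr_inj; rewrite oppr0 -W0; ring.
  have [/eqP] : (1 : R) = 0 /\ (0 : R) = 0; last by rewrite oner_eq0.
  apply: ind; apply: row2P; rewrite !mxE ?v0 ?v1.
    by move/eqP: u0; rewrite oppr_eq0 => /eqP->; ring.
  by move/eqP: u1; rewrite oppr_eq0 => /eqP->; ring.
Qed.

End Frame.
End Adapted.

(** * Closed 1-forms on plane boxes *)

Section Box.
Context {R : realType}.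
Implicit Types (p q : 'rV[R]_2) (r : R).

Definition box p r : set 'rV[R]_2 := [set q | `|q 0 0 - p 0 0| < r /\ `|q 0 1 - p 0 1| < r].

Lemma ball_box p r : 0 < r -> ball p r = box p r.
Proof.
move=> r0; apply/seteqP; split=> [q [_ H]|q [h0 h1]].
  by split; rewrite distrC; exact: H.
split=> // i j; rewrite (ord1 i) /ball /= distrC; case: j => -[|[|j]] lt //.
  by rewrite (_ : Ordinal lt = 0) //; exact: val_inj.
by rewrite (_ : Ordinal lt = 1) //; exact: val_inj.
Qed.

Lemma box_open p r : 0 < r -> open (box p r).
Proof. by move=> r0; rewrite -ball_box //; exact: ball_open. Qed.

Lemma box_center p r : 0 < r -> box p r p.
Proof. by move=> r0; split; rewrite subrr normr0. Qed.

Lemma nbhs_box p (A : set 'rV[R]_2) : nbhs p A -> exists2 r, 0 < r & box p r `<=` A.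
Proof. by case/nbhs_ballP => r /= r0 H; exists r => //; rewrite -ball_box. Qed.

Lemma box_sub p r r' : r <= r' -> box p r `<=` box p r'.
Proof. by move=> rr q [h0 h1]; split; [exact: lt_le_trans h0 rr|exact: lt_le_trans h1 rr]. Qed.

Lemma vec2_eta p : vec2 (p 0 0) (p 0 1) = p.
Proof. by apply: row2P; have [e0 e1] := vec2E (p 0 0) (p 0 1). Qed.

Lemma coord_norm (h : 'rV[R]_2) j : `|h 0 j| <= `|h|.
Proof.
rewrite [leRHS]mx_normrE.
exact: (le_bigmax _ (fun ij : 'I_1 * 'I_2 => `|h ij.1 ij.2|) (0, j)).
Qed.

Lemma is_derive_vec2 (f : 'rV[R]_2 -> R) (x y : R) : differentiable f (vec2 x y) ->
  is_derive x 1 (fun t => f (vec2 t y)) (partial 0 f (vec2 x y)) /\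
  is_derive y 1 (fun t => f (vec2 x t)) (partial 1 f (vec2 x y)).
Proof.
have e0 t : vec2 t y = vec2 0 y + t *: delta_mx 0 0 by apply: row2P; rewrite !mxE /=; ring.
have e1 t : vec2 x t = vec2 x 0 + t *: delta_mx 0 1 by apply: row2P; rewrite !mxE /=; ring.
move=> df.
have d0 : differentiable f (vec2 0 y + x *: delta_mx 0 0) by rewrite -e0.
have d1 : differentiable f (vec2 x 0 + y *: delta_mx 0 1) by rewrite -e1.
have D0 := is_derive_line d0; have D1 := is_derive_line d1.
have E0 : (fun t => f (vec2 0 y + t *: delta_mx 0 0)) = fun t => f (vec2 t y).
  by apply/funext => t; rewrite -e0.
have E1 : (fun t => f (vec2 x 0 + t *: delta_mx 0 1)) = fun t => f (vec2 x t).
  by apply/funext => t; rewrite -e1.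
rewrite E0 -e0 in D0; rewrite E1 -e1 in D1.
exact: (conj D0 D1).
Qed.

Lemma mvt_signed (F f : R -> R) (x h : R) :
  (forall t, `|t - x| <= `|h| -> is_derive t 1 F (f t)) ->
  exists c, `|c - x| <= `|h| /\ F (x + h) - F x = f c * h.
Proof.
move=> D; case: (ltgtP h 0) => [h0|h0|h0].
- have [|t /andP[t1 t2]|c /andP[c1 c2] E] := @mvt R F f (x + h) x; first lra.
    by apply: D; rewrite (ltr0_norm h0) ler_norml; apply/andP; split; lra.
  exists c; split; first by rewrite (ltr0_norm h0) ler_norml; apply/andP; split; lra.
  by rewrite -opprB E; ring.
- have [|t /andP[t1 t2]|c /andP[c1 c2] E] := @mvt R F f x (x + h); first lra.
    by apply: D; rewrite (gtr0_norm h0) ler_norml; apply/andP; split; lra.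
  exists c; split; first by rewrite (gtr0_norm h0) ler_norml; apply/andP; split; lra.
  by rewrite E; ring.
- by exists x; rewrite h0 subrr normr0 addr0 subrr mulr0.
Qed.

(** Total differentiability from a coordinate estimate in which c0 and c1 are the candidates for the
    partial derivatives. *)
Lemma differentiable_delta (f : 'rV[R]_2 -> R) p (c0 c1 : R) :
  (forall e : R, 0 < e -> exists2 d : R, 0 < d & forall h : 'rV[R]_2, `|h 0 0| < d -> `|h 0 1| < d ->
    `|f (h + p) - f p - (c0 * h 0 0 + c1 * h 0 1)| <= e * `|h|) ->
  differentiable f p /\ (partial 0 f p = c0 /\ partial 1 f p = c1).
Proof.
move=> H; pose L q : R := c0 * q 0 0 + c1 * q 0 1.
have sL : smooth_on setT L.
  exact: (smoothD openT (smoothM openT (smooth_cst c0) (smooth_id_coord 0 openT))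
    (smoothM openT (smooth_cst c1) (smooth_id_coord 1 openT))).
have dL q : differentiable L q := smooth_on_diff (U := setT) (p := q) sL I.
have vL v q : 'D_v L q = L v.
  have e : (fun s : R => L (q + s *: v)) = fun s => L q + s * L v.
    by apply/funext => s; rewrite /L !mxE; ring.
  have d0 : differentiable L (q + 0 *: v) by exact: dL.
  have D := is_derive_line d0; rewrite e scale0r addr0 in D.
  rewrite -(@derive_val _ _ _ _ _ _ _ D).
  have D2 : is_derive (0 : R) 1 (fun s => L q + s * L v) (L v).
    have D1 := is_derive_mul (is_derive_id (0 : R) 1) (is_derive_const (L v) (0 : R) 1).
    by apply: (is_derive_eq (is_derive_add (is_derive_const (L q) (0 : R) 1) D1)); ring.
  by rewrite (@derive_val _ _ _ _ _ _ _ D2).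
have dE v : 'd L p v = L v by rewrite -(vL v p) deriveE.
have [df fE] : differentiable f p /\ 'd f p = 'd L p :> (_ -> _).
  apply: differentiable_approx; first exact: diff_continuous.
  move=> e e0; have [d d0 Hd] := H e e0; apply/nbhs_ballP; exists d => //= h.
  rewrite ball_box // => -[h0 h1]; rewrite dE; apply: Hd.
    by move: h0; rewrite mxE subr0.
  by move: h1; rewrite mxE subr0.
have pE j : partial j f p = L (delta_mx 0 j) by rewrite /partial (deriveE _ df) fE dE.
split; first exact: df.
have L0 : L (delta_mx 0 0) = c0 by rewrite /L !mxE /=; ring.
have L1 : L (delta_mx 0 1) = c1 by rewrite /L !mxE /=; ring.
exact: (conj (etrans (pE 0) L0) (etrans (pE 1) L1)).
Qed.

(** Poincare's lemma on a box: s integrates f0 along the horizontal line through p0, then f1 along a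
    vertical line. The dependence of the second integral on the parameter x is controlled by mean
    value estimates with a bound K for the second x-derivative of f1. *)
Lemma closed_form_exact (U : set 'rV[R]_2) (f0 f1 : 'rV[R]_2 -> R) p0 : open U -> U p0 ->
  smooth_on U f0 -> smooth_on U f1 -> (forall p, U p -> partial 1 f0 p = partial 0 f1 p) ->
  exists (r : R) (s : 'rV[R]_2 -> R), [/\ 0 < r, box p0 r `<=` U &
    forall p, box p0 r p -> differentiable s p /\ (partial 0 s p = f0 p /\ partial 1 s p = f1 p)].
Proof.
move=> oU Up s0 s1 cl; set g := partial 0 (partial 0 f1).
have sp1 := smooth_on_partial 0 s1; have sg := smooth_on_partial 0 sp1.
have [R0 [K [R00 RU RK] ] ] : exists R0 K : R, [/\ 0 < R0, box p0 R0 `<=` U & forall q, box p0 R0 q -> `|g q| <= K].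
  have cg : {for p0, continuous g} by exact: differentiable_continuous (smooth_on_diff sg Up).
  have nU : nbhs p0 U by exact: open_nbhs_nbhs.
  have nK : \forall q \near p0, `|g q| < `|g p0| + 1.
    have cn : {for p0, continuous (fun q => `|g q|)}.
      by apply: continuous_comp; [exact: cg|exact: norm_continuous].
    by apply: (cn [set z | z < `|g p0| + 1]); apply: open_nbhs_nbhs; split; [exact: open_lt|rewrite /= ltrDl].
  have [r r0 rB] := nbhs_box (filterI nU nK).
  exists r, (`|g p0| + 1); split=> // q /rB[]//; by move=> _ /ltW.
set x0 := p0 0 0; set y0 := p0 0 1.
have inB (x y r : R) : `|x - x0| < r -> `|y - y0| < r -> box p0 r (vec2 x y).
  by move=> h1 h2; have [e0 e1] := vec2E x y; split; rewrite ?e0 ?e1.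
have cont (f : 'rV[R]_2 -> R) x y : smooth_on U f -> `|x - x0| < R0 -> `|y - y0| < R0 ->
    {for x, continuous (fun t => f (vec2 t y))} /\ {for y, continuous (fun t => f (vec2 x t))}.
  move=> sf h1 h2; have [d0 d1] := is_derive_vec2 (smooth_on_diff sf (RU _ (inB _ _ _ h1 h2))).
  by split; apply: differentiable_continuous; apply/derivable1_diffP; exact: ex_derive.
have y00 : `|y0 - y0| < R0 by rewrite subrr normr0.
have [A [A0 dA] ] := antiderivative R00 (fun t h => (cont f0 t y0 s0 h y00).1).
have B' (x : R) : exists B : R -> R, `|x - x0| < R0 ->
    B y0 = 0 /\ forall t, `|t - y0| < R0 / 2 -> is_derive t 1 B (f1 (vec2 x t)).
  case: (boolP (`|x - x0| < R0)) => [h|_]; last by exists (fun=> 0).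
  by have [B HB] := antiderivative R00 (fun t h' => (cont f1 x t s1 h h').2); exists B.
have [B BP] := choice B'.
(* [antiderivative] provides primitives on half the radius. *)
pose r : R := R0 / 2; have r0 : 0 < r by rewrite /r; lra.
have rR (z : R) : `|z| < r -> `|z| < R0 by move=> h; apply: lt_trans h _; rewrite /r; lra.
exists r, (fun p => A (p 0 0) + B (p 0 0) (p 0 1)); split=> //.
  by apply: subset_trans RU; apply: box_sub; rewrite /r; lra.
move=> p [px py]; set x := p 0 0 in px *; set y := p 0 1 in py *.
have pE : p = vec2 x y by rewrite -(vec2_eta p).
apply: differentiable_delta => e e0.
have Upp : U p by apply: RU; split; apply: rR.
have cf1 : {for p, continuous f1} by exact: differentiable_continuous (smooth_on_diff s1 Upp).
have e3 : 0 < e / 3 by lra.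
have [d1 d10 D1] : exists2 d : R, 0 < d & forall q, box p d q -> `|f1 q - f1 p| < e / 3.
  have : \forall q \near p, `|f1 q - f1 p| < e / 3.
    by move/cvgr_dist_lt: cf1 => /(_ _ e3); apply: filterS => q; rewrite distrC.
  by move/nbhs_box => [d d0 H]; exists d.
have [d2 d20 D2] : exists2 d : R, 0 < d & forall c, `|c - x| < d -> `|f0 (vec2 c y0) - f0 (vec2 x y0)| < e / 3.
  have [c0 _] := cont f0 x y0 s0 (rR _ px) y00.
  have : \forall c \near x, `|f0 (vec2 c y0) - f0 (vec2 x y0)| < e / 3.
    by move/cvgr_dist_lt: c0 => /(_ _ e3); apply: filterS => q; rewrite distrC.
  by move/nbhs_ballP => [d d0 H]; exists d => // c hc; apply: H; rewrite /ball /= distrC.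
have K0 : 0 <= K by apply: le_trans (RK p0 (box_center _ R00)).
have M0 : 0 < K * r + 1 by have := mulr_ge0 K0 (ltW r0); lra.
pose d := Num.min (Num.min d1 d2) (Num.min (Num.min (r - `|x - x0|) (r - `|y - y0|)) (e / 3 / (K * r + 1))).
have dpos : 0 < d by rewrite /d !lt_min d10 d20 !subr_gt0 px py divr_gt0.
exists d => // h h0 h1.
have small (z : R) : `|z| < d -> [/\ `|z| < d1, `|z| < d2, `|z| < r - `|x - x0|, `|z| < r - `|y - y0| & `|z| * (K * r + 1) < e / 3].
  by rewrite /d !lt_min ltr_pdivlMr // => /andP[/andP[-> ->] /andP[/andP[-> ->] ->] ].
set a := h 0 0 in h0 *; set b := h 0 1 in h1 *.
have near_x (z : R) : `|z - x| <= `|a| -> `|z - x0| < r.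
  move=> hz; have [_ _ h3 _ _] := small _ h0.
  have := ler_normD (z - x) (x - x0); rewrite addrA subrK => /le_lt_trans; apply; lra.
have near_y (z : R) : `|z - y| <= `|b| -> `|z - y0| < r.
  move=> hz; have [_ _ _ h3 _] := small _ h1.
  have := ler_normD (z - y) (y - y0); rewrite addrA subrK => /le_lt_trans; apply; lra.
have xa : `|x + a - x0| < r by apply: near_x; rewrite addrAC subrr add0r.
have [c1 [c1x E1] ] := @mvt_signed A (fun t => f0 (vec2 t y0)) x a (fun t ht => dA t (near_x t ht)).
have [c2 [c2y E2] ] := @mvt_signed (B (x + a)) (fun t => f1 (vec2 (x + a) t)) y b
   (fun t ht => (BP _ (rR _ xa)).2 t (near_y t ht)).
pose m (t : R) : R := a * (f0 (vec2 x t) - f0 (vec2 x y0)).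
(* The error in replacing the increment of B in x by its expected value m. It vanishes at y0, and by
   closedness its derivative is of second order in a. *)
pose G (t : R) : R := B (x + a) t - B x t - m t.
have dG (t : R) : `|t - y0| < r -> is_derive t 1 G (f1 (vec2 (x + a) t) - f1 (vec2 x t) - a * partial 1 f0 (vec2 x t)).
  move=> ht; have D3 := (BP _ (rR _ xa)).2 t ht; have D4 := (BP _ (rR _ px)).2 t ht.
  have [_ D5] := is_derive_vec2 (smooth_on_diff s0 (RU _ (inB _ _ _ (rR _ px) (rR _ ht)))).
  have D6 := is_derive_scale a (is_derive_add D5 (is_derive_const (- f0 (vec2 x y0)) t 1)).
  exact: (is_derive_eq (is_derive_add (is_derive_add D3 (is_derive_opp D4)) (is_derive_opp D6)) (congr1 (fun z => _ - a * z) (addr0 _))).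
have [c3 [c3y E3] ] := @mvt_signed G (fun t => f1 (vec2 (x + a) t) - f1 (vec2 x t) - a * partial 1 f0 (vec2 x t))
  y0 (y - y0) (fun t ht => dG t (le_lt_trans ht py)).
have G0 : G y0 = 0 by rewrite /G /m (BP _ (rR _ xa)).1 (BP _ (rR _ px)).1 !subrr mulr0 subrr.
have c3r : `|c3 - y0| < r := le_lt_trans c3y py.
have inU (z : R) : `|z - x| <= `|a| -> U (vec2 z c3).
  by move=> hz; apply: RU; apply: inB; apply: rR => //; exact: near_x.
have [c4 [c4x E4] ] := @mvt_signed (fun t => f1 (vec2 t c3)) (fun t => partial 0 f1 (vec2 t c3)) x a
  (fun t ht => (is_derive_vec2 (smooth_on_diff s1 (inU t ht))).1).
have [c5 [c5x E5] ] := @mvt_signed (fun t => partial 0 f1 (vec2 t c3)) (fun t => g (vec2 t c3)) x (c4 - x)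
  (fun t ht => (is_derive_vec2 (smooth_on_diff sp1 (inU t (le_trans ht c4x)))).1).
(* Three mean value steps: in t for G, in x for f1, and in x for the derivative of f1. The result is
   at most K r |a|^2. *)
have Gy : G y = g (vec2 c5 c3) * (c4 - x) * a * (y - y0).
  move: E3; rewrite (_ : y0 + (y - y0) = y); last by ring.
  rewrite G0 subr0 => ->; rewrite E4 (cl _ (inU x _)); last by rewrite subrr normr0.
  by move: E5; rewrite (_ : x + (c4 - x) = c4); [move=> <-; ring|ring].
have gK : `|g (vec2 c5 c3)| <= K.
  by apply: RK; apply: inB; apply: rR => //; apply: near_x; exact: le_trans c5x c4x.
have Gb : `|G y| <= e / 3 * `|a|.
  have [_ _ _ _ h5] := small _ h0.
  rewrite Gy !normrM.
  have t1 : `|g (vec2 c5 c3)| * `|c4 - x| <= K * `|a| by apply: ler_pM.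
  have t2 : `|g (vec2 c5 c3)| * `|c4 - x| * `|a| * `|y - y0| <= K * `|a| * `|a| * r.
    by apply: ler_pM; rewrite ?mulr_ge0 //; [apply: ler_wpM2r|exact: ltW].
  apply: le_trans t2 _; rewrite (_ : K * `|a| * `|a| * r = (`|a| * (K * r)) * `|a|); last by ring.
  apply: ler_wpM2r => //; have := normr_ge0 a; lra.
have F1 : `|f0 (vec2 c1 y0) - f0 (vec2 x y0)| <= e / 3.
  by apply/ltW/D2; apply: le_lt_trans c1x _; have [] := small _ h0.
have F2 : `|f1 (vec2 (x + a) c2) - f1 p| <= e / 3.
  apply/ltW/D1; have [q0 q1] := vec2E (x + a) c2; split; rewrite ?q0 ?q1 -/x -/y.
    by rewrite addrAC subrr add0r; have [] := small _ h0.
  by apply: le_lt_trans c2y _; have [] := small _ h1.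
(* The increment of s minus its linear part splits into the error of A, the error of B in its second
   variable, and G; each is at most e |h| / 3. *)
have -> : A ((h + p) 0 0) + B ((h + p) 0 0) ((h + p) 0 1) - (A x + B x y) - (f0 p * a + f1 p * b) =
    (f0 (vec2 c1 y0) - f0 (vec2 x y0)) * a + (f1 (vec2 (x + a) c2) - f1 p) * b + G y.
  have [-> ->] : (h + p) 0 0 = x + a /\ (h + p) 0 1 = y + b.
    by rewrite !mxE -/x -/y -/a -/b addrC [b + y]addrC.
  have -> : A (x + a) = f0 (vec2 c1 y0) * a + A x by rewrite -E1; ring.
  have -> : B (x + a) (y + b) = f1 (vec2 (x + a) c2) * b + B (x + a) y by rewrite -E2; ring.
  by rewrite /G /m -pE; ring.
have n0 : `|a| <= `|h| by exact: coord_norm.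
have n1 : `|b| <= `|h| by exact: coord_norm.
apply: le_trans (ler_normD _ _) _.
have -> : e * `|h| = e / 3 * `|h| + e / 3 * `|h| + e / 3 * `|h| by field.
apply: lerD; last by apply: le_trans Gb _; rewrite ler_pM2l.
apply: le_trans (ler_normD _ _) _.
by apply: lerD; rewrite normrM; apply: ler_pM.
Qed.

End Box.

(** * Curves of prescribed geodesic curvature *)

Definition vec4 (R : realType) (x y a b : R) : 'rV[R]_4 := \row_(i < 4) [:: x; y; a; b]`_i.

Lemma vec4E (R : realType) (x y a b : R) : [/\ vec4 x y a b 0 0 = x, vec4 x y a b 0 1 = y,
  vec4 x y a b 0 2 = a & vec4 x y a b 0 3 = b].
Proof. by rewrite !mxE. Qed.

Lemma row4P (R : realType) (u v : 'rV[R]_4) : u 0 0 = v 0 0 -> u 0 1 = v 0 1 ->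
  u 0 2 = v 0 2 -> u 0 3 = v 0 3 -> u = v.
Proof.
move=> e0 e1 e2 e3; apply/rowP => -[[|[|[|[|j]]]] lt] //.
- by rewrite (_ : Ordinal lt = 0) //; exact: val_inj.
- by rewrite (_ : Ordinal lt = 1) //; exact: val_inj.
- by rewrite (_ : Ordinal lt = 2) //; exact: val_inj.
- by rewrite (_ : Ordinal lt = 3) //; exact: val_inj.
Qed.

(* The state (x, y, a, b) is a point (x, y) with the unit vector
   lam (a d/dx + b d/dy), lam = 1 + kappa / 4 (x^2 + y^2); c is minus the
   geodesic curvature. *)
Definition frenet_field (R : realType) (kappa c : R) (S : 'rV[R]_4) : 'rV[R]_4 :=
  let x := S 0 0 in let y := S 0 1 in let a := S 0 2 in let b := S 0 3 in
  let lam := 1 + kappa / 4 * (x ^+ 2 + y ^+ 2) in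
  let sg := kappa / 2 * (y * a - x * b) in
  vec4 (lam * a) (lam * b) ((c + sg) * b) (- ((c + sg) * a)).

Section LipschitzPairs.
Context {R : realType}.
Variables (T : R -> Prop) (delta : R -> R).
Hypothesis delta0 : forall r, 0 <= delta r.
Implicit Types f g : R -> R.

(** Bounded functions whose difference is controlled by [delta]. Sums and products preserve such
    pairs, so a polynomial field is Lipschitz along two bounded solutions with a constant that is
    never made explicit. *)
Definition lip_pair f g := exists C, forall r, T r ->
  [/\ `|f r| <= C, `|g r| <= C & `|f r - g r| <= C * delta r].

Lemma lip_common f C : (forall r, T r -> `|f r| <= C) -> lip_pair f f.
Proof.
move=> fC; exists C => r Tr; split; [exact: fC|exact: fC|].
by rewrite subrr normr0 mulr_ge0 // (le_trans _ (fC r Tr)).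
Qed.

Lemma lipD f g f' g' : lip_pair f g -> lip_pair f' g' ->
  lip_pair (fun r => f r + f' r) (fun r => g r + g' r).
Proof.
move=> [C H] [C' H']; exists (C + C') => r Tr.
have [h1 h2 h3] := H r Tr; have [k1 k2 k3] := H' r Tr.
split; [exact: le_trans (ler_normD _ _) (lerD h1 k1)|exact: le_trans (ler_normD _ _) (lerD h2 k2)|].
rewrite (_ : _ - _ = f r - g r + (f' r - g' r)); last by ring.
by rewrite mulrDl; exact: le_trans (ler_normD _ _) (lerD h3 k3).
Qed.

Lemma lipM f g f' g' : lip_pair f g -> lip_pair f' g' ->
  lip_pair (fun r => f r * f' r) (fun r => g r * g' r).
Proof.
move=> [C H] [C' H']; exists (C * C' + C * C') => r Tr.
have [h1 h2 h3] := H r Tr; have [k1 k2 k3] := H' r Tr.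
have C0 : 0 <= C by exact: le_trans h1.
have C0' : 0 <= C' by exact: le_trans k1.
have CC : C * C' <= C * C' + C * C' by rewrite lerDl mulr_ge0.
split.
- by rewrite normrM; apply: le_trans CC; exact: ler_pM.
- by rewrite normrM; apply: le_trans CC; exact: ler_pM.
rewrite (_ : _ - _ = f r * (f' r - g' r) + (f r - g r) * g' r); last by ring.
apply: le_trans (ler_normD _ _) _; rewrite !normrM mulrDl; apply: lerD.
  by rewrite -mulrA; exact: ler_pM.
by rewrite mulrAC; exact: ler_pM.
Qed.

Lemma lip_cst (c : R) : lip_pair (fun=> c) (fun=> c).
Proof. by apply: (@lip_common _ `|c|). Qed.

Lemma lipN f g : lip_pair f g -> lip_pair (fun r => - f r) (fun r => - g r).
Proof.
move=> [C H]; exists C => r Tr; have [h1 h2 h3] := H r Tr.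
by rewrite !normrN -opprD normrN; split.
Qed.

End LipschitzPairs.

Lemma derivable_coord_continuous (R : realType) n (S : R -> 'rV[R]_n.+1) (t : R) v j :
  is_derive t 1 S v -> {for t, continuous (fun s => S s 0 j)}.
Proof.
move=> D; apply: differentiable_continuous; apply/derivable1_diffP.
exact: (@ex_derive _ _ _ _ _ _ _ (is_derive_coord j (@ex_derive _ _ _ _ _ _ _ D))).
Qed.

Lemma le_sum4 (R : realType) (z0 z1 z2 z3 : R) : 0 <= z0 -> 0 <= z1 -> 0 <= z2 -> 0 <= z3 ->
  [/\ z0 <= z0 + z1 + z2 + z3, z1 <= z0 + z1 + z2 + z3, z2 <= z0 + z1 + z2 + z3 &
      z3 <= z0 + z1 + z2 + z3].
Proof. by move=> *; split; lra. Qed.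

(** The factor theta is the speed of the parametrization: 1 for arc length, and the derivative of s
    along a segment when the equation is pulled back to a patch. *)
Lemma frenet_unique (R : realType) (kappa : R) (J : set R) (theta k : R -> R)
    (S1 S2 : R -> 'rV[R]_4) (s t : R) : is_interval J ->
  (forall r, J r -> {for r, continuous theta} /\ {for r, continuous k}) ->
  (forall r, J r -> is_derive r 1 S1 (theta r *: frenet_field kappa (k r) (S1 r))) ->
  (forall r, J r -> is_derive r 1 S2 (theta r *: frenet_field kappa (k r) (S2 r))) ->
  J s -> J t -> S1 s = S2 s -> S1 t = S2 t.
Proof.
move=> iJ ct D1 D2 Js Jt e; apply/eqP; rewrite -subr_eq0; apply/eqP.
pose V i r := theta r *: frenet_field kappa (k r) (if i then S1 r else S2 r).
apply: (@lipschitz_ode_zero R 3 J (fun r => S1 r - S2 r) (fun r => V true r - V false r) s t iJ) => //.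
- move=> r Jr; exact: (is_deriveB (D1 r Jr) (D2 r Jr)).
- move=> a b Ja Jb; pose T r := a <= r <= b; pose delta r := \sum_j `|(S1 r - S2 r) 0 j|.
  have JT r : T r -> J r by move=> h; exact: iJ Ja Jb r h.
  have delta0 r : 0 <= delta r by apply: sumr_ge0.
  have bd (f : R -> R) : (forall r, J r -> {for r, continuous f}) -> lip_pair T delta f f.
    move=> cf; have [C H] := continuous_segment_bounded (fun r (h : a <= r <= b) => cf r (JT r h)).
    exact: (lip_common delta0 H).
  have lt := bd theta (fun r Jr => (ct r Jr).1); have lk := bd k (fun r Jr => (ct r Jr).2).
  have lS j : lip_pair T delta (fun r => S1 r 0 j) (fun r => S2 r 0 j).
    have [C1 H1] := bd _ (fun r Jr => derivable_coord_continuous (j := j) (D1 r Jr)).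
    have [C2 H2] := bd _ (fun r Jr => derivable_coord_continuous (j := j) (D2 r Jr)).
    (* The summand 1 makes the constant at least 1, so that the difference of one coordinate is
       bounded by the constant times [delta]. *)
    exists (C1 + C2 + 1) => r Tr; have [h1 _ _] := H1 r Tr; have [h2 _ _] := H2 r Tr.
    have n1 := normr_ge0 (S1 r 0 j); have n2 := normr_ge0 (S2 r 0 j).
    split; [lra|lra|].
    have dj : `|S1 r 0 j - S2 r 0 j| <= delta r.
      rewrite /delta (bigD1 j) //= !mxE lerDl; exact: sumr_ge0.
    apply: le_trans dj _; rewrite ler_peMl //; lra.
  have lc (c : R) : lip_pair T delta (fun=> c) (fun=> c) by exact: lip_cst.
  have M (f g f' g' : R -> R) : lip_pair T delta f g -> lip_pair T delta f' g' ->
      lip_pair T delta (fun r => f r * f' r) (fun r => g r * g' r) by exact: lipM.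
  have A (f g f' g' : R -> R) : lip_pair T delta f g -> lip_pair T delta f' g' ->
      lip_pair T delta (fun r => f r + f' r) (fun r => g r + g' r) by exact: lipD.
  have N (f g : R -> R) : lip_pair T delta f g ->
      lip_pair T delta (fun r => - f r) (fun r => - g r) by exact: lipN.
  have ll : lip_pair T delta (fun r => 1 + kappa / 4 * (S1 r 0 0 ^+ 2 + S1 r 0 1 ^+ 2))
      (fun r => 1 + kappa / 4 * (S2 r 0 0 ^+ 2 + S2 r 0 1 ^+ 2)).
    exact: (A _ _ _ _ (lc 1) (M _ _ _ _ (lc (kappa / 4)) (A _ _ _ _ (M _ _ _ _ (lS 0) (lS 0)) (M _ _ _ _ (lS 1) (lS 1))))).
  have ls : lip_pair T delta (fun r => k r + kappa / 2 * (S1 r 0 1 * S1 r 0 2 + - (S1 r 0 0 * S1 r 0 3)))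
      (fun r => k r + kappa / 2 * (S2 r 0 1 * S2 r 0 2 + - (S2 r 0 0 * S2 r 0 3))).
    exact: (A _ _ _ _ lk (M _ _ _ _ (lc (kappa / 2)) (A _ _ _ _ (M _ _ _ _ (lS 1) (lS 2)) (N _ _ (M _ _ _ _ (lS 0) (lS 3)))))).
  have [C0 H0] := M _ _ _ _ lt (M _ _ _ _ ll (lS 2)).
  have [C1 H1] := M _ _ _ _ lt (M _ _ _ _ ll (lS 3)).
  have [C2 H2] := M _ _ _ _ lt (M _ _ _ _ ls (lS 3)).
  have [C3 H3] := M _ _ _ _ lt (N _ _ (M _ _ _ _ ls (lS 2))).
  exists (C0 + C1 + C2 + C3) => r Tr i; rewrite -/(delta r).
  have [p0 _ h0] := H0 r Tr; have [p1 _ h1] := H1 r Tr.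
  have [p2 _ h2] := H2 r Tr; have [p3 _ h3] := H3 r Tr.
  have pos (C x : R) : `|x| <= C -> 0 <= C * delta r.
    by move=> h; apply: mulr_ge0 => //; exact: le_trans h.
  have q0 := pos _ _ p0; have q1 := pos _ _ p1; have q2 := pos _ _ p2; have q3 := pos _ _ p3.
  rewrite !mulrDl; have [l0 l1 l2 l3] := le_sum4 q0 q1 q2 q3.
  have entry j : (V true r - V false r) 0 j = theta r * frenet_field kappa (k r) (S1 r) 0 j
      - theta r * frenet_field kappa (k r) (S2 r) 0 j by rewrite !mxE.
  rewrite entry /frenet_field.
  have [E0 E1 E2 E3] := vec4E ((1 + kappa / 4 * (S1 r 0 0 ^+ 2 + S1 r 0 1 ^+ 2)) * S1 r 0 2)
    ((1 + kappa / 4 * (S1 r 0 0 ^+ 2 + S1 r 0 1 ^+ 2)) * S1 r 0 3)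
    ((k r + kappa / 2 * (S1 r 0 1 * S1 r 0 2 - S1 r 0 0 * S1 r 0 3)) * S1 r 0 3)
    (- ((k r + kappa / 2 * (S1 r 0 1 * S1 r 0 2 - S1 r 0 0 * S1 r 0 3)) * S1 r 0 2)).
  have [F0 F1 F2 F3] := vec4E ((1 + kappa / 4 * (S2 r 0 0 ^+ 2 + S2 r 0 1 ^+ 2)) * S2 r 0 2)
    ((1 + kappa / 4 * (S2 r 0 0 ^+ 2 + S2 r 0 1 ^+ 2)) * S2 r 0 3)
    ((k r + kappa / 2 * (S2 r 0 1 * S2 r 0 2 - S2 r 0 0 * S2 r 0 3)) * S2 r 0 3)
    (- ((k r + kappa / 2 * (S2 r 0 1 * S2 r 0 2 - S2 r 0 0 * S2 r 0 3)) * S2 r 0 2)).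
  case: i => -[|[|[|[|j]]]] lti //.
  + rewrite (_ : Ordinal lti = 0); last exact: val_inj.
    rewrite E0 F0; exact: le_trans h0 l0.
  + rewrite (_ : Ordinal lti = 1); last exact: val_inj.
    rewrite E1 F1; exact: le_trans h1 l1.
  + rewrite (_ : Ordinal lti = 2); last exact: val_inj.
    rewrite E2 F2; exact: le_trans h2 l2.
  + rewrite (_ : Ordinal lti = 3); last exact: val_inj.
    rewrite E3 F3; exact: le_trans h3 l3.
- by rewrite e subrr.
Qed.

(** * Maximal solutions of the Frenet equations *)

Section FrenetCurves.
Context {R : realType}.
Variable kappa : R.
Implicit Types (P : {poly R}) (J : set R) (S : R -> 'rV[R]_4) (s t : R).

Definition frenet_curve P J S := [/\ open J, is_interval J & forall t, J t ->
  [/\ is_derive t 1 S (frenet_field kappa P.[t] (S t)),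
      0 < 1 + kappa / 4 * (S t 0 0 ^+ 2 + S t 0 1 ^+ 2) & S t 0 2 ^+ 2 + S t 0 3 ^+ 2 = 1] ].

Lemma frenet_curve_unique P J J1 J2 S1 S2 s t : is_interval J -> J `<=` J1 -> J `<=` J2 ->
  frenet_curve P J1 S1 -> frenet_curve P J2 S2 -> J s -> J t -> S1 s = S2 s -> S1 t = S2 t.
Proof.
move=> iJ JJ1 JJ2 [_ _ C1] [_ _ C2]; apply: (frenet_unique (kappa := kappa) (theta := fun=> 1) (k := fun r => P.[r]) iJ).
- move=> r _; split; first exact: cst_continuous.
  exact: continuous_horner.
- by move=> r Jr; rewrite scale1r; have [] := C1 r (JJ1 r Jr).
- by move=> r Jr; rewrite scale1r; have [] := C2 r (JJ2 r Jr).
Qed.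

Lemma is_intervalI J1 J2 : is_interval J1 -> is_interval J2 -> is_interval (J1 `&` J2).
Proof.
by move=> i1 i2 a b [a1 a2] [b1 b2] c h; split; [exact: i1 a1 b1 c h|exact: i2 a2 b2 c h].
Qed.

Lemma is_intervalU J1 J2 s : is_interval J1 -> is_interval J2 -> J1 s -> J2 s ->
  is_interval (J1 `|` J2).
Proof.
move=> i1 i2 s1 s2 a b ha hb c /andP[ac cb]; case: (leP c s) => [cs|/ltW sc].
  by case: ha => ha; [left; apply: (i1 a s)|right; apply: (i2 a s)] => //; rewrite ac cs.
by case: hb => hb; [left; apply: (i1 s b)|right; apply: (i2 s b)] => //; rewrite sc cb.
Qed.

Lemma near_eq_is_derive (V W : normedModType R) (f g : V -> W) (p v : V) l :
  {near p, f =1 g} -> is_derive p v f l -> is_derive p v g l.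
Proof.
move=> fg D; split; last by rewrite -(near_eq_derive v fg); exact: derive_val.
by apply: near_eq_derivable fg _; exact: ex_derive.
Qed.

(** The overlap is an interval containing s, so the two solutions agree on all of it by uniqueness,
    and solving the equation is a local property. *)
Lemma frenet_curve_glue P J1 J2 S1 S2 s : frenet_curve P J1 S1 -> frenet_curve P J2 S2 ->
  J1 s -> J2 s -> S1 s = S2 s ->
  exists S, [/\ frenet_curve P (J1 `|` J2) S, forall t, J1 t -> S t = S1 t & forall t, J2 t -> S t = S2 t].
Proof.
move=> C1 C2 s1 s2 e; have [G1 i1 D1] := C1; have [G2 i2 D2] := C2.
pose S t := if `[< J1 t >] then S1 t else S2 t.
have SE1 t : J1 t -> S t = S1 t by move=> h; rewrite /S asboolT.
have SE2 t : J2 t -> S t = S2 t.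
  move=> h; rewrite /S; case: asboolP => // h1.
  exact: (frenet_curve_unique (is_intervalI i1 i2) (@subIsetl _ _ _) (@subIsetr _ _ _) C1 C2 (conj s1 s2) (conj h1 h) e).
exists S; split=> //; split; [exact: openU|exact: is_intervalU s1 s2|].
have key J' S' t : open J' -> J' t -> (forall t, J' t -> S t = S' t) ->
  [/\ is_derive t 1 S' (frenet_field kappa P.[t] (S' t)),
      0 < 1 + kappa / 4 * (S' t 0 0 ^+ 2 + S' t 0 1 ^+ 2) & S' t 0 2 ^+ 2 + S' t 0 3 ^+ 2 = 1] ->
  [/\ is_derive t 1 S (frenet_field kappa P.[t] (S t)),
      0 < 1 + kappa / 4 * (S t 0 0 ^+ 2 + S t 0 1 ^+ 2) & S t 0 2 ^+ 2 + S t 0 3 ^+ 2 = 1].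
  move=> oJ' Jt' SE [h1 h2 h3]; rewrite SE //; split=> //.
  by apply: near_eq_is_derive h1; apply: (near_eq_open oJ' Jt') => q /SE.
by move=> t [h|h]; [exact: (key J1 S1 t G1 h SE1 (D1 t h))|exact: (key J2 S2 t G2 h SE2 (D2 t h))].
Qed.

(** The domain is the union of the domains of all solutions with the given value at s0, whose values
    are coherent by uniqueness. A solution that meets the maximal one anywhere can be glued to it,
    hence is contained in it. *)
Lemma frenet_curve_maximal P J0 S0 s0 : frenet_curve P J0 S0 -> J0 s0 ->
  exists J S, [/\ frenet_curve P J S, J s0, S s0 = S0 s0 &
    forall J' S' s, frenet_curve P J' S' -> J s -> J' s -> S s = S' s ->
      J' `<=` J /\ forall t, J' t -> S t = S' t].
Proof.
move=> C0 J0s.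
pose good t (JS : set R * (R -> 'rV[R]_4)) :=
  [/\ frenet_curve P JS.1 JS.2, JS.1 s0, JS.1 t & JS.2 s0 = S0 s0].
pose J t := exists JS, good t JS.
(* A solution reaching t is chosen for each t in the union; elsewhere the initial one is a
   default. *)
have pick t : exists JS, J t -> good t JS.
  by case: (pselect (J t)) => [[JS h]|n]; [exists JS|exists (J0, S0)].
have [F FP] := choice pick.
pose S t := (F t).2 t.
have SE J' S' t : frenet_curve P J' S' -> J' s0 -> S' s0 = S0 s0 -> J' t -> J t /\ S t = S' t.
  move=> C' J's0 e J't; have Jt : J t by exists (J', S'); split.
  split=> //; have [C1 h1 h2 h3] := FP t Jt; rewrite /S.
  have [_ i1 _] := C1; have [_ i2 _] := C'.
  apply: (frenet_curve_unique (is_intervalI i1 i2) (@subIsetl _ _ _) (@subIsetr _ _ _) C1 C'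
    (conj h1 J's0) (conj h2 J't)).
  by rewrite h3 e.
have CS : frenet_curve P J S.
  split.
  - rewrite openE => t Jt; have [C1 h1 h2 h3] := FP t Jt; have [oF _ _] := C1.
    apply: (@filterS _ _ _ (F t).1); last exact: open_nbhs_nbhs.
    by move=> q hq; have [] := SE _ _ q C1 h1 h3 hq.
  - move=> a b Ja Jb c /andP[ac cb].
    have [Ca ha1 ha2 ha3] := FP a Ja; have [Cb hb1 hb2 hb3] := FP b Jb.
    have [_ ia _] := Ca; have [_ ib _] := Cb.
    case: (leP c s0) => [cs|/ltW sc].
      by have [] := SE _ _ c Ca ha1 ha3 (ia a s0 ha2 ha1 c (introT andP (conj ac cs))).
    by have [] := SE _ _ c Cb hb1 hb3 (ib s0 b hb1 hb2 c (introT andP (conj sc cb))).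
  - move=> t Jt; have [C1 h1 h2 h3] := FP t Jt; have [oF _ D] := C1.
    have [d1 d2 d3] := D t h2; have e : S t = (F t).2 t by [].
    rewrite e; split=> //; apply: near_eq_is_derive d1.
    by apply: (near_eq_open oF h2) => q hq; have [_ ->] := SE _ _ q C1 h1 h3 hq.
have [Js0 Ss0] := SE _ _ s0 C0 J0s (erefl _) J0s.
exists J, S; split=> // J' S' s C' Js J's e.
have [S'' [C'' e1 e2] ] := frenet_curve_glue CS C' Js J's e.
have h t : J' t -> J t /\ S t = S' t.
  move=> J't; rewrite -(e2 t J't); apply: (SE _ _ _ C''); [by left| |by right].
  by rewrite e1.
by split=> t /h[].
Qed.

End FrenetCurves.

(** * Comparison of two Frenet curves with the same trace *)

Section Reparametrization.
Context {R : realType}.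
Variable kappa : R.
Implicit Types (P Q : {poly R}) (J I : set R) (S : R -> 'rV[R]_4) (s t : R).

Lemma is_derive_row n (F : R -> 'rV[R]_n) (t : R) (l : 'rV[R]_n) :
  (forall j, is_derive t 1 (fun s => F s 0 j) (l 0 j)) -> is_derive t 1 F l.
Proof.
move=> D; have dF : derivable F t 1.
  by apply/derivable_mxP => i j; rewrite ord1; exact: (@ex_derive _ _ _ _ _ _ _ (D j)).
split=> //; rewrite derive_mx //; apply/rowP => j; rewrite mxE.
exact: (@derive_val _ _ _ _ _ _ _ (D j)).
Qed.

Lemma is_derive_unique (f : R -> R) (t l l' : R) : is_derive t 1 f l -> is_derive t 1 f l' -> l = l'.
Proof.
by move=> D D'; rewrite -(@derive_val _ _ _ _ _ _ _ D) (@derive_val _ _ _ _ _ _ _ D').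
Qed.

Lemma is_derive_entry n (F : R -> 'rV[R]_n) (t : R) (l : 'rV[R]_n) j :
  is_derive t 1 F l -> is_derive t 1 (fun s => F s 0 j) (l 0 j).
Proof.
move=> D; have := is_derive_coord j (@ex_derive _ _ _ _ _ _ _ D).
by rewrite (@derive_val _ _ _ _ _ _ _ D).
Qed.

Lemma frenet_fieldE (c : R) (S : 'rV[R]_4) :
  [/\ frenet_field kappa c S 0 0 = (1 + kappa / 4 * (S 0 0 ^+ 2 + S 0 1 ^+ 2)) * S 0 2,
      frenet_field kappa c S 0 1 = (1 + kappa / 4 * (S 0 0 ^+ 2 + S 0 1 ^+ 2)) * S 0 3,
      frenet_field kappa c S 0 2 = (c + kappa / 2 * (S 0 1 * S 0 2 - S 0 0 * S 0 3)) * S 0 3 &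
      frenet_field kappa c S 0 3 = - ((c + kappa / 2 * (S 0 1 * S 0 2 - S 0 0 * S 0 3)) * S 0 2)].
Proof. exact: vec4E. Qed.

(** For e = -1 the state of the reversed curve, for e = 1 the identity. *)
Definition flip (e : R) (S : 'rV[R]_4) : 'rV[R]_4 := vec4 (S 0 0) (S 0 1) (e * S 0 2) (e * S 0 3).

(** The change of parameter is a translation or a reflection; a reflection changes the sign of the
    direction and of the curvature. *)
Lemma frenet_curve_flip (e s1 t1 : R) P Q J S : e ^+ 2 = 1 -> frenet_curve kappa P J S ->
  (forall t, Q.[t] = e * P.[s1 + e * (t - t1)]) ->
  frenet_curve kappa Q [set t | J (s1 + e * (t - t1))] (fun t => flip e (S (s1 + e * (t - t1)))).
Proof.
move=> e2 [oJ iJ C] QP; pose th t := s1 + e * (t - t1).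
have dth t : is_derive t 1 th e.
  have D := is_derive_add (is_derive_const s1 t 1) (is_derive_scale e
    (is_derive_add (is_derive_id t 1) (is_derive_const (- t1) t 1))).
  by apply: (is_derive_eq D); rewrite addr0 add0r mulr1.
split.
- apply: open_comp => // t _; apply: differentiable_continuous; apply/derivable1_diffP.
  exact: (@ex_derive _ _ _ _ _ _ _ (dth t)).
- move=> a b Ja Jb c /andP[ac cb] /=.
  have := sqrf_eq1 e; rewrite e2 eqxx => /esym/orP[/eqP e1|/eqP e1].
    by apply: (iJ _ _ Ja Jb); rewrite e1 !mul1r; apply/andP; split; lra.
  by apply: (iJ _ _ Jb Ja); rewrite e1 !mulN1r; apply/andP; split; lra.
move=> t Jt; have [D d2 d3] := C _ Jt; rewrite -/(th t) in D d2 d3 *.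
have [F0 F1 F2 F3] := vec4E (S (th t) 0 0) (S (th t) 0 1) (e * S (th t) 0 2) (e * S (th t) 0 3).
rewrite -/(flip e (S (th t))) in F0 F1 F2 F3; rewrite F0 F1 F2 F3.
have ee : e * e = 1 by rewrite -expr2.
split=> //; last by rewrite !exprMn e2 !mul1r.
have co j : is_derive t 1 (fun s => S (th s) 0 j) (frenet_field kappa P.[th t] (S (th t)) 0 j * e).
  exact: (@is_derive1_comp _ (fun s => S s 0 j) th t _ _ (is_derive_entry j D) (dth t)).
have [V0 V1 V2 V3] := frenet_fieldE P.[th t] (S (th t)).
have [W0 W1 W2 W3] := frenet_fieldE Q.[t] (flip e (S (th t))).
have c0 := co 0; have c1 := co 1; have c2 := is_derive_scale e (co 2); have c3 := is_derive_scale e (co 3).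
rewrite V0 in c0; rewrite V1 in c1; rewrite V2 in c2; rewrite V3 in c3.
rewrite F0 F1 F2 F3 in W0 W1 W2 W3.
move: W0 W1 W2 W3 c0 c1 c2 c3; rewrite QP -/(th t).
move: (S (th t) 0 0) (S (th t) 0 1) (S (th t) 0 2) (S (th t) 0 3) P.[th t] => x y a b c.
move=> W0 W1 W2 W3 c0 c1 c2 c3; apply: is_derive_row => j.
have fl i : (fun s => flip e (S (th s)) 0 i) = if val i == 0%N then (fun s => S (th s) 0 0)
  else if val i == 1%N then (fun s => S (th s) 0 1) else if val i == 2 then (fun s => e * S (th s) 0 2)
  else (fun s => e * S (th s) 0 3).
  by apply/funext => s; rewrite mxE; case: i => -[|[|[|[|i]]]].
rewrite fl; case: j => -[|[|[|[|j]]]] lt //=.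
- rewrite (_ : Ordinal lt = 0); last exact: val_inj.
  by apply: (is_derive_eq c0); rewrite W0; ring.
- rewrite (_ : Ordinal lt = 1); last exact: val_inj.
  by apply: (is_derive_eq c1); rewrite W1; ring.
- rewrite (_ : Ordinal lt = 2); last exact: val_inj.
  by apply: (is_derive_eq c2); rewrite W2; ring.
- rewrite (_ : Ordinal lt = 3); last exact: val_inj.
  by apply: (is_derive_eq c3); rewrite W3; ring.
Qed.

(** Equal positions have velocities that agree up to the factor th', and unit length gives th'^2 =
    1. Once this sign is constant, th is affine, and the remaining two equations compare the
    curvatures. *)
Lemma frenet_reparametrization P1 P2 J1 J2 I S1 S2 (th : R -> R) s :
  frenet_curve kappa P1 J1 S1 -> frenet_curve kappa P2 J2 S2 ->
  open I -> is_interval I -> I `<=` J1 -> I s ->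
  (forall t, I t -> derivable th t 1) -> (forall t, I t -> J2 (th t)) ->
  (forall t, I t -> S1 t 0 0 = S2 (th t) 0 0 /\ S1 t 0 1 = S2 (th t) 0 1) ->
  exists2 e : R, e ^+ 2 = 1 & forall t, I t -> [/\ th t = th s + e * (t - s),
    P1.[t] = e * P2.[th t] & S1 t = flip e (S2 (th t))].
Proof.
move=> [_ _ C1] [_ _ C2] oI iI IJ1 Is dth IJ2 pos.
pose dt t := 'D_1 th t.
have Dth t : I t -> is_derive t 1 th (dt t) by move=> /dth; exact: derivableP.
have D1 j t : I t -> is_derive t 1 (fun s => S1 s 0 j) (frenet_field kappa P1.[t] (S1 t) 0 j).
  by move=> /IJ1/C1[D _ _]; exact: is_derive_entry.
have D2 j t : I t -> is_derive t 1 (fun s => S2 (th s) 0 j)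
    (frenet_field kappa P2.[th t] (S2 (th t)) 0 j * dt t).
  move=> It; have [D _ _] := C2 _ (IJ2 t It).
  exact: (@is_derive1_comp _ (fun s => S2 s 0 j) th t _ _ (is_derive_entry j D) (Dth t It)).
have sameD (f g : R -> R) t l l' : I t -> (forall t, I t -> f t = g t) ->
    is_derive t 1 f l -> is_derive t 1 g l' -> l = l'.
  move=> It fg Df; apply: is_derive_unique.
  by apply: near_eq_is_derive Df; apply: (near_eq_open oI It).
have ab t (It : I t) : S1 t 0 2 = dt t * S2 (th t) 0 2 /\ S1 t 0 3 = dt t * S2 (th t) 0 3.
  have e0 := sameD _ _ t _ _ It (fun t It => (pos t It).1) (D1 0 t It) (D2 0 t It).
  have e1 := sameD _ _ t _ _ It (fun t It => (pos t It).2) (D1 1 t It) (D2 1 t It).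
  have [V0 V1 _ _] := frenet_fieldE P1.[t] (S1 t); have [W0 W1 _ _] := frenet_fieldE P2.[th t] (S2 (th t)).
  have [p0 p1] := pos t It; have [_ l0 _] := C2 _ (IJ2 t It).
  rewrite V0 W0 p0 p1 in e0; rewrite V1 W1 p0 p1 in e1.
  move/lt0r_neq0: l0 e0 e1; move: (1 + _) => l l0 e0 e1.
  by split; apply: (mulfI l0); [rewrite e0|rewrite e1]; ring.
have dt2 t (It : I t) : dt t ^+ 2 = 1.
  have [e0 e1] := ab t It; have [_ _ u1] := C1 _ (IJ1 t It); have [_ _ u2] := C2 _ (IJ2 t It).
  by rewrite e0 e1 in u1; rewrite -u1 !exprMn -mulrDr u2 mulr1.
(* Continuity of th' is not among the hypotheses. But th' equals the scalar product psi of the two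
   directions, which is differentiable, and psi^2 = 1 forces psi' = 0. *)
pose psi t := S1 t 0 2 * S2 (th t) 0 2 + S1 t 0 3 * S2 (th t) 0 3.
have psiE t (It : I t) : dt t = psi t.
  have [e0 e1] := ab t It; have [_ _ u2] := C2 _ (IJ2 t It).
  by rewrite /psi e0 e1; apply: (lin_comb1 u2 (c := - dt t)); ring.
have dpsi t (It : I t) : is_derive t 1 psi 0.
  have D := is_derive_add (is_derive_mul (D1 2 t It) (D2 2 t It)) (is_derive_mul (D1 3 t It) (D2 3 t It)).
  set l := (X in is_derive _ _ _ X) in D.
  have z : l * psi t + psi t * l = 0.
    have pp q (Iq : I q) : psi q * psi q = 1 by rewrite -psiE // -expr2 dt2.
    exact: (sameD (fun q => psi q * psi q) (fun=> 1) t _ 0 It pp (is_derive_mul D D) (is_derive_const 1 t 1)).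
  have psi0 : psi t != 0 by rewrite -psiE // -sqrf_eq0 dt2 // oner_eq0.
  have z2 : psi t * l = 0 by apply: (lin_comb1 z (c := 2^-1)); field.
  by apply: (is_derive_eq D); apply: (mulfI psi0); rewrite mulr0.
have dtc t (It : I t) : dt t = dt s.
  rewrite !psiE //; exact: (zero_derive_const iI dpsi It Is).
exists (dt s); first exact: dt2.
set e := dt s in dtc *; have e2 : e * e = 1 by rewrite -expr2 dt2.
move=> t It.
have lin : th t - e * t = th s - e * s.
  apply: (zero_derive_const (f := fun t => th t - e * t) iI _ It Is) => q Iq.
  have D := is_derive_add (Dth q Iq) (is_derive_opp (is_derive_scale e (is_derive_id q 1))).
  by apply: (is_derive_eq D); rewrite (dtc q Iq) mulr1 subrr.
have [a1 b1] := ab t It; rewrite (dtc t It) in a1 b1.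
have e3 := sameD _ _ t _ _ It (fun t It => (ab t It).1) (D1 2 t It).
have e4 := sameD _ _ t _ _ It (fun t It => (ab t It).2) (D1 3 t It).
have m j : is_derive t 1 (fun s => dt s * S2 (th s) 0 j) (e * (frenet_field kappa P2.[th t] (S2 (th t)) 0 j * dt t)).
  apply: near_eq_is_derive (is_derive_scale e (D2 j t It)).
  by apply: (near_eq_open oI It) => q Iq; rewrite (dtc q Iq).
have {}e3 := e3 _ (m 2); have {}e4 := e4 _ (m 3).
have [p0 p1] := pos t It.
split.
- by apply: (lin_comb1 lin (c := 1)); ring.
- have [_ _ V2 V3] := frenet_fieldE P1.[t] (S1 t); have [_ _ W2 W3] := frenet_fieldE P2.[th t] (S2 (th t)).
  have [_ _ u2] := C2 _ (IJ2 t It).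
  rewrite V2 W2 (dtc t It) p0 p1 a1 b1 in e3; rewrite V3 W3 (dtc t It) p0 p1 a1 b1 in e4.
  move: e3 e4 u2; move: (S2 (th t) 0 0) (S2 (th t) 0 1) (S2 (th t) 0 2) (S2 (th t) 0 3) => x y a b.
  move: P1.[t] P2.[th t] => k1 k2 e3 e4 u2.
  have z3 : (k1 - e * k2) * b = 0.
    apply: (lin_comb2 e3 e2 (c1 := e) (c2 := - k1 * b + e * k2 * b - (kappa / 2 * (y * a - x * b)) * b * e + e * kappa / 2 * (y * a - x * b) * b)); ring.
  have z4 : (k1 - e * k2) * a = 0.
    apply: (lin_comb2 e4 e2 (c1 := - e) (c2 := - k1 * a + e * k2 * a)); ring.
  have z : k1 - e * k2 = 0.
    apply: (lin_comb3 z3 z4 u2 (c1 := b) (c2 := a) (c3 := - (k1 - e * k2))); ring.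
  by apply/eqP; rewrite -subr_eq0; apply/eqP.
- have [F0 F1 F2 F3] := vec4E (S2 (th t) 0 0) (S2 (th t) 0 1) (e * S2 (th t) 0 2) (e * S2 (th t) 0 3).
  by apply: row4P; rewrite ?F0 ?F1 ?F2 ?F3.
Qed.

Lemma poly_eq_open P Q I s : open I -> I s -> (forall t, I t -> P.[t] = Q.[t]) -> P = Q.
Proof.
move=> oI Is PQ; apply/eqP; rewrite -subr_eq0; apply: contraT => nz.
have /nbhs_ballP[r /= r0 H] : nbhs s I by exact: open_nbhs_nbhs.
(* As many distinct roots as the size of P - Q, one more than its degree; the shift in [i.+2] keeps
   them at distance less than r from s. *)
pose rs := [seq s + r / (i.+2)%:R | i <- iota 0 (size (P - Q))].
have := max_poly_roots nz (rs := rs); rewrite size_map size_iota ltnn => -> //.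
  apply/allP => _ /mapP[i _ ->]; rewrite rootE !hornerE PQ ?subrr //.
  apply: H; rewrite /ball /= opprD addrA subrr sub0r normrN gtr0_norm ?divr_gt0 ?ltr0n //.
  by rewrite ltr_pdivrMr ?ltr0n // ltr_pMr // ltr1n.
rewrite map_inj_uniq ?iota_uniq // => i j /addrI /(mulfI (lt0r_neq0 r0)) /invr_inj /eqP.
by rewrite eqr_nat => /eqP [].
Qed.

End Reparametrization.

(** * Arc length and geodesic curvature of Frenet curves *)

Section CurveGeometry.
Context {R : realType}.
Implicit Types (J : set R) (t : R).

Fixpoint derivable_upto (W : normedModType R) (n : nat) (J : set R) (f : R -> W) : Prop :=
  (forall t, J t -> derivable f t 1) /\ (if n is n'.+1 then derivable_upto n' J (derive1 f) else True).

Lemma eq_Dn (W : normedModType R) n J (f g : R -> W) : open J -> (forall t, J t -> f t = g t) ->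
  derivable_upto n J f -> derivable_upto n J g.
Proof.
move=> oJ; elim: n f g => [|n IH] f g fg [df Df]; split=> //.
- by move=> t Jt; apply: near_eq_derivable (df t Jt); exact: near_eq_open oJ Jt fg.
- by move=> t Jt; apply: near_eq_derivable (df t Jt); exact: near_eq_open oJ Jt fg.
apply: IH Df => t Jt; rewrite !derive1E; apply: near_eq_derive; exact: near_eq_open oJ Jt fg.
Qed.

Lemma Dn_low (W : normedModType R) n J (f : R -> W) : derivable_upto n.+1 J f -> derivable_upto n J f.
Proof. by elim: n f => [|n IH] f [df Df]; split=> //; exact: IH. Qed.

Lemma Dn_step (W : normedModType R) n J (f g : R -> W) : open J ->
  (forall t, J t -> is_derive t 1 f (g t)) -> derivable_upto n J g -> derivable_upto n.+1 J f.
Proof.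
move=> oJ D Dg; split=> [t /D h|]; first exact: (@ex_derive _ _ _ _ _ _ _ h).
apply: eq_Dn Dg => // t /D h; rewrite derive1E; exact: esym (@derive_val _ _ _ _ _ _ _ h).
Qed.

Lemma Dn_derive1n (W : normedModType R) J (f : R -> W) n t : derivable_upto n J f -> J t ->
  derivable (derive1n n f) t 1.
Proof.
elim: n f => [|n IH] f [df Df] Jt; first exact: df.
by rewrite derive1Sn; exact: IH.
Qed.

Lemma Dn_cst n J (c : R) : open J -> derivable_upto n J (fun=> c).
Proof.
move=> oJ; elim: n c => [|n IH] c; first by split=> // t _; exact: derivable_cst.
exact: (@Dn_step R n J _ (fun=> 0) oJ (fun t _ => is_derive_const c t 1) (IH 0)).
Qed.

Lemma Dn_D n J (f g : R -> R) : open J -> derivable_upto n J f -> derivable_upto n J g -> derivable_upto n J (fun t => f t + g t).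
Proof.
move=> oJ; elim: n f g => [|n IH] f g [df Df] [dg Dg].
  split; [move=> t Jt|exact: I].
  exact: (@ex_derive _ _ _ _ _ _ _ (is_derive_add (derivableP (df t Jt)) (derivableP (dg t Jt)))).
apply: (Dn_step oJ _ (IH _ _ Df Dg)) => t Jt; rewrite !derive1E.
exact: is_derive_add (derivableP (df t Jt)) (derivableP (dg t Jt)).
Qed.

Lemma Dn_M n J (f g : R -> R) : open J -> derivable_upto n J f -> derivable_upto n J g -> derivable_upto n J (fun t => f t * g t).
Proof.
move=> oJ; elim: n f g => [|n IH] f g Df0 Dg0; have [df Df] := Df0; have [dg Dg] := Dg0.
  split; [move=> t Jt|exact: I].
  exact: (@ex_derive _ _ _ _ _ _ _ (is_derive_mul (derivableP (df t Jt)) (derivableP (dg t Jt)))).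
have D t : J t -> is_derive t 1 (fun t => f t * g t) (derive1 f t * g t + f t * derive1 g t).
  by move=> Jt; rewrite !derive1E; exact: is_derive_mul (derivableP (df t Jt)) (derivableP (dg t Jt)).
apply: (Dn_step oJ D); exact: Dn_D oJ (IH _ _ Df (Dn_low Dg0)) (IH _ _ (Dn_low Df0) Dg).
Qed.

Lemma is_derive_vec2_row (f g : R -> R) t l m : is_derive t 1 f l -> is_derive t 1 g m ->
  is_derive t 1 (fun t => vec2 (f t) (g t)) (vec2 l m).
Proof.
move=> Df Dg; have [l0 l1] := vec2E l m.
have e0 : (fun s => vec2 (f s) (g s) 0 0) = f by apply/funext => s; have [] := vec2E (f s) (g s).
have e1 : (fun s => vec2 (f s) (g s) 0 1) = g by apply/funext => s; have [] := vec2E (f s) (g s).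
apply: is_derive_row => -[[|[|j]] lt] //.
  by rewrite (_ : Ordinal lt = 0); [rewrite e0 l0|exact: val_inj].
by rewrite (_ : Ordinal lt = 1); [rewrite e1 l1|exact: val_inj].
Qed.

Lemma Dn_vec2 n J (f g : R -> R) : open J -> derivable_upto n J f -> derivable_upto n J g -> derivable_upto n J (fun t => vec2 (f t) (g t)).
Proof.
move=> oJ; have D := is_derive_vec2_row.
elim: n f g => [|n IH] f g [df Df] [dg Dg].
  split=> // t Jt; exact: (@ex_derive _ _ _ _ _ _ _ (D _ _ _ _ _ (derivableP (df t Jt)) (derivableP (dg t Jt)))).
apply: (Dn_step oJ _ (IH _ _ Df Dg)) => t Jt; rewrite !derive1E.
exact: D (derivableP (df t Jt)) (derivableP (dg t Jt)).
Qed.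

Lemma is_derive_poly (Q : {poly R}) t : is_derive t 1 (fun t => Q.[t]) (deriv Q).[t].
Proof.
have D : is_derive t 1 (horner Q) (deriv Q).[t].
  apply: DeriveDef; first exact: derivable_horner.
  by rewrite -derive1E -derivE.
exact: D.
Qed.

Variable kappa : R.
Local Notation lam q := (bcv_factor kappa q).

Lemma base_entry (q : 'rV[R]_2) i j : base_metric kappa q i j = (lam q) ^- 2 * (i == j)%:R.
Proof.
rewrite /base_metric !mxE !big_ord1 !mxE; congr (_ * _).
by case: i j => -[|[|i]] lti // [[|[|j]] ltj] //=; rewrite ?mulr0 ?mul0r ?mulr1 ?addr0 ?add0r.
Qed.

Lemma base_inner (q u v : 'rV[R]_2) :
  inner (base_metric kappa) q u v = (lam q) ^- 2 * (u 0 0 * v 0 0 + u 0 1 * v 0 1).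
Proof.
rewrite innerE !sum_ord2 !base_entry /=; ring.
Qed.

Lemma is_derive_base_lam (q u : 'rV[R]_2) : lam q != 0 ->
  is_derive q u (fun x => (lam x) ^- 2)
    (- kappa * (q 0 0 * u 0 0 + q 0 1 * u 0 1) / (lam q) ^+ 3).
Proof.
move=> l0; have did : derivable (@id 'rV[R]_2) q u by exact: derivable_id.
have d j : is_derive q u (fun x : 'rV[R]_2 => x 0 j) (u 0 j).
  by have := is_derive_coord j did; rewrite derive_id.
have dl : is_derive q u (fun x : 'rV[R]_2 => lam x) (kappa / 2 * (q 0 0 * u 0 0 + q 0 1 * u 0 1)).
  have := is_derive_add (is_derive_const 1 q u) (is_derive_scale (kappa / 4)
    (is_derive_add (is_derive_mul (d 0) (d 0)) (is_derive_mul (d 1) (d 1)))).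
  by move=> H; apply: (is_derive_eq H); field.
have l2 : lam q * lam q != 0 by rewrite mulf_neq0.
have := is_derive_inv (f := fun x : 'rV[R]_2 => lam x * lam x) l2 (is_derive_mul dl dl).
by move=> H; apply: (is_derive_eq H); field.
Qed.

Lemma base_entry_diff (q : 'rV[R]_2) i j : 0 < lam q ->
  differentiable (fun x => base_metric kappa x i j) q.
Proof.
move=> l0; pose O := bcv_domain kappa : set 'rV[R]_2.
have sl : smooth_on setT (fun x : 'rV[R]_2 => lam x).
  have sx k : smooth_on setT (fun q : 'rV[R]_2 => q 0 k) by exact: (smooth_id_coord k openT).
  apply: (smoothD openT (smooth_cst _)); apply: (smoothM openT (smooth_cst _)).
  apply: (smoothD openT); first exact: (smoothX (f := fun q : 'rV[R]_2 => q 0 0) 2 openT (sx 0)).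
  exact: (smoothX (f := fun q : 'rV[R]_2 => q 0 1) 2 openT (sx 1)).
have oO : open O.
  apply: open_comp (@open_gt R 0) => x _; apply: differentiable_continuous.
  exact: (smooth_on_diff sl).
rewrite (_ : (fun x => _) = fun x => (lam x ^+ 2)^-1 * (i == j)%:R); last by apply/funext => x; exact: base_entry.
apply: (smooth_on_diff (U := O)) => //; apply: smoothM => //; last exact: smooth_cst.
apply: smoothV => //; first by move=> x Ox; rewrite expf_neq0 // gt_eqF.
apply: smoothX => //; apply: smooth_on_sub sl; exact: subsetT.
Qed.

(** The geodesic curvature only involves the component orthogonal to the velocity u; for such w the
    two Koszul terms with the inner product of u and w vanish. *)
Lemma base_christoffel (q u w : 'rV[R]_2) : 0 < lam q -> u 0 0 * w 0 0 + u 0 1 * w 0 1 = 0 ->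
  inner (base_metric kappa) q (christoffel_form (base_metric kappa) q u u) w =
  kappa / 2 * (q 0 0 * w 0 0 + q 0 1 * w 0 1) / (lam q) ^+ 3 * (u 0 0 ^+ 2 + u 0 1 ^+ 2).
Proof.
move=> l0 uw; have ln : lam q != 0 by rewrite gt_eqF.
have D a v v' : 'D_a (fun x => inner (base_metric kappa) x v v') q =
    - kappa * (q 0 0 * a 0 0 + q 0 1 * a 0 1) / (lam q) ^+ 3 * (v 0 0 * v' 0 0 + v 0 1 * v' 0 1).
  rewrite (_ : (fun x => _) = fun x => (v 0 0 * v' 0 0 + v 0 1 * v' 0 1) * (lam x) ^- 2); last first.
    by apply/funext => x; rewrite base_inner mulrC.
  have := is_derive_scale (v 0 0 * v' 0 0 + v 0 1 * v' 0 1) (is_derive_base_lam a ln).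
  by move=> H; rewrite (@derive_val _ _ _ _ _ _ _ H) mulrC.
rewrite koszul.
- rewrite !D uw !mulr0; field; exact: ln.
- by move=> i j; exact: base_entry_diff.
- by move=> x i j; rewrite !base_entry eq_sym.
apply: definite_unitmx => v; rewrite base_inner => /eqP.
rewrite mulf_eq0 invr_eq0 expf_eq0 (negbTE ln) /= -!expr2 paddr_eq0 ?sqr_ge0 // !sqrf_eq0.
by move=> /andP[/eqP v0 /eqP v1]; apply: row2P; rewrite mxE.
Qed.

Lemma frenet_arclength (P : {poly R}) J (S : R -> 'rV[R]_4) : frenet_curve kappa P J S -> J !=set0 ->
  arclength_curve kappa J (fun t => vec2 (S t 0 0) (S t 0 1)) /\
  forall t, J t -> geodesic_curvature kappa (fun t => vec2 (S t 0 0) (S t 0 1)) t = - P.[t].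
Proof.
move=> [oJ iJ C] J0; set gam := fun t => _.
pose l t := 1 + kappa / 4 * (S t 0 0 ^+ 2 + S t 0 1 ^+ 2).
have lE t : lam (gam t) = l t by have [e0 e1] := vec2E (S t 0 0) (S t 0 1); rewrite /bcv_factor /xcoord /ycoord e0 e1.
have D j t : J t -> is_derive t 1 (fun t => S t 0 j) (frenet_field kappa P.[t] (S t) 0 j).
  by move=> /C[h _ _]; exact: is_derive_entry.
have Dg t (Jt : J t) : is_derive t 1 gam (vec2 (l t * S t 0 2) (l t * S t 0 3)).
  have [V0 V1 _ _] := frenet_fieldE kappa P.[t] (S t).
  have d0 := D 0 t Jt; have d1 := D 1 t Jt; rewrite V0 in d0; rewrite V1 in d1.
  exact: is_derive_vec2_row d0 d1.
have g1 t (Jt : J t) : derive1 gam t = vec2 (l t * S t 0 2) (l t * S t 0 3).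
  by rewrite derive1E; exact: (@derive_val _ _ _ _ _ _ _ (Dg t Jt)).
have DP n : derivable_upto n J (fun t => P.[t]).
  elim: n P {C D} => [|n IH] Q; first by split=> // t _; exact: derivable_horner.
  by apply: (Dn_step oJ _ (IH (deriv Q))) => t _; exact: is_derive_poly.
(* Bootstrapping: the derivatives of the coordinates of S are polynomials in these coordinates and
   P, so n derivatives of all of them give one more. *)
have DS n j : derivable_upto n J (fun t => S t 0 j).
  elim: n j => [|n IH] j; first by split=> // t /(D j) h; exact: (@ex_derive _ _ _ _ _ _ _ h).
  apply: (Dn_step oJ (D j)).
  have M f g := @Dn_M n J f g oJ; have A f g := @Dn_D n J f g oJ; have c r := @Dn_cst n J r oJ.
  have ll : derivable_upto n J l by exact: (A _ _ (c 1) (M _ _ (c (kappa / 4)) (A _ _ (M _ _ (IH 0) (IH 0)) (M _ _ (IH 1) (IH 1))))).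
  have ls : derivable_upto n J (fun t => P.[t] + kappa / 2 * (S t 0 1 * S t 0 2 + (-1) * (S t 0 0 * S t 0 3))).
    exact: (A _ _ (DP n) (M _ _ (c (kappa / 2)) (A _ _ (M _ _ (IH 1) (IH 2)) (M _ _ (c (-1)) (M _ _ (IH 0) (IH 3)))))).
  case: j => -[|[|[|[|j]]]] lt //.
  + rewrite (_ : Ordinal lt = 0); last exact: val_inj.
    by apply: (eq_Dn oJ _ (M _ _ ll (IH 2))) => t _; have [-> _ _ _] := frenet_fieldE kappa P.[t] (S t).
  + rewrite (_ : Ordinal lt = 1); last exact: val_inj.
    by apply: (eq_Dn oJ _ (M _ _ ll (IH 3))) => t _; have [_ -> _ _] := frenet_fieldE kappa P.[t] (S t).
  + rewrite (_ : Ordinal lt = 2); last exact: val_inj.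
    by apply: (eq_Dn oJ _ (M _ _ ls (IH 3))) => t _; have [_ _ -> _] := frenet_fieldE kappa P.[t] (S t); rewrite mulN1r.
  + rewrite (_ : Ordinal lt = 3); last exact: val_inj.
    apply: (eq_Dn oJ _ (M _ _ (c (-1)) (M _ _ ls (IH 2)))) => t _; have [_ _ _ ->] := frenet_fieldE kappa P.[t] (S t).
    by rewrite !mulN1r.
split.
  split=> // t Jt; have [_ l0 u] := C t Jt; split.
  - by move=> n; apply: (Dn_derive1n (J := J)) => //; exact: Dn_vec2.
  - by rewrite /bcv_domain /= lE.
  - have [e0 e1] := vec2E (l t * S t 0 2) (l t * S t 0 3).
    rewrite base_inner g1 // e0 e1 lE; move/lt0r_neq0: l0; rewrite -/(l t) => l0.
    by rewrite -[RHS]u; field.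
move=> t Jt; have [_ l0 u] := C t Jt; rewrite -/(l t) in l0; have ln := lt0r_neq0 l0.
have [V0 V1 V2 V3] := frenet_fieldE kappa P.[t] (S t).
have d0 := D 0 t Jt; have d1 := D 1 t Jt; have d2 := D 2 t Jt; have d3 := D 3 t Jt.
rewrite V0 -/(l t) in d0; rewrite V1 -/(l t) in d1; rewrite V2 in d2; rewrite V3 in d3.
have dl := is_derive_add (is_derive_const 1 t 1) (is_derive_scale (kappa / 4)
  (is_derive_add (is_derive_mul d0 d0) (is_derive_mul d1 d1))).
have DD := is_derive_vec2_row (is_derive_mul dl d2) (is_derive_mul dl d3).
have D2 := near_eq_is_derive (near_eq_open oJ Jt (fun q Jq => esym (g1 q Jq))) DD.
have Dd := @derive_val _ _ _ _ _ _ _ D2.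
have lg : 0 < lam (gam t) by rewrite lE.
rewrite /geodesic_curvature covariant_alongE innerDl Dd -derive1E g1 //.
have [q0 q1] := vec2E (S t 0 0) (S t 0 1); rewrite -/(gam t) in q0 q1.
have [e0 e1] := vec2E (l t * S t 0 2) (l t * S t 0 3).
rewrite /xcoord /ycoord e0 e1; have [f0 f1] := vec2E (- (l t * S t 0 3)) (l t * S t 0 2).
rewrite base_christoffel //; last by rewrite e0 e1 f0 f1; ring.
set X := (X in inner _ _ (vec2 X _) _); set Y := (Y in inner _ _ (vec2 _ Y) _).
have [h0 h1] := vec2E X Y.
rewrite base_inner lE e0 e1 f0 f1 q0 q1 h0 h1 /X /Y -/(l t).
move: u ln; move: (S t 0 0) (S t 0 1) (S t 0 2) (S t 0 3) (l t) P.[t] => x y a b L c u ln.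
(* The left side simplifies to -c (a^2 + b^2); with the factor (a^2 + b^2)^2 = 1 inserted on the
   right, the difference is a multiple of the unit condition. *)
rewrite [RHS](_ : _ = - (c * (a ^+ 2 + b ^+ 2) ^+ 2)); last by rewrite u expr1n mulr1.
apply: (lin_comb1 u (c := c * (a ^+ 2 + b ^+ 2))) => //.
by field.
Qed.

End CurveGeometry.

(** * Local structure of vertical surfaces *)

(** On the line through p in the direction v the function s is strictly increasing near p; inverting
    it there reparametrizes the line by the values of s. *)
Lemma line_section (R : realType) (O : set 'rV[R]_2) (s : 'rV[R]_2 -> R) (p v : 'rV[R]_2) :
  open O -> smooth_on O s -> O p -> 0 < 'D_v s p ->
  exists (e : R) (c : R -> 'rV[R]_2), [/\ 0 < e, c (s p) = p & forall t, `|t - s p| < e ->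
    [/\ O (c t), s (c t) = t & exists2 w, is_derive t 1 c w & 'D_w s (c t) = 1] ].
Proof.
move=> oO ss Op sv.
have dsv : {for p, continuous (fun q => 'D_v s q)}.
  have e q : O q -> 'D_v s q = \sum_i v 0 i * partial i s q.
    by move=> Oq; rewrite (derive_sum_partial v (smooth_on_diff ss Oq)).
  have sm : smooth_on O (fun q => 'D_v s q).
    apply: (eq_smooth oO (f := fun q => \sum_i v 0 i * partial i s q)); first by move=> q /e ->.
    apply: smooth_sum => // i; apply: smoothM => //; first exact: smooth_cst.
    exact: smooth_on_partial.
  exact: differentiable_continuous (smooth_on_diff sm Op).
have nO : \forall q \near p, O q by exact: open_nbhs_nbhs.
have nv : \forall q \near p, 0 < 'D_v s q.
  by apply: (dsv [set z | 0 < z]); apply: open_nbhs_nbhs; split; [exact: open_gt|].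
have line : {for (0 : R), continuous (fun t : R => p + t *: v)}.
  have D : differentiable (fun t : R => p + t *: v) (0 : R).
    by apply: differentiableD; [exact: differentiable_cst|exact: differentiableZl].
  exact: differentiable_continuous.
have : \forall t \near (0 : R), O (p + t *: v) /\ 0 < 'D_v s (p + t *: v).
  have H : nbhs (p + (0 : R) *: v) [set q | O q /\ 0 < 'D_v s q].
    by rewrite scale0r addr0; exact: filterI nO nv.
  exact: (line _ H).
case/nbhs_ballP => r /= r0 H.
have Hr (t : R) : `|t - 0| < r -> O (p + t *: v) /\ 0 < 'D_v s (p + t *: v).
  by move=> tr; apply: H; rewrite /ball /= distrC.
have [e [g [e0 g0 gP] ] ] := @local_inverse R (fun t => s (p + t *: v)) (fun t => 'D_v s (p + t *: v)) 0 r r0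
  (fun t tr => conj (is_derive_line (smooth_on_diff ss (Hr t tr).1)) (Hr t tr).2).
have s0 : s (p + 0 *: v) = s p by rewrite scale0r addr0.
rewrite s0 in g0 gP.
exists e, (fun t => p + g t *: v); split=> //; first by rewrite g0 scale0r addr0.
move=> t te; have [h1 h2 h3] := gP t te; have [h4 h5] := Hr _ h1; split=> //.
exists (('D_v s (p + g t *: v))^-1 *: v).
  apply: is_derive_row => j.
  have D := is_derive_add (is_derive_const (p 0 j) t 1) (is_derive_mul h3 (is_derive_const (v 0 j) t 1)).
  have E : (fun s0 => p 0 j + g s0 * v 0 j) = fun s0 => (p + g s0 *: v) 0 j.
    by apply/funext => q; rewrite !mxE.
  by rewrite E in D; apply: (is_derive_eq D); rewrite mxE; ring.
have ds := smooth_on_diff ss h4.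
by rewrite deriveE // linearZ /= -deriveE // /GRing.scale /= mulVf // gt_eqF.
Qed.

Lemma is_derive_along (R : realType) n (f : 'rV[R]_n.+1 -> R) (g : R -> 'rV[R]_n.+1) (t : R) w :
  differentiable f (g t) -> is_derive t 1 g w -> is_derive t 1 (fun t => f (g t)) ('D_w f (g t)).
Proof.
move=> df D; have dg : differentiable g t.
  by apply/derivable1_diffP; exact: (@ex_derive _ _ _ _ _ _ _ D).
have dfg : differentiable (fun t => f (g t)) t by exact: (@differentiable_comp _ _ _ _ g f).
apply: DeriveDef; first exact: diff_derivable.
by rewrite (derive_comp (f := f) (g := g) _ dg df) (@derive_val _ _ _ _ _ _ _ D).
Qed.

Lemma box_convex (R : realType) (p0 p q : 'rV[R]_2) (r t : R) : box p0 r p -> box p0 r q -> 0 <= t <= 1 ->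
  box p0 r (p + t *: (q - p)).
Proof.
have key (x a b : R) : `|a - x| < r -> `|b - x| < r -> 0 <= t <= 1 -> `|a + t * (b - a) - x| < r.
  move=> ha hb /andP[t0 t1]; rewrite (_ : _ - x = (1 - t) * (a - x) + t * (b - x)); last by ring.
  apply: le_lt_trans (ler_normD _ _) _; rewrite !normrM (ger0_norm t0) ger0_norm ?subr_ge0 //.
  (* Strictness is taken from the summand with the factor 1 - t, so t = 1 is treated apart. *)
  have := ler_wpM2l t0 (ltW hb); have [->|tn] := eqVneq t 1.
    by rewrite subrr mul0r add0r !mul1r.
  have t1' : 0 < 1 - t by rewrite subr_gt0 lt_neqAle tn.
  move=> h2; have h1 : (1 - t) * `|a - x| < (1 - t) * r by rewrite ltr_pM2l.
  by have := ltr_leD h1 h2; rewrite -mulrDl subrK mul1r.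
by move=> [p1 p2] [q1 q2] ht; split; rewrite !mxE; exact: key.
Qed.

Lemma box_const (R : realType) (p0 p q : 'rV[R]_2) (r : R) (f : 'rV[R]_2 -> R) : 
  (forall p, box p0 r p -> differentiable f p /\ forall j, partial j f p = 0) ->
  box p0 r p -> box p0 r q -> f p = f q.
Proof.
move=> D Bp Bq; have [|c /andP[c0 c1]] := @MVT_line R _ f p (q - p) 1 ltr01.
  by move=> t ht; apply: (D _ _).1; exact: box_convex.
have Bc : box p0 r (p + c *: (q - p)) by apply: box_convex => //; rewrite !ltW.
have [df f0] := D _ Bc; rewrite (derive_sum_partial _ df) big1 => [|j _].
  have -> : p + 1 *: (q - p) = q by rewrite scale1r addrC subrK.
  by rewrite mul0r => /eqP; rewrite subr_eq0 => /eqP ->.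
by rewrite f0 scaler0.
Qed.

(** * The arc length function of a vertical patch *)

Section Local.
Context {R : realType}.
Variables (kappa : R) (k : nat) (U : set 'rV[R]_2) (X1 X2 : 'rV[R]_2 -> 'rV[R]_2)
  (x y a b c : 'rV[R]_2 -> R).
Hypothesis oU : open U.
Hypothesis cf : cylinder_frame kappa k U X1 X2 x y a b c.
Hypothesis lpos : forall p, U p -> 0 < 1 + kappa / 4 * (x p ^+ 2 + y p ^+ 2).

Implicit Types (p q v : 'rV[R]_2) (X : 'rV[R]_2 -> 'rV[R]_2) (f : 'rV[R]_2 -> R).
Let W p : R := X1 p 0 0 * X2 p 0 1 - X1 p 0 1 * X2 p 0 0.
(** By Cramer's rule, al0 dx + al1 dy is the 1-form with value 1 on X1 and 0 on X2. *)
Let al0 p : R := X2 p 0 1 / W p.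
Let al1 p : R := - X2 p 0 0 / W p.

Let sX1 j : smooth_on U (fun p => X1 p 0 j). Proof. exact: smooth_coord oU (cy_X1 cf). Qed.
Let sX2 j : smooth_on U (fun p => X2 p 0 j). Proof. exact: smooth_coord oU (cy_X2 cf). Qed.

Let sW : smooth_on U W.
Proof. exact: (smoothB oU (smoothM oU (sX1 0) (sX2 1)) (smoothM oU (sX1 1) (sX2 0))). Qed.
Let sal0 : smooth_on U al0.
Proof. exact: (smoothM oU (sX2 1) (smoothV oU (cy_basis cf) sW)). Qed.
Let sal1 : smooth_on U al1.
Proof. exact: (smoothM oU (smoothN oU (sX2 0)) (smoothV oU (cy_basis cf) sW)). Qed.

Let lie2 X f p : lie X f p = X p 0 0 * partial 0 f p + X p 0 1 * partial 1 f p.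
Proof. exact: sum_ord2. Qed.

Lemma coframe_partial f p : U p -> lie X2 f p = 0 ->
  partial 0 f p = al0 p * lie X1 f p /\ partial 1 f p = al1 p * lie X1 f p.
Proof.
move=> Up; have := cy_basis cf Up; rewrite !lie2 /al0 /al1 /W.
move: (X1 p 0 0) (X1 p 0 1) (X2 p 0 0) (X2 p 0 1) (partial 0 f p) (partial 1 f p).
move=> u0 u1 v0 v1 f0 f1 w0 e.
have key (z t : R) : (u0 * v1 - u1 * v0) * z = t -> z = t / (u0 * v1 - u1 * v0).
  by move=> <-; field.
split; rewrite mulrAC; apply: key.
  by apply: (lin_comb1 e (c := - u1)); ring.
by apply: (lin_comb1 e (c := u0)); ring.
Qed.

(** On (X1, X2) the exterior derivative of the dual form alpha is X1 (alpha(X2)) - X2 (alpha(X1)) -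
    alpha([X1, X2]); both values are constant and the fields commute. *)
Lemma coframe_closed p : U p -> partial 1 al0 p = partial 0 al1 p.
Proof.
move=> Up; have w0 := cy_basis cf Up.
have zero X f (r : R) : (forall q, U q -> f q = r) -> lie X f p = 0.
  by move=> fr; rewrite (eq_lie X oU Up fr) lie_cst.
have e1 : lie X2 (fun q => al0 q * X1 q 0 0 + al1 q * X1 q 0 1) p = 0.
  apply: (zero _ _ 1) => q Uq; have := cy_basis cf Uq; rewrite /al0 /al1 /W => h; field; exact: h.
have e2 : lie X1 (fun q => al0 q * X2 q 0 0 + al1 q * X2 q 0 1) p = 0.
  by apply: (zero _ _ 0) => q Uq; have := cy_basis cf Uq; rewrite /al0 /al1 /W => h; field; exact: h.
have x1 := lieD X2 Up (smoothM oU sal0 (sX1 0)) (smoothM oU sal1 (sX1 1)).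
have x2 := lieD X1 Up (smoothM oU sal0 (sX2 0)) (smoothM oU sal1 (sX2 1)).
have y1 := lieM X2 Up sal0 (sX1 0); have y2 := lieM X2 Up sal1 (sX1 1).
have z1 := lieM X1 Up sal0 (sX2 0); have z2 := lieM X1 Up sal1 (sX2 1).
have b0 := cy_bracket cf 0 Up; have b1 := cy_bracket cf 1 Up.
rewrite y1 y2 e1 in x1; rewrite z1 z2 e2 b0 b1 in x2.
move: x1 x2; rewrite (lie2 X2 al0) (lie2 X2 al1) (lie2 X1 al0) (lie2 X1 al1).
move: w0; rewrite -/(W p).
move: (partial 0 al0 p) (partial 1 al0 p) (partial 0 al1 p) (partial 1 al1 p)
  (lie X2 (fun q => X1 q 0 0) p) (lie X2 (fun q => X1 q 0 1) p) (al0 p) (al1 p).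
rewrite /W; move: (X1 p 0 0) (X1 p 0 1) (X2 p 0 0) (X2 p 0 1).
move=> u0 u1 v0 v1 p00 p10 p01 p11 l0 l1 A0 A1 w0 h1 h2.
by apply: (mulfI w0); apply: (lin_comb2 h1 h2 (c1 := -1) (c2 := 1)); ring.
Qed.

Section Arc.
Variables (p0 : 'rV[R]_2) (r : R) (s : 'rV[R]_2 -> R).
Hypothesis r0 : 0 < r.
Hypothesis BU : box p0 r `<=` U.
Hypothesis sP : forall p, box p0 r p -> differentiable s p /\ (partial 0 s p = al0 p /\ partial 1 s p = al1 p).

Lemma arc_smooth : smooth_on (box p0 r) s.
Proof.
have oB : open (box p0 r) by exact: box_open.
apply/smooth_onP; case=> [|n]; first by split=> // p /sP[].
split=> [p /sP[]//|]; case=> -[|[|j]] lt //.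
  rewrite (_ : Ordinal lt = 0); last exact: val_inj.
  apply: (eq_Ck oB (f := al0)); first by move=> q /sP[_ [-> _] ].
  by have /smooth_onP := smooth_on_sub BU sal0; apply.
rewrite (_ : Ordinal lt = 1); last exact: val_inj.
apply: (eq_Ck oB (f := al1)); first by move=> q /sP[_ [_ ->] ].
by have /smooth_onP := smooth_on_sub BU sal1; apply.
Qed.

Lemma arc_derive f p v : box p0 r p -> smooth_on U f -> lie X2 f p = 0 ->
  'D_v f p = lie X1 f p * 'D_v s p.
Proof.
move=> Bp sf f2; have Up := BU Bp; have [f0 f1] := coframe_partial Up f2.
have [ds [s0 s1] ] := sP Bp.
rewrite (derive_sum_partial v (smooth_on_diff sf Up)) (derive_sum_partial v ds) !sum_ord2.
rewrite f0 f1 s0 s1 /GRing.scale /=; ring.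
Qed.

Lemma arc_X1 p : box p0 r p -> 'D_(X1 p) s p = 1.
Proof.
move=> Bp; have [ds [s0 s1] ] := sP Bp; have := cy_basis cf (BU Bp).
rewrite (derive_sum_partial _ ds) sum_ord2 s0 s1 /GRing.scale /= /al0 /al1 /W => h; field; exact: h.
Qed.

(** A function killed by X2 satisfies df = (X1 f) ds. By induction X1 f = Q(s), and for a primitive
    P0 of Q the difference f - P0(s) is constant on the box. *)
Lemma arc_polynomial m f : smooth_on U f ->
  (forall j p, U p -> lie X2 (iter j (lie X1) f) p = 0) ->
  (forall p, U p -> iter m (lie X1) f p = 0) ->
  exists2 P : {poly R}, (size P <= m)%N & forall p, box p0 r p -> f p = P.[s p].
Proof.
elim: m f => [|m IH] f sf f2 fm.
  by exists 0 => [|p /BU/fm]; rewrite ?size_poly0 // horner0.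
have [| | |Q sQ QE] := IH (lie X1 f).
- exact: lie_smooth oU (cy_X1 cf) sf.
- by move=> j p Up; have := f2 j.+1 p Up; rewrite iterSr.
- by move=> p Up; have := fm p Up; rewrite iterSr.
(* The primitive of Q; at i = 0 the division by 0 yields 0, so its constant term vanishes. *)
pose P0 : {poly R} := \poly_(i < m.+1) (Q`_i.-1 / i%:R).
have dP0 : deriv P0 = Q.
  apply/polyP => i; rewrite coef_deriv coef_poly ltnS.
  case: (ltnP i m) => im /=; last by rewrite mul0rn nth_default // (leq_trans sQ).
  by rewrite -[LHS]mulr_natr divfK // pnatr_eq0.
have B0 : box p0 r p0 by exact: box_center.
have oB : open (box p0 r) by exact: box_open.
pose C := f p0 - P0.[s p0].
exists (P0 + C%:P).
  apply: (leq_trans (size_polyD _ _)); rewrite geq_max size_poly /=.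
  by apply: leq_trans (size_polyC_leq1 _) _.
move=> p Bp; rewrite hornerD hornerC.
suff : f p - P0.[s p] = C by move=> <-; rewrite addrC subrK.
apply: (box_const (f := fun q => f q - P0.[s q]) (p0 := p0) (r := r)) => // q Bq.
have Uq := BU Bq; have [ds _] := sP Bq.
have df := smooth_on_diff sf Uq.
have dP : differentiable (fun z : R => P0.[z]) (s q).
  by apply/derivable1_diffP; exact: derivable_horner.
have dPs : differentiable (fun q => P0.[s q]) q by exact: (@differentiable_comp _ _ _ _ s (fun z => P0.[z])).
split; first exact: differentiableB.
move=> j; pose v : 'rV[R]_2 := delta_mx 0 j.
have e1 : 'D_v (fun q => P0.[s q]) q = Q.[s q] * 'D_v s q.
  rewrite (derive_comp (f := fun z : R => P0.[z]) v ds dP).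
  have dh : derivable (fun z : R => P0.[z]) (s q) 1 by exact: derivable_horner.
  rewrite [LHS](_ : _ = 'D_v s q * 'D_1 (fun z : R => P0.[z]) (s q)); last first.
    by rewrite !deriveE // -[X in 'd _ _ X]mulr1 linearZ.
  by rewrite mulrC -derive1E -dP0 derivE.
have e2 := arc_derive v Bq sf (f2 0%N q Uq); rewrite QE // in e2.
rewrite /partial -/v.
have -> : 'D_v (fun q => f q - P0.[s q]) q = 'D_v f q - 'D_v (fun q => P0.[s q]) q.
  by apply: deriveB; exact: diff_derivable.
by rewrite e1 e2 subrr.
Qed.

Definition state p : 'rV[R]_4 := vec4 (x p) (y p) (a p) (b p).

Lemma state_derive p v j : box p0 r p ->
  'D_v (fun q => state q 0 j) p = frenet_field kappa (c p) (state p) 0 j * 'D_v s p.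
Proof.
move=> Bp; have Up := BU Bp.
have [V0 V1 V2 V3] := frenet_fieldE kappa (c p) (state p).
have [S0 S1 S2 S3] := vec4E (x p) (y p) (a p) (b p); rewrite -/(state p) in S0 S1 S2 S3.
rewrite S0 S1 S2 S3 in V0 V1 V2 V3.
have fn : (fun q => state q 0 j) = if val j == 0%N then x else if val j == 1%N then y
    else if val j == 2 then a else b.
  by apply/funext => q; rewrite mxE; case: j => -[|[|[|[|j]]]].
have d0 := arc_derive v Bp (cy_x cf) (cy_x2 cf Up); have d1 := arc_derive v Bp (cy_y cf) (cy_y2 cf Up).
have d2 := arc_derive v Bp (cy_a cf) (cy_a2 cf Up); have d3 := arc_derive v Bp (cy_b cf) (cy_b2 cf Up).
rewrite (cy_x1 cf Up) in d0; rewrite (cy_y1 cf Up) in d1.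
rewrite (cy_a1 cf Up) in d2; rewrite (cy_b1 cf Up) in d3.
rewrite fn; case: j {fn} => -[|[|[|[|j]]]] lt //=.
- by rewrite (_ : Ordinal lt = 0); [rewrite V0|exact: val_inj].
- by rewrite (_ : Ordinal lt = 1); [rewrite V1|exact: val_inj].
- by rewrite (_ : Ordinal lt = 2); [rewrite V2|exact: val_inj].
- by rewrite (_ : Ordinal lt = 3); [rewrite V3|exact: val_inj].
Qed.

Lemma state_smooth j : smooth_on U (fun q => state q 0 j).
Proof.
have -> : (fun q => state q 0 j) = if val j == 0%N then x else if val j == 1%N then y
    else if val j == 2 then a else b.
  by apply/funext => q; rewrite mxE; case: j => -[|[|[|[|j]]]].
case: ifP => _; first exact: cy_x cf.
case: ifP => _; first exact: cy_y cf.
by case: ifP => _; [exact: cy_a cf|exact: cy_b cf].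
Qed.

Lemma state_along (g : R -> 'rV[R]_2) t w : box p0 r (g t) -> is_derive t 1 g w ->
  is_derive t 1 (fun t => state (g t)) ('D_w s (g t) *: frenet_field kappa (c (g t)) (state (g t))).
Proof.
move=> Bp D; apply: is_derive_row => j.
have df : differentiable (fun q => state q 0 j) (g t) := smooth_on_diff (state_smooth j) (BU Bp).
have mz (z : R) (u : 'rV[R]_4) : u 0 j * z = (z *: u) 0 j by rewrite [RHS]mxE mulrC.
exact: (is_derive_eq (is_derive_along df D) (etrans (state_derive _ _ Bp) (mz _ _))).
Qed.

Lemma state_frenet_curve (P : {poly R}) p (e : R) (g : R -> 'rV[R]_2) :
  0 < e -> (forall q, box p0 r q -> c q = P.[s q]) ->
  (forall t, `|t - s p| < e -> [/\ box p0 r (g t), s (g t) = t &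
     exists2 w, is_derive t 1 g w & 'D_w s (g t) = 1]) ->
  frenet_curve kappa P [set t | `|t - s p| < e] (fun t => state (g t)).
Proof.
move=> e0 cP gP; split.
- rewrite (_ : [set t | _] = ball (s p) e); first exact: ball_open.
  by apply/funext => t; rewrite /ball /= distrC.
- move=> t1 t2 /=; rewrite !ltr_norml => /andP[h1 h2] /andP[h3 h4] t /andP[h5 h6].
  by rewrite ltr_norml; apply/andP; split; lra.
move=> t /gP[Bg st [w Dw sw] ].
have [S0 S1 S2 S3] := vec4E (x (g t)) (y (g t)) (a (g t)) (b (g t)).
rewrite -/(state (g t)) in S0 S1 S2 S3; rewrite S0 S1 S2 S3; split.
- by have D := state_along Bg Dw; rewrite sw scale1r cP // st in D.
- exact: lpos (BU Bg).
- exact: (cy_unit cf (BU Bg)).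
Qed.

(** The state depends on s alone: along the segment from p1 to p both sides solve the Frenet
    equation with the derivative of s as speed, and they agree at p1. *)
Lemma state_factor (P : {poly R}) J S p p1 (r1 : R) : frenet_curve kappa P J S ->
  (forall q, box p0 r q -> c q = P.[s q]) ->
  box p1 r1 `<=` box p0 r -> (forall q, box p1 r1 q -> J (s q)) -> box p1 r1 p1 ->
  S (s p1) = state p1 -> box p1 r1 p -> S (s p) = state p.
Proof.
move=> [_ _ C] cP BB BJ Bp1 e Bp; pose g (t : R) : 'rV[R]_2 := p1 + t *: (p - p1).
have sB := arc_smooth; have oB : open (box p0 r) by exact: box_open.
pose I := [set t : R | 0 <= t <= 1].
have Bg t : I t -> box p1 r1 (g t) by move=> It; exact: box_convex.
have Dg (t : R) : is_derive t 1 g (p - p1).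
  apply: is_derive_row => j.
  have D := is_derive_add (is_derive_const (p1 0 j) t 1) (is_derive_mul (is_derive_id t 1) (is_derive_const ((p - p1) 0 j) t 1)).
  have E : (fun t => p1 0 j + id t * (p - p1) 0 j) = fun t => g t 0 j.
    by apply/funext => q; rewrite !mxE.
  by rewrite E in D; apply: (is_derive_eq D); rewrite mulr0 addr0 mul1r add0r.
have Ds (t : R) (It : I t) : is_derive t 1 (fun t => s (g t)) ('D_(p - p1) s (g t)).
  exact: is_derive_along (smooth_on_diff sB (BB _ (Bg t It))) (Dg t).
have g0 : g 0 = p1 by rewrite /g scale0r addr0.
have g1 : g 1 = p by rewrite /g scale1r addrC subrK.
have iI : is_interval I.
  move=> t1 t2 /andP[h1 h2] /andP[h3 h4] t /andP[h5 h6].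
  by apply/andP; split; [exact: le_trans h1 h5|exact: le_trans h6 h4].
rewrite -[in LHS]g1 -[in RHS]g1.
apply: (@frenet_unique R kappa I (fun t => 'D_(p - p1) s (g t)) (fun t => P.[s (g t)])
  (fun t => S (s (g t))) (fun t => state (g t)) 0 1 iI).
- move=> t It; split.
    have sm : smooth_on (box p0 r) (fun q => 'D_(p - p1) s q).
      apply: (eq_smooth oB (f := fun q => \sum_i (p - p1) 0 i * partial i s q)).
        by move=> q Bq; rewrite (derive_sum_partial _ (smooth_on_diff sB Bq)).
      apply: smooth_sum => // i; apply: smoothM => //; first exact: smooth_cst.
      exact: smooth_on_partial.
    have D := is_derive_along (smooth_on_diff sm (BB _ (Bg t It))) (Dg t).
    apply: differentiable_continuous; apply/derivable1_diffP; exact: (@ex_derive _ _ _ _ _ _ _ D).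
  apply: (@continuous_comp _ _ _ (fun t => s (g t)) (fun z => P.[z])); last exact: continuous_horner.
  apply: differentiable_continuous; apply/derivable1_diffP; exact: (@ex_derive _ _ _ _ _ _ _ (Ds t It)).
- move=> t It; have [D _ _] := C _ (BJ _ (Bg t It)).
  apply: is_derive_row => j.
  have mz (z : R) (u : 'rV[R]_4) : u 0 j * z = (z *: u) 0 j by rewrite [RHS]mxE mulrC.
  have D1 := @is_derive1_comp _ (fun t => S t 0 j) (fun t => s (g t)) t _ _ (is_derive_entry j D) (Ds t It).
  exact: (is_derive_eq D1 (mz _ _)).
- move=> t It; have D := state_along (BB _ (Bg t It)) (Dg t).
  by rewrite cP // in D; exact: BB (Bg t It).
- by rewrite /I /= lexx ler01.
- by rewrite /I /= lexx ler01.
- by rewrite g0.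
Qed.

End Arc.

(** The curve is the state along a line section through p0, parametrized by s. On a smaller box s
    stays in its parameter interval, and [state_factor] applies. *)
Lemma local_cylinder p0 : U p0 -> exists (r : R) (s : 'rV[R]_2 -> R) (P : {poly R}) (J : set R)
    (S : R -> 'rV[R]_4),
  [/\ 0 < r, box p0 r `<=` U, smooth_on (box p0 r) s, (size P <= k)%N & frenet_curve kappa P J S] /\
  forall p, box p0 r p -> [/\ J (s p), S (s p) = state p & 'D_(X1 p) s p = 1].
Proof.
move=> Up0; have [r [s [r0 BU sP] ] ] := closed_form_exact oU Up0 sal0 sal1 coframe_closed.
have sB := arc_smooth r0 BU sP.
have [P sizeP cP] := arc_polynomial r0 BU sP (cy_c cf) (cy_c2 cf) (cy_ck cf).
have oB : open (box p0 r) by exact: box_open.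
have B0 : box p0 r p0 by exact: box_center.
have pos : 0 < 'D_(X1 p0) s p0 by rewrite (arc_X1 BU sP B0) ltr01.
have [e [g [e0 gp0 gP] ] ] := line_section oB sB B0 pos.
have FC := state_frenet_curve BU sP e0 cP gP.
have cs : {for p0, continuous s} by exact: differentiable_continuous (smooth_on_diff sB B0).
have nJ : \forall q \near p0, `|s q - s p0| < e.
  by move/cvgr_dist_lt: cs => /(_ _ e0); apply: filterS => q; rewrite distrC.
have nB : nbhs p0 (box p0 r) by exact: open_nbhs_nbhs.
have [r1 r10 B1] := nbhs_box (filterI nB nJ).
have B10 : box p0 r1 p0 by exact: box_center.
have BB : box p0 r1 `<=` box p0 r by move=> q /B1[].
have BJ q : box p0 r1 q -> [set t | `|t - s p0| < e] (s q) by move=> /B1[].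
exists r1, s, P, [set t | `|t - s p0| < e], (fun t => state (g t)); split.
  split=> //; first exact: subset_trans BB BU.
  exact: smooth_on_sub BB sB.
move=> p Bp; split; first exact: BJ.
  apply: (state_factor r0 BU sP FC cP BB BJ B10 _ Bp); by rewrite gp0.
exact: (arc_X1 BU sP (BB _ Bp)).
Qed.

End Local.

(** * Gluing *)

Section Gluing.
Context {R : realType}.
Variables (kappa tau : R) (k : nat) (M : surface R) (f : M -> 'rV[R]_3).
Hypothesis imm : immersion_bcv kappa f.
Hypothesis kp : k_parallel kappa tau k f.
Hypothesis ver : forall (i : patch M) u, dom i u -> vertical_at (f \o par i) u.
Implicit Types (i j : patch M) (u v p w : 'rV[R]_2) (P : {poly R}) (J : set R) (S : R -> 'rV[R]_4).

Definition base_curve S (t : R) : 'rV[R]_2 := vec2 (S t 0 0) (S t 0 1).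

Lemma patch_local i u : dom i u -> exists (r : R) (s : 'rV[R]_2 -> R) P J S,
  [/\ 0 < r, box u r `<=` dom i, smooth_on (box u r) s, (size P <= k)%N & frenet_curve kappa P J S] /\
  forall p, box u r p -> [/\ J (s p), hopf (f (par i p)) = base_curve S (s p) & exists v, 'D_v s p = 1].
Proof.
move=> du; have [sF iF DF] := imm i; have oU := dom_open (i := i).
have [X1 [X2 [orth ad] ] ] := adapted_frame_exists tau oU sF iF DF (@ver i).
have cf := adapted_cylinder_frame oU sF iF DF orth ad (kp (i := i)).
have lpos p : dom i p -> 0 < 1 + kappa / 4 * (xcoord (f (par i p)) ^+ 2 + ycoord (f (par i p)) ^+ 2).
  by move=> /DF.
have [r [s [P [J [S [ [r0 BU ss sP FC] H] ] ] ] ] ] := local_cylinder oU cf lpos du.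
exists r, s, P, J, S; split=> // p /H[h1 h2 h3]; split=> //; last by exists (X1 p).
by rewrite /base_curve h2 !mxE.
Qed.

(** The parameter sg carries no normalization, which makes the notion invariant under a change of
    patch. *)
Definition covered J S i u := exists (O : set 'rV[R]_2) (sg : 'rV[R]_2 -> R),
  [/\ open O, O u, O `<=` dom i, smooth_on O sg &
      forall p, O p -> J (sg p) /\ hopf (f (par i p)) = base_curve S (sg p)].

Lemma covered_transition J S i j u v : dom i u -> dom j v -> par i u = par j v ->
  covered J S j v -> covered J S i u.
Proof.
move=> du dv e [Q [sg [oQ Qv Qj ssg H] ] ].
have [V [phi [ [oV Vu Vi sphi phiu] phiE] ] ] := surface_transition du dv e.
have oW : open (V `&` phi @^-1` Q).
  rewrite openE => p [Vp Qp]; apply: filterI; first exact: open_nbhs_nbhs.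
  by apply: (differentiable_continuous (smooth_on_diff sphi Vp)); exact: open_nbhs_nbhs.
have WV : V `&` phi @^-1` Q `<=` V by move=> p [].
exists (V `&` phi @^-1` Q), (fun p => sg (phi p)); split=> //.
- by split=> //; rewrite /= phiu.
- exact: subset_trans WV Vi.
- by apply: (smooth_comp oW _ (smooth_on_sub WV sphi) ssg) => p [].
by move=> p [Vp Qp]; have [_ <-] := phiE p Vp; exact: H.
Qed.

Lemma flipK (e : R) (S : 'rV[R]_4) : e ^+ 2 = 1 -> flip e (flip e S) = S.
Proof.
move=> e2; have [E0 E1 E2 E3] := vec4E (S 0 0) (S 0 1) (e * S 0 2) (e * S 0 3).
rewrite -/(flip e S) in E0 E1 E2 E3.
have [F0 F1 F2 F3] := vec4E (flip e S 0 0) (flip e S 0 1) (e * flip e S 0 2) (e * flip e S 0 3).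
rewrite -/(flip e (flip e S)) in F0 F1 F2 F3.
apply: row4P; [by rewrite F0|by rewrite F1|by rewrite F2 E2 mulrA -expr2 e2 mul1r|].
by rewrite F3 E3 mulrA -expr2 e2 mul1r.
Qed.

(** Near u' the projection has both descriptions, so the local curve S is an affine
    reparametrization of the maximal one, possibly reversed. Undoing it yields a solution with the
    polynomial Pm that meets the maximal curve, hence lies in it, for the whole box around u. *)
Lemma covered_extend Pm Jm Sm i u P J S r s u' : frenet_curve kappa Pm Jm Sm ->
  (forall J' S' t, frenet_curve kappa Pm J' S' -> Jm t -> J' t -> Sm t = S' t ->
     J' `<=` Jm /\ forall t, J' t -> Sm t = S' t) ->
  0 < r -> box u r `<=` dom i -> smooth_on (box u r) s -> frenet_curve kappa P J S ->
  (forall p, box u r p -> [/\ J (s p), hopf (f (par i p)) = base_curve S (s p) & exists v, 'D_v s p = 1]) ->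
  box u r u' -> covered Jm Sm i u' -> covered Jm Sm i u.
Proof.
move=> Cm mx r0 BU ss C H Bu' [Q [sg [oQ Qu' Qi ssg HQ] ] ].
have oB : open (box u r) by exact: box_open.
have oI : open (Q `&` box u r) by exact: openI.
have sB : smooth_on (Q `&` box u r) s by apply: smooth_on_sub ss => p [].
have [_ _ [v sv] ] := H u' Bu'.
have sv0 : 0 < 'D_v s u' by rewrite sv ltr01.
have [e [g [e0 g0 gP] ] ] := line_section oI sB (conj Qu' Bu') sv0.
set s1 := s u' in g0 gP; pose I := ball s1 e; pose th t := sg (g t).
have IE t : I t -> `|t - s1| < e by rewrite /I /ball /= distrC.
have I1 : I s1 by exact: ballxx.
have iI : is_interval I.
  move=> t1 t2 /IE + /IE; rewrite !ltr_norml => /andP[h1 h2] /andP[h3 h4] t /andP[h5 h6].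
  by rewrite /I /ball /= distrC ltr_norml; apply/andP; split; lra.
have pos t : I t -> [/\ J t, Jm (th t) & base_curve S t = base_curve Sm (th t)].
  move=> /IE/gP[ [Qg Bg] sgt _]; have [h1 h2 _] := H _ Bg; have [h3 h4] := HQ _ Qg.
  by rewrite sgt in h1 h2; split=> //; rewrite -h2 h4.
have bc (S' S'' : R -> 'rV[R]_4) t t' : base_curve S' t = base_curve S'' t' -> S' t 0 0 = S'' t' 0 0 /\ S' t 0 1 = S'' t' 0 1.
  move=> E; have [a0 a1] := vec2E (S' t 0 0) (S' t 0 1); have [b0 b1] := vec2E (S'' t' 0 0) (S'' t' 0 1).
  by split; [rewrite -a0 -b0|rewrite -a1 -b1]; rewrite -/(base_curve S' t) -/(base_curve S'' t') E.
have dth t : I t -> derivable th t 1.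
  move=> /IE/gP[ [Qg Bg] _ [w Dw _] ].
  exact: (@ex_derive _ _ _ _ _ _ _ (is_derive_along (smooth_on_diff ssg Qg) Dw)).
have [ep ep2 epP] := frenet_reparametrization C Cm (ball_open s1 e) iI
  (fun t It => let: And3 h _ _ := pos t It in h) I1 dth
  (fun t It => let: And3 _ h _ := pos t It in h)
  (fun t It => let: And3 _ _ h := pos t It in bc _ _ _ _ h).
set t1 := th s1 in epP.
have ee : ep * ep = 1 by rewrite -expr2.
(* The values are compared on an interval only; equality of polynomials extends the relation between
   the curvatures to all parameters. *)
have PE : P = ep *: (Pm \Po ((t1 - ep * s1)%:P + ep *: 'X)).
  apply: (poly_eq_open (ball_open s1 e) I1) => t It; have [h1 h2 _] := epP t It.
  rewrite h2 !(hornerE, horner_comp) h1; congr (_ * Pm.[_]); ring.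
have PmE t : Pm.[t] = ep * P.[s1 + ep * (t - t1)].
  have QE z : P.[z] = ep * Pm.[t1 - ep * s1 + ep * z].
    by rewrite {1}PE hornerZ horner_comp hornerD hornerC hornerZ hornerX.
  rewrite QE mulrA ee mul1r; congr (Pm.[_]).
  by apply: (lin_comb1 ee (c := t1 - t)); ring.
(* The inverse change of parameter, which carries S back to the parameter of the maximal curve. *)
have C' := frenet_curve_flip ep2 C PmE.
have J1 : J s1 by have [] := pos s1 I1.
have back : s1 + ep * (t1 - t1) = s1 by rewrite subrr mulr0 addr0.
have Jm1 : Jm t1 by have [_ h _] := pos s1 I1.
have agree : Sm t1 = flip ep (S (s1 + ep * (t1 - t1))).
  by rewrite back; have [_ _ ->] := epP s1 I1; rewrite flipK.
have J'1 : [set t | J (s1 + ep * (t - t1))] t1 by rewrite /= back.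
have [sub eqS] := mx _ _ _ C' Jm1 J'1 agree.
exists (box u r), (fun p => t1 + ep * (s p - s1)); split=> //.
- exact: box_center.
- exact: (smoothD oB (smooth_cst t1) (smoothM oB (smooth_cst ep) (smoothB oB ss (smooth_cst s1)))).
move=> p Bp; have [h1 h2 _] := H p Bp.
have bk : s1 + ep * (t1 + ep * (s p - s1) - t1) = s p.
  by apply: (lin_comb1 ee (c := s p - s1)); ring.
have J'p : [set t | J (s1 + ep * (t - t1))] (t1 + ep * (s p - s1)) by rewrite /= bk.
split; first exact: sub.
rewrite h2 /base_curve (eqS _ J'p) bk.
by have [-> -> _ _] := vec4E (S (s p) 0 0) (S (s p) 0 1) (ep * S (s p) 0 2) (ep * S (s p) 0 3).
Qed.

(** The points covered by the maximal curve through one local piece form an open set. By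
    [covered_extend] an uncovered point has a neighbourhood without covered points, so connectedness
    applies. *)
Lemma covering_curve : exists P J S, [/\ (size P <= k)%N, frenet_curve kappa P J S, J !=set0 &
  forall i u, dom i u -> covered J S i u].
Proof.
have [m0 _] := surface_nonempty M; have [i0 [u0 du0 um0] ] := par_cover m0.
have [r [s [P [J0 [S0 [ [r0 BU ss sP C0] H] ] ] ] ] ] := patch_local du0.
have B0 : box u0 r u0 by exact: box_center.
have [J00 _ _] := H u0 B0.
have [J [S [C Js Ss mx] ] ] := frenet_curve_maximal C0 J00.
exists P, J, S; split=> //; first by exists (s u0).
have [sub0 eq0] := mx _ _ _ C0 Js J00 Ss.
pose T := [set m : M | exists i u, [/\ dom i u, par i u = m & covered J S i u] ].
have T0 : T !=set0.
  exists m0, i0, u0; split=> //; exists (box u0 r), s; split=> //; first exact: box_open.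
  move=> p Bp; have [h1 h2 _] := H p Bp; split; first exact: sub0.
  by rewrite h2 /base_curve eq0.
have inT i u : dom i u -> T (par i u) -> covered J S i u.
  by move=> du [j [v [dv e cv] ] ]; exact: covered_transition du dv (esym e) cv.
have oT : open T.
  have -> : T = \bigcup_i (par i @` [set u | dom i u /\ covered J S i u]).
    apply/seteqP; split=> m.
      by move=> [i [u [du um cu] ] ]; exists i => //; exists u.
    by move=> [i _ [u [du cu] um] ]; exists i, u.
  apply: bigcup_open => i _; apply: par_open; last by move=> u [].
  rewrite openE => u [du [Q [sg [oQ Qu Qi ssg HQ] ] ] ].
  apply: (@filterS _ _ _ Q); last exact: open_nbhs_nbhs.
  by move=> p Qp; split; [exact: Qi|exists Q, sg].
have oC : open (~` T).
  rewrite openE => m Tm; have [i [u du um] ] := par_cover m.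
  have [r1 [s1 [P1 [J1 [S1 [ [r10 BU1 ss1 _ C1] H1] ] ] ] ] ] := patch_local du.
  have B1 : box u r1 u by exact: box_center.
  have ob : open (par i @` box u r1) by apply: par_open => //; exact: box_open.
  apply: (@filterS _ _ _ (par i @` box u r1)); last first.
    by apply: open_nbhs_nbhs; split=> //; exists u.
  move=> _ [p Bp <-] Tp; apply: Tm; rewrite -um; exists i, u; split=> //.
  exact: (covered_extend C mx r10 BU1 ss1 C1 H1 Bp (inT _ _ (BU1 _ Bp) Tp)).
have TT := connected_surface T0 oT oC.
by move=> i u du; apply: inT => //; rewrite TT.
Qed.

(** The local diffeomorphism is (sg, z). A vector killed by its differential is killed by that of F,
    since F factors through (sg, z), and F is an immersion. *)
Lemma covered_reparametrizes P J S i u : frenet_curve kappa P J S -> covered J S i u ->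
  reparametrizes_near (dom i) (f \o par i) (cylinder_dom J) (cylinder_par (base_curve S)) u.
Proof.
move=> [_ _ C] [Q [sg [oQ Qu Qi ssg HQ] ] ]; have [sF iF _] := imm i.
pose z q : R := f (par i q) 0 2; have sz : smooth_on Q z := smooth_on_sub Qi (smooth_coord 2 (dom_open (i := i)) sF).
pose phi q : 'rV[R]_2 := vec2 (sg q) (z q).
have ph q : phi q 0 0 = sg q /\ phi q 0 1 = z q by exact: vec2E.
have sphi : smooth_on Q phi.
  apply: smooth_row => // j; rewrite (_ : (fun p => phi p 0 j) = if val j == 0%N then sg else z).
    by case: ifP.
  by apply/funext => q; rewrite mxE; case: j => -[|[|j]].
have FE q : Q q -> f (par i q) = cylinder_par (base_curve S) (phi q).
  move=> Qq; have [_ e] := HQ q Qq; have [p0 p1] := ph q.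
  rewrite /cylinder_par /xcoord /ycoord p0 p1 -e.
  have [E0 E1 E2] := vec3E (hopf (f (par i q)) 0 0) (hopf (f (par i q)) 0 1) (z q).
  have [h0 h1] := vec2E (xcoord (f (par i q))) (ycoord (f (par i q))).
  apply/rowP => -[[|[|[|j]]] lt] //.
  - by rewrite (_ : Ordinal lt = 0); [rewrite E0 h0|exact: val_inj].
  - by rewrite (_ : Ordinal lt = 1); [rewrite E1 h1|exact: val_inj].
  - by rewrite (_ : Ordinal lt = 2); [rewrite E2|exact: val_inj].
exists Q, phi; split; last first.
  by move=> q Qq; split; [have [h _] := HQ q Qq; rewrite /cylinder_dom /= /xcoord (ph q).1|exact: FE].
split=> // q Qq w Dw; apply: (iF q (Qi q Qq)).
have dphi : derivable phi q w by apply: diff_derivable; exact: smooth_on_diff sphi Qq.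
have Dj (j : 'I_2) : 'D_w (fun p => phi p 0 j) q = 0 by rewrite derive_coord // Dw mxE.
have Ds : 'D_w sg q = 0.
  by have := Dj 0; rewrite (_ : (fun p => phi p 0 0) = sg) //; apply/funext => p; exact: (ph p).1.
have Dz : 'D_w z q = 0.
  by have := Dj 1; rewrite (_ : (fun p => phi p 0 1) = z) //; apply/funext => p; exact: (ph p).2.
have [Jq _] := HQ q Qq; have [DS _ _] := C _ Jq.
have DSj (j : 'I_4) : 'D_w (fun p => S (sg p) 0 j) q = 0.
  have dS : differentiable (fun t => S t 0 j) (sg q).
    by apply/derivable1_diffP; exact: (@ex_derive _ _ _ _ _ _ _ (is_derive_entry j DS)).
  rewrite (derive_comp (f := fun t => S t 0 j) w (smooth_on_diff ssg Qq) dS) Ds deriveE //.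
  exact: linear0.
have dF : derivable (f \o par i) q w by apply: diff_derivable; exact: smooth_on_diff sF (Qi q Qq).
have hE p : Q p -> f (par i p) 0 0 = S (sg p) 0 0 /\ f (par i p) 0 1 = S (sg p) 0 1.
  move=> Qp; have [_ e] := HQ p Qp.
  have [h0 h1] := vec2E (xcoord (f (par i p))) (ycoord (f (par i p))).
  have [b0 b1] := vec2E (S (sg p) 0 0) (S (sg p) 0 1).
  rewrite -/(hopf (f (par i p))) e in h0 h1; rewrite -/(base_curve S (sg p)) in b0 b1.
  by split; [rewrite -b0 h0|rewrite -b1 h1].
apply/rowP => -[[|[|[|j]]] lt] //; rewrite -derive_coord // [RHS]mxE.
- rewrite (_ : Ordinal lt = 0); last exact: val_inj.
  by rewrite -[RHS](DSj 0); apply: near_eq_derive; apply: (near_eq_open oQ Qq) => p /hE[].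
- rewrite (_ : Ordinal lt = 1); last exact: val_inj.
  by rewrite -[RHS](DSj 1); apply: near_eq_derive; apply: (near_eq_open oQ Qq) => p /hE[].
- by rewrite (_ : Ordinal lt = 2); last exact: val_inj.
Qed.

End Gluing.

Theorem theorem8 (R : realType) (kappa tau : R) (k : nat)
    (M : surface R) (f : M -> 'rV[R]_3) :
  kappa <> 4 * tau ^+ 2 ->
  (1 <= k)%N ->
  immersion_bcv kappa f ->
  k_parallel kappa tau k f ->
  (exists (J : set R) (gamma : R -> 'rV[R]_2) (P : {poly R}),
     [/\ arclength_curve kappa J gamma,
         (size P <= k)%N,
         forall s, J s -> geodesic_curvature kappa gamma s = P.[s] &
         open_part_cylinder f J gamma]) \/
  (tau = 0 /\
   exists (L : surface R) (l : L -> 'rV[R]_3),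
     [/\ immersion_bcv kappa l,
         hopf_leaf kappa tau l,
         totally_geodesic kappa tau l &
         open_part f l]).
Proof.
move=> c0 k0 imm kp; have [ver|hor] := vertical_or_horizontal_surface imm c0 k0 kp.
  left; have [P [J [S [sP C J0 cov] ] ] ] := covering_curve imm kp ver.
  have [arc gc] := frenet_arclength C J0.
  (* The coefficient in the Frenet equations is minus the geodesic curvature; size at most k means
     degree at most k - 1. *)
  exists J, (base_curve S), (- P); split=> //.
  - by rewrite size_polyN.
  - by move=> t Jt; rewrite hornerN; exact: gc.
  - by move=> i u du; exact: (covered_reparametrizes imm C (cov i u du)).
right; split; first exact: horizontal_tau imm hor.
(* A horizontal surface is itself a leaf, so it is taken as the leaf of which it is an open part. *)
exists M, f; split=> //.
- exact: horizontal_hopf_leaf hor.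
- exact: horizontal_totally_geodesic imm hor.
- exact: open_part_refl.
Qed.
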